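(* Let $\Sigma^+$ be a topologically mixing one-sided countable Markov shift with finite Gurevich entropy, and let $\phi$ be an SPR $\theta$-weakly H\''older continuous potential with $\sup\phi<\infty$. Then there exist $M:=M_\theta(\phi)>1$ and $\varepsilon:=\varepsilon_\theta(\phi)>0$ such that for every $\beta>|\log\theta|$ and every $\psi\in\mathcal H_\beta$ with $\|\psi\|_\beta\le1$, writing $\mathfrak p_{\phi,\psi}(t)=P_G(\phi+t\psi)$: (1) $\mathfrak p_{\phi,\psi}$ is real-analytic on $(-\varepsilon,\varepsilon)$. (2) If $|t|\le\varepsilon$, there is a unique equilibrium measure $m_t$ for $\phi+t\psi$, i.e. $\mathfrak p_{\phi,\psi}(t)=P_{m_t}(\phi+t\psi)$ and $\mathfrak p_{\phi,\psi}(t)>P_\mu(\phi+t\psi)$ for all invariant probability measures $\mu\neq m_t$. (3) If $|t|<\varepsilon$, then $\mathfrak p'_{\phi,\psi}(t)=\int\psi\,dm_t$. (4) If $|t|<\varepsilon$, then $\mathfrak p''_{\phi,\psi}(t)=\sigma^2_{m_t}(\psi):=\lim_{n\to\infty}\frac1n\mathbb E_{m_t}[(\psi_n-\mathbb E_{m_t}\psi_n)^2]$, where $\psi_n=\sum_{k=0}^{n-1}\psi\circ\sigma^k$. (5) If $|t|<\varepsilon$, then $|\mathfrak p'_{\phi,\psi}(t)|,|\mathfrak p''_{\phi,\psi}(t)|,|\mathfrak p'''_{\phi,\psi}(t)|\le M$. (6) If $\varphi\in\mathcal H_\beta$ with $\|\varphi\|_\beta\le1$, then $(t,s)\mapsto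 P_G(\phi+t\psi+s\varphi)$ has continuous partial derivatives of all orders on $(-\varepsilon,\varepsilon)^2$.
   Context: One-sided TMS over a countable directed graph with vertices $S$: $\Sigma^+=\{(x_0,x_1,\dots):x_i\to x_{i+1}\}$, left shift $\sigma$, metric $d(\underline x,\underline y)=e^{-t(\underline x,\underline y)}$, $t(\underline x,\underline y)=\min\{i:x_i\ne y_i\}$; mixing: strongly connected graph, gcd of loop lengths 1. $\mathrm{osc}_n(\phi)=\sup\{|\phi(\underline x)-\phi(\underline y)|:x_i=y_i,i<n\}$; $\theta$-weakly H\''older ($0<\theta<1$): $\mathrm{osc}_n(\phi)\le A\theta^n$ for $n\ge2$. $\phi_n=\sum_{k<n}\phi\circ\sigma^k$; $Z_n(\phi,a)=\sum_{\sigma^n\underline x=\underline x}e^{\phi_n(\underline x)}1_{[a]}(\underline x)$; Gurevich pressure $P_G(\phi)=\lim\frac1n\log Z_n(\phi,a)$; Gurevich entropy $P_G(0)$. $P_\mu(\phi)=h_\mu(\sigma)+\int\phi d\mu$; equilibrium measure: invariant probability maximizing $P_\mu$. SPR: for some (every) state $a$, $\limsup\frac1n\log Z^\ast_n(\phi,a)<P_G(\phi)$ where $Z^\ast_n(\phi,a)=\sum_{\sigma^n\underline x=\underline x}e^{\phi_n(\underline x)}1_{[\tau_a=n]}(\underline x)$, $\tau_a(\underline x)=1_{[a]}(\underline x)\min\{n>0:x_n=a\}$ (equivalent to the paper's discriminant definition). $\mathcal H_\beta$: functions with $\|\psi\|_\beta=\|\psi\|_\infty+\sup_{\underline x\ne\underline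 y}|\psi(\underline x)-\psi(\underline y)|e^{\beta t(\underline x,\underline y)}<\infty$. *)

(* Defs.v *)
From HB Require Import structures.
From mathcomp Require Import all_boot all_order all_algebra.
From mathcomp Require Import all_classical all_reals all_analysis.
Set Implicit Arguments. Unset Strict Implicit. Unset Printing Implicit Defensive.
Import Order.TTheory GRing.Theory Num.Theory.
Import numFieldNormedType.Exports.
Local Open Scope classical_set_scope.
Local Open Scope ring_scope.

(* Sequences x : nat -> S.  The shift space Sigma^+ is the set of admissible  *)
(* sequences [set x | adm E x] inside the full sequence space.               *)

Section Graph.
Variables (S : countType) (E : rel S).

Definition gpath (n : nat) (u v : S) : Prop :=
  exists w : nat -> S, [/\ w 0%N = u, w n = v & forall i, (i < n)%N -> E (w i) (w i.+1)].

Definition strongly_connected : Prop := forall u v, exists n, gpath n u v.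

Definition aperiodic_graph : Prop :=
  forall d : nat, (forall (n : nat) (u : S), (0 < n)%N -> gpath n u u -> (d %| n)%N) -> d = 1%N.

Definition mixing_graph : Prop := strongly_connected /\ aperiodic_graph.

Definition adm (x : nat -> S) : Prop := forall i, E (x i) (x i.+1).
End Graph.

(* Full sequence space, pointed by a state a (only used to build the          *)
(* measurable-space structure), with the sigma-algebra generated by cylinders. *)
Definition seqsp (S : countType) (a : S) := nat -> S.
HB.instance Definition _ (S : countType) (a : S) := Choice.on (seqsp a).
HB.instance Definition _ (S : countType) (a : S) :=
  isPointed.Build (seqsp a) (fun _ => a).

Definition cylinders (S : countType) (a : S) : set (set (seqsp a)) :=
  [set C | exists (n : nat) (w : nat -> S),
     C = [set x : seqsp a | forall i, (i < n)%N -> x i = w i]].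

Definition Sig (S : countType) (a : S) := g_sigma_algebraType (@cylinders S a).

Section Shift.
Variables (S : countType) (a : S) (E : rel S) (R : realType).
Local Notation X := (Sig a).

Definition shift (x : X) : X := fun n => x n.+1.

Definition birkhoff (phi : X -> R) (n : nat) (x : X) : R :=
  \sum_(k < n) phi (iter k shift x).

Definition agree (n : nat) (x y : X) : Prop := forall i, (i < n)%N -> x i = y i.

Definition weakly_holder (theta : R) (phi : X -> R) : Prop :=
  exists A : R, forall n : nat, (2 <= n)%N ->
    forall x y : X, adm E x -> adm E y -> agree n x y ->
      `|phi x - phi y| <= A * theta ^+ n.

Definition sup_finite (phi : X -> R) : Prop :=
  exists C : R, forall x : X, adm E x -> phi x <= C.

(* ||psi||_beta <= 1, where ||psi||_beta = ||psi||_oo +                      *)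
(*   sup_{x <> y} |psi x - psi y| e^{beta t(x,y)}, t(x,y) = min{i : x_i<>y_i} *)
(* (both suprema taken over Sigma^+, the empty supremum being 0).             *)
Definition Hbeta_norm_le1 (beta : R) (psi : X -> R) : Prop :=
  exists A B : R, [/\ 0 <= A, 0 <= B, A + B <= 1,
    (forall x : X, adm E x -> `|psi x| <= A) &
    (forall (x y : X) (n : nat), adm E x -> adm E y ->
        agree n x y -> x n <> y n ->
        `|psi x - psi y| * expR (beta * n%:R) <= B)].

Local Open Scope ereal_scope.

Definition Zn (phi : X -> R) (n : nat) (b : S) : \bar R :=
  \esum_(x in [set x : X | [/\ adm E x, iter n shift x = x & x 0%N = b]])
     (expR (birkhoff phi n x))%:E.

Definition Zstar (phi : X -> R) (n : nat) (b : S) : \bar R :=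
  \esum_(x in [set x : X | [/\ adm E x, iter n shift x = x, x 0%N = b,
                              (0 < n)%N &
                              forall i, (0 < i)%N -> (i < n)%N -> x i <> b]])
     (expR (birkhoff phi n x))%:E.

(* Gurevich pressure: lim (1/n) log Z_n (written as limsup) *)
Definition PG (phi : X -> R) (b : S) : \bar R :=
  limn_esup (fun n : nat => ((n%:R)^-1)%:E * lne (Zn phi n b)).

Definition SPR (phi : X -> R) (b : S) : Prop :=
  limn_esup (fun n : nat => ((n%:R)^-1)%:E * lne (Zstar phi n b)) < PG phi b.

(* potentials are only relevant on Sigma^+; we integrate phi 1_{Sigma^+} *)
Definition restr (phi : X -> R) (x : X) : R := if `[< adm E x >] then phi x else 0%R.

Definition invariant_prob (mu : probability X R) : Prop :=
  mu [set x : X | adm E x] = 1 /\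
  forall A : set X, measurable A -> mu (shift @^-1` A) = mu A.

Definition etaf (u : R) : R := if (u <= 0)%R then 0%R else (- (u * ln u))%R.

Definition meas_partition (k : nat) (f : X -> 'I_k) : Prop :=
  forall i : 'I_k, measurable (f @^-1` [set i]).

(* H_mu(alpha v sigma^-1 alpha v ... v sigma^-(n-1) alpha) *)
Definition Hjoin (mu : probability X R) (k : nat) (f : X -> 'I_k) (n : nat) : R :=
  (\sum_(w : n.-tuple 'I_k)
     etaf (fine (mu [set x : X | forall j : 'I_n, f (iter j shift x) = tnth w j])))%R.

Definition hpart (mu : probability X R) (k : nat) (f : X -> 'I_k) : \bar R :=
  limn_esup (fun n : nat => ((n%:R)^-1 * Hjoin mu f n)%R%:E).

Definition hKS (mu : probability X R) : \bar R :=
  ereal_sup [set e | exists (k : nat) (f : X -> 'I_k), meas_partition f /\ e = hpart mu f].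

Definition Pmu (mu : probability X R) (phi : X -> R) : \bar R :=
  hKS mu + \int[mu]_x (restr phi x)%:E.

Definition integ (mu : probability X R) (phi : X -> R) : R :=
  fine (\int[mu]_x (restr phi x)%:E).

Definition var_seq (mu : probability X R) (psi : X -> R) (n : nat) : R :=
  ((n%:R)^-1 * integ mu (fun x => (birkhoff psi n x - integ mu (birkhoff psi n)) ^+ 2))%R.

Definition same_measure (mu nu : probability X R) : Prop :=
  forall A : set X, measurable A -> mu A = nu A.
End Shift.

Section Analytic.
Variable R : realType.

Definition real_analytic_on (f : R -> R) (D : set R) : Prop :=
  forall t0, D t0 -> exists r : R, (0 < r)%R /\ exists c : nat -> R,
    forall t, `|t - t0| < r ->
      (fun n : nat => \sum_(k < n) c k * (t - t0) ^+ k) @ \oo --> f t.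

Definition pderiv (b : bool) (f : R -> R -> R) : R -> R -> R :=
  if b then fun t s => derive1 (fun u => f u s) t
  else fun t s => derive1 (fun u => f t u) s.

Fixpoint ipderiv (l : seq bool) (f : R -> R -> R) : R -> R -> R :=
  if l is b :: l' then pderiv b (ipderiv l' f) else f.

Definition smooth2_on (f : R -> R -> R) (D : set (R * R)) : Prop :=
  forall l : seq bool,
    (forall p : R * R, D p ->
       derivable (fun u => ipderiv l f u p.2) p.1 1 /\
       derivable (fun u => ipderiv l f p.1 u) p.2 1) /\
    (forall p : R * R, D p ->
       (fun q : R * R => ipderiv l f q.1 q.2) x @[x --> p] --> ipderiv l f p.1 p.2).
End Analytic.

(* Main.v *)
(* Inducing on the state [a] turns the shift into a full shift on countably many
   first-return loops; by the SPR property the return time has an exponential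
   moment for the loop weights at the Gurevich pressure [P].  So the induced
   transfer operator has a positive log-Lipschitz eigenfunction [h], and
   normalising by [h] gives a Markov average contracting a Lipschitz seminorm.
   The pressure [P + q] of [phi + t psi + s chi] is the value for which the induced
   operator keeps eigenvalue 1; expanded in powers of [t, s], the equation for [q]
   and the relative change of [h] is triangular in the degree and preserves an l1
   ball of coefficients depending only on the base data.  This gives analyticity,
   smoothness and bounds uniform in [psi].

   The stationary functional of the Markov average, spread along the loops, is an
   invariant probability with Gibbs bounds; comparing it with long words gives both
   halves of the variational principle.  An equilibrium measure is a tangent of the
   pressure, and differentiability along cylinder indicators makes it unique.  The
   first-order coefficient solves a Poisson equation, whose martingale-coboundary
   decomposition identifies the asymptotic variance with the second derivative. *)
Require Import Defs.
From HB Require Import structures.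
From mathcomp Require Import all_boot all_order all_algebra.
From mathcomp Require Import all_classical all_reals all_analysis.
From mathcomp Require Import measurable_realfun.
From mathcomp Require Import lra ring zify.
Set Implicit Arguments. Unset Strict Implicit. Unset Printing Implicit Defensive.
Import Order.TTheory GRing.Theory Num.Theory.
Import numFieldNormedType.Exports.
Local Open Scope classical_set_scope.
Local Open Scope ring_scope.

(** * Absolutely summable series *)

Section AbsolutelySummable.
Variable R : realType.
Implicit Types u v w : nat -> R.

Definition asm u (K : R) := forall N, \sum_(k < N) `|u k| <= K.
Definition sm u : R := limn (series u).

Lemma series_ordE u N : series u N = \sum_(k < N) u k.
Proof. by rewrite /series /= big_mkord. Qed.

Lemma asm_ge0 u K : asm u K -> 0 <= K.
Proof. by move=> /(_ 0%N); rewrite big_ord0. Qed.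

Lemma asmW u K L : asm u K -> K <= L -> asm u L.
Proof. by move=> h kl N; apply: le_trans kl. Qed.

Lemma asm_le u v K : (forall n, `|u n| <= v n) -> asm v K -> asm u K.
Proof.
move=> uv h N; apply: le_trans (h N); apply: ler_sum => i _.
by apply: le_trans (uv i) _; exact: ler_norm.
Qed.

Lemma asmP u K : (forall n, 0 <= u n) -> (forall N, \sum_(k < N) u k <= K) -> asm u K.
Proof. by move=> u0 h N; under eq_bigr do rewrite ger0_norm//. Qed.

Lemma asm_term u K n : asm u K -> `|u n| <= K.
Proof.
move=> h; apply: le_trans (h n.+1); rewrite big_ord_recr/= lerDr.
by apply: sumr_ge0 => i _; exact: normr_ge0.
Qed.

Lemma asmD u v K L : asm u K -> asm v L -> asm (fun n => u n + v n) (K + L).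
Proof.
move=> h g N; apply: le_trans (lerD (h N) (g N)).
by rewrite -big_split/=; apply: ler_sum => i _; exact: ler_normD.
Qed.

Lemma asmZ u K c : asm u K -> asm (fun n => c * u n) (`|c| * K).
Proof.
move=> h N; under eq_bigr do rewrite normrM.
by rewrite -mulr_sumr; apply: ler_wpM2l.
Qed.

Lemma asmN u K : asm u K -> asm (fun n => - u n) K.
Proof. by move=> h N; under eq_bigr do rewrite normrN. Qed.

Lemma asm0 : asm (fun=> 0) 0.
Proof. by move=> N; rewrite big1// => i _; rewrite normr0. Qed.

Lemma cvgn_epsP (u : nat -> R) l :
  (u @ \oo --> l) <-> (forall e, 0 < e -> exists N, forall n, (N <= n)%N -> `|l - u n| <= e).
Proof.
split.
  move=> /cvgrPdist_le h e e0; have [N _ hN] := h e e0.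
  by exists N => n Nn; exact: hN.
move=> h; apply/cvgrPdist_le => e e0; have [N hN] := h e e0.
by exists N => //.
Qed.

Lemma cvgn_uniq (u : nat -> R) (l l' : R) : u @ \oo --> l -> u @ \oo --> l' -> l = l'.
Proof.
move=> h h'; have <- : limn u = l by apply/cvg_lim.
by apply/cvg_lim.
Qed.

Lemma asm_cvg u K : asm u K -> series u @ \oo --> sm u.
Proof.
move=> h; apply: (@normed_cvg R R^o).
apply: nondecreasing_is_cvgn.
  by apply: nondecreasing_series => i _ _; exact: normr_ge0.
exists K => _ [N _ <-].
by rewrite [X in X <= _]series_ordE; exact: h.
Qed.

Lemma sm_unique u l : series u @ \oo --> l -> sm u = l.
Proof. by move=> h; apply/cvg_lim. Qed.

Lemma sm_bound u K : asm u K -> `|sm u| <= K.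
Proof.
move=> h; have /cvg_norm c := asm_cvg h.
apply: (cvgr_to_le c); apply: nearW => N; rewrite series_ordE.
by apply: le_trans (h N); exact: ler_norm_sum.
Qed.

Lemma eq_sm u v : (forall n, u n = v n) -> sm u = sm v.
Proof. by move=> /funext ->. Qed.

Lemma smD u v K L : asm u K -> asm v L -> sm (fun n => u n + v n) = sm u + sm v.
Proof.
move=> h g; apply: sm_unique; rewrite (_ : series _ = fun N => series u N + series v N).
  exact: cvgD (asm_cvg h) (asm_cvg g).
by apply/funext => N; rewrite !series_ordE big_split.
Qed.

Lemma smZ u c K : asm u K -> sm (fun n => c * u n) = c * sm u.
Proof.
move=> h; apply: sm_unique; rewrite (_ : series _ = fun N => c * series u N).
  by apply: cvgM (asm_cvg h); exact: cvg_cst.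
by apply/funext => N; rewrite !series_ordE -mulr_sumr.
Qed.

Lemma smN u K : asm u K -> sm (fun n => - u n) = - sm u.
Proof.
by move=> h; rewrite -mulN1r -(smZ _ h); apply: eq_sm => n; rewrite mulN1r.
Qed.

Lemma smB u v K L : asm u K -> asm v L -> sm (fun n => u n - v n) = sm u - sm v.
Proof. by move=> h g; rewrite (smD h (asmN g)) (smN g). Qed.

Lemma sm0 : sm (fun=> 0) = 0.
Proof.
apply: sm_unique; rewrite (_ : series _ = fun=> 0); first exact: cvg_cst.
by apply/funext => N; rewrite series_ordE big1.
Qed.

Lemma eq_asm u v K : (forall n, u n = v n) -> asm v K -> asm u K.
Proof. by move=> /funext ->. Qed.

Lemma asm_sum I (r : seq I) (u : I -> nat -> R) (K : I -> R) :
  (forall i, asm (u i) (K i)) -> asm (fun n => \sum_(i <- r) u i n) (\sum_(i <- r) K i).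
Proof.
move=> h; elim: r => [|i r ih].
  by rewrite big_nil; apply: eq_asm asm0 => n; rewrite big_nil.
by rewrite big_cons; apply: eq_asm (asmD (h i) ih) => n; rewrite big_cons.
Qed.

Lemma sm_sum I (r : seq I) (u : I -> nat -> R) (K : I -> R) :
  (forall i, asm (u i) (K i)) ->
  sm (fun n => \sum_(i <- r) u i n) = \sum_(i <- r) sm (u i).
Proof.
move=> h; elim: r => [|i r ih].
  by rewrite big_nil -[RHS]sm0; apply: eq_sm => n; rewrite big_nil.
rewrite big_cons -ih -(smD (h i) (asm_sum r h)).
by apply: eq_sm => n; rewrite big_cons.
Qed.

Lemma sm_le u v K L : asm u K -> asm v L -> (forall n, u n <= v n) -> sm u <= sm v.
Proof.
move=> h g uv; apply: (ler_cvg_to (asm_cvg h) (asm_cvg g)).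
by apply: nearW => N; rewrite !series_ordE; exact: ler_sum.
Qed.

Lemma sm_ge0 u K : asm u K -> (forall n, 0 <= u n) -> 0 <= sm u.
Proof. by move=> h u0; rewrite -sm0; apply: (sm_le asm0 h). Qed.

Lemma asm_norm u K : asm u K -> asm (fun n => `|u n|) K.
Proof. by move=> h N; under eq_bigr do rewrite normr_id. Qed.

Lemma sm_norm u K : asm u K -> `|sm u| <= sm (fun n => `|u n|).
Proof.
move=> h; have hn := asm_norm h; rewrite ler_norml; apply/andP; split.
  rewrite -(smN hn); apply: (sm_le (asmN hn) h) => n.
  by rewrite lerNl -normrN ler_norm.
by apply: (sm_le h hn) => n; exact: ler_norm.
Qed.

Lemma sm_norm_le u v K : (forall n, `|u n| <= v n) -> asm v K -> `|sm u| <= sm v.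
Proof.
move=> uv h; have g := asm_le uv h; apply: le_trans (sm_norm g) _.
by apply: (sm_le (asm_norm g) h).
Qed.

Lemma sum_ord_split u N M : (N <= M)%N ->
  \sum_(k < M) u k = \sum_(k < N) u k + \sum_(N <= k < M) u k.
Proof. by move=> NM; rewrite -(big_mkord xpredT) (big_cat_nat (n:=N))//= big_mkord. Qed.

Lemma sm_ge_part u K N : asm u K -> (forall n, 0 <= u n) -> \sum_(k < N) u k <= sm u.
Proof.
move=> h u0; apply: (cvgr_to_ge (asm_cvg h)); exists N => // M NM.
by rewrite series_ordE (sum_ord_split _ NM) lerDl; apply: sumr_ge0.
Qed.

Lemma asm_sm_ge0 u K : asm u K -> (forall n, 0 <= u n) -> asm u (sm u).
Proof.
by move=> h u0 N; under eq_bigr do rewrite ger0_norm//; exact: (sm_ge_part N h).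
Qed.

Lemma sm_le_bound u K : asm u K -> sm u <= K.
Proof. by move=> /sm_bound; apply: le_trans; exact: ler_norm. Qed.

Lemma sm_finsupp u N : (forall n, (N <= n)%N -> u n = 0) ->
  sm u = \sum_(k < N) u k.
Proof.
move=> h; apply: sm_unique; apply/cvgn_epsP => e e0; exists N => n Nn.
rewrite series_ordE (sum_ord_split _ Nn) [X in _ - (_ + X)]big1_seq.
  by rewrite addr0 subrr normr0 ltW.
by move=> i /andP[_]; rewrite mem_index_iota => /andP[Ni _]; exact: h.
Qed.

Lemma sm_tail u v K N : (forall n, `|u n| <= v n) -> asm v K ->
  `|sm u - \sum_(k < N) u k| <= sm v - \sum_(k < N) v k.
Proof.
move=> uv h; have g := asm_le uv h.
have c : (fun n => `|series u n - \sum_(k < N) u k|) @ \oo --> `|sm u - \sum_(k < N) u k|.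
  by apply: cvg_norm; apply: cvgB; [exact: asm_cvg g|exact: cvg_cst].
have d : (fun n => series v n - \sum_(k < N) v k) @ \oo --> sm v - \sum_(k < N) v k.
  by apply: cvgB; [exact: asm_cvg h|exact: cvg_cst].
apply: (ler_cvg_to c d); exists N => // M /= NM.
rewrite !series_ordE !(sum_ord_split _ NM) ![_ + _ - _]addrAC !subrr !add0r.
by apply: le_trans (ler_norm_sum _ _ _) _; exact: ler_sum.
Qed.

Lemma cvg_sum_ord N (U : nat -> nat -> R) u : (forall k, (fun n => U n k) @ \oo --> u k) ->
  (fun n => \sum_(k < N) U n k) @ \oo --> \sum_(k < N) u k.
Proof.
move=> h; elim: N => [|N ih].
  by rewrite big_ord0; under eq_fun do rewrite big_ord0; exact: cvg_cst.
by rewrite big_ord_recr; under eq_fun do rewrite big_ord_recr; exact: cvgD.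
Qed.

Lemma sm_tannery (U : nat -> nat -> R) u v K :
  (forall N n, `|U N n| <= v n) -> asm v K ->
  (forall n, (fun N => U N n) @ \oo --> u n) -> (fun N => sm (U N)) @ \oo --> sm u.
Proof.
move=> Uv h Uu.
have uv n : `|u n| <= v n.
  by apply: (cvgr_to_le (cvg_norm (Uu n))); apply: nearW => N; exact: Uv.
apply/cvgn_epsP => e e0.
have e3 : 0 < e / 3 by rewrite divr_gt0.
have /cvgn_epsP/(_ _ e3)[M /(_ M (leqnn _)) hM] := asm_cvg h.
have c : (fun N => \sum_(k < M) U N k) @ \oo --> \sum_(k < M) u k.
  by apply: cvg_sum_ord => k; exact: Uu.
have /cvgn_epsP/(_ _ e3)[N0 hN0] := c.
exists N0 => N /hN0 {}hN0.
have t1 := sm_tail M uv h.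
have t2 := sm_tail M (Uv N) h.
move: hM; rewrite series_ordE => /(le_trans (ler_norm _)) hM.
have -> : sm u - sm (U N) = (sm u - \sum_(k < M) u k) +
   (\sum_(k < M) u k - \sum_(k < M) U N k) - (sm (U N) - \sum_(k < M) U N k) by ring.
apply: le_trans (ler_normB _ _) _; apply: le_trans (lerD (ler_normD _ _) (lexx _)) _.
have := lerD (lerD (le_trans t1 hM) hN0) (le_trans t2 hM).
by move/le_trans; apply; lra.
Qed.

Lemma sm_swap (f : nat -> nat -> R) v K :
  (forall n, asm (f n) (v n)) -> asm v K ->
  sm (fun n => sm (f n)) = sm (fun m => sm (fun n => f n m)).
Proof.
move=> h g; apply/esym/sm_unique.
have v0 n : 0 <= v n by exact: asm_ge0 (h n).
have hm m : asm (fun n => f n m) K.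
  by apply: asm_le g => n; exact: asm_term (h n).
rewrite (_ : series _ = fun N => sm (fun n => \sum_(k < N) f n k)); last first.
  by apply/funext => N; rewrite series_ordE -(sm_sum (index_enum 'I_N) (K:=fun=>K)).
apply: sm_tannery g _ => [N n|n].
  by apply: le_trans (h n N); exact: ler_norm_sum.
by rewrite (_ : (fun N => _) = series (f n)); [exact: asm_cvg (h n)|apply/funext => N; rewrite series_ordE].
Qed.

Definition shiftS u n := if n is m.+1 then u m else 0.

Lemma asm_shiftS u K : asm u K -> asm (shiftS u) K.
Proof.
move=> h [|N]; first by rewrite big_ord0 (asm_ge0 h).
by rewrite big_ord_recl/= normr0 add0r; exact: h.
Qed.

Lemma sm_recl u K : asm u K -> sm u = u 0%N + sm (fun n => u n.+1).
Proof.
move=> h; have g : asm (fun n => u n.+1) K.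
  by move=> N; apply: le_trans (h N.+1); rewrite big_ord_recl/= lerDr.
apply: sm_unique.
rewrite -(cvg_shiftS (series u)) (_ : (fun n => _) = fun n => u 0%N + series (fun n => u n.+1) n).
  by apply: cvgD; [exact: cvg_cst|exact: asm_cvg g].
by apply/funext => n /=; rewrite !series_ordE big_ord_recl.
Qed.

Definition cauchy u v n := \sum_(k < n.+1) u k * v (n - k)%N.

Lemma cauchy_part u v N :
  \sum_(n < N) cauchy u v n = \sum_(k < N) u k * \sum_(l < N - k) v l.
Proof.
elim: N => [|N ih]; first by rewrite !big_ord0.
rewrite big_ord_recr/= ih /cauchy big_ord_recr/= [in RHS]big_ord_recr/= addrA.
rewrite subSnn big_ord1 subnn; congr (_ + _).
rewrite -big_split/=; apply: eq_bigr => k _.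
by rewrite -mulrDr subSn ?big_ord_recr//= ltnW.
Qed.

Lemma asm_cauchy u v K L : asm u K -> asm v L -> asm (cauchy u v) (K * L).
Proof.
move=> h g N.
apply: (@le_trans _ _ (\sum_(n < N) cauchy (fun n => `|u n|) (fun n => `|v n|) n)).
  apply: ler_sum => n _; apply: le_trans (ler_norm_sum _ _ _) _.
  by apply: ler_sum => k _; rewrite normrM.
rewrite cauchy_part; apply: (@le_trans _ _ (\sum_(k < N) `|u k| * L)).
  by apply: ler_sum => k _; apply: ler_wpM2l => //; exact: g.
by rewrite -mulr_suml; apply: ler_wpM2r (h N); exact: asm_ge0 g.
Qed.

Lemma sm_cauchy u v K L : asm u K -> asm v L -> sm (cauchy u v) = sm u * sm v.
Proof.
move=> h g; apply: sm_unique.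
rewrite mulrC -(smZ (sm v) h).
rewrite (_ : series _ = fun N => sm (fun k => (k < N)%N%:R * (\sum_(l < N - k) v l) * u k)); last first.
  apply/funext => N; rewrite series_ordE cauchy_part (sm_finsupp (N:=N)).
    by apply: eq_bigr => k _; rewrite ltn_ord mul1r mulrC.
  by move=> n Nn; rewrite ltnNge Nn/= !mul0r.
apply: (sm_tannery (v := fun k => L * `|u k|)).
- move=> N n; rewrite !normrM; apply: ler_wpM2r => //.
  case: (n < N)%N; rewrite ?normr1 ?normr0 ?mul0r ?mul1r ?(asm_ge0 g)//.
  by apply: le_trans (g (N - n)%N); exact: ler_norm_sum.
- exact: (asmZ L (asm_norm h)).
- move=> n; apply: cvgMl.
  have /cvgn_epsP c := asm_cvg g; apply/cvgn_epsP => e /c[N hN].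
  exists (n + N.+1)%N => m le_m.
  have -> : (n < m)%N by lia.
  by rewrite mul1r -series_ordE; apply: hN; lia.
Qed.

Lemma mulr_frac_le (x T : R) : 0 <= T -> 0 <= x -> x * (T / (1 + T)) <= x.
Proof. by move=> T0 x0; apply: ler_piMr => //; rewrite ler_pdivrMr ?mul1r ?lerDr// ltr_pwDl. Qed.

End AbsolutelySummable.

(** * Double power series with summable coefficients *)

Section Arrays.
Variable R : realType.
Implicit Types c d e : nat -> nat -> R.

(* A double power series is represented by its array of coefficients, and
   [nb c K] bounds its l1 norm through finite boxes, so that the bound passes
   to coefficientwise limits. *)
Definition nb c (K : R) := forall N, \sum_(i < N) \sum_(j < N) `|c i j| <= K.

Definition ev c (t s : R) : R := sm (fun i => t ^+ i * sm (fun j => c i j * s ^+ j)).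

Definition mono (a b : nat) (k : R) : nat -> nat -> R :=
  fun i j => if (i == a) && (j == b) then k else 0.

Definition addA c d : nat -> nat -> R := fun i j => c i j + d i j.
Definition subA c d : nat -> nat -> R := fun i j => c i j - d i j.
Definition sclA (k : R) c : nat -> nat -> R := fun i j => k * c i j.

Definition prodA c d : nat -> nat -> R :=
  fun i j => \sum_(k < i.+1) \sum_(l < j.+1) c k l * d (i - k)%N (j - l)%N.

Fixpoint powA c n := if n is m.+1 then prodA c (powA c m) else mono 0 0 1.

Definition expT m c : nat -> nat -> R :=
  fun i j => sm (fun n => (m <= n)%N%:R * powA c n i j / n`!%:R).

Lemma nb_ge0 c K : nb c K -> 0 <= K.
Proof. by move=> /(_ 0%N); rewrite big_ord0. Qed.

Lemma nbW c K L : nb c K -> K <= L -> nb c L.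
Proof. by move=> h kl N; apply: le_trans kl. Qed.

Lemma nb_le c d K : (forall i j, `|c i j| <= `|d i j|) -> nb d K -> nb c K.
Proof.
by move=> cd h N; apply: le_trans (h N); apply: ler_sum => i _; apply: ler_sum.
Qed.

Lemma eq_nb c d K : (forall i j, c i j = d i j) -> nb d K -> nb c K.
Proof. by move=> cd; apply: nb_le => i j; rewrite cd. Qed.

Lemma eq_ev c d t s : (forall i j, c i j = d i j) -> ev c t s = ev d t s.
Proof. by move=> cd; suff -> : c = d by []; apply/funext => i; apply/funext => j. Qed.

Lemma sum_ord_le (u : nat -> R) N M : (N <= M)%N -> (forall n, 0 <= u n) ->
  \sum_(k < N) u k <= \sum_(k < M) u k.
Proof. by move=> NM u0; rewrite (sum_ord_split _ NM) lerDl sumr_ge0. Qed.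

Lemma nb_rect c K : nb c K -> forall N M, \sum_(i < N) \sum_(j < M) `|c i j| <= K.
Proof.
move=> h N M; apply: le_trans (h (maxn N M)).
apply: (@le_trans _ _ (\sum_(i < N) \sum_(j < maxn N M) `|c i j|)).
  by apply: ler_sum => i _; apply: (sum_ord_le (u := fun j => `|c i j|)); rewrite ?leq_maxr.
apply: (sum_ord_le (u := fun i => \sum_(j < maxn N M) `|c i j|)); first by rewrite leq_maxl.
by move=> n; exact: sumr_ge0.
Qed.

Lemma nb_row c K i : nb c K -> asm (c i) K.
Proof.
move=> h M; apply: le_trans (nb_rect h i.+1 M).
by rewrite big_ord_recr/= lerDr; apply: sumr_ge0 => k _; exact: sumr_ge0.
Qed.

Lemma nb_term c K i j : nb c K -> `|c i j| <= K.
Proof. by move=> h; exact: asm_term (nb_row i h). Qed.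

Lemma nb_rows c K : nb c K -> asm (fun i => sm (fun j => `|c i j|)) K.
Proof.
move=> h N; under eq_bigr => i _.
  rewrite ger0_norm; last by apply: sm_ge0 (asm_norm (nb_row i h)) _.
  over.
have cv : (fun M => \sum_(i < N) series (fun j => `|c i j|) M) @ \oo -->
    \sum_(i < N) sm (fun j => `|c i j|).
  exact: (@cvg_sum_ord R N (fun M i => series (fun j => `|c i j|) M)
    (fun i => sm (fun j => `|c i j|)) (fun k => asm_cvg (asm_norm (nb_row k h)))).
apply: (cvgr_to_le cv); apply: nearW => M.
by under eq_bigr do rewrite series_ordE; exact: nb_rect.
Qed.

Lemma nb_asm c v K : (forall i, asm (c i) (v i)) -> asm v K -> nb c K.
Proof.
move=> h g N; apply: le_trans (g N); apply: ler_sum => i _.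
by apply: le_trans (h i N) _; exact: ler_norm.
Qed.

Section evaluation.
Variables t s : R.
Hypotheses (t1 : `|t| <= 1) (s1 : `|s| <= 1).

Lemma normrX_le1 (x : R) n : `|x| <= 1 -> `|x ^+ n| <= 1.
Proof. by move=> x1; rewrite normrX; exact: exprn_ile1. Qed.

Lemma ev_row_asm c K i : nb c K -> asm (fun j => c i j * s ^+ j) (sm (fun j => `|c i j|)).
Proof.
move=> h; apply: asm_le (asm_sm_ge0 (asm_norm (nb_row i h)) _) => // j.
by rewrite normrM ler_piMr// normrX_le1.
Qed.

Lemma ev_asm c K : nb c K -> asm (fun i => t ^+ i * sm (fun j => c i j * s ^+ j)) K.
Proof.
move=> h; apply: asm_le (nb_rows h) => i; rewrite normrM.
apply: le_trans (ler_wpM2r (normr_ge0 _) (normrX_le1 i t1)) _; rewrite mul1r.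
exact: sm_bound (ev_row_asm i h).
Qed.

Lemma ev_bound c K : nb c K -> `|ev c t s| <= K.
Proof. by move=> h; exact: sm_bound (ev_asm h). Qed.

Lemma nbD c d K L : nb c K -> nb d L -> nb (addA c d) (K + L).
Proof.
move=> h g N; apply: le_trans (lerD (h N) (g N)); rewrite -big_split/=.
apply: ler_sum => i _; rewrite -big_split/=; apply: ler_sum => j _; exact: ler_normD.
Qed.

Lemma nbZ k c K : nb c K -> nb (sclA k c) (`|k| * K).
Proof.
move=> h N; apply: le_trans (ler_wpM2l (normr_ge0 k) (h N)); rewrite mulr_sumr.
by apply: ler_sum => i _; rewrite mulr_sumr; apply: ler_sum => j _; rewrite normrM.
Qed.

Lemma nbB c d K L : nb c K -> nb d L -> nb (subA c d) (K + L).
Proof.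
move=> h g; apply: nb_le (nbD h (nbW (nbZ (-1) g) _)) => [i j|].
  by rewrite /addA /sclA mulN1r.
by rewrite normrN1 mul1r.
Qed.

Lemma evD c d K L : nb c K -> nb d L -> ev (addA c d) t s = ev c t s + ev d t s.
Proof.
move=> h g; rewrite -(smD (ev_asm h) (ev_asm g)); apply: eq_sm => i.
rewrite -mulrDr -(smD (ev_row_asm i h) (ev_row_asm i g)); congr (_ * _).
by apply: eq_sm => j; rewrite -mulrDl.
Qed.

Lemma evZ k c K : nb c K -> ev (sclA k c) t s = k * ev c t s.
Proof.
move=> h; rewrite -(smZ k (ev_asm h)); apply: eq_sm => i.
rewrite mulrCA -(smZ k (ev_row_asm i h)); congr (_ * _).
by apply: eq_sm => j; rewrite mulrA.
Qed.

Lemma evB c d K L : nb c K -> nb d L -> ev (subA c d) t s = ev c t s - ev d t s.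
Proof.
move=> h g; rewrite -mulN1r -(evZ _ g) -(evD h (nbZ (-1) g)); apply: eq_ev => i j.
by rewrite /addA /sclA mulN1r.
Qed.

Lemma nb_mono a b k : nb (mono a b k) `|k|.
Proof.
move=> N; rewrite /mono.
have row i : \sum_(j < N) `|if (i == a) && ((j : nat) == b) then k else 0| <= (i == a)%:R * `|k|.
  case: (i == a) => /=; last by rewrite big1 ?mul0r// => j _; rewrite normr0.
  have [bN|Nb] := ltnP b N; last first.
    rewrite big1 ?mul1r// => j _; rewrite ifF ?normr0//.
    by apply/negbTE; rewrite neq_ltn (leq_trans (ltn_ord j) Nb).
  rewrite (bigD1 (Ordinal bN))//= eqxx mul1r big1 ?addr0// => j /negbTE jb.
  by rewrite -(inj_eq val_inj)/= in jb; rewrite jb normr0.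
apply: le_trans (ler_sum _ (fun (i : 'I_N) _ => row i)) _; rewrite -mulr_suml ler_piMl//.
have [aN|Na] := ltnP a N; last first.
  rewrite big1 ?ler01// => j _; case: eqP => // ja.
  by move: (ltn_ord j); rewrite ja ltnNge Na.
rewrite (bigD1 (Ordinal aN))//= eqxx big1 ?addr0// => j /negbTE jb.
by rewrite -(inj_eq val_inj)/= in jb; rewrite jb.
Qed.

Lemma sm_single (u : nat -> R) a : (forall i, i != a -> u i = 0) -> sm u = u a.
Proof.
move=> h; rewrite (sm_finsupp (N := a.+1)) => [|n an].
  rewrite big_ord_recr/= big1 ?add0r// => i _; apply: h.
  by rewrite neq_ltn ltn_ord.
by apply: h; rewrite neq_ltn an orbT.
Qed.

Lemma ev_mono a b k : ev (mono a b k) t s = k * t ^+ a * s ^+ b.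
Proof.
rewrite /ev (sm_single (a := a)) => [|i ia].
  rewrite (sm_single (a := b)) => [|j jb]; rewrite /mono ?eqxx/=; first by ring.
  by rewrite (negbTE jb) mul0r.
rewrite (_ : sm _ = 0) ?mulr0// -[RHS](@sm0 R); apply: eq_sm => j.
by rewrite /mono (negbTE ia) mul0r.
Qed.

Lemma nb_prod c d K L : nb c K -> nb d L -> nb (prodA c d) (K * L).
Proof.
move=> h g N.
pose C i := \sum_(j < N) `|c i j|; pose D i := \sum_(j < N) `|d i j|.
apply: (@le_trans _ _ (\sum_(i < N) cauchy C D i)).
  apply: ler_sum => i _; rewrite /prodA.
  apply: (@le_trans _ _ (\sum_(j < N) \sum_(k < i.+1) cauchy (fun j => `|c k j|) (fun j => `|d (i - k)%N j|) j)).
    apply: ler_sum => j _; apply: le_trans (ler_norm_sum _ _ _) _; apply: ler_sum => k _.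
    apply: le_trans (ler_norm_sum _ _ _) _; apply: ler_sum => l _; by rewrite normrM.
  rewrite exchange_big/=; apply: ler_sum => k _; rewrite cauchy_part /C mulr_suml.
  apply: ler_sum => l _; apply: ler_wpM2l => //.
  by apply: (sum_ord_le (u := fun j => `|d (i - k)%N j|)); rewrite ?leq_subr.
rewrite cauchy_part; apply: (@le_trans _ _ (\sum_(k < N) C k * L)).
  apply: ler_sum => k _; apply: ler_wpM2l; first exact: sumr_ge0.
  exact: nb_rect.
by rewrite -mulr_suml; apply: ler_wpM2r (h N); exact: nb_ge0 g.
Qed.

Lemma ev_prod c d K L : nb c K -> nb d L -> ev (prodA c d) t s = ev c t s * ev d t s.
Proof.
move=> h g; rewrite -(sm_cauchy (ev_asm h) (ev_asm g)); apply: eq_sm => i.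
transitivity (t ^+ i * \sum_(k < i.+1) sm (cauchy (fun j => c k j * s ^+ j) (fun j => d (i - k)%N j * s ^+ j))).
  congr (_ * _).
  rewrite -(sm_sum (index_enum 'I_i.+1) (u := fun (k : 'I_i.+1) => cauchy (fun j => c k j * s ^+ j) (fun j => d (i - k)%N j * s ^+ j))
     (K := fun k => sm (fun j => `|c k j|) * sm (fun j => `|d (i - k)%N j|))); last first.
    by move=> k; apply: asm_cauchy; [exact: ev_row_asm h|exact: ev_row_asm g].
  apply: eq_sm => j; rewrite /prodA mulr_suml; apply: eq_bigr => k _.
  rewrite mulr_suml; apply: eq_bigr => l _.
  have -> : s ^+ j = s ^+ l * s ^+ (j - l) by rewrite -exprD subnKC// -ltnS.
  by ring.
rewrite mulr_sumr; apply: eq_bigr => k _.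
rewrite (sm_cauchy (ev_row_asm k h) (ev_row_asm (i - k)%N g)).
have -> : t ^+ i = t ^+ k * t ^+ (i - k) by rewrite -exprD subnKC// -ltnS.
by ring.
Qed.

Lemma nb_sm (c : nat -> nat -> nat -> R) v K : (forall n, nb (c n) (v n)) -> asm v K ->
  nb (fun i j => sm (fun n => c n i j)) K.
Proof.
move=> h g N.
have gc i j : asm (fun n => c n i j) K by apply: asm_le g => n; exact: nb_term (h n).
apply: (@le_trans _ _ (\sum_(i < N) \sum_(j < N) sm (fun n => `|c n i j|))).
  by apply: ler_sum => i _; apply: ler_sum => j _; exact: sm_norm (gc i j).
under eq_bigr => i _.
  rewrite -(sm_sum (index_enum 'I_N) (K:=fun=>K) (u:=fun (j : 'I_N) n => `|c n i j|)); last first.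
    by move=> j; exact: asm_norm (gc i j).
  over.
rewrite -(sm_sum (index_enum 'I_N) (K:=fun=> \sum_(j < N) K) (u:=fun (i : 'I_N) n => \sum_(j < N) `|c n i j|)); last first.
  by move=> i; apply: (asm_sum (index_enum 'I_N) (u := fun (j : 'I_N) n => `|c n i j|) (K := fun=> K)) => j; exact: asm_norm.
apply: sm_le_bound; apply: asm_le g => n.
by rewrite ger0_norm; [exact: h|by apply: sumr_ge0 => i _; exact: sumr_ge0].
Qed.

Lemma ev_sm (c : nat -> nat -> nat -> R) v K : (forall n, nb (c n) (v n)) -> asm v K ->
  ev (fun i j => sm (fun n => c n i j)) t s = sm (fun n => ev (c n) t s).
Proof.
move=> h g; rewrite /ev.
have gc i j : asm (fun n => c n i j) K by apply: asm_le g => n; exact: nb_term (h n).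
rewrite (sm_swap (v := v) (K := K)) //; last by move=> n; exact: ev_asm (h n).
apply: eq_sm => i.
have hr n : asm (fun j => c n i j * s ^+ j) (v n).
  apply: asmW (ev_row_asm i (h n)) _.
  by apply: sm_le_bound; exact: asm_norm (nb_row i (h n)).
have a : asm (fun n => sm (fun j => c n i j * s ^+ j)) K.
  by apply: asm_le g => n; exact: sm_bound.
rewrite (smZ _ a).
congr (_ * _); rewrite (sm_swap (v := v) (K := K)) //.
apply: eq_sm => j; rewrite mulrC -(smZ _ (gc i j)).
by apply: eq_sm => n; rewrite mulrC.
Qed.

Lemma nb_pow c K n : nb c K -> nb (powA c n) (K ^+ n).
Proof.
move=> h; elim: n => [|n ih] /=; first by apply: nbW (nb_mono 0 0 1) _; rewrite normr1 expr0.
by rewrite exprS; exact: nb_prod.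
Qed.

Lemma ev_pow c K n : nb c K -> ev (powA c n) t s = ev c t s ^+ n.
Proof.
move=> h; elim: n => [|n ih] /=; first by rewrite ev_mono !expr0; ring.
by rewrite (ev_prod h (nb_pow n h)) ih exprS.
Qed.

Lemma asm_exp (K : R) : 0 <= K -> asm (fun n => K ^+ n / n`!%:R) (expR K).
Proof.
move=> K0; apply: asmP => [n|N]; first by rewrite divr_ge0 ?exprn_ge0.
have e0 : nondecreasing_seq (series (exp_coeff K)).
  by apply: nondecreasing_series => n _ _; exact: exp_coeff_ge0.
have := nondecreasing_cvgn_le e0 (is_cvg_series_exp_coeff K) N.
by rewrite series_ordE.
Qed.

Lemma fact_gt0R n : 0 < (n`!%:R : R).
Proof. by rewrite ltr0n fact_gt0. Qed.

Lemma nb_expterm m c K n : nb c K ->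
  nb (fun i j => (m <= n)%N%:R * powA c n i j / n`!%:R) (K ^+ n / n`!%:R).
Proof.
move=> h; apply: nb_le (nbW (nbZ (n`!%:R)^-1 (nb_pow n h)) _) => [i j|].
  rewrite /sclA mulrC !normrM; apply: ler_wpM2l => //.
  by case: leq; rewrite ?normr1 ?mul1r// normr0 mul0r.
by rewrite mulrC ger0_norm// invr_ge0 ltW// fact_gt0R.
Qed.

Lemma nb_expA c K : nb c K -> nb (expT 0 c) (expR K).
Proof.
by move=> h; apply: nb_sm (asm_exp (nb_ge0 h)) => n; exact: nb_expterm.
Qed.

Lemma ev_expA c K : nb c K -> ev (expT 0 c) t s = expR (ev c t s).
Proof.
move=> h; rewrite (ev_sm (fun n => nb_expterm 0 n h) (asm_exp (nb_ge0 h))).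
rewrite /expR -/(sm _); apply: eq_sm => n.
rewrite /exp_coeff/= -(ev_pow n h) mulrC -(evZ _ (nb_pow n h)).
by apply: eq_ev => i j; rewrite mul1r mulrC.
Qed.

End evaluation.

Lemma asm_exp1 (K : R) : 0 <= K ->
  asm (fun n => (1 <= n)%N%:R * (K ^+ n / n`!%:R)) (K * expR K).
Proof.
move=> K0; have := asm_shiftS (asmZ K (asm_exp K0)); rewrite ger0_norm//.
apply: asm_le => -[|n]/=; first by rewrite mul0r normr0.
rewrite mul1r ger0_norm ?divr_ge0 ?exprn_ge0// exprS -mulrA; apply: ler_wpM2l => //.
by apply: ler_wpM2l; rewrite ?exprn_ge0// lef_pV2 ?posrE ?fact_gt0R// ler_nat factS leq_pmull.
Qed.

Lemma asm_exp2 (K : R) : 0 <= K ->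
  asm (fun n => (2 <= n)%N%:R * (K ^+ n / n`!%:R)) (K ^+ 2 * expR K).
Proof.
move=> K0; have := asm_shiftS (asm_shiftS (asmZ (K ^+ 2) (asm_exp K0))).
rewrite ger0_norm ?exprn_ge0//.
apply: asm_le => -[|[|n]]/=; rewrite ?mul0r ?normr0//.
rewrite mul1r ger0_norm ?divr_ge0 ?exprn_ge0// -[X in K ^+ X]add2n exprD -mulrA.
apply: ler_wpM2l; rewrite ?exprn_ge0//.
apply: ler_wpM2l; rewrite ?exprn_ge0// lef_pV2 ?posrE ?fact_gt0R// ler_nat !factS.
by rewrite mulnA leq_pmull.
Qed.

Lemma nb_expT1 c K : nb c K -> nb (expT 1 c) (K * expR K).
Proof.
move=> h; apply: nb_sm (asm_exp1 (nb_ge0 h)) => -[|n].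
  by move=> N; rewrite !mul0r; under eq_bigr do under eq_bigr do rewrite !mul0r normr0;
    rewrite big1// => i _; rewrite big1.
by rewrite mul1r; exact: (nb_expterm 1 n.+1 h).
Qed.

Lemma nb_expT2 c K : nb c K -> nb (expT 2 c) (K ^+ 2 * expR K).
Proof.
move=> h; apply: nb_sm (asm_exp2 (nb_ge0 h)) => n.
case: (leqP 2 n) => n2.
  by rewrite mul1r; have := nb_expterm 2 n h; rewrite n2.
move=> N; rewrite !mul0r.
by rewrite big1// => i _; rewrite big1// => j _; rewrite !mul0r normr0.
Qed.

Lemma powA1 c i j : powA c 1 i j = c i j.
Proof.
rewrite /powA /prodA big_ord_recr/= big_ord_recr/= !subnn /mono/= mulr1.
rewrite !big1 ?add0r// => k _.
  by rewrite gtn_eqF ?mulr0// subn_gt0 ltn_ord.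
rewrite big1// => l _.
by rewrite [(i - k == 0)%N]gtn_eqF ?mulr0 ?subn_gt0 ?ltn_ord.
Qed.

Lemma subA_pow c d K D n : nb c K -> nb d K -> nb (subA c d) D ->
  nb (subA (powA c n.+1) (powA d n.+1)) (n.+1%:R * K ^+ n * D).
Proof.
move=> h g e; elim: n => [|n ih].
  by apply: nbW (eq_nb _ e) _ => [i j|]; rewrite /subA ?powA1 ?expr0 ?mulr1 ?mul1r.
have -> : (n.+2%:R * K ^+ n.+1 * D) = K * (n.+1%:R * K ^+ n * D) + D * K ^+ n.+1.
  by rewrite -[n.+2]addn1 natrD exprS; ring.
apply: eq_nb (nbD (nb_prod h ih) (nb_prod e (nb_pow n.+1 g))) => i j.
rewrite /subA -![powA _ n.+2]/(prodA _ (powA _ n.+1)).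
move: (powA c n.+1) (powA d n.+1) => P Q.
rewrite /addA /prodA -sumrB -big_split/=; apply: eq_bigr => k _.
by rewrite -sumrB -big_split/=; apply: eq_bigr => l _; ring.
Qed.

Lemma nb_expT_sub m c d K D v L : nb c K -> nb d K -> nb (subA c d) D ->
  (forall n, v n = (m <= n)%N%:R * (if n is n'.+1 then K ^+ n' / n'`!%:R else 0) * D) ->
  asm v L -> nb (subA (expT m c) (expT m d)) L.
Proof.
move=> h g e hv hL.
have E i j : subA (expT m c) (expT m d) i j =
   sm (fun n => (m <= n)%N%:R * subA (powA c n) (powA d n) i j / n`!%:R).
  rewrite /subA /expT -(smB (K := expR K) (L := expR K)).
  - by apply: eq_sm => n; ring.
  - by apply: asm_le (asm_exp (nb_ge0 h)) => n; exact: nb_term (nb_expterm m n h).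
  - by apply: asm_le (asm_exp (nb_ge0 h)) => n; exact: nb_term (nb_expterm m n g).
apply: eq_nb E _; apply: nb_sm hL => n.
have D0 := nb_ge0 e; have K0 := nb_ge0 h.
case: n hv => [|n] hv; rewrite hv.
  rewrite mulr0 mul0r => N; rewrite big1// => i _; rewrite big1// => j _.
  by rewrite /subA/= subrr mulr0 mul0r normr0.
case: leq; last first.
  move=> N; rewrite !mul0r big1// => i _; rewrite big1// => j _.
  by rewrite !mul0r normr0.
rewrite mul1r; apply: nb_le (nbW (nbZ (n.+1`!%:R)^-1 (subA_pow n h g e)) _) => [i j|].
  by rewrite /sclA mul1r mulrC.
rewrite ger0_norm ?invr_ge0 ?(ltW (fact_gt0R _))// factS natrM.
rewrite le_eqVlt; apply/orP; left; apply/eqP; field.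
by rewrite !gt_eqF// ?fact_gt0R.
Qed.

Lemma nb_expT1_sub c d K D : nb c K -> nb d K -> nb (subA c d) D ->
  nb (subA (expT 1 c) (expT 1 d)) (expR K * D).
Proof.
move=> h g e; apply: (nb_expT_sub h g e (fun=> erefl)).
have := asm_shiftS (asmZ D (asm_exp (nb_ge0 h))); rewrite ger0_norm ?(nb_ge0 e)// mulrC.
by apply: eq_asm => -[|n]/=; rewrite ?mul0r// mul1r mulrC.
Qed.

Lemma nb_expT2_sub c d K D : nb c K -> nb d K -> nb (subA c d) D ->
  nb (subA (expT 2 c) (expT 2 d)) (K * expR K * D).
Proof.
move=> h g e; apply: (nb_expT_sub h g e (fun=> erefl)).
have := asm_shiftS (asmZ D (asm_exp1 (nb_ge0 h))); rewrite ger0_norm ?(nb_ge0 e)// mulrC.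
by apply: eq_asm => -[|n]/=; rewrite ?mul0r// mulrC.
Qed.

Definition eqd n c d := forall i j, (i + j < n)%N -> c i j = d i j.

Lemma prodA_eqd n c c' d d' : eqd n c c' -> eqd n d d' -> eqd n (prodA c d) (prodA c' d').
Proof.
move=> h g i j ij; apply: eq_bigr => k _; apply: eq_bigr => l _.
by rewrite h ?g//; move: (ltn_ord k) (ltn_ord l); lia.
Qed.

Lemma prodA_eqdS n c c' d d' : c 0%N 0%N = 0 -> c' 0%N 0%N = 0 ->
  d 0%N 0%N = 0 -> d' 0%N 0%N = 0 ->
  eqd n c c' -> eqd n d d' -> eqd n.+1 (prodA c d) (prodA c' d').
Proof.
move=> c0 c0' d0 d0' h g i j ij; apply: eq_bigr => k _; apply: eq_bigr => l _.
have [k0|k0] := eqVneq (k + l)%N 0%N.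
  by have -> : k = 0%N :> nat; [lia|]; have -> : l = 0%N :> nat; [lia|]; rewrite c0 c0' !mul0r.
have [e|ne] := eqVneq (i + j)%N (k + l)%N.
  have -> : (i - k = 0)%N; first by move: (ltn_ord k) (ltn_ord l); lia.
  have -> : (j - l = 0)%N; first by move: (ltn_ord k) (ltn_ord l); lia.
  by rewrite d0 d0' !mulr0.
by rewrite h ?g//; move: (ltn_ord k) (ltn_ord l); lia.
Qed.

Lemma prodA00 c d : prodA c d 0 0 = c 0%N 0%N * d 0%N 0%N.
Proof. by rewrite /prodA !big_ord1. Qed.

Lemma powA_eqd n c c' m : eqd n c c' -> eqd n (powA c m) (powA c' m).
Proof. by move=> h; elim: m => [|m ih] //=; exact: prodA_eqd. Qed.

Lemma powA00 c m : c 0%N 0%N = 0 -> powA c m.+1 0 0 = 0.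
Proof. by move=> h; rewrite /= prodA00 h mul0r. Qed.

Lemma expT_eqd m n c c' : eqd n c c' -> eqd n (expT m c) (expT m c').
Proof. by move=> h i j ij; apply: eq_sm => k; rewrite (powA_eqd _ h). Qed.

Lemma expT2_eqdS n c c' : c 0%N 0%N = 0 -> c' 0%N 0%N = 0 ->
  eqd n c c' -> eqd n.+1 (expT 2 c) (expT 2 c').
Proof.
move=> c0 c0' h i j ij; apply: eq_sm => -[|[|k]]; rewrite ?mul0r//.
congr (_ * _ / _).
by apply: (@prodA_eqdS n c c' (powA c k.+1) (powA c' k.+1)) => //; rewrite ?powA00//; exact: powA_eqd.
Qed.

Lemma expT00 m c : (0 < m)%N -> c 0%N 0%N = 0 -> expT m c 0 0 = 0.
Proof.
case: m => // m _ c0; rewrite /expT -[RHS](@sm0 R); apply: eq_sm => -[|n].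
  by rewrite !mul0r.
by rewrite powA00// mulr0 mul0r.
Qed.

Lemma expT1E c K i j : nb c K -> expT 1 c i j = c i j + expT 2 c i j.
Proof.
move=> h; rewrite /expT.
have a m : asm (fun n => (m <= n)%N%:R * powA c n i j / n`!%:R) (expR K).
  by apply: asm_le (asm_exp (nb_ge0 h)) => n; exact: nb_term (nb_expterm m n h).
have b : asm (fun n => (n == 1)%N%:R * c i j) `|c i j|.
  apply: asm_le (_ : asm (fun n => (n == 1)%N%:R * `|c i j|) _).
    by move=> n; rewrite normrM; case: eqP; rewrite ?normr1 ?normr0.
  move=> N; case: N => [|[|N]]; rewrite ?big_ord0// ?big_ord1 ?mul0r ?normr0//.
  rewrite 2!big_ord_recl/= big1; first by rewrite mul0r mul1r normr0 normr_id addr0 add0r.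
  by move=> k _; rewrite mul0r normr0.
rewrite -[in RHS](_ : sm (fun n => (n == 1)%N%:R * c i j) = c i j); last first.
  by rewrite (sm_single (a := 1%N)) ?mul1r// => k /negbTE ->; rewrite mul0r.
rewrite -(smD b (a 2%N)); apply: eq_sm => -[|[|n]]; rewrite ?mul0r ?addr0 ?add0r//.
by rewrite !mul1r powA1 invr1 mulr1.
Qed.

Lemma expT0E c K i j : nb c K -> expT 0 c i j = mono 0 0 1 i j + expT 1 c i j.
Proof.
move=> h; rewrite /expT.
have a m : asm (fun n => (m <= n)%N%:R * powA c n i j / n`!%:R) (expR K).
  by apply: asm_le (asm_exp (nb_ge0 h)) => n; exact: nb_term (nb_expterm m n h).
rewrite (sm_recl (a 0%N)) [in RHS](sm_recl (a 1%N)).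
by rewrite !mul0r add0r mul1r invr1 mulr1.
Qed.

Lemma prodA10 c d : prodA c d 1 0 = c 0%N 0%N * d 1%N 0%N + c 1%N 0%N * d 0%N 0%N.
Proof. by rewrite /prodA !big_ord_recr !big_ord0/= ?big_ord_recr ?big_ord0/= !add0r ?subn0 ?subnn. Qed.

Lemma prodA20 c d : prodA c d 2 0 = c 0%N 0%N * d 2%N 0%N + c 1%N 0%N * d 1%N 0%N +
  c 2%N 0%N * d 0%N 0%N.
Proof. by rewrite /prodA !big_ord_recr !big_ord0/= ?big_ord_recr ?big_ord0/= !add0r ?subn0 ?subnn. Qed.

Lemma powA10 c n : c 0%N 0%N = 0 -> powA c n.+2 1 0 = 0.
Proof. by move=> h; rewrite [powA _ n.+2]/= prodA10 h mul0r add0r -/(powA c n.+1) powA00// mulr0. Qed.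

Lemma expT2_10 c : c 0%N 0%N = 0 -> expT 2 c 1 0 = 0.
Proof.
move=> h; rewrite /expT -[RHS](@sm0 R); apply: eq_sm => -[|[|n]]; rewrite ?mul0r//.
by rewrite powA10// mulr0 mul0r.
Qed.

Lemma expT2_20 c : c 0%N 0%N = 0 -> expT 2 c 2 0 = c 1%N 0%N ^+ 2 / 2.
Proof.
move=> h; rewrite /expT (sm_single (a := 2%N)) => [|[|[|[|n]]]//=] => [|_|_|_]; rewrite ?mul0r//.
  by rewrite mul1r [powA _ 2]/= prodA20 h mul0r add0r -/(powA c 1) !powA1 h mulr0 addr0 expr2.
rewrite -/(powA c n.+3) [powA _ n.+3]/= -/(powA c n.+2) prodA20 h mul0r add0r powA10// mulr0 add0r.
by rewrite powA00// mulr0 mulr0 mul0r.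
Qed.

End Arrays.

(** * Contraction of Markov averages over loops *)

Section RealFacts.
Variable R : realType.

Lemma expR_sub1_le (z : R) : 0 <= z -> expR z - 1 <= z * expR z.
Proof.
move=> z0; have := expR_ge1Dx (- z); rewrite expRN => h.
have e0 := expR_gt0 z.
have : (1 - z) * expR z <= (expR z)^-1 * expR z by apply: ler_wpM2r => //; exact: ltW.
rewrite mulVf ?gt_eqF//; lra.
Qed.

Lemma expr_eventually_le (x e : R) : 0 <= x < 1 -> 0 < e -> exists N, forall n, (N <= n)%N -> x ^+ n <= e.
Proof.
move=> /andP[x0 x1] e0; have : (fun n => x ^+ n) @ \oo --> 0.
  by apply: cvg_expr; rewrite ger0_norm.
move=> /cvgn_epsP/(_ _ e0)[N hN]; exists N => n /hN.
by rewrite sub0r normrN ger0_norm// exprn_ge0.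
Qed.

Lemma cauchy_geom_lim (u : nat -> R) C g : 0 <= g < 1 ->
  (forall n m, `|u (n + m)%N - u n| <= C * g ^+ n) ->
  (u @ \oo --> limn u) /\ (forall n, `|u n - limn u| <= C * g ^+ n).
Proof.
move=> g01 h.
have C0 : 0 <= C by have := le_trans (normr_ge0 _) (h 0%N 0%N); rewrite expr0 mulr1.
have cu : u @ \oo --> limn u.
  apply: R_complete; apply/cauchy_exP => e e0.
  have e1 : 0 < e / (C + 1) / 2 by rewrite !divr_gt0// ltr_wpDl.
  have [N hN] := expr_eventually_le g01 e1.
  exists (u N); exists N => // n /= Nn; rewrite -ball_normE/= distrC.
  rewrite -(subnKC Nn); apply: le_lt_trans (h _ _) _.
  apply: (@le_lt_trans _ _ (C * (e / (C + 1) / 2))); first by apply: ler_wpM2l => //; exact: hN.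
  have -> : C * (e / (C + 1) / 2) = (C / (C + 1)) * (e / 2).
    by field; rewrite gt_eqF// ltr_wpDl.
  apply: (@le_lt_trans _ _ (1 * (e / 2))); last by lra.
  apply: ler_wpM2r; first by lra.
  by rewrite ler_pdivrMr ?ltr_wpDl//; lra.
split=> // n; rewrite distrC.
have c2 : (fun m => `|u m - u n|) @ \oo --> `|limn u - u n|.
  by apply: cvg_norm; apply: cvgB => //; exact: cvg_cst.
by apply: (cvgr_to_le c2); exists n => // m /= nm; rewrite -(subnKC nm); exact: h.
Qed.

Lemma asm_geom (C g : R) : 0 <= C -> 0 <= g < 1 -> asm (fun n => C * g ^+ n) (C / (1 - g)).
Proof.
move=> C0 /andP[g0 g1]; apply: asmP => [n|N]; first by rewrite mulr_ge0// exprn_ge0.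
rewrite -mulr_sumr; apply: ler_wpM2l => //.
have g2 : 0 < 1 - g by rewrite subr_gt0.
rewrite -[leRHS]mul1r ler_pdivlMr//.
by rewrite mulrC -opprB mulNr -subrX1 opprB lerBlDr lerDl exprn_ge0.
Qed.

(* Weights [al k] turning agreement up to [k] symbols into a distance for which
   one application of a Markov kernel is already a strict contraction. *)
Definition metric_weights (b th : R) (al : nat -> R) (gam : R) :=
  [/\ 0 <= gam < 1, forall k, 0 < al k <= 1,
      forall k, (0 < k)%N -> 1 - expR (- (b * th ^+ k)) * (1 - al k.+1) <= gam * al k &
      forall k, th ^+ k <= 2 * al k].

Lemma metric_weights_exist (b th : R) : 0 <= b -> 0 < th < 1 ->
  exists al gam, metric_weights b th al gam.
Proof.
move=> b0 /andP[th0 th1].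
pose kap := expR (- b); have kap0 : 0 < kap by exact: expR_gt0.
have kap1 : kap <= 1 by rewrite /kap -[leRHS]expR0 ler_expR oppr_le0.
pose K := 2 / kap; have K2 : 2 <= K by rewrite /K ler_pdivlMr//; lra.
have K0 : 0 < K by lra.
pose rho := (1 + th) / 2; have rho1 : rho < 1 by rewrite /rho; lra.
have rth : th <= rho by rewrite /rho; lra.
have rho0 : 0 < rho by lra.
pose eta := (1 - rho) / 8; have eta0 : 0 < eta by rewrite /eta; lra.
have [N hN] : exists N, b * th ^+ N <= eta.
  have e1 : 0 < eta / (b + 1) by rewrite divr_gt0// ltr_wpDl.
  have th01 : 0 <= th < 1 by rewrite ltW.
  have [N hN] := expr_eventually_le th01 e1.
  exists N; apply: le_trans (ler_wpM2l b0 (hN N (leqnn _))) _.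
  rewrite mulrCA -[leRHS]mulr1; apply: ler_wpM2l; first by lra.
  by rewrite ler_pdivrMr ?ltr_wpDl//; lra.
pose ep := (2 * K ^+ N)^-1.
have KN0 : 0 < K ^+ N by exact: exprn_gt0.
have ep0 : 0 < ep by rewrite invr_gt0 mulr_gt0.
have epN : ep * K ^+ N = 1 / 2 by rewrite /ep; field; rewrite gt_eqF.
have epk k : (k <= N)%N -> ep <= ep * K ^+ k <= 1 / 2.
  move=> kN; rewrite -epN; apply/andP; split.
    by rewrite -[leLHS]mulr1; apply: ler_wpM2l; [lra|]; apply: exprn_ege1; lra.
  by apply: ler_wpM2l; [lra|]; apply: ler_weXn2l => //; lra.
pose al k := if (k <= N)%N then 1 - ep * K ^+ k else rho ^+ (k - N) / 2.
have alN k : (N <= k)%N -> al k = rho ^+ (k - N) / 2.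
  rewrite leq_eqVlt => /orP[/eqP<-|Nk]; last by rewrite /al leqNgt Nk.
  by rewrite /al leqnn epN subnn expr0; lra.
have al01 k : 0 < al k <= 1.
  have [kN|Nk] := leqP k N.
    by rewrite /al kN; have := epk k kN; lra.
  rewrite (alN _ (ltnW Nk)) divr_gt0 ?exprn_gt0//=.
  by have := exprn_ile1 (k - N) (ltW rho0) (ltW rho1); lra.
exists al, (Num.max (1 - ep) ((3 * rho + 1) / 4)); split=> //.
- rewrite le_max gt_max; have := epk 0%N (leq0n _); rewrite expr0 mulr1 => h.
  by apply/andP; split; [apply/orP; left; lra|apply/andP; split; lra].
- move=> k k0; have [kN|Nk] := ltnP k N.
    apply: (@le_trans _ _ ((1 - ep) * al k)); last first.
      by apply: ler_wpM2r; [case/andP: (al01 k) => /ltW|rewrite le_max lexx].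
    have -> : al k = 1 - ep * K ^+ k by rewrite /al (ltnW kN).
    have -> : al k.+1 = 1 - ep * K ^+ k * K by rewrite /al kN exprSr mulrA.
    have := epk k (ltnW kN); move: (ep * K ^+ k) => z /andP[z1 z2].
    have : kap <= expR (- (b * th ^+ k)).
      by rewrite ler_expR lerN2 ler_piMr// exprn_ile1// ltW.
    move=> hk; have : kap * (z * K) <= expR (- (b * th ^+ k)) * (z * K).
      by apply: ler_wpM2r => //; rewrite mulr_ge0; lra.
    have -> : kap * (z * K) = 2 * z by rewrite /K; field; rewrite gt_eqF.
    have -> : 1 - (1 - z * K) = z * K by ring.
    move=> h; have : 1 - 2 * z <= (1 - ep) * (1 - z) by nra.
    by lra.
  apply: (@le_trans _ _ ((3 * rho + 1) / 4 * al k)); last first.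
    by apply: ler_wpM2r; [case/andP: (al01 k) => /ltW|rewrite le_max lexx orbT].
  have -> : al k.+1 = rho * al k.
    by rewrite !alN// 1?ltnW// subSn// exprS; ring.
  have e1 := expR_ge1Dx (- (b * th ^+ k)).
  have tk : b * th ^+ k <= 2 * eta * al k.
    rewrite (alN _ Nk) -{1}(subnKC Nk) exprD mulrA.
    have -> : 2 * eta * (rho ^+ (k - N) / 2) = eta * rho ^+ (k - N) by field.
    apply: ler_pM => //; first by rewrite mulr_ge0// exprn_ge0// ltW.
      by rewrite exprn_ge0// ltW.
    by apply: lerXn2r; rewrite ?nnegrE// ltW.
  have := al01 k => /andP[a0 a1].
  have : 0 <= b * th ^+ k by rewrite mulr_ge0// exprn_ge0// ltW.
  move: tk e1; rewrite /eta; move: (b * th ^+ k) (expR _) (al k) a0 a1 => z e x x0 x1 zx ez z0.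
  have : (1 - z) * (1 - rho * x) <= e * (1 - rho * x).
    by apply: ler_wpM2r; [nra|lra].
  have : 0 <= z * (rho * x) by rewrite mulr_ge0// mulr_ge0// ltW.
  by lra.
- move=> k; have [kN|Nk] := leqP k N.
    have : th ^+ k <= 1 by apply: exprn_ile1; lra.
    by rewrite /al kN; have := epk k kN; lra.
  rewrite (alN _ (ltnW Nk)); apply: (@le_trans _ _ (rho ^+ (k - N))); last lra.
  apply: (@le_trans _ _ (th ^+ (k - N))); last by apply: lerXn2r; rewrite ?nnegrE// ltW.
  by apply: ler_wiXn2l; rewrite ?leq_subr//; lra.
Qed.

End RealFacts.

(* The full shift induced on a state: [pre n] prepends the [n]-th first-return
   loop, [tau n] is its length, and [agr k] is agreement up to [k] symbols. *)
Record loopsys := LoopSys {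
  lpt :> Type;
  pre : nat -> lpt -> lpt;
  tau : nat -> nat;
  agr : nat -> lpt -> lpt -> Prop;
  bpt : lpt;
  tau_gt0 : forall n, (0 < tau n)%N;
  agr1 : forall x y, agr 1 x y;
  agr_sym : forall k x y, agr k x y -> agr k y x;
  agr_le : forall k l x y, (k <= l)%N -> agr l x y -> agr k x y;
  agr_pre : forall k n x y, agr k x y -> agr (tau n + k) (pre n x) (pre n y) }.

Section Markov.
Variables (R : realType) (L : loopsys).
Implicit Types (f g : L -> R) (q A : nat -> L -> R) (al : nat -> R).

Definition op q f (x : L) : R := sm (fun n => q n x * f (pre n x)).

Definition Lip al H f := 0 <= H /\
  forall k x y, (0 < k)%N -> agr k x y -> `|f x - f y| <= H * al k.

Definition bdd B f := forall x : L, `|f x| <= B.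

Definition kern (b th : R) q :=
  [/\ forall n x, 0 <= q n x, forall x, asm (fun n => q n x) 1,
      forall x, sm (fun n => q n x) = 1 &
      forall n k x y, (0 < k)%N -> agr k x y -> q n x <= expR (b * th ^+ k) * q n y].

Lemma agr_preS k n (x y : L) : agr k x y -> agr k.+1 (pre n x) (pre n y).
Proof. by move=> h; apply: agr_le (agr_pre n h); rewrite -add1n leq_add2r tau_gt0. Qed.

Variables (b th : R) (al : nat -> R) (gam : R).
Hypotheses (b0 : 0 <= b) (th01 : 0 < th < 1) (mw : metric_weights b th al gam).

Lemma gam01 : 0 <= gam < 1. Proof. by case: mw. Qed.

Lemma al01 k : 0 < al k <= 1. Proof. by case: mw. Qed.

Lemma al_ge0 k : 0 <= al k. Proof. by case/andP: (al01 k) => /ltW. Qed.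

Lemma alS k : (0 < k)%N -> al k.+1 <= gam * al k.
Proof.
move=> k0; have [_ _ /(_ k k0) h _] := mw; apply: le_trans h.
have e1 : expR (- (b * th ^+ k)) <= 1.
  by rewrite -[leRHS]expR0 ler_expR oppr_le0 mulr_ge0// exprn_ge0// ltW; case/andP: th01.
have : expR (- (b * th ^+ k)) * (1 - al k.+1) <= 1 * (1 - al k.+1).
  by apply: ler_wpM2r => //; rewrite subr_ge0; case/andP: (al01 k.+1).
by lra.
Qed.

Lemma al_le k l : (0 < k)%N -> (k <= l)%N -> al l <= al k.
Proof.
move=> k0 /subnKC <-; elim: (l - k)%N => [|m ih]; first by rewrite addn0.
rewrite addnS; apply: le_trans ih; apply: le_trans (alS _) _; first by rewrite addn_gt0 k0.
by rewrite ler_piMl// ?al_ge0//; case/andP: gam01 => _ /ltW.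
Qed.

Lemma Lip_bdd H f : Lip al H f -> forall x y, `|f x - f y| <= H.
Proof.
move=> [H0 h] x y; apply: le_trans (h 1%N x y isT (agr1 x y)) _.
by rewrite ler_piMr//; case/andP: (al01 1).
Qed.

Lemma LipW H H' f : Lip al H f -> H <= H' -> Lip al H' f.
Proof.
move=> [H0 h] HH; split; first exact: le_trans HH.
by move=> k x y k0 xy; apply: le_trans (h k x y k0 xy) _; by apply: ler_wpM2r => //; exact: al_ge0.
Qed.

Lemma Lip_cst c : Lip al 0 (fun=> c).
Proof. by split=> // k x y _ _; rewrite subrr normr0 mul0r. Qed.

Lemma LipD H H' f g : Lip al H f -> Lip al H' g -> Lip al (H + H') (fun x => f x + g x).
Proof.
move=> [H0 h] [H0' h']; split; first exact: addr_ge0.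
move=> k x y k0 xy; rewrite opprD addrACA mulrDl.
by apply: le_trans (ler_normD _ _) _; apply: lerD; [exact: h|exact: h'].
Qed.

Lemma LipZ H c f : Lip al H f -> Lip al (`|c| * H) (fun x => c * f x).
Proof.
move=> [H0 h]; split; first exact: mulr_ge0.
move=> k x y k0 xy; rewrite -mulrBr normrM -mulrA; apply: ler_wpM2l => //.
exact: h.
Qed.

Lemma bdd_of_Lip H f : Lip al H f -> bdd (`|f (bpt L)| + H) f.
Proof.
move=> h x; have -> : f x = f (bpt L) + (f x - f (bpt L)) by ring.
by apply: le_trans (ler_normD _ _) _; apply: lerD => //; exact: Lip_bdd.
Qed.

Section Kernel.
Variable q : nat -> L -> R.
Hypothesis hq : kern b th q.

Lemma q_ge0 n x : 0 <= q n x. Proof. by case: hq. Qed.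
Lemma q_asm x : asm (fun n => q n x) 1. Proof. by case: hq. Qed.
Lemma q_sm x : sm (fun n => q n x) = 1. Proof. by case: hq. Qed.

Lemma bdd_ge0 B f : bdd B f -> 0 <= B.
Proof. by move=> /(_ (bpt L)); apply: le_trans. Qed.

Lemma op_asm B f x : bdd B f -> asm (fun n => q n x * f (pre n x)) B.
Proof.
move=> h; have B0 := bdd_ge0 h.
have := asmZ B (q_asm x); rewrite ger0_norm// mulr1; apply: asm_le => n.
by rewrite normrM ger0_norm ?q_ge0// mulrC; apply: ler_wpM2r; rewrite ?q_ge0.
Qed.

Lemma op_bdd B f : bdd B f -> bdd B (op q f).
Proof. by move=> h x; exact: sm_bound (op_asm x h). Qed.

Lemma opD B B' f g x : bdd B f -> bdd B' g ->
  op q (fun y => f y + g y) x = op q f x + op q g x.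
Proof.
move=> h h'; rewrite -(smD (op_asm x h) (op_asm x h')).
by apply: eq_sm => n; rewrite mulrDr.
Qed.

Lemma opZ B c f x : bdd B f -> op q (fun y => c * f y) x = c * op q f x.
Proof. by move=> h; rewrite -(smZ c (op_asm x h)); apply: eq_sm => n; rewrite mulrCA. Qed.

Lemma op_cst c x : op q (fun=> c) x = c.
Proof.
rewrite /op -[RHS]mulr1 -(q_sm x) -(smZ c (q_asm x)); apply: eq_sm => n.
by rewrite mulrC.
Qed.

Lemma op_le B B' f g x : bdd B f -> bdd B' g -> (forall y, f y <= g y) -> op q f x <= op q g x.
Proof.
move=> h h' fg; apply: (sm_le (op_asm x h) (op_asm x h')) => n.
by apply: ler_wpM2l; rewrite ?q_ge0.
Qed.

Lemma op_near B f x c d : bdd B f -> (forall y, `|f y - c| <= d) -> `|op q f x - c| <= d.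
Proof.
move=> h fc; have d0 : 0 <= d by apply: le_trans (fc (bpt L)).
have hc : bdd `|- c| (fun=> - c) by move=> y.
rewrite -[X in _ - X](op_cst c x) -[X in `|_ - X|](_ : - op q (fun=> - c) x = _); last first.
  by rewrite !op_cst opprK.
rewrite opprK -(opD x h hc); apply: op_bdd => y; exact: fc.
Qed.

Lemma iter_bdd B f n : bdd B f -> bdd B (iter n (op q) f).
Proof. by move=> h; elim: n => //= n ih; exact: op_bdd. Qed.

Lemma iter_near B f x c d n : bdd B f -> (forall y, `|f y - c| <= d) ->
  `|iter n (op q) f x - c| <= d.
Proof.
move=> h fc; elim: n x => [|n ih] x //=.
by apply: (op_near _ (iter_bdd n h)).
Qed.

Lemma sup_bracket H f : Lip al H f -> exists S, forall z : L, S - H <= f z <= S.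
Proof.
move=> hf; exists (sup (range f)) => z.
have ub : has_sup (range f).
  split; first by exists (f z), z.
  exists (f z + H) => _ [y _ <-]; have := Lip_bdd hf y z.
  by rewrite ler_norml; lra.
apply/andP; split; last by apply: ub_le_sup; [case: ub|exists z].
rewrite lerBlDr; apply: ge_sup; first by case: ub.
move=> _ [y _ <-]; have := Lip_bdd hf y z.
by rewrite ler_norml; lra.
Qed.

Lemma contraction_half H f k x y : Lip al H f -> (0 < k)%N -> agr k x y ->
  op q f x - op q f y <= gam * H * al k.
Proof.
move=> hf k0 xy; have [H0 h] := hf; have /andP[g0 g1] := gam01.
have bf := bdd_of_Lip hf; set B := _ + H in bf.
have [_ _ _ dist] := hq.
pose m n := Num.min (q n x) (q n y).
have m0 n : 0 <= m n by rewrite le_min !q_ge0.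
have mx n : m n <= q n x by rewrite ge_min lexx.
have my n : m n <= q n y by rewrite ge_min lexx orbT.
have am : asm m 1 by apply: asm_le (q_asm x) => n; rewrite ger0_norm.
set kap := sm m.
have kap0 : expR (- (b * th ^+ k)) <= kap.
  rewrite -[leLHS]mulr1 -(q_sm x) -(smZ _ (q_asm x)).
  apply: (sm_le (asmZ _ (q_asm x)) am) => n.
  rewrite le_min; apply/andP; split.
    rewrite ler_piMl ?q_ge0// -[leRHS]expR0 ler_expR oppr_le0 mulr_ge0// exprn_ge0// ltW//.
    by case/andP: th01.
  rewrite expRN mulrC ler_pdivrMr ?expR_gt0// mulrC; exact: dist.
have [S hS] := sup_bracket hf.
have B0 := bdd_ge0 bf.
have amf z : asm (fun n => m n * f (pre n z)) (B * 1).
  have := asmZ B am; rewrite ger0_norm//; apply: asm_le => n.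
  by rewrite normrM (ger0_norm (m0 n)) mulrC; apply: ler_wpM2r.
have arx : asm (fun n => q n x - m n) (1 + 1) by exact: asmD (q_asm x) (asmN am).
have ary : asm (fun n => q n y - m n) (1 + 1) by exact: asmD (q_asm y) (asmN am).
have e1 : op q f x - sm (fun n => m n * f (pre n x)) <= (1 - kap) * S.
  rewrite -(smB (op_asm x bf) (amf x)) -(q_sm x) -(smB (q_asm x) am) mulrC -(smZ S arx).
  apply: (sm_le (asmD (op_asm x bf) (asmN (amf x))) (asmZ S arx)) => n.
  rewrite -mulrBl mulrC; apply: ler_wpM2r; first by rewrite subr_ge0.
  by case/andP: (hS (pre n x)).
have e2 : (1 - kap) * (S - H) <= op q f y - sm (fun n => m n * f (pre n y)).
  rewrite -(smB (op_asm y bf) (amf y)) -(q_sm y) -(smB (q_asm y) am) mulrC -(smZ (S - H) ary).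
  apply: (sm_le (asmZ (S - H) ary) (asmD (op_asm y bf) (asmN (amf y)))) => n.
  rewrite -mulrBl mulrC; apply: ler_wpM2l; first by rewrite subr_ge0.
  by case/andP: (hS (pre n y)).
have e3 : sm (fun n => m n * f (pre n x)) - sm (fun n => m n * f (pre n y)) <= kap * (H * al k.+1).
  rewrite -(smB (amf x) (amf y)) mulrC -(smZ _ am).
  apply: (sm_le (asmD (amf x) (asmN (amf y))) (asmZ _ am)) => n.
  rewrite -mulrBr mulrC; apply: ler_wpM2r => //.
  apply: le_trans (ler_norm _) _; apply: h => //; exact: agr_preS.
have [_ _ /(_ k k0) e4 _] := mw.
have e5 : expR (- (b * th ^+ k)) * (1 - al k.+1) <= kap * (1 - al k.+1).
  by apply: ler_wpM2r => //; rewrite subr_ge0; case/andP: (al01 k.+1).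
have : H * (1 - kap * (1 - al k.+1)) <= H * (gam * al k) by apply: ler_wpM2l => //; lra.
by move: e1 e2 e3; lra.
Qed.

Lemma contraction H f : Lip al H f -> Lip al (gam * H) (op q f).
Proof.
move=> hf; have [H0 h] := hf; have /andP[g0 g1] := gam01.
split; first exact: mulr_ge0.
move=> k x y k0 xy; rewrite ler_norml lerNl opprB; apply/andP; split.
  by apply: contraction_half => //; exact: agr_sym.
exact: contraction_half.
Qed.

Lemma iter_Lip H f n : Lip al H f -> Lip al (gam ^+ n * H) (iter n (op q) f).
Proof.
move=> h; elim: n => [|n ih] /=; first by rewrite expr0 mul1r.
by rewrite exprS -mulrA; exact: contraction.
Qed.

Definition nu f : R := limn (fun n => iter n (op q) f (bpt L)).

Lemma iter_cauchy H f n m x y : Lip al H f ->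
  `|iter (n + m) (op q) f x - iter n (op q) f y| <= H * gam ^+ n.
Proof.
move=> h; have hn := iter_Lip n h; rewrite addnC iterD.
apply: (@iter_near _ _ x _ _ m (bdd_of_Lip hn)) => z.
by rewrite mulrC; exact: Lip_bdd hn z y.
Qed.

Lemma nu_cvg H f : Lip al H f -> (fun n => iter n (op q) f (bpt L)) @ \oo --> nu f.
Proof.
by move=> h; have [] := cauchy_geom_lim gam01 (fun n m => iter_cauchy n m (bpt L) (bpt L) h).
Qed.

Lemma nu_near H f n x : Lip al H f -> `|iter n (op q) f x - nu f| <= H * gam ^+ n.
Proof.
move=> h; have c := nu_cvg h.
have c2 : (fun m => `|iter m (op q) f (bpt L) - iter n (op q) f x|) @ \oo --> `|nu f - iter n (op q) f x|.
  by apply: cvg_norm; apply: cvgB => //; exact: cvg_cst.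
rewrite distrC; apply: (cvgr_to_le c2); exists n => // m /= nm.
by rewrite -(subnKC nm); exact: iter_cauchy.
Qed.

Lemma nu_unique H f l : Lip al H f ->
  (fun n => iter n (op q) f (bpt L)) @ \oo --> l -> nu f = l.
Proof. by move=> h c; apply/cvg_lim. Qed.

Lemma nu_cst c : nu (fun=> c) = c.
Proof.
apply: (nu_unique (Lip_cst c)); rewrite (_ : (fun n => _) = fun=> c); first exact: cvg_cst.
apply/funext => n.
suff -> : iter n (op q) (fun=> c) = fun=> c by [].
by elim: n => //= n ->; apply/funext => x; rewrite op_cst.
Qed.

Lemma iterD_op H H' f g n x : Lip al H f -> Lip al H' g ->
  iter n (op q) (fun y => f y + g y) x = iter n (op q) f x + iter n (op q) g x.
Proof.
move=> h h'; have /funext : forall x, iter n (op q) (fun y => f y + g y) x =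
    iter n (op q) f x + iter n (op q) g x; last by move=> ->.
elim: n => // n ih y /=; rewrite (funext ih).
exact: (opD _ (bdd_of_Lip (iter_Lip n h)) (bdd_of_Lip (iter_Lip n h'))).
Qed.

Lemma iterZ_op H c f n x : Lip al H f ->
  iter n (op q) (fun y => c * f y) x = c * iter n (op q) f x.
Proof.
move=> h; have /funext : forall x, iter n (op q) (fun y => c * f y) x =
    c * iter n (op q) f x; last by move=> ->.
elim: n => // n ih y /=; rewrite (funext ih).
exact: (opZ _ _ (bdd_of_Lip (iter_Lip n h))).
Qed.

Lemma nuD H H' f g : Lip al H f -> Lip al H' g -> nu (fun x => f x + g x) = nu f + nu g.
Proof.
move=> h h'; apply: (nu_unique (LipD h h')).
under eq_fun do rewrite (iterD_op _ _ h h').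
by apply: cvgD; [exact: nu_cvg h|exact: nu_cvg h'].
Qed.

Lemma nuZ H c f : Lip al H f -> nu (fun x => c * f x) = c * nu f.
Proof.
move=> h; apply: (nu_unique (LipZ c h)).
under eq_fun do rewrite (iterZ_op _ _ _ h).
by apply: cvgM; [exact: cvg_cst|exact: nu_cvg h].
Qed.

Lemma nu_op H f : Lip al H f -> nu (op q f) = nu f.
Proof.
move=> h; apply: (nu_unique (contraction h)).
rewrite (_ : (fun n => _) = [sequence iter n.+1 (op q) f (bpt L)]_n).
  by rewrite (cvg_shiftS (fun n => iter n (op q) f (bpt L))); exact: nu_cvg h.
by apply/funext => n /=; rewrite -iterSr.
Qed.

Lemma nu_ge_iter H f n c : Lip al H f -> (forall x, c <= iter n (op q) f x) -> c <= nu f.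
Proof.
move=> h hc; have bn := bdd_of_Lip (iter_Lip n h).
apply: (cvgr_to_ge (nu_cvg h)); exists n => // m /= /subnKC <-.
rewrite addnC iterD; have -> : c = iter (m - n) (op q) (fun=> c) (bpt L).
  suff -> : iter (m - n) (op q) (fun=> c) = fun=> c by [].
  by elim: (m - n)%N => //= k ->; apply/funext => x; rewrite op_cst.
have hcst : bdd `|c| (fun=> c) by move=> y.
have : forall y, iter (m - n) (op q) (fun=> c) y <= iter (m - n) (op q) (iter n (op q) f) y.
  elim: (m - n)%N => [|k ih] y /=; first exact: hc.
  by apply: (op_le _ (iter_bdd k hcst) (iter_bdd k bn)).
exact.
Qed.

Lemma nu_ge H f c : Lip al H f -> (forall x, c <= f x) -> c <= nu f.
Proof. by move=> h hc; exact: (nu_ge_iter (n := 0) h). Qed.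

Lemma nu_le_iter H f n c : Lip al H f -> (forall x, iter n (op q) f x <= c) -> nu f <= c.
Proof.
move=> h hc; rewrite -lerN2 -[- nu f]mulN1r -(nuZ _ h).
apply: (nu_ge_iter (n := n) (LipZ _ h)) => x.
by rewrite (iterZ_op _ _ _ h) mulN1r lerN2.
Qed.

Lemma nu_le H f c : Lip al H f -> (forall x, f x <= c) -> nu f <= c.
Proof. by move=> h hc; exact: (nu_le_iter (n := 0) h). Qed.

Lemma nu_norm H f B : Lip al H f -> bdd B f -> `|nu f| <= B.
Proof.
move=> h hB; rewrite ler_norml; apply/andP; split.
  by apply: (nu_ge h) => x; move: (hB x); rewrite ler_norml => /andP[].
by apply: (nu_le h) => x; move: (hB x); rewrite ler_norml => /andP[].
Qed.

Definition sol f (x : L) : R := sm (fun n => iter n (op q) f x - nu f).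

Lemma sol_asm H f x : Lip al H f -> asm (fun n => iter n (op q) f x - nu f) (H / (1 - gam)).
Proof.
move=> h; have [H0 _] := h; apply: asm_le (asm_geom H0 gam01) => n; exact: nu_near.
Qed.

Lemma sol_bdd H f : Lip al H f -> bdd (H / (1 - gam)) (sol f).
Proof. by move=> h x; exact: sm_bound (sol_asm x h). Qed.

Lemma sol_Lip H f : Lip al H f -> Lip al (H / (1 - gam)) (sol f).
Proof.
move=> h; have [H0 _] := h; have /andP[g0 g1] := gam01.
split; first by rewrite divr_ge0// subr_ge0 ltW.
move=> k x y k0 xy; rewrite /sol -(smB (sol_asm x h) (sol_asm y h)).
rewrite mulrAC; apply: sm_bound; apply: asm_le (asm_geom (mulr_ge0 H0 (al_ge0 k)) gam01) => n.
have [_ /(_ k x y k0 xy)] := iter_Lip n h.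
rewrite opprB addrA subrK => /le_trans; apply.
by rewrite le_eqVlt; apply/orP; left; apply/eqP; ring.
Qed.

Lemma sol_eq H f x : Lip al H f -> sol f x - op q (sol f) x = f x - nu f.
Proof.
move=> h; have [H0 _] := h; have /andP[g0 g1] := gam01.
have a := sol_asm x h.
rewrite /sol (sm_recl a) /=.
suff -> : op q (sol f) x = sm (fun n => iter n.+1 (op q) f x - nu f) by rewrite addrK.
transitivity (sm (fun n => sm (fun m => q n x * (iter m (op q) f (pre n x) - nu f)))).
  by apply: eq_sm => n; rewrite (smZ _ (sol_asm (pre n x) h)).
rewrite (sm_swap (v := fun n => H / (1 - gam) * q n x) (K := H / (1 - gam))).
- apply: eq_sm => m; rewrite iterS.
  have b1 := bdd_of_Lip (iter_Lip m h).
  have b2 : bdd `|nu f| (fun=> - nu f) by move=> y; rewrite normrN.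
  by rewrite -[X in _ + X](op_cst _ x) -(opD _ b1 b2).
- move=> n; have := asmZ (q n x) (sol_asm (pre n x) h).
  by rewrite ger0_norm ?q_ge0// mulrC.
- have := asmZ (H / (1 - gam)) (q_asm x).
  by rewrite ger0_norm ?mulr1// divr_ge0// subr_ge0 ltW.
Qed.

Lemma solD H H' f g x : Lip al H f -> Lip al H' g ->
  sol (fun y => f y + g y) x = sol f x + sol g x.
Proof.
move=> h h'; rewrite /sol -(smD (sol_asm x h) (sol_asm x h')).
by apply: eq_sm => n; rewrite (iterD_op _ _ h h') (nuD h h'); ring.
Qed.

Lemma solZ H c f x : Lip al H f -> sol (fun y => c * f y) x = c * sol f x.
Proof.
move=> h; rewrite /sol -(smZ c (sol_asm x h)).
by apply: eq_sm => n; rewrite (iterZ_op _ _ _ h) (nuZ _ h); ring.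
Qed.

End Kernel.
End Markov.

Section RuellePerronFrobenius.
Variables (R : realType) (L : loopsys) (c th K dl : R) (A : nat -> L -> R).
Hypotheses (c0 : 0 <= c) (th01 : 0 < th < 1) (A0 : forall n x, 0 <= A n x)
  (AK : forall x, asm (fun n => A n x) K) (dl0 : 0 < dl) (Adl : forall x, dl <= sm (fun n => A n x))
  (Adist : forall n k (x y : L), (0 < k)%N -> agr k x y -> A n x <= expR (c * th ^+ k) * A n y).

Definition logLip B (f : L -> R) :=
  (forall x, 0 < f x) /\
  forall k x y, (0 < k)%N -> agr k x y -> f x <= expR (B * th ^+ k) * f y.

Let B := c / (1 - th).

Lemma B_ge0 : 0 <= B. Proof. by rewrite divr_ge0// subr_ge0; case/andP: th01 => _ /ltW. Qed.

Lemma B_eq : c + B * th = B.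
Proof.
rewrite /B; field; rewrite gt_eqF// subr_gt0; by case/andP: th01.
Qed.

Lemma th_ge0 k : 0 <= th ^+ k <= 1.
Proof. by case/andP: th01 => h1 h2; rewrite exprn_ge0 ?exprn_ile1// ltW. Qed.

Lemma logLip_le B' f x y : 0 <= B' -> logLip B' f -> f x <= expR B' * f y.
Proof.
move=> B0 [f0 h]; apply: le_trans (h 1%N x y isT (agr1 x y)) _.
apply: ler_wpM2r; first exact: ltW.
by rewrite ler_expR ler_piMr//; case/andP: (th_ge0 1).
Qed.

Lemma logLip_bdd B' f : 0 <= B' -> logLip B' f -> bdd (expR B' * f (bpt L)) f.
Proof.
move=> B0 h x; rewrite ger0_norm; first exact: logLip_le.
by case: h => h _; exact: ltW.
Qed.

Lemma rpf_asm M f x : bdd M f -> asm (fun n => A n x * f (pre n x)) (M * K).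
Proof.
move=> h; have M0 := bdd_ge0 h.
have := asmZ M (AK x); rewrite ger0_norm//; apply: asm_le => n.
by rewrite normrM ger0_norm ?A0// mulrC; apply: ler_wpM2r; rewrite ?A0.
Qed.

Lemma op_logLip f : logLip B f -> logLip B (op A f).
Proof.
move=> h; have [f0 hf] := h; have bf := logLip_bdd B_ge0 h; set M := _ * _ in bf.
have M0 := bdd_ge0 bf.
split.
  move=> x; apply: (@lt_le_trans _ _ (expR (- B) * f (bpt L) * dl)).
    by rewrite !mulr_gt0// expR_gt0.
  apply: le_trans (ler_wpM2l _ (Adl x)) _; first by rewrite mulr_ge0 ?expR_ge0// ltW.
  rewrite -(smZ _ (AK x)); apply: (sm_le (asmZ _ (AK x)) (rpf_asm x bf)) => n.
  rewrite mulrC; apply: ler_wpM2l => //.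
  rewrite expRN mulrC ler_pdivrMr ?expR_gt0// mulrC.
  exact: logLip_le B_ge0 h.
move=> k x y k0 xy.
rewrite -(smZ _ (rpf_asm y bf)).
apply: (sm_le (rpf_asm x bf) (asmZ _ (rpf_asm y bf))) => n.
have e : expR (B * th ^+ k) = expR (c * th ^+ k) * expR (B * th ^+ k.+1).
  by rewrite -expRD exprS mulrA -mulrDl B_eq.
rewrite e mulrACA; apply: ler_pM => //; [exact: ltW|exact: Adist|].
by apply: hf => //; exact: agr_preS.
Qed.

Let hh n : L -> R := iter n (op A) (fun=> 1).

Lemma hh_logLip n : logLip B (hh n).
Proof.
elim: n => [|n ih]; last exact: op_logLip.
split=> // k x y _ _ /=; rewrite mulr1 -[leLHS]expR0 ler_expR mulr_ge0 ?B_ge0//.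
by case/andP: (th_ge0 k).
Qed.

Lemma hh_gt0 n x : 0 < hh n x. Proof. by case: (hh_logLip n). Qed.

Lemma hh_bdd n : bdd (expR B * hh n (bpt L)) (hh n).
Proof. exact: logLip_bdd B_ge0 (hh_logLip n). Qed.

Let qq j n x := A n x * hh j (pre n x) / hh j.+1 x.

Lemma qq_kern j : kern (2 * B) th (qq j).
Proof.
have a x : asm (fun n => A n x * hh j (pre n x)) _ := rpf_asm x (hh_bdd j).
have q0 n x : 0 <= qq j n x.
  by rewrite divr_ge0 ?mulr_ge0// ltW// hh_gt0.
have s x : sm (fun n => qq j n x) = 1.
  transitivity (sm (fun n => (hh j.+1 x)^-1 * (A n x * hh j (pre n x)))).
    by apply: eq_sm => n; rewrite mulrC.
  by rewrite (smZ _ (a x)) -/(op A (hh j) x) mulVf// gt_eqF// (hh_gt0 j.+1).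
split=> //.
- move=> x; rewrite -(s x); apply: asm_sm_ge0 => //.
  by apply: eq_asm (asmZ (hh j.+1 x)^-1 (a x)) => n; rewrite mulrC.
- move=> n k x y k0 xy; rewrite /qq.
  rewrite ler_pdivrMr ?hh_gt0//.
  have [_ /(_ k.+1 (pre n x) (pre n y) isT (agr_preS n xy)) h1] := hh_logLip j.
  have [_ /(_ k y x k0 (agr_sym xy)) h2] := hh_logLip j.+1.
  have h3 := Adist n k0 xy.
  have e : expR (2 * B * th ^+ k) = expR (c * th ^+ k) * expR (B * th ^+ k.+1) * expR (B * th ^+ k).
    rewrite -!expRD; congr expR; rewrite exprS.
    by transitivity ((c + B * th + B) * th ^+ k); [rewrite B_eq; ring|ring].
  rewrite e.
  have := ler_pM (A0 n x) (ltW (hh_gt0 j (pre n x))) h3 h1.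
  move=> /le_trans; apply.
  have y0 : 0 < hh j.+1 y := hh_gt0 j.+1 y.
  have -> : expR (c * th ^+ k) * expR (B * th ^+ k.+1) * expR (B * th ^+ k) *
     (A n y * hh j (pre n y) / hh j.+1 y) * hh j.+1 x =
     (expR (c * th ^+ k) * A n y * (expR (B * th ^+ k.+1) * hh j (pre n y))) *
     (expR (B * th ^+ k) * hh j.+1 x / hh j.+1 y) by ring.
  rewrite ler_peMr//.
    by rewrite !mulr_ge0 ?expR_ge0 ?A0// ltW// hh_gt0.
  by rewrite ler_pdivlMr// mul1r.
Qed.

Lemma rpf_exists : exists lam h B', [/\ 0 < lam, 0 <= B', logLip B' h &
  forall x, op A h x = lam * h x].
Proof.
have B0 := B_ge0.
have B20 : 0 <= 2 * B by rewrite mulr_ge0.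
have [al [gam mw]] := metric_weights_exist B20 th01.
have g01 : 0 <= gam < 1 by case: mw.
pose r n x := hh n.+1 x / hh n x.
have rS n x : r n.+1 x = op (qq n) (r n) x.
  rewrite /r [X in X / _](_ : _ = op A (hh n.+1) x)//.
  have a : asm (fun k => A k x * hh n.+1 (pre k x)) _ := rpf_asm x (hh_bdd n.+1).
  rewrite mulrC -(smZ _ a); apply: eq_sm => k; rewrite /qq.
  have h1 := hh_gt0 n (pre k x); have h2 := hh_gt0 n.+1 x.
  by field; rewrite !gt_eqF.
pose M := expR B * hh 1 (bpt L).
pose H := 2 * (B * expR B * M).
have M0 : 0 <= M := bdd_ge0 (hh_bdd 1).
have eB0 : 0 <= B * expR B by rewrite mulr_ge0 ?expR_ge0.
have BM0 : 0 <= B * expR B * M by exact: mulr_ge0.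
have H0 : 0 <= H by apply: mulr_ge0.
have r0E x : r 0%N x = hh 1 x by rewrite /r divr1.
have half k x y : (0 < k)%N -> agr k x y -> hh 1 x - hh 1 y <= H * al k.
  move=> k0 xy; have [_ /(_ k x y k0 xy) h] := hh_logLip 1.
  have t := th_ge0 k; have [_ _ _ /(_ k) ta] := mw.
  apply: (@le_trans _ _ (B * th ^+ k * expR B * hh 1 y)).
    have z0 : 0 <= B * th ^+ k by rewrite mulr_ge0//; case/andP: t.
    have : expR (B * th ^+ k) <= expR B by rewrite ler_expR ler_piMr//; case/andP: t.
    have := expR_sub1_le z0; move: (B * th ^+ k) z0 h => z z0 h e1 e2.
    have y0 := hh_gt0 1 y.
    have : z * expR z <= z * expR B by apply: ler_wpM2l.
    move=> e3; have : (expR z - 1) * hh 1 y <= z * expR B * hh 1 y.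
      by apply: ler_wpM2r; [exact: ltW|lra].
    by lra.
  rewrite /H; have -> : 2 * (B * expR B * M) * al k = (B * expR B * M) * (2 * al k) by ring.
  have -> : B * th ^+ k * expR B * hh 1 y = B * expR B * hh 1 y * th ^+ k by ring.
  apply: ler_pM => //; [|by case/andP: t|].
    by apply: mulr_ge0 => //; exact: ltW (hh_gt0 1 y).
  by apply: ler_wpM2l => //; exact: le_trans (ler_norm _) (hh_bdd 1 y).
have r0L : Lip al H (r 0%N).
  split=> // k x y k0 xy; rewrite !r0E ler_norml lerNl opprB; apply/andP; split.
    by apply: half => //; exact: agr_sym.
  exact: half.
have rL n : Lip al (gam ^+ n * H) (r n).
  elim: n => [|n ih]; first by rewrite expr0 mul1r.
  rewrite (funext (rS n)) exprS -mulrA; exact: (contraction B20 th01 mw (qq_kern n) ih).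
have rnear n m x y : `|r (n + m)%N x - r n y| <= H * gam ^+ n.
  elim: m x => [|m ih] x.
    by rewrite addn0 mulrC; exact: (Lip_bdd mw (rL n)).
  rewrite addnS rS; apply: (op_near (qq_kern (n + m)) _ (bdd_of_Lip mw (rL (n + m)%N))) => z.
  exact: ih.
have rdl n x : dl <= r n x.
  have r0 x' : dl <= r 0%N x'.
    rewrite r0E; apply: le_trans (Adl x') _; rewrite le_eqVlt; apply/orP; left; apply/eqP.
    by apply: eq_sm => k; rewrite mulr1.
  elim: n x => // n ih x; rewrite rS -(op_cst (qq_kern n) dl x).
  have bd : bdd `|dl| (fun _ : L => dl) by move=> y.
  exact: (op_le (qq_kern n) _ bd (bdd_of_Lip mw (rL n)) ih).
have [lcv lnear] := cauchy_geom_lim g01 (fun n m => rnear n m (bpt L) (bpt L)).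
set lam := limn _ in lcv lnear.
have lam0 : dl <= lam by apply: (cvgr_to_ge lcv); apply: nearW => n; exact: rdl.
pose ff n x := hh n x / hh n (bpt L).
have ffB n x : 0 <= ff n x <= expR B.
  rewrite divr_ge0 ?(ltW (hh_gt0 _ _))//= ler_pdivrMr ?hh_gt0//.
  exact: le_trans (ler_norm _) (hh_bdd n x).
pose C := expR B * H / dl.
have C0 : 0 <= C by apply: divr_ge0; [apply: mulr_ge0 => //; exact: expR_ge0|exact: ltW].
have step n x : `|ff n.+1 x - ff n x| <= C * gam ^+ n.
  have -> : ff n.+1 x - ff n x = ff n x * (r n x - r n (bpt L)) / r n (bpt L).
    have h1 := hh_gt0 n x; have h2 := hh_gt0 n (bpt L); have h3 := hh_gt0 n.+1 (bpt L).
    by rewrite /ff /r; field; rewrite !gt_eqF.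
  rewrite normrM [`|ff n x * _|]normrM.
  have -> : C * gam ^+ n = expR B * (H * gam ^+ n) * dl^-1 by rewrite /C; ring.
  have i1 : `|(r n (bpt L))^-1| <= dl^-1.
    rewrite normfV lef_pV2 ?posrE//; last by rewrite normr_gt0 gt_eqF// (lt_le_trans dl0).
    exact: le_trans (rdl n (bpt L)) (ler_norm _).
  have i2 : `|r n x - r n (bpt L)| <= H * gam ^+ n by have := rnear n 0%N x (bpt L); rewrite addn0.
  have i3 : `|ff n x| <= expR B by case/andP: (ffB n x) => ? ?; rewrite ger0_norm.
  exact: ler_pM (mulr_ge0 (normr_ge0 _) (normr_ge0 _)) (normr_ge0 _) (ler_pM (normr_ge0 _) (normr_ge0 _) i3 i2) i1.
have ffc x n m : `|ff (n + m)%N x - ff n x| <= C / (1 - gam) * gam ^+ n.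
  have -> : ff (n + m)%N x - ff n x = \sum_(k < m) (ff (n + k).+1 x - ff (n + k)%N x).
    elim: m => [|m ih]; first by rewrite addn0 subrr big_ord0.
    by rewrite big_ord_recr/= -ih addnS; ring.
  apply: le_trans (ler_norm_sum _ _ _) _.
  apply: (@le_trans _ _ (\sum_(k < m) gam ^+ n * (C * gam ^+ k))).
    by apply: ler_sum => k _; rewrite mulrCA -exprD; exact: step.
  rewrite -mulr_sumr mulrC; apply: ler_wpM2r; first by rewrite exprn_ge0//; case/andP: g01.
  have := asm_geom C0 g01 m; apply: le_trans; apply: ler_sum => k _; exact: ler_norm.
have ffl x := cauchy_geom_lim g01 (ffc x).
pose h x := limn (ff ^~ x).
have hcv x : (fun n => ff n x) @ \oo --> h x by case: (ffl x).
have hB x : expR (- B) <= h x.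
  apply: (cvgr_to_ge (hcv x)); apply: nearW => n.
  rewrite /ff expRN -[(expR B)^-1]mul1r ler_pdivrMr ?expR_gt0// mulrAC ler_pdivlMr ?hh_gt0// mul1r mulrC.
  exact: logLip_le B0 (hh_logLip n).
exists lam, h, B; split=> //; first exact: lt_le_trans lam0.
  split; first by move=> x; apply: lt_le_trans (hB x); exact: expR_gt0.
  move=> k x y k0 xy.
  have cy : (fun n => expR (B * th ^+ k) * ff n y) @ \oo --> expR (B * th ^+ k) * h y.
    by apply: cvgM; [exact: cvg_cst|exact: hcv].
  apply: (ler_cvg_to (hcv x) cy); apply: nearW => n.
  rewrite /ff mulrA; apply: ler_wpM2r; first by rewrite invr_ge0 ltW// hh_gt0.
  by have [_] := hh_logLip n; apply.
move=> x.
have c1 : (fun n => r n (bpt L) * ff n.+1 x) @ \oo --> lam * h x.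
  by apply: cvgM => //; have := hcv x; rewrite -(cvg_shiftS (ff ^~ x)).
have c2 : (fun n => op A (ff n) x) @ \oo --> op A h x.
  apply: (sm_tannery (v := fun n => expR B * A n x)).
  - move=> N n; rewrite normrM ger0_norm// mulrC; apply: ler_wpM2r => //.
    by rewrite ger0_norm; case/andP: (ffB N (pre n x)).
  - exact: (asmZ (expR B) (AK x)).
  - by move=> n; apply: cvgM; [exact: cvg_cst|exact: hcv].
suff e : (fun n => op A (ff n) x) = (fun n => r n (bpt L) * ff n.+1 x).
  by rewrite e in c2; exact: cvgn_uniq c2 c1.
apply/funext => n; rewrite /r /ff.
have -> : hh n.+1 (bpt L) / hh n (bpt L) * (hh n.+1 x / hh n.+1 (bpt L)) = (hh n (bpt L))^-1 * hh n.+1 x.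
  have h1 := hh_gt0 n (bpt L); have h2 := hh_gt0 n.+1 (bpt L).
  by field; rewrite !gt_eqF.
rewrite [hh n.+1 x]/(op A (hh n) x) -(smZ _ (rpf_asm x (hh_bdd n))).
by apply: eq_sm => k; ring.
Qed.

End RuellePerronFrobenius.

(** * The perturbed eigenvalue equation *)

Section Perturbation.
Variables (R : realType) (L : loopsys) (b th : R) (al : nat -> R) (gam : R).
Hypotheses (b0 : 0 <= b) (th01 : 0 < th < 1) (mw : metric_weights b th al gam).
Variable g : nat -> L -> R.
Hypothesis hg : kern b th g.
Variables (om K : R).
Hypotheses (om0 : 0 < om) (expmom : forall x, asm (fun n => g n x * expR (om * (tau L n)%:R)) K).

Let g0 n x : 0 <= g n x := q_ge0 hg n x.

Definition Tn n : R := (tau L n)%:R ^+ 2 * expR (om / 2 * (tau L n)%:R).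

Lemma tau_ge1 n : 1 <= (tau L n)%:R :> R. Proof. by rewrite ler1n tau_gt0. Qed.

Definition K2 := 8 / om ^+ 2 * K.

Lemma K2_ge0 : 0 <= K2.
Proof. by rewrite mulr_ge0 ?(asm_ge0 (expmom (bpt L)))// divr_ge0// exprn_ge0// ltW. Qed.

Lemma expR_ge_sqr (y : R) : 0 <= y -> y ^+ 2 / 2 <= expR y.
Proof.
move=> y0; have := sm_ge_part 3 (asm_exp y0).
rewrite !big_ord_recr big_ord0/= => h; rewrite -[expR y]/(sm (exp_coeff y)).
apply: le_trans (h _) => [|n]; last by rewrite divr_ge0// exprn_ge0.
by rewrite add0r lerDr addr_ge0// divr_ge0.
Qed.

Lemma gT_asm x : asm (fun n => g n x * Tn n) K2.
Proof.
have := asmZ (8 / om ^+ 2) (expmom x).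
rewrite ger0_norm ?divr_ge0 ?exprn_ge0 ?(ltW om0)//; apply: asm_le => n.
rewrite ger0_norm ?mulr_ge0 ?exprn_ge0 ?expR_ge0//.
rewrite [leRHS]mulrCA; apply: ler_wpM2l => //; rewrite /Tn.
have t0 : 0 <= (tau L n)%:R :> R by [].
have -> : om * (tau L n)%:R = om / 2 * (tau L n)%:R + om / 2 * (tau L n)%:R by lra.
rewrite expRD mulrA; apply: ler_wpM2r; first exact: expR_ge0.
have := @expR_ge_sqr (om / 2 * (tau L n)%:R); rewrite mulr_ge0 ?divr_ge0 ?(ltW om0)// => /(_ isT).
set z := expR _; set t := (tau L n)%:R => h.
have : 8 / om ^+ 2 * ((om / 2 * t) ^+ 2 / 2) <= 8 / om ^+ 2 * z.
  by apply: ler_wpM2l => //; rewrite divr_ge0 ?exprn_ge0// ltW.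
suff -> : 8 / om ^+ 2 * ((om / 2 * t) ^+ 2 / 2) = t ^+ 2 by [].
by field; rewrite gt_eqF.
Qed.

Lemma Tn_ge n : [/\ 0 <= Tn n, 1 <= Tn n, (tau L n)%:R <= Tn n &
  forall s, s <= om / 2 -> [/\ expR (s * (tau L n)%:R) <= Tn n,
    (tau L n)%:R * expR (s * (tau L n)%:R) <= Tn n &
    (tau L n)%:R ^+ 2 * expR (s * (tau L n)%:R) <= Tn n]].
Proof.
rewrite /Tn; have := tau_ge1 n; set t := (tau L n)%:R => t1.
have e1 : 1 <= expR (om / 2 * t) by rewrite -[leLHS]expR0 ler_expR; apply: mulr_ge0; [exact: divr_ge0 (ltW om0) _|exact: le_trans ler01 t1].
have t2 : t <= t ^+ 2 by rewrite expr2 ler_peMr; lra.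
split; [by rewrite mulr_ge0 ?exprn_ge0 ?expR_ge0; lra|nra|nra|].
move=> s s2; have e2 : expR (s * t) <= expR (om / 2 * t).
  by rewrite ler_expR; apply: ler_wpM2r => //; lra.
have e3 := expR_ge0 (s * t).
have h3 : t ^+ 2 * expR (s * t) <= t ^+ 2 * expR (om / 2 * t) by apply: ler_wpM2l => //; nra.
have h2 : t * expR (s * t) <= t ^+ 2 * expR (s * t) by apply: ler_wpM2r.
by split; nra.
Qed.

Lemma asm_gle f C x : (forall n, `|f n| <= C * Tn n) -> 0 <= C ->
  asm (fun n => g n x * f n) (C * K2).
Proof.
move=> h C0; have := asmZ C (gT_asm x); rewrite ger0_norm//; apply: asm_le => n.
by rewrite normrM ger0_norm// mulrCA; apply: ler_wpM2l.
Qed.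

Definition Cb := 4 * b * expR b.

Lemma Cb_ge0 : 0 <= Cb. Proof. by rewrite mulr_ge0 ?expR_ge0// mulr_ge0. Qed.

Lemma g_dist n k x y : (0 < k)%N -> agr k x y ->
  `|g n x - g n y| <= Cb / 2 * al k * (g n x + g n y).
Proof.
move=> k0 xy; have [_ _ _ hd] := hg; have [_ _ _ /(_ k) ta] := mw.
have t0 : 0 <= th ^+ k <= 1 by case/andP: th01 => h1 h2; rewrite exprn_ge0 ?exprn_ile1// ltW.
have half u v : agr k u v -> g n u - g n v <= Cb / 2 * al k * g n v.
  move=> uv; have h := hd n k u v k0 uv.
  have z0 : 0 <= b * th ^+ k by rewrite mulr_ge0//; case/andP: t0.
  have e1 : expR (b * th ^+ k) <= expR b by rewrite ler_expR ler_piMr//; case/andP: t0.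
  have e2 := expR_sub1_le z0.
  have e3 : b * th ^+ k * expR (b * th ^+ k) <= b * (2 * al k) * expR b.
    by apply: ler_pM => //; apply: ler_wpM2l.
  have : (expR (b * th ^+ k) - 1) * g n v <= b * (2 * al k) * expR b * g n v.
    by apply: ler_wpM2r => //; lra.
  rewrite /Cb; lra.
have a0 : 0 <= al k by case: mw => _ /(_ k) /andP[/ltW].
have c0 : 0 <= Cb / 2 * al k by rewrite mulr_ge0// divr_ge0// Cb_ge0.
have h1 := half x y xy; have h2 := half y x (agr_sym xy).
have p1 : 0 <= Cb / 2 * al k * g n x by exact: mulr_ge0.
have p2 : 0 <= Cb / 2 * al k * g n y by exact: mulr_ge0.
by rewrite ler_norml mulrDr; apply/andP; split; lra.
Qed.

Lemma avg_Lip (f : nat -> L -> R) C D : 0 <= C -> 0 <= D ->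
  (forall n x, `|f n x| <= C * Tn n) ->
  (forall n k x y, (0 < k)%N -> agr k x y -> `|f n x - f n y| <= D * al k * Tn n) ->
  Lip al ((Cb * C + D) * K2) (fun x => sm (fun n => g n x * f n x)).
Proof.
move=> C0 D0 hC hD; split; first by rewrite mulr_ge0 ?K2_ge0// addr_ge0// mulr_ge0// Cb_ge0.
move=> k x y k0 xy; have a0 : 0 <= al k by case: mw => _ /(_ k) /andP[/ltW].
rewrite -(smB (asm_gle x (hC^~ x) C0) (asm_gle y (hC^~ y) C0)).
have A1 := asmZ (Cb / 2 * al k * C) (asmD (gT_asm x) (gT_asm y)).
have A2 := asmZ (D * al k) (gT_asm y).
have c0 : 0 <= Cb / 2 * al k by rewrite mulr_ge0// divr_ge0// Cb_ge0.
rewrite ger0_norm in A1; last by rewrite mulr_ge0.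
rewrite ger0_norm in A2; last by rewrite mulr_ge0.
apply: sm_bound; apply: asmW (asm_le _ (asmD A1 A2)) _ => [n|]; last first.
  by rewrite le_eqVlt; apply/orP; left; apply/eqP; field.
have -> : g n x * f n x - g n y * f n y = (g n x - g n y) * f n x + g n y * (f n x - f n y) by ring.
apply: le_trans (ler_normD _ _) _; rewrite !normrM (ger0_norm (g0 n y)); apply: lerD.
  have -> : Cb / 2 * al k * C * (g n x * Tn n + g n y * Tn n) =
    (Cb / 2 * al k * (g n x + g n y)) * (C * Tn n) by ring.
  by apply: ler_pM => //; exact: g_dist.
by rewrite mulrCA; apply: ler_wpM2l => //; exact: hD.
Qed.

Definition tauhat x : R := sm (fun n => g n x * (tau L n)%:R).

Lemma tauhat_Lip : Lip al (Cb * K2) tauhat.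
Proof.
have -> : Cb * K2 = (Cb * 1 + 0) * K2 by ring.
apply: (@avg_Lip (fun n _ => (tau L n)%:R) 1 0 ler01 (lexx 0)) => [n x|n k x y _ _].
  by rewrite ger0_norm// mul1r; case: (Tn_ge n).
by rewrite subrr normr0 !mul0r.
Qed.

Lemma tauhat_ge1 x : 1 <= tauhat x.
Proof.
rewrite -(q_sm hg x); apply: (sm_le (q_asm hg x)).
  apply: (asm_gle (C := 1)) => // n; rewrite ger0_norm// mul1r; by case: (Tn_ge n).
by move=> n; rewrite ler_peMr ?tau_ge1.
Qed.

Lemma tauhat_asm x : asm (fun n => g n x * (tau L n)%:R) (1 * K2).
Proof. by apply: asm_gle => // n; rewrite ger0_norm// mul1r; case: (Tn_ge n). Qed.

Definition taubar : R := nu g tauhat.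

Lemma taubar_ge1 : 1 <= taubar.
Proof. by apply: (nu_ge b0 th01 mw hg tauhat_Lip) => x; exact: tauhat_ge1. Qed.

Definition LipA H (F : L -> nat -> nat -> R) := 0 <= H /\
  forall k x y, (0 < k)%N -> agr k x y -> nb (subA (F x) (F y)) (H * al k).

Lemma LipA_term H F i j : LipA H F -> Lip al H (fun x => F x i j).
Proof. by move=> [H0 h]; split=> // k x y k0 xy; exact: nb_term (h k x y k0 xy). Qed.

Definition comb (F : L -> nat -> nat -> R) (e : nat -> nat -> R) N x :=
  \sum_(i < N) \sum_(j < N) e i j * F x i j.

Lemma comb_Lip H F e N : (forall i j, `|e i j| <= 1) -> LipA H F -> Lip al H (comb F e N).
Proof.
move=> e1 [H0 h]; split=> // k x y k0 xy; apply: le_trans (h k x y k0 xy N).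
rewrite /comb -sumrB; apply: le_trans (ler_norm_sum _ _ _) _; apply: ler_sum => i _.
rewrite -sumrB; apply: le_trans (ler_norm_sum _ _ _) _; apply: ler_sum => j _.
by rewrite -mulrBr normrM ler_piMl.
Qed.

Lemma comb_bdd M F e N : (forall i j, `|e i j| <= 1) -> (forall x, nb (F x) M) -> bdd M (comb F e N).
Proof.
move=> e1 h x; apply: le_trans (h x N).
apply: le_trans (ler_norm_sum _ _ _) _; apply: ler_sum => i _.
apply: le_trans (ler_norm_sum _ _ _) _; apply: ler_sum => j _.
by rewrite normrM ler_piMl.
Qed.

Lemma lin_nb (Phi : (L -> R) -> R) (M H : R) F : LipA H F ->
  (forall f1 f2 H1 H2, Lip al H1 f1 -> Lip al H2 f2 -> Phi (fun x => f1 x + f2 x) = Phi f1 + Phi f2) ->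
  (forall c f1 H1, Lip al H1 f1 -> Phi (fun x => c * f1 x) = c * Phi f1) ->
  (forall e N, (forall i j, `|e i j| <= 1) -> `|Phi (comb F e N)| <= M) ->
  nb (fun i j => Phi (fun x => F x i j)) M.
Proof.
move=> hF hD hZ hM N.
have P0 : Phi (fun=> 0) = 0.
  rewrite -[RHS](mul0r (Phi (fun=> 0))) -(hZ 0 (fun=> 0) _ (@Lip_cst R L al 0)).
  by congr Phi; apply/funext => x; rewrite mul0r.
have term i j c : exists H', Lip al H' (fun x => c * F x i j).
  by eexists; exact: LipZ (LipA_term i j hF).
have row i (e : nat -> nat -> R) M' : exists2 H', Lip al H' (fun x => \sum_(j < M') e i j * F x i j) &
   Phi (fun x => \sum_(j < M') e i j * F x i j) = \sum_(j < M') e i j * Phi (fun x => F x i j).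
  elim: M' => [|M' [H' ih1 ih2]].
    exists 0; first by under eq_fun do rewrite big_ord0; exact: Lip_cst.
    by under eq_fun do rewrite big_ord0; rewrite big_ord0.
  have [H2 h2] := term i M' (e i M').
  exists (H' + H2); first by under eq_fun do rewrite big_ord_recr/=; exact: LipD.
  by under eq_fun do rewrite big_ord_recr/=; rewrite (hD _ _ _ _ ih1 h2) ih2 (hZ _ _ _ (LipA_term i M' hF)) big_ord_recr.
have box (e : nat -> nat -> R) M1 M2 : exists2 H', Lip al H' (fun x => \sum_(i < M1) \sum_(j < M2) e i j * F x i j) &
   Phi (fun x => \sum_(i < M1) \sum_(j < M2) e i j * F x i j) =
   \sum_(i < M1) \sum_(j < M2) e i j * Phi (fun x => F x i j).
  elim: M1 => [|M1 [H' ih1 ih2]].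
    exists 0; first by under eq_fun do rewrite big_ord0; exact: Lip_cst.
    by under eq_fun do rewrite big_ord0; rewrite big_ord0.
  have [H2 h2 h3] := row M1 e M2.
  exists (H' + H2); first by under eq_fun do rewrite big_ord_recr/=; exact: LipD.
  by under eq_fun do rewrite big_ord_recr/=; rewrite (hD _ _ _ _ ih1 h2) ih2 h3 big_ord_recr.
pose e i j := Num.sg (Phi (fun x => F x i j)).
have e1 i j : `|e i j| <= 1 by rewrite /e normr_sg lern1; case: eqP.
have := hM e N e1; have [_ _ ->] := box e N N.
apply: le_trans; apply: le_trans (ler_norm _).
by apply: ler_sum => i _; apply: ler_sum => j _; rewrite /e normrEsg.
Qed.

Lemma nu_nb H M F : LipA H F -> (forall x, nb (F x) M) ->
  nb (fun i j => nu g (fun x => F x i j)) M.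
Proof.
move=> hF hM; apply: (lin_nb hF) => [f1 f2 H1 H2 h1 h2|c f1 H1 h1|e N e1].
- exact: (nuD b0 th01 mw hg h1 h2).
- exact: (nuZ b0 th01 mw hg _ h1).
- exact: (nu_norm b0 th01 mw hg (comb_Lip N e1 hF) (comb_bdd N e1 hM)).
Qed.

Lemma sol_nb H F x : LipA H F -> nb (fun i j => sol g (fun x => F x i j) x) (H / (1 - gam)).
Proof.
move=> hF; apply: (lin_nb (Phi := fun f => sol g f x) hF) => [f1 f2 H1 H2 h1 h2|c f1 H1 h1|e N e1].
- exact: (solD b0 th01 mw hg _ h1 h2).
- exact: (solZ b0 th01 mw hg _ _ h1).
- exact: (sol_bdd b0 th01 mw hg (comb_Lip N e1 hF)).
Qed.

Lemma sol_LipA H F : LipA H F -> LipA (H / (1 - gam)) (fun x i j => sol g (fun x => F x i j) x).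
Proof.
move=> hF; have [H0 _] := hF; split; first by rewrite divr_ge0// subr_ge0 ltW//; case/andP: (gam01 mw).
move=> k x y k0 xy.
apply: (lin_nb (Phi := fun f => sol g f x - sol g f y) hF) => [f1 f2 H1 H2 h1 h2|c f1 H1 h1|e N e1].
- by rewrite !(solD b0 th01 mw hg _ h1 h2); ring.
- by rewrite !(solZ b0 th01 mw hg _ _ h1); ring.
- by have [_] := sol_Lip b0 th01 mw hg (comb_Lip N e1 hF); apply.
Qed.

Lemma sol_eq_A H F i j x : LipA H F -> nu g (fun x => F x i j) = 0 ->
  sol g (fun x => F x i j) x = F x i j + op g (sol g (fun x => F x i j)) x.
Proof.
move=> hF n0; have := sol_eq b0 th01 mw hg x (LipA_term i j hF).
by rewrite n0 subr0 => <-; rewrite subrK.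
Qed.

(* The unknown arrays [Q] (pressure increment) and [G x] (relative change of the
   eigenfunction) solve 1 + G = sum_n g_n exp(t Psi + s Chi - tau Q) (1 + G o pre n);
   [cd], [ce] and [rad] are chosen so that an l1 ball is invariant under the
   degree-by-degree iteration. *)
Section Equation.
Variables (Cp : R).
Hypothesis Cp0 : 0 <= Cp.

Definition cd := 3 * K2.
Definition ce := K2 * (3 * Cb + 8 * Cp + 1 + cd * Cb) / (1 - gam).
Definition cN := 2 + cd + ce.
Definition rad := Num.min 1 om / (2 * cN ^+ 2).

Lemma cd_ge0 : 0 <= cd. Proof. by rewrite mulr_ge0 ?K2_ge0. Qed.

Lemma ce_ge0 : 0 <= ce.
Proof.
have C0 := Cb_ge0; have d0 := cd_ge0; have [/andP[_ g1] _ _ _] := mw.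
apply: divr_ge0; last by rewrite subr_ge0 ltW.
apply: mulr_ge0 K2_ge0 _; have : 0 <= cd * Cb by exact: mulr_ge0.
by move: Cp0; lra.
Qed.

Lemma cN_ge2 : 2 <= cN. Proof. by have := cd_ge0; have := ce_ge0; rewrite /cN; lra. Qed.

Lemma rad_gt0 : 0 < rad.
Proof.
have N2 := cN_ge2; apply: divr_gt0; first by rewrite lt_min om0 ltr01.
by apply: mulr_gt0 => //; apply: exprn_gt0; lra.
Qed.

Variable r : R.
Hypothesis r_rad : r = rad.
Let de := cd * r.
Let et := ce * r.
Let s := 2 * r + de.

Lemma radP : [/\ 0 < r <= 1, 0 <= de, 0 <= et <= 1 / 4, 0 <= s <= om / 2 &
  s <= 1 / 4 /\ s ^+ 2 + s * et <= r].
Proof.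
have N2 := cN_ge2; have r0 : 0 < r by rewrite r_rad; exact: rad_gt0.
have d0 := cd_ge0; have e0 := ce_ge0.
have NN : 0 < 2 * cN ^+ 2 by rewrite mulr_gt0// exprn_gt0//; lra.
have e1 : r * (2 * cN ^+ 2) = Num.min 1 om by rewrite r_rad /rad divfK// gt_eqF.
have m1 : Num.min 1 om <= 1 by rewrite ge_min lexx.
have m2 : Num.min 1 om <= om by rewrite ge_min lexx orbT.
have rN : r * cN * 4 <= Num.min 1 om.
  rewrite -e1; have -> : r * (2 * cN ^+ 2) = r * cN * (2 * cN) by ring.
  by apply: ler_wpM2l; [rewrite mulr_ge0//; lra|lra].
have eN : r * cN = s + et by rewrite /s /de /et /cN; ring.
have et0 : 0 <= et by exact: mulr_ge0 e0 (ltW r0).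
have de0 : 0 <= de by exact: mulr_ge0 d0 (ltW r0).
have s0 : 0 <= s by rewrite /s; lra.
split; rewrite ?s0 ?et0 ?r0//=; [|lra|lra|split; first lra].
  have : r * 8 <= 1.
    by apply: le_trans m1; apply: le_trans rN; rewrite -mulrA; apply: ler_wpM2l; lra.
  by lra.
have -> : s ^+ 2 + s * et = s * (r * cN) by rewrite eN; ring.
apply: (@le_trans _ _ ((r * cN) * (r * cN))).
  by apply: ler_wpM2r; [rewrite mulr_ge0; lra|lra].
have -> : r * cN * (r * cN) = r * (r * (2 * cN ^+ 2)) / 2 by field.
rewrite e1; have : r * Num.min 1 om <= r * 1 by apply: ler_wpM2l; [exact: ltW|].
by lra.
Qed.

Variables (Psi Chi : nat -> L -> R).
Hypotheses (Psi1 : forall n x, `|Psi n x| <= (tau L n)%:R)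
  (Chi1 : forall n x, `|Chi n x| <= (tau L n)%:R)
  (Psi2 : forall n k x y, (0 < k)%N -> agr k x y -> `|Psi n x - Psi n y| <= Cp * th ^+ k)
  (Chi2 : forall n k x y, (0 < k)%N -> agr k x y -> `|Chi n x - Chi n y| <= Cp * th ^+ k).

Definition e0A n x := addA (mono 1 0 (r * Psi n x)) (mono 0 1 (r * Chi n x)).
Definition eA Q n x := subA (e0A n x) (sclA (tau L n)%:R Q).
Definition BA Q (G : L -> nat -> nat -> R) n x :=
  addA (addA (e0A n x) (expT 2 (eA Q n x))) (prodA (expT 1 (eA Q n x)) (G (pre n x))).
Definition UA Q G x i j := sm (fun n => g n x * BA Q G n x i j).
Definition stepQ Q G i j := nu g (fun x => UA Q G x i j) / taubar.
Definition WA Q G x i j := UA Q G x i j - stepQ Q G i j * tauhat x.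
Definition stepG Q G x i j := sol g (fun x => WA Q G x i j) x.

Definition inv Q (G : L -> nat -> nat -> R) :=
  [/\ nb Q de, forall x, nb (G x) et, LipA et G, Q 0%N 0%N = 0 & forall x, G x 0%N 0%N = 0].

Let D := 4 * Cp * r.

Lemma e0A_nb n x : nb (e0A n x) (2 * r * (tau L n)%:R).
Proof.
have [/andP[r0 _] _ _ _ _] := radP.
apply: nbW (nbD (nb_mono 1 0 _) (nb_mono 0 1 _)) _.
rewrite !normrM gtr0_norm// -mulrDr.
by apply: le_trans (ler_wpM2l (ltW r0) (lerD (Psi1 n x) (Chi1 n x))) _; lra.
Qed.

Lemma al_ge0' k : 0 <= al k. Proof. by case: mw => _ /(_ k) /andP[/ltW]. Qed.

Lemma e0A_sub n k x y : (0 < k)%N -> agr k x y -> nb (subA (e0A n x) (e0A n y)) (D * al k).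
Proof.
move=> k0 xy; have [/andP[r0 _] _ _ _ _] := radP.
have [_ _ _ /(_ k) ta] := mw.
apply: nbW (eq_nb (d := addA (mono 1 0 (r * (Psi n x - Psi n y))) (mono 0 1 (r * (Chi n x - Chi n y)))) _ (nbD (nb_mono 1 0 _) (nb_mono 0 1 _))) _.
  by move=> i j; rewrite /e0A /subA /addA /mono; case: ifP => _; case: ifP => _; ring.
rewrite !normrM gtr0_norm//.
have h1 := Psi2 n k0 xy; have h2 := Chi2 n k0 xy.
have h3 : Cp * th ^+ k <= Cp * (2 * al k) by apply: ler_wpM2l.
rewrite -mulrDr /D; have -> : 4 * Cp * r * al k = r * (4 * Cp * al k) by ring.
by apply: ler_wpM2l; [exact: ltW|lra].
Qed.

Lemma eA_nb Q n x : nb Q de -> nb (eA Q n x) (s * (tau L n)%:R).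
Proof.
move=> h; apply: nbW (nbB (e0A_nb n x) (nbZ (tau L n)%:R h)) _.
by rewrite ger0_norm// /s; lra.
Qed.

Lemma eA_sub Q n k x y : (0 < k)%N -> agr k x y -> nb (subA (eA Q n x) (eA Q n y)) (D * al k).
Proof.
move=> k0 xy; apply: eq_nb (e0A_sub n k0 xy) => i j; rewrite /eA /subA; ring.
Qed.

Lemma dfm_ge0 : 0 <= D.
Proof. by have [/andP[/ltW r0 _] _ _ _ _] := radP; rewrite mulr_ge0// mulr_ge0. Qed.

Lemma BA_nb Q G n x : inv Q G -> nb (BA Q G n x) (3 * r * Tn n).
Proof.
case=> hQ hG _ _ _; have [/andP[r0 r1] de0 /andP[et0 et1] /andP[s0 s1] [s4 hs]] := radP.
have he := eA_nb n x hQ.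
apply: nbW (nbD (nbD (e0A_nb n x) (nb_expT2 he)) (nb_prod (nb_expT1 he) (hG (pre n x)))) _.
have [T0 T1 T2 /(_ s s1) [T3 T4 T5]] := Tn_ge n.
have -> : (s * (tau L n)%:R) ^+ 2 * expR (s * (tau L n)%:R) =
   s ^+ 2 * ((tau L n)%:R ^+ 2 * expR (s * (tau L n)%:R)) by ring.
have -> : s * (tau L n)%:R * expR (s * (tau L n)%:R) * et =
   s * et * ((tau L n)%:R * expR (s * (tau L n)%:R)) by ring.
have h1 : 2 * r * (tau L n)%:R <= 2 * r * Tn n by apply: ler_wpM2l => //; lra.
have h2 : s ^+ 2 * ((tau L n)%:R ^+ 2 * expR (s * (tau L n)%:R)) <= s ^+ 2 * Tn n.
  by apply: ler_wpM2l => //; rewrite exprn_ge0.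
have h3 : s * et * ((tau L n)%:R * expR (s * (tau L n)%:R)) <= s * et * Tn n.
  by apply: ler_wpM2l => //; rewrite mulr_ge0.
apply: le_trans (lerD (lerD h1 h2) h3) _; rewrite -!mulrDl.
by apply: ler_wpM2r => //; lra.
Qed.

Lemma BA_sub Q G n k x y : inv Q G -> (0 < k)%N -> agr k x y ->
  nb (subA (BA Q G n x) (BA Q G n y)) ((2 * D + r) * al k * Tn n).
Proof.
case=> hQ hG [_ hGL] _ _ k0 xy.
have [/andP[r0 r1] de0 /andP[et0 et1] /andP[s0 s1] [s4 hs]] := radP.
have hx := eA_nb n x hQ; have hy := eA_nb n y hQ.
have D0 := dfm_ge0; have a0 := al_ge0' k.
have hGs : nb (subA (G (pre n x)) (G (pre n y))) (et * al k).
  apply: nbW (hGL k.+1 _ _ isT (agr_preS n xy)) _; apply: ler_wpM2l => //.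
  exact: (al_le b0 th01 mw k0 (leqnSn k)).
have P := nbD (nb_prod (nb_expT1_sub hx hy (eA_sub Q n k0 xy)) (hG (pre n x)))
   (nb_prod (nb_expT1 hy) hGs).
have T := nbD (nbD (e0A_sub n k0 xy) (nb_expT2_sub hx hy (eA_sub Q n k0 xy))) P.
have E i j : subA (BA Q G n x) (BA Q G n y) i j =
  addA (addA (subA (e0A n x) (e0A n y)) (subA (expT 2 (eA Q n x)) (expT 2 (eA Q n y))))
  (addA (prodA (subA (expT 1 (eA Q n x)) (expT 1 (eA Q n y))) (G (pre n x)))
        (prodA (expT 1 (eA Q n y)) (subA (G (pre n x)) (G (pre n y))))) i j.
  have P' : prodA (subA (expT 1 (eA Q n x)) (expT 1 (eA Q n y))) (G (pre n x)) i j +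
     prodA (expT 1 (eA Q n y)) (subA (G (pre n x)) (G (pre n y))) i j =
     prodA (expT 1 (eA Q n x)) (G (pre n x)) i j - prodA (expT 1 (eA Q n y)) (G (pre n y)) i j.
    rewrite /prodA -big_split -sumrB/=; apply: eq_bigr => k' _.
    by rewrite -big_split -sumrB/=; apply: eq_bigr => l' _; rewrite /subA; ring.
  transitivity ((e0A n x i j - e0A n y i j) + (expT 2 (eA Q n x) i j - expT 2 (eA Q n y) i j) +
    (prodA (expT 1 (eA Q n x)) (G (pre n x)) i j - prodA (expT 1 (eA Q n y)) (G (pre n y)) i j)).
    by rewrite /subA /BA /addA; ring.
  by rewrite -P'.
apply: nbW (eq_nb E T) _.
have [T0 T1 T2 /(_ s s1) [T3 T4 T5]] := Tn_ge n.
set z := expR (s * (tau L n)%:R) in T3 T4 T5 *; set t := (tau L n)%:R in T2 T4 T5 *.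
have t1 : 1 <= t := tau_ge1 n.
have z0 : 0 <= z := expR_ge0 _.
have u0 : 0 <= D * al k by exact: mulr_ge0.
have h1 : D * al k <= D * al k * Tn n by rewrite ler_peMr.
have h2 : s * t * z * (D * al k) <= (s * D * al k) * Tn n.
  have -> : s * t * z * (D * al k) = (s * D * al k) * (t * z) by ring.
  by apply: ler_wpM2l => //; rewrite mulr_ge0// mulr_ge0.
have h3 : z * (D * al k) * et <= (et * D * al k) * Tn n.
  have -> : z * (D * al k) * et = (et * D * al k) * z by ring.
  by apply: ler_wpM2l => //; rewrite mulr_ge0// mulr_ge0.
have h4 : s * t * z * (et * al k) <= (s * et * al k) * Tn n.
  have -> : s * t * z * (et * al k) = (s * et * al k) * (t * z) by ring.
  by apply: ler_wpM2l => //; rewrite mulr_ge0// mulr_ge0.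
apply: le_trans (lerD (lerD h1 h2) (lerD h3 h4)) _; rewrite -!mulrDl.
apply: ler_wpM2r => //; apply: ler_wpM2r => //.
have : s * D <= 1 / 4 * D by apply: ler_wpM2r.
have : et * D <= 1 / 4 * D by apply: ler_wpM2r.
have : 0 <= s ^+ 2 by rewrite exprn_ge0.
by lra.
Qed.

Lemma UA_nb Q G x : inv Q G -> nb (UA Q G x) (3 * r * K2).
Proof.
move=> h; have [/andP[r0 _] _ _ _ _] := radP.
have a : asm (fun n => g n x * (3 * r * Tn n)) (3 * r * K2).
  apply: asm_gle; last by rewrite mulr_ge0// ltW.
  move=> n; have [T0 _ _ _] := Tn_ge n; rewrite ger0_norm//.
  by apply: mulr_ge0 => //; apply: mulr_ge0 => //; exact: ltW.
apply: nb_sm a => n; have := nbZ (g n x) (BA_nb n x h).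
by rewrite ger0_norm.
Qed.

Lemma r_ge0 : 0 <= r. Proof. by have [/andP[/ltW]] := radP. Qed.

Lemma UA_asm Q G x i j : inv Q G -> asm (fun n => g n x * BA Q G n x i j) (3 * r * K2).
Proof.
move=> h; apply: asm_gle => [n|]; first exact: nb_term (BA_nb n x h).
by rewrite mulr_ge0 ?r_ge0.
Qed.

Lemma UA_Lip Q G : inv Q G -> LipA ((Cb * (3 * r) + (2 * D + r)) * K2) (UA Q G).
Proof.
move=> h; have r0 := r_ge0; have D0 := dfm_ge0.
have C30 : 0 <= 3 * r by rewrite mulr_ge0.
have D20 : 0 <= 2 * D + r by lra.
split; first by rewrite mulr_ge0 ?K2_ge0// addr_ge0// mulr_ge0// Cb_ge0.
move=> k x y k0 xy N.
pose sgE i j := Num.sg (UA Q G x i j - UA Q G y i j).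
pose f n z := \sum_(i < N) \sum_(j < N) sgE i j * BA Q G n z i j.
have sg1 i j : `|sgE i j| <= 1 by rewrite /sgE normr_sg lern1; case: eqP.
have f1 n z : `|f n z| <= 3 * r * Tn n.
  apply: le_trans (BA_nb n z h N); apply: le_trans (ler_norm_sum _ _ _) _; apply: ler_sum => i _.
  apply: le_trans (ler_norm_sum _ _ _) _; apply: ler_sum => j _.
  by rewrite normrM ler_piMl.
have f2 n k' u v : (0 < k')%N -> agr k' u v -> `|f n u - f n v| <= (2 * D + r) * al k' * Tn n.
  move=> k0' uv; apply: le_trans (BA_sub n h k0' uv N).
  rewrite /f -sumrB; apply: le_trans (ler_norm_sum _ _ _) _; apply: ler_sum => i _.
  rewrite -sumrB; apply: le_trans (ler_norm_sum _ _ _) _; apply: ler_sum => j _.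
  by rewrite -mulrBr normrM ler_piMl.
have [_ /(_ k x y k0 xy)] := avg_Lip C30 D20 f1 f2.
apply: le_trans; apply: le_trans (ler_norm _).
have E z : sm (fun n => g n z * f n z) = \sum_(i < N) \sum_(j < N) sgE i j * UA Q G z i j.
  transitivity (sm (fun n => \sum_(i < N) \sum_(j < N) sgE i j * (g n z * BA Q G n z i j))).
    apply: eq_sm => n; rewrite /f mulr_sumr; apply: eq_bigr => i _.
    by rewrite mulr_sumr; apply: eq_bigr => j _; ring.
  have a i j : asm (fun n => sgE i j * (g n z * BA Q G n z i j)) (`|sgE i j| * (3 * r * K2)).
    by apply: asmZ; exact: UA_asm.
  rewrite (sm_sum (index_enum 'I_N) (u := fun (i : 'I_N) n => \sum_(j < N) sgE i j * (g n z * BA Q G n z i j))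
     (K := fun i => \sum_(j < N) `|sgE i j| * (3 * r * K2))); last first.
    by move=> i; apply: (asm_sum (index_enum 'I_N) (u := fun (j : 'I_N) n => sgE i j * (g n z * BA Q G n z i j))).
  apply: eq_bigr => i _.
  rewrite (sm_sum (index_enum 'I_N) (u := fun (j : 'I_N) n => sgE i j * (g n z * BA Q G n z i j))
     (K := fun j => `|sgE i j| * (3 * r * K2))) => [|j]; last exact: a.
  by apply: eq_bigr => j _; rewrite (smZ _ (UA_asm z i j h)).
rewrite !E -sumrB; apply: ler_sum => i _; rewrite -sumrB; apply: ler_sum => j _.
by rewrite -mulrBr /sgE -normrEsg.
Qed.

Lemma stepQ_nb Q G : inv Q G -> nb (stepQ Q G) de.
Proof.
move=> h; have t1 := taubar_ge1.
have := nbZ taubar^-1 (nu_nb (UA_Lip h) (fun x => UA_nb x h)).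
rewrite ger0_norm; last by rewrite invr_ge0; lra.
move=> h2; apply: nbW (eq_nb _ h2) _ => [i j|]; first by rewrite /sclA mulrC.
have -> : de = 1 * (3 * r * K2) by rewrite /de /cd; ring.
apply: ler_wpM2r; first by rewrite mulr_ge0 ?K2_ge0// mulr_ge0// r_ge0.
by rewrite invf_le1 // lt_neqAle; lra.
Qed.

Lemma WA_Lip Q G : inv Q G -> LipA (ce * r * (1 - gam)) (WA Q G).
Proof.
move=> h; have [U0 hU] := UA_Lip h; have hQ := stepQ_nb h.
have [_ hT] := tauhat_Lip; have [/andP[_ g1] _ _ _] := mw.
have g1' : 0 < 1 - gam by rewrite subr_gt0.
split; first by apply: mulr_ge0 (ltW g1'); exact: mulr_ge0 ce_ge0 r_ge0.
move=> k x y k0 xy.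
have := nbB (hU k x y k0 xy) (nbZ (tauhat x - tauhat y) hQ).
move=> h2; apply: nbW (eq_nb _ h2) _ => [i j|]; first by rewrite /WA /sclA /subA; ring.
have -> : ce * r * (1 - gam) = (3 * Cb + 8 * Cp + 1 + cd * Cb) * K2 * r.
  by rewrite /ce; field; rewrite gt_eqF.
have := hT k x y k0 xy; have de0 : 0 <= de by case: radP.
move=> h3; have := ler_wpM2r de0 h3.
rewrite /de /D => h4; apply: le_trans (lerD (lexx _) h4) _.
by rewrite le_eqVlt; apply/orP; left; apply/eqP; ring.
Qed.

Lemma WA_nu0 Q G i j : inv Q G -> nu g (fun x => WA Q G x i j) = 0.
Proof.
move=> h; have hU := LipA_term i j (UA_Lip h).
have hT := LipZ (- stepQ Q G i j) tauhat_Lip.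
transitivity (nu g (fun x => UA Q G x i j + - stepQ Q G i j * tauhat x)).
  by congr nu; apply/funext => x; rewrite /WA mulNr.
rewrite (nuD b0 th01 mw hg hU hT) (nuZ b0 th01 mw hg _ tauhat_Lip) /stepQ mulNr -/taubar.
rewrite divfK ?subrr// gt_eqF//; apply: lt_le_trans taubar_ge1; exact: ltr01.
Qed.

Lemma step_inv Q G : inv Q G -> inv (stepQ Q G) (stepG Q G).
Proof.
move=> h; have [_ _ _ Q0 G0] := h.
have [/andP[_ g1] _ _ _] := mw; have g1' : 0 < 1 - gam by rewrite subr_gt0.
have e : et = ce * r * (1 - gam) / (1 - gam) by rewrite mulfK// gt_eqF.
have e0A00 n x : e0A n x 0%N 0%N = 0 by rewrite /e0A /addA /mono/= addr0.
have eA00 n x : eA Q n x 0%N 0%N = 0 by rewrite /eA /subA e0A00 /sclA Q0 mulr0 subr0.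
have U00 x : UA Q G x 0%N 0%N = 0.
  rewrite /UA -[RHS](@sm0 R); apply: eq_sm => n; rewrite /BA /addA e0A00 !expT00//.
  by rewrite prodA00 expT00// mul0r !addr0 mulr0.
have Q00 : stepQ Q G 0 0 = 0.
  rewrite /stepQ; have -> : (fun x => UA Q G x 0%N 0%N) = fun=> 0 by apply/funext => x; exact: U00.
  by rewrite (nu_cst al hg) mul0r.
split=> //.
- exact: stepQ_nb.
- by move=> x; rewrite e; exact: (sol_nb x (WA_Lip h)).
- by rewrite e; exact: (sol_LipA (WA_Lip h)).
- move=> x; rewrite /stepG.
  have -> : (fun x => WA Q G x 0%N 0%N) = fun=> 0.
    by apply/funext => y; rewrite /WA U00 Q00 mul0r subrr.
  have := sol_bdd b0 th01 mw hg (Lip_cst L al 0) x; rewrite mul0r.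
  by rewrite normr_le0 => /eqP.
Qed.

Lemma step_eqd n Q G Q' G' : inv Q G -> inv Q' G' -> eqd n Q Q' ->
  (forall x, eqd n (G x) (G' x)) ->
  eqd n.+1 (stepQ Q G) (stepQ Q' G') /\ (forall x, eqd n.+1 (stepG Q G x) (stepG Q' G' x)).
Proof.
move=> [_ _ _ Q0 G0] [_ _ _ Q0' G0'] hQ hG.
have e0A00 m x : e0A m x 0%N 0%N = 0 by rewrite /e0A /addA /mono/= addr0.
have eA00 P m x : P 0%N 0%N = 0 -> eA P m x 0%N 0%N = 0.
  by move=> P0; rewrite /eA /subA e0A00 /sclA P0 mulr0 subr0.
have he m x : eqd n (eA Q m x) (eA Q' m x).
  by move=> i j ij; rewrite /eA /subA /sclA hQ.
have hU x : eqd n.+1 (UA Q G x) (UA Q' G' x).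
  move=> i j ij; apply: eq_sm => m; congr (_ * _); rewrite /BA /addA.
  rewrite (expT2_eqdS (n := n) _ _ (he m x))// ?eA00//.
  by rewrite (prodA_eqdS (n := n) _ _ _ _ (expT_eqd 1 (he m x)) (hG _))// expT00// eA00.
have hq : eqd n.+1 (stepQ Q G) (stepQ Q' G').
  move=> i j ij; rewrite /stepQ; suff -> : (fun x => UA Q G x i j) = fun x => UA Q' G' x i j by [].
  by apply/funext => x; exact: hU.
split; first exact: hq.
move=> x i j ij; change (sol g (fun x => WA Q G x i j) x = sol g (fun x => WA Q' G' x i j) x).
suff -> : (fun x => WA Q G x i j) = fun x => WA Q' G' x i j by [].
by apply/funext => y; rewrite /WA (hU y i j ij) (hq i j ij).
Qed.

Fixpoint iterA m := if m is m'.+1 then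
    (stepQ (iterA m').1 (iterA m').2, stepG (iterA m').1 (iterA m').2)
  else (fun _ _ => 0, fun _ _ _ => 0).

Lemma iterA_inv m : inv (iterA m).1 (iterA m).2.
Proof.
elim: m => [|m ih] /=; last exact: step_inv.
have [_ de0 /andP[et0 _] _ _] := radP.
have z (K' : R) : 0 <= K' -> nb (fun _ _ => 0 : R) K'.
  move=> K0 N; rewrite big1// => i _; rewrite big1// => j _; by rewrite normr0.
split=> //; [exact: z|by move=> x; exact: z|split=> // k x y _ _].
apply: eq_nb (z _ (mulr_ge0 et0 (al_ge0' k))) => i j; by rewrite /subA subrr.
Qed.

Lemma iterA_eqd m k : eqd m (iterA m).1 (iterA (m + k)).1 /\
  (forall x, eqd m ((iterA m).2 x) ((iterA (m + k)).2 x)).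
Proof.
elim: m => [|m [ih1 ih2]]; first by split=> [|x] i j; rewrite ltn0.
rewrite addSn; exact: (step_eqd (iterA_inv m) (iterA_inv (m + k)) ih1 ih2).
Qed.

Definition Qs i j := (iterA (i + j).+1).1 i j.
Definition Gs x i j := (iterA (i + j).+1).2 x i j.

Lemma Qs_eqd m : eqd m Qs (iterA m).1.
Proof.
move=> i j ij; rewrite /Qs; have [h _] := iterA_eqd (i + j).+1 (m - (i + j).+1).
by rewrite subnKC// in h; apply: h.
Qed.

Lemma Gs_eqd m x : eqd m (Gs x) ((iterA m).2 x).
Proof.
move=> i j ij; rewrite /Gs; have [_ h] := iterA_eqd (i + j).+1 (m - (i + j).+1).
by rewrite subnKC// in h; apply: h.
Qed.

Lemma QG_inv : inv Qs Gs.
Proof.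
have [_ _ /andP[et0 _] _ _] := radP.
split.
- move=> N; have [h _ _ _ _] := iterA_inv (N + N).
  apply: le_trans (h N); rewrite le_eqVlt; apply/orP; left; apply/eqP.
  apply: eq_bigr => i _; apply: eq_bigr => j _; rewrite (Qs_eqd (m := N + N))//.
  by move: (ltn_ord i) (ltn_ord j); lia.
- move=> x N; have [_ h _ _ _] := iterA_inv (N + N).
  apply: le_trans (h x N); rewrite le_eqVlt; apply/orP; left; apply/eqP.
  apply: eq_bigr => i _; apply: eq_bigr => j _; rewrite (Gs_eqd (m := N + N))//.
  by move: (ltn_ord i) (ltn_ord j); lia.
- split=> // k x y k0 xy N; have [_ _ [_ h] _ _] := iterA_inv (N + N).
  apply: le_trans (h k x y k0 xy N); rewrite le_eqVlt; apply/orP; left; apply/eqP.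
  apply: eq_bigr => i _; apply: eq_bigr => j _; rewrite /subA !(Gs_eqd (m := N + N))//;
  by move: (ltn_ord i) (ltn_ord j); lia.
- by have [_ _ _ h _] := iterA_inv 1.
- by move=> x; have [_ _ _ _ h] := iterA_inv 1; exact: h.
Qed.

Lemma QG_fix : (forall i j, Qs i j = stepQ Qs Gs i j) /\ (forall x i j, Gs x i j = stepG Qs Gs x i j).
Proof.
have h m := step_eqd QG_inv (iterA_inv m) (@Qs_eqd m) (fun x => @Gs_eqd m x).
split=> [i j|x i j].
  by have [-> //] := h (i + j)%N.
by have [_ ->] := h (i + j)%N.
Qed.

Lemma solution_exists : exists Q G, [/\ inv Q G, forall i j, Q i j = stepQ Q G i j &
  forall x i j, G x i j = stepG Q G x i j].
Proof. by have [h1 h2] := QG_fix; exists Qs, Gs; split=> //; exact: QG_inv. Qed.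

Section Solution.
Variables (Qs : nat -> nat -> R) (Gs : L -> nat -> nat -> R).
Hypotheses (QG_inv : inv Qs Gs) (fQ : forall i j, Qs i j = stepQ Qs Gs i j)
  (fG : forall x i j, Gs x i j = stepG Qs Gs x i j).

Lemma Gs_eq x i j : Gs x i j = UA Qs Gs x i j - Qs i j * tauhat x + op g (fun y => Gs y i j) x.
Proof.
have h := QG_inv; transitivity (stepG Qs Gs x i j); first exact: fG.
rewrite /stepG (sol_eq_A x (WA_Lip h) (WA_nu0 i j h)).
have -> : (fun y => Gs y i j) = sol g (fun y => WA Qs Gs y i j) by apply/funext => y; exact: fG.
by rewrite /WA -fQ.
Qed.

Lemma Qs_eq i j : Qs i j * taubar = nu g (fun x => UA Qs Gs x i j).
Proof.
rewrite (fQ i j) /stepQ divfK// gt_eqF//.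
by apply: lt_le_trans taubar_ge1; exact: ltr01.
Qed.

Lemma oneG_eq x i j : mono 0 0 1 i j + Gs x i j =
  sm (fun n => g n x * prodA (expT 0 (eA Qs n x)) (addA (mono 0 0 1) (Gs (pre n x))) i j).
Proof.
have h := QG_inv; have [hQ hG _ _ _] := h.
have a1 := UA_asm x i j h.
have a2 : asm (fun n => g n x * Gs (pre n x) i j) et.
  by apply: (op_asm hg (f := fun y => Gs y i j)) => y; exact: nb_term (hG y).
have a3 := asmZ (mono 0 0 1 i j : R) (q_asm hg x).
have a4 := asmZ (- Qs i j) (tauhat_asm x).
have P n : prodA (expT 0 (eA Qs n x)) (addA (mono 0 0 1) (Gs (pre n x))) i j =
  mono 0 0 1 i j + (BA Qs Gs n x i j - (tau L n)%:R * Qs i j) + Gs (pre n x) i j.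
  have he := eA_nb n x hQ.
  have p1 (c d : nat -> nat -> R) : prodA c (addA (mono 0 0 1) d) i j = c i j + prodA c d i j.
    transitivity (prodA c (mono 0 0 1) i j + prodA c d i j); last by congr (_ + _); exact: powA1.
    rewrite /prodA -big_split/=; apply: eq_bigr => k _.
    by rewrite -big_split/=; apply: eq_bigr => l _; rewrite /addA; ring.
  have p2 (c d : nat -> nat -> R) : prodA (addA (mono 0 0 1) c) d i j = d i j + prodA c d i j.
    rewrite /prodA.
    transitivity (\sum_(k < i.+1) \sum_(l < j.+1) (mono 0 0 1 k l * d (i - k)%N (j - l)%N) +
       \sum_(k < i.+1) \sum_(l < j.+1) (c k l * d (i - k)%N (j - l)%N)).
      rewrite -big_split/=; apply: eq_bigr => k _; rewrite -big_split/=; apply: eq_bigr => l _.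
      by rewrite /addA mulrDl.
    congr (_ + _); rewrite big_ord_recl [X in _ + X]big1 ?addr0; last first.
      by move=> k _; rewrite big1// => l _; rewrite /mono/= mul0r.
    rewrite big_ord_recl [X in _ + X]big1 ?addr0 ?subn0; last first.
      by move=> l _; rewrite /mono/= mul0r.
    by rewrite /mono/= mul1r.
  have e01 : expT 0 (eA Qs n x) = addA (mono 0 0 1) (expT 1 (eA Qs n x)).
    by apply/funext => i'; apply/funext => j'; exact: expT0E he.
  rewrite e01 p2 p1 /addA (expT1E i j he) /BA /addA /eA /subA /sclA; ring.
transitivity (sm (fun n => (mono 0 0 1 i j * g n x + (g n x * BA Qs Gs n x i j + - Qs i j * (g n x * (tau L n)%:R)))
   + g n x * Gs (pre n x) i j)).
  rewrite (smD (asmD a3 (asmD a1 a4)) a2) (smD a3 (asmD a1 a4)) (smD a1 a4) (smZ _ (q_asm hg x)).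
  by rewrite (q_sm hg) (smZ _ (tauhat_asm x)) Gs_eq /op /UA /tauhat; ring.
by apply: eq_sm => n; rewrite P; ring.
Qed.

Lemma eval_eq t u x : `|t| <= 1 -> `|u| <= 1 ->
  1 + ev (Gs x) t u = sm (fun n => g n x *
    (expR (t * (r * Psi n x) + u * (r * Chi n x) - (tau L n)%:R * ev Qs t u) * (1 + ev (Gs (pre n x)) t u))).
Proof.
move=> t1 u1; have h := QG_inv; have [hQ hG _ _ _] := h.
have [_ de0 /andP[et0 et1] /andP[s0 s1] _] := radP.
have e1 (d : nat -> nat -> R) M : nb d M -> ev (addA (mono 0 0 1) d) t u = 1 + ev d t u.
  by move=> hd; rewrite (evD t1 u1 (nb_mono 0 0 1) hd) ev_mono expr0 !mulr1.
rewrite -(e1 _ _ (hG x)).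
have hP n : nb (fun i j => g n x * prodA (expT 0 (eA Qs n x)) (addA (mono 0 0 1) (Gs (pre n x))) i j)
   (g n x * (expR (s * (tau L n)%:R) * (1 + et))).
  have := nbZ (g n x) (nb_prod (nb_expA (eA_nb n x hQ)) (nbD (nb_mono 0 0 1) (hG (pre n x)))).
  by rewrite !ger0_norm.
have a : asm (fun n => g n x * (expR (s * (tau L n)%:R) * (1 + et))) ((1 + et) * K2).
  apply: asm_gle; last lra.
  move=> n; have [T0 T1 T2 /(_ s s1) [T3 T4 T5]] := Tn_ge n.
  rewrite ger0_norm; last by rewrite mulr_ge0 ?expR_ge0//; lra.
  by rewrite mulrC; apply: ler_wpM2l => //; lra.
rewrite (eq_ev (d := fun i j => sm (fun n => g n x * prodA (expT 0 (eA Qs n x)) (addA (mono 0 0 1) (Gs (pre n x))) i j))); last first.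
  by move=> i j; exact: oneG_eq.
rewrite (ev_sm t1 u1 hP a); apply: eq_sm => n.
have he := eA_nb n x hQ.
rewrite (evZ t1 u1 (g n x) (nb_prod (nb_expA he) (nbD (nb_mono 0 0 1) (hG (pre n x))))).
rewrite (ev_prod t1 u1 (nb_expA he) (nbD (nb_mono 0 0 1) (hG (pre n x)))) (ev_expA t1 u1 he) (e1 _ _ (hG (pre n x))).
rewrite (evB t1 u1 (e0A_nb n x) (nbZ (tau L n)%:R hQ)) (evZ t1 u1 _ hQ).
rewrite (evD t1 u1 (nb_mono 1 0 _) (nb_mono 0 1 _)) !ev_mono !expr0 !expr1 !mulr1.
by congr (_ * (expR _ * _)); ring.
Qed.

Lemma eA00 n x : eA Qs n x 0%N 0%N = 0.
Proof.
have [_ _ _ Q0 _] := QG_inv.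
by rewrite /eA /subA /e0A /addA /mono/= /sclA Q0 mulr0 subr0 addr0.
Qed.

Lemma eA10 n x : eA Qs n x 1%N 0%N = r * Psi n x - (tau L n)%:R * Qs 1%N 0%N.
Proof. by rewrite /eA /subA /e0A /addA /mono/= /sclA addr0. Qed.

Lemma first_order x :
  Gs x 1%N 0%N = sm (fun n => g n x * (r * Psi n x)) - Qs 1%N 0%N * tauhat x +
    op g (fun y => Gs y 1%N 0%N) x.
Proof.
rewrite Gs_eq; congr (_ - _ + _); apply: eq_sm => n; congr (_ * _).
have [hQ hG _ Q0 G0] := QG_inv.
rewrite /BA /addA expT2_10 ?eA00// prodA10 expT00 ?eA00// G0 !mulr0 mul0r !addr0.
by rewrite /e0A /addA /mono/= addr0.
Qed.

Lemma second_order : Qs 2%N 0%N * taubar = nu g (fun x => sm (fun n => g n x *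
   ((r * Psi n x - (tau L n)%:R * Qs 1%N 0%N) ^+ 2 / 2 +
    (r * Psi n x - (tau L n)%:R * Qs 1%N 0%N) * Gs (pre n x) 1%N 0%N))).
Proof.
rewrite Qs_eq; congr nu; apply/funext => x; apply: eq_sm => n; congr (_ * _).
have [hQ hG _ Q0 G0] := QG_inv.
rewrite /BA /addA expT2_20 ?eA00// prodA20 expT00 ?eA00// G0 mulr0 mul0r addr0 add0r.
rewrite (expT1E _ _ (eA_nb n x hQ)) expT2_10 ?eA00// addr0 !eA10.
by rewrite /e0A /addA /mono/= addr0 add0r.
Qed.

End Solution.
End Equation.

Lemma perturbation Cp : 0 <= Cp -> exists r KQ : R, [/\ 0 < r, 2 * r + KQ <= om / 2 &
  forall Psi Chi : nat -> L -> R,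
  (forall n x, `|Psi n x| <= (tau L n)%:R) -> (forall n x, `|Chi n x| <= (tau L n)%:R) ->
  (forall n k x y, (0 < k)%N -> agr k x y -> `|Psi n x - Psi n y| <= Cp * th ^+ k) ->
  (forall n k x y, (0 < k)%N -> agr k x y -> `|Chi n x - Chi n y| <= Cp * th ^+ k) ->
  exists Q G, [/\ nb Q KQ, Q 0%N 0%N = 0, forall x, nb (G x) (1 / 4),
    (forall t u x, `|t| <= 1 -> `|u| <= 1 -> 1 + ev (G x) t u = sm (fun n => g n x *
      (expR (t * (r * Psi n x) + u * (r * Chi n x) - (tau L n)%:R * ev Q t u) *
        (1 + ev (G (pre n x)) t u)))) &
    [/\ Lip al (1 / 4) (fun x => G x 1%N 0%N),
      forall x, G x 1%N 0%N = sm (fun n => g n x * (r * Psi n x)) - Q 1%N 0%N * tauhat x +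
        op g (fun y => G y 1%N 0%N) x &
      Q 2%N 0%N * taubar = nu g (fun x => sm (fun n => g n x *
        ((r * Psi n x - (tau L n)%:R * Q 1%N 0%N) ^+ 2 / 2 +
        (r * Psi n x - (tau L n)%:R * Q 1%N 0%N) * G (pre n x) 1%N 0%N)))]]].
Proof.
move=> Cp0; exists (rad Cp), (cd * rad Cp).
have [_ _ _ /andP[_ s1] _] := radP Cp0 (erefl (rad Cp)).
split=> //; first exact: rad_gt0.
move=> Psi Chi h1 h2 h3 h4.
have [_ _ /andP[_ et1] _ _] := radP Cp0 (erefl (rad Cp)).
have [Q [G [hi hQ hG]]] := solution_exists Cp0 (erefl (rad Cp)) h1 h2 h3 h4.
have [i1 i2 i3 i4 i5] := hi.
exists Q, G; split=> //.
- by move=> x; apply: nbW (i2 x) et1.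
- by move=> t u x t1 u1; exact: (eval_eq Cp0 (erefl (rad Cp)) h1 h2 h3 h4 hi hQ hG).
- split.
  + exact: (LipW mw (LipA_term 1%N 0%N i3) et1).
  + by move=> x; exact: (first_order Cp0 (erefl (rad Cp)) h1 h2 h3 h4 hi hQ hG).
  + by eapply second_order; eauto.

Qed.
End Perturbation.

(** * Partition functions and their growth *)

Section ExtendedSums.
Variable R : realType.
Local Open Scope ereal_scope.

Lemma esum_fsets_le (T : choiceType) (D : set T) (f : T -> \bar R) M :
  (forall X, finite_set X -> X `<=` D -> \sum_(i \in X) f i <= M) -> \esum_(i in D) f i <= M.
Proof. by move=> h; apply: ge_ereal_sup => _ [X [fX XD] <-]; exact: h. Qed.

Lemma esum_ge_fset (T : choiceType) (D : set T) (f : T -> \bar R) X :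
  finite_set X -> X `<=` D -> \sum_(i \in X) f i <= \esum_(i in D) f i.
Proof. by move=> fX XD; apply: esum_ge; exists X. Qed.

Lemma esum_scale (T : choiceType) (D : set T) (f g : T -> \bar R) (c : R) : (0 <= c)%R ->
  (forall i, 0 <= g i) -> (forall i, D i -> f i <= c%:E * g i) ->
  \esum_(i in D) f i <= c%:E * \esum_(i in D) g i.
Proof.
move=> c0 g0 h; apply: esum_fsets_le => X fX XD.
apply: (@le_trans _ _ (\sum_(i \in X) c%:E * g i)).
  by apply: lee_fsum => // i Xi; exact: h (XD _ Xi).
rewrite -ge0_mule_fsumr//; apply: lee_wpmul2l => //.
exact: esum_ge_fset.
Qed.

Lemma esum_sub (T : choiceType) (D D' : set T) (f : T -> \bar R) :
  (forall i, 0 <= f i) -> D `<=` D' -> \esum_(i in D) f i <= \esum_(i in D') f i.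
Proof.
move=> f0 DD; apply: esum_fsets_le => X fX XD; apply: esum_ge_fset => //.
exact: subset_trans DD.
Qed.

Lemma esum_inj_le (T T' : choiceType) (D : set T) (D' : set T') (e : T -> T')
    (f : T -> \bar R) (g : T' -> \bar R) (c : R) : (0 <= c)%R ->
  set_inj D e -> (forall i, D i -> D' (e i)) -> (forall i, 0 <= g i) ->
  (forall i, D i -> f i <= c%:E * g (e i)) ->
  \esum_(i in D) f i <= c%:E * \esum_(i in D') g i.
Proof.
move=> c0 ei DD g0 h.
apply: (le_trans (esum_scale (g := fun i => g (e i)) c0 _ h)) => //.
apply: lee_wpmul2l => //; rewrite -esum_image//.
by apply: esum_sub => // _ [i Di <-]; exact: DD.
Qed.

Lemma esum_sm (u : nat -> R) K : asm u K -> (forall n, 0 <= u n)%R ->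
  \esum_(n in [set: nat]) (u n)%:E = (sm u)%:E.
Proof.
move=> h u0; rewrite -nneseries_esumT => [|n]; last by rewrite lee_fin.
apply/cvg_lim => //; apply: cvg_EFin.
  by apply: nearW => N; rewrite sumEFin.
rewrite (_ : fine \o _ = series u); first exact: asm_cvg h.
by apply/funext => N /=; rewrite sumEFin.
Qed.

Lemma limn_esup_lt (u : nat -> \bar R) (p : \bar R) : limn_esup u < p ->
  exists N, forall n, (N <= n)%N -> u n < p.
Proof.
move=> /ereal_inf_lt[_ [V [N _ NV] <-] h]; exists N => n Nn.
by apply: le_lt_trans h; apply: ereal_sup_ubound; exists n => //; exact: NV.
Qed.

Lemma limn_esup_le (u : nat -> \bar R) (p : \bar R) N :
  (forall n, (N <= n)%N -> u n <= p) -> limn_esup u <= p.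
Proof.
move=> h; apply: (@le_trans _ _ (ereal_sup [set u x | x in [set n | (N <= n)%N]])).
  by apply: ereal_inf_lbound; exists [set n | (N <= n)%N] => //; exists N.
by apply: ge_ereal_sup => _ [n /= Nn <-]; exact: h.
Qed.

Lemma limn_esup_ge (u : nat -> \bar R) (p : \bar R) :
  (forall N, exists2 n, (N <= n)%N & p <= u n) -> p <= limn_esup u.
Proof.
move=> h; apply: le_ereal_inf_tmp => _ [V [N _ NV] <-].
have [n Nn pn] := h N; apply: le_trans pn _; apply: ereal_sup_ubound; exists n => //.
exact: NV.
Qed.

Definition grow (z : nat -> \bar R) (p : R) :=
  exists (C : R) N, forall n, (N <= n)%N -> z n <= (C * expR (p * n%:R))%:E.

Definition rate (z : nat -> \bar R) := limn_esup (fun n : nat => ((n%:R)^-1)%:E * lne (z n)).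

Lemma lne_le_ln (z : \bar R) (c : R) : (0 < c)%R -> 0 <= z -> z <= c%:E -> lne z <= (ln c)%:E.
Proof. by move=> c0 z0 zc; rewrite -lne_EFin// lee_lne// in_itv/= ?andbT ?leey ?z0//= lee_fin ltW. Qed.

Lemma rate_le z p : (forall n, 0 <= z n) -> grow z p -> rate z <= p%:E.
Proof.
move=> z0 [C [N h]].
have [C' C0 h'] : exists2 C', (0 < C')%R & forall n, (N <= n)%N -> z n <= (C' * expR (p * n%:R))%:E.
  exists (`|C| + 1)%R => [|n /h/le_trans]; first by rewrite ltr_wpDl.
  by apply; rewrite lee_fin; apply: ler_wpM2r; [exact: expR_ge0|have := ler_norm C; lra].
apply/lee_addgt0Pr => e e0.
have [M hM] : exists M, forall n, (M <= n)%N -> (ln C' <= e * n%:R)%R.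
  exists (Num.truncn (`|ln C'| / e)).+1 => n Mn; apply: le_trans (ler_norm _) _.
  rewrite mulrC -ler_pdivrMr//; apply: le_trans (ltW (truncnS_gt _)) _.
  by rewrite ler_nat.
apply: (limn_esup_le (N := maxn N (maxn M 1))) => n; rewrite !geq_max => /and3P[Nn Mn n1].
have n0 : (0 < n%:R :> R)%R by rewrite ltr0n.
have CE : (0 < C' * expR (p * n%:R))%R by rewrite mulr_gt0// expR_gt0.
have := lne_le_ln CE (z0 n) (h' n Nn).
rewrite lnM ?posrE ?expR_gt0// expRK => hl.
apply: le_trans (lee_wpmul2l _ hl) _; first by rewrite lee_fin invr_ge0 ltW.
rewrite -EFinM -EFinD lee_fin mulrDr mulrCA mulVf ?gt_eqF// mulr1 addrC lerD2l.
by rewrite mulrC ler_pdivrMr//; exact: hM.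
Qed.

Lemma rate_lt_grow z (p : \bar R) : (forall n, 0 <= z n) -> rate z < p ->
  exists2 p' : R, p'%:E < p & exists N, forall n, (N <= n)%N -> z n <= (expR (p' * n%:R))%:E.
Proof.
move=> z0 h.
have [p' h1 h2] : exists2 p' : R, rate z < p'%:E & p'%:E < p.
  move: h; case: (rate z) => [r||]; case: p => [q||]// h.
  - by move: h; rewrite lte_fin => h; exists ((r + q) / 2)%R; rewrite lte_fin; lra.
  - by exists (r + 1)%R; rewrite ?ltry// lte_fin; lra.
  - by exists (q - 1)%R; rewrite ?ltNyr// lte_fin; lra.
  - by exists 0%R; rewrite ?ltNyr ?ltry.
exists p' => //; have [N hN] := limn_esup_lt h1.
exists (maxn N 1) => n; rewrite geq_max => /andP[/hN hn n1].
have n0 : (0 < n%:R :> R)%R by rewrite ltr0n.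
have {}hn : lne (z n) <= (p' * n%:R)%:E.
  move: hn; case: (lne (z n)) => [l||]//.
  - rewrite -EFinM lte_fin lee_fin => /ltW; by rewrite mulrC ler_pdivrMr.
  - by rewrite mulry gtr0_sg ?invr_gt0// mul1e.
  - by move=> _; rewrite leNye.
rewrite -(lneK (x := z n)) ?in_itv/= ?z0 ?leey//.
by have := hn; case: (lne (z n)) => [l||]//= hl; rewrite lee_fin ?ler_expR ?expR_ge0.
Qed.

Lemma rate_ge z (p : R) : (forall n, 0 <= z n) -> (forall p', (p' < p)%R -> ~ grow z p') -> p%:E <= rate z.
Proof.
move=> z0 h; rewrite leNgt; apply/negP => /(rate_lt_grow z0)[p' pp [N hN]].
apply: (h p'); first by rewrite lte_fin in pp.
by exists 1%R, N => n; rewrite mul1r; exact: hN.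
Qed.

End ExtendedSums.

Section Sequences.
Variables (S : countType) (a0 : S) (E : rel S) (R : realType).
Local Notation X := (Sig a0).
Implicit Types (x y : X) (phi : X -> R).

Lemma iter_shiftE k x : iter k (@Defs.shift S a0) x = (fun n => x (n + k)%N) :> (nat -> S).
Proof.
elim: k x => [|k ih] x; first by apply/funext => n; rewrite addn0.
by rewrite iterS /Defs.shift (ih x); apply/funext => n; rewrite addSnnS.
Qed.

Lemma iter_shift_at k x n : iter k (@Defs.shift S a0) x n = x (n + k)%N.
Proof. by rewrite iter_shiftE. Qed.

Lemma adm_iter k x : adm E x -> adm E (iter k (@Defs.shift S a0) x).
Proof. by move=> h i; rewrite !iter_shift_at addSn; exact: h. Qed.

Lemma birkhoffD phi n m x :
  birkhoff phi (n + m) x = birkhoff phi n x + birkhoff phi m (iter n (@Defs.shift S a0) x).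
Proof.
rewrite /birkhoff big_split_ord/=; congr (_ + _); apply: eq_bigr => i _.
by rewrite addnC iterD.
Qed.

Lemma birkhoff1 phi x : birkhoff phi 1 x = phi x.
Proof. by rewrite /birkhoff big_ord1. Qed.

Lemma birkhoff0 phi x : birkhoff phi 0 x = 0.
Proof. by rewrite /birkhoff big_ord0. Qed.

Lemma birkhoffE_D phi psi n x : birkhoff (fun x => phi x + psi x) n x = birkhoff phi n x + birkhoff psi n x.
Proof. by rewrite /birkhoff big_split. Qed.

Lemma birkhoffE_Z (c : R) psi n x : birkhoff (fun x => c * psi x) n x = c * birkhoff psi n x.
Proof. by rewrite /birkhoff mulr_sumr. Qed.

Lemma agree_le n m x y : (n <= m)%N -> agree m x y -> agree n x y.
Proof. by move=> nm h i ni; apply: h; exact: leq_trans nm. Qed.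

Lemma agree_sym n x y : agree n x y -> agree n y x.
Proof. by move=> h i ni; rewrite h. Qed.

Lemma agree_trans n y x z : agree n x y -> agree n y z -> agree n x z.
Proof. by move=> h h' i ni; rewrite h ?h'. Qed.

Lemma agree_iter k n x y : agree (n + k) x y -> agree n (iter k (@Defs.shift S a0) x) (iter k (@Defs.shift S a0) y).
Proof. by move=> h i ni; rewrite !iter_shift_at; apply: h; rewrite ltn_add2r. Qed.

Definition holder_with (A th : R) phi := forall n, (2 <= n)%N -> forall x y,
  adm E x -> adm E y -> agree n x y -> `|phi x - phi y| <= A * th ^+ n.

Variables (A th : R) (phi : X -> R).
Hypotheses (A0 : 0 <= A) (th01 : 0 < th < 1) (hphi : holder_with A th phi).

Definition dist_cst := A / (1 - th).

Lemma dist_cst_ge0 : 0 <= dist_cst.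
Proof. by rewrite divr_ge0// subr_ge0; case/andP: th01 => _ /ltW. Qed.

Lemma birkhoff_dist n j x y : (0 < j)%N -> adm E x -> adm E y -> agree (n + j) x y ->
  `|birkhoff phi n x - birkhoff phi n y| <= dist_cst * th ^+ j.
Proof.
move=> j0 hx hy xy; have /andP[th0 th1] := th01.
have th' : 0 < 1 - th by rewrite subr_gt0.
apply: (@le_trans _ _ (\sum_(k < n) A * th ^+ j * th ^+ (n - k))).
  rewrite /birkhoff -sumrB; apply: le_trans (ler_norm_sum _ _ _) _.
  apply: ler_sum => k _; rewrite -mulrA -exprD; apply: hphi.
  - by move: (ltn_ord k); lia.
  - exact: adm_iter.
  - exact: adm_iter.
  - by apply: agree_iter; apply: agree_le xy; move: (ltn_ord k); lia.
rewrite -mulr_sumr /dist_cst mulrAC.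
have : \sum_(k < n) th ^+ (n - k) <= (1 - th)^-1.
  have t01 : 0 <= th < 1 by rewrite ltW.
  have := asm_geom ler01 t01 n; rewrite div1r.
  apply: le_trans; rewrite (reindex_inj rev_ord_inj)/=; apply: ler_sum => k _.
  rewrite mul1r ger0_norm ?exprn_ge0 ?(ltW th0)//.
  have -> : (n - (n - k.+1) = k.+1)%N by move: (ltn_ord k); lia.
  by rewrite exprS ler_piMl ?exprn_ge0// ltW.
by move=> h; apply: ler_wpM2r; [rewrite exprn_ge0// ltW|exact: ler_wpM2l].
Qed.

Lemma birkhoff_dist1 n x y : adm E x -> adm E y -> agree n.+1 x y ->
  `|birkhoff phi n x - birkhoff phi n y| <= dist_cst.
Proof.
move=> hx hy xy; have /andP[th0 th1] := th01.
have := @birkhoff_dist n 1 x y isT hx hy; rewrite addn1 => /(_ xy) /le_trans; apply.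
by rewrite ler_piMr ?dist_cst_ge0// expr1 ltW.
Qed.

End Sequences.

Section Paths.
Variables (S : countType) (a0 : S) (E : rel S).
Local Notation X := (Sig a0).

Definition persq (w : nat -> S) n : X := fun i => w (i %% n)%N.

Lemma persq_adm (w : nat -> S) n : (0 < n)%N -> w 0%N = w n ->
  (forall i, (i < n)%N -> E (w i) (w i.+1)) -> adm E (persq w n).
Proof.
move=> n0 w0 h i; rewrite /persq.
have lt : (i %% n < n)%N by rewrite ltn_mod.
have [e|ne] := eqVneq (i %% n).+1 n.
  have -> : (i.+1 %% n = 0)%N by rewrite -addn1 -modnDml addn1 e modnn.
  by rewrite w0 -{2}e; exact: h.
have -> : (i.+1 %% n = (i %% n).+1)%N.
  by rewrite -addn1 -modnDml addn1 modn_small// ltn_neqAle ne.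
exact: h.
Qed.

Lemma persq_per (w : nat -> S) n : iter n (@Defs.shift S a0) (persq w n) = persq w n.
Proof. by rewrite iter_shiftE; apply/funext => i; rewrite /persq modnDr. Qed.

Lemma persq_lt (w : nat -> S) n i : (i < n)%N -> persq w n i = w i.
Proof. by move=> h; rewrite /persq modn_small. Qed.

Lemma persq_n (w : nat -> S) n : w 0%N = w n -> persq w n n = w n.
Proof. by rewrite /persq modnn. Qed.

Lemma per_mod (x : X) n i : iter n (@Defs.shift S a0) x = x -> x i = x (i %% n)%N.
Proof.
move=> h; rewrite [in LHS](divn_eq i n); elim: (i %/ n)%N => [|k ih]; first by rewrite mul0n.
by rewrite mulSn -addnA addnC -ih -{2}h iter_shift_at.
Qed.

Lemma per_eq (x y : X) n : (0 < n)%N -> iter n (@Defs.shift S a0) x = x ->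
  iter n (@Defs.shift S a0) y = y -> agree n x y -> x = y.
Proof.
move=> n0 hx hy xy; apply/funext => i; rewrite (per_mod i hx) (per_mod i hy).
by apply: xy; rewrite ltn_mod.
Qed.

Lemma gpath_cat n m u v w : gpath E n u v -> gpath E m v w -> gpath E (n + m) u w.
Proof.
move=> [f [f0 fn hf]] [g [g0 gm hg]].
exists (fun i => if (i <= n)%N then f i else g (i - n)%N); split.
- by rewrite leq0n.
- case: leqP => nm; last by rewrite addnC addnK.
  have e : m = 0%N by lia.
  by rewrite e addn0 fn -g0 -gm e.
- move=> i im; case: (ltnP i n) => ni; first by rewrite (ltnW ni); exact: hf.
  have [e|ne] := eqVneq i n.
    rewrite e leqnn subSnn fn -g0; apply: hg; lia.
  have -> : (i <= n)%N = false by lia.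
  by rewrite subSn//; apply: hg; lia.
Qed.

Lemma loop_exists (u : S) : mixing_graph E -> exists2 n, (0 < n)%N & gpath E n u u.
Proof.
move=> [sc ap]; apply: contrapT => h.
suff /ap : forall (n : nat) (v : S), (0 < n)%N -> gpath E n v v -> (0 %| n)%N by [].
move=> n v n0 hn; exfalso; apply: h.
have [k hk] := sc u v; have [l hl] := sc v u.
by exists (k + (n + l))%N; [lia|apply: gpath_cat hk (gpath_cat hn hl)].
Qed.
End Paths.

Section ZnComparison.
Variables (S : countType) (a0 : S) (E : rel S) (R : realType) (A th : R) (phi : Sig a0 -> R).
Hypotheses (mix : mixing_graph E) (A0 : 0 <= A) (th01 : 0 < th < 1) (hphi : holder_with E A th phi).
Local Notation X := (Sig a0).

Lemma Zn_ge0 n b : (0 <= Zn E phi n b)%E.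
Proof. by apply: esum_ge0 => x _; rewrite lee_fin expR_ge0. Qed.

Lemma gpath_pos (b c : S) : exists2 k, (0 < k)%N & gpath E k b c.
Proof.
have [n n0 hn] := loop_exists b mix; have [k hk] := (mix.1 b c).
by exists (n + k)%N; [rewrite addn_gt0 n0|exact: gpath_cat hn hk].
Qed.

Lemma words_Zn b b' c : exists k (C : R), 0 <= C /\
  forall n (V : set X), (0 < n)%N -> (forall x, V x -> [/\ adm E x, x 0%N = b & x n = b']) ->
    (forall x y, V x -> V y -> agree n x y -> x = y) ->
    (\esum_(x in V) (expR (birkhoff phi n x))%:E <= C%:E * Zn E phi (n + k) c)%E.
Proof.
have [k1 k10 [u [u0 uk hu]]] := gpath_pos c b; have [k2 k20 [v [v0 vk hv]]] := gpath_pos b' c.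
pose W n (x : X) i := if (i < k1)%N then u i else
   if (i < k1 + n)%N then x (i - k1)%N else v (i - (k1 + n))%N.
pose Y n x : X := persq a0 (W n x) (n + (k1 + k2)).
have W0 n x : W n x 0%N = W n x (n + (k1 + k2))%N.
  rewrite /W k10 ltnNge; have -> : (k1 <= n + (k1 + k2))%N by lia.
  have -> : (n + (k1 + k2) < k1 + n)%N = false by lia.
  by have -> : (n + (k1 + k2) - (k1 + n) = k2)%N; [lia|rewrite vk u0].
pose ok n (x : X) := [/\ (0 < n)%N, adm E x, x 0%N = b & x n = b'].
have Wa n (x : X) : ok n x -> forall i, (i < n + (k1 + k2))%N -> E (W n x i) (W n x i.+1).
  move=> [n0 xa xb xn] i im; rewrite /W.
  have [i1|i1] := ltnP i k1.
    have [i2|i2] := ltnP i.+1 k1; first exact: hu.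
    have e : i.+1 = k1 by lia.
    rewrite ifT; last lia.
    by rewrite e subnn xb -uk -e; apply: hu.
  have -> : (i.+1 < k1)%N = false by lia.
  have [i2|i2] := ltnP i (k1 + n).
    have [i3|i3] := ltnP i.+1 (k1 + n); first by rewrite subSn//; exact: xa.
    have e : (i.+1 = k1 + n)%N by lia.
    rewrite e subnn v0 -xn; have -> : n = (i - k1).+1 by lia.
    exact: xa.
  have -> : (i.+1 < k1 + n)%N = false by lia.
  by rewrite subSn//; apply: hv; lia.
have Ya n x : ok n x -> adm E (Y n x).
  by move=> h; apply: persq_adm; [lia|exact: W0|exact: Wa].
have Y1 n x i : (i < k1)%N -> Y n x i = u i.
  by move=> i1; rewrite /Y persq_lt ?/W ?i1//; lia.
have Y2 n x i : (i < n)%N -> Y n x (i + k1)%N = x i.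
  move=> i1; rewrite /Y persq_lt /W; last lia.
  by rewrite ifF ?ifT ?addnK//; lia.
have Yk1 n x : ok n x -> Y n x k1 = b.
  by move=> [n0 _ xb _]; have := @Y2 n x 0%N n0; rewrite add0n xb.
have Y3 n x i : (i <= k2)%N -> Y n x (i + (k1 + n))%N = v i.
  move=> i1; have [i2|i2] := ltnP i k2.
    rewrite /Y persq_lt /W; last lia.
    by rewrite ifF ?ifF ?addnK//; lia.
  have -> : i = k2 by lia.
  have -> : (k2 + (k1 + n) = n + (k1 + k2))%N by lia.
  by rewrite /Y persq_n -?W0// /W k10 vk u0.
have [[[m z] /= hz]|no] := pselect (exists p : nat * X, ok p.1 p.2); last first.
  exists 0%N, 1; split=> // n V n0 hV _; rewrite (_ : V = set0) ?esum_set0.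
    by apply: mule_ge0; rewrite ?lee_fin//; exact: Zn_ge0.
  by apply/seteqP; split=> x // /hV[xa x0 xn]; apply: no; exists (n, x).
pose D := dist_cst A th; pose sh := @Defs.shift S a0.
pose c0 := `|birkhoff phi k1 (Y m z)| + `|birkhoff phi k2 (iter (m + k1) sh (Y m z))| + 3 * D.
exists (k1 + k2)%N, (expR c0); split; first exact: expR_ge0.
move=> n V n0 hV inj; have hok x : V x -> ok n x by move=> /hV[].
apply: (@esum_inj_le R _ _ _ _ (Y n) _ _ (expR c0) (expR_ge0 _)).
- move=> x y /set_mem Vx /set_mem Vy /= e; apply: inj => // i ni.
  by rewrite -(Y2 n x)// -(Y2 n y)// e.
- by move=> x Vx; split; [exact: Ya (hok _ Vx)|exact: persq_per|rewrite Y1// u0].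
- by move=> x; rewrite lee_fin expR_ge0.
- move=> x Vx; have ox := hok _ Vx; have [_ xa xb xn] := ox.
  rewrite -EFinM lee_fin -expRD ler_expR.
  have -> : (n + (k1 + k2) = k1 + (n + k2))%N by lia.
  rewrite !birkhoffD -iterD.
  have h1 : `|birkhoff phi k1 (Y n x) - birkhoff phi k1 (Y m z)| <= D.
    apply: (birkhoff_dist1 A0 th01 hphi (Ya n x ox) (Ya m z hz)) => i; rewrite ltnS => ik.
    have [i1|i1] := ltnP i k1; first by rewrite !Y1.
    by have -> : i = k1; [lia|rewrite !Yk1].
  have h2 : `|birkhoff phi n (iter k1 sh (Y n x)) - birkhoff phi n x| <= D.
    apply: (birkhoff_dist1 A0 th01 hphi (adm_iter k1 (Ya n x ox)) xa) => i; rewrite ltnS => ik.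
    rewrite iter_shift_at; have [i1|i1] := ltnP i n; first by rewrite Y2.
    have -> : i = n by lia.
    by have := @Y3 n x 0%N isT; rewrite add0n addnC => ->; rewrite v0 xn.
  have h3 : `|birkhoff phi k2 (iter (n + k1) sh (Y n x)) - birkhoff phi k2 (iter (m + k1) sh (Y m z))| <= D.
    apply: (birkhoff_dist1 A0 th01 hphi (adm_iter (n + k1) (Ya n x ox)) (adm_iter (m + k1) (Ya m z hz))) => i.
    by rewrite ltnS => ik; rewrite !iter_shift_at [(n + k1)%N]addnC [(m + k1)%N]addnC !Y3.
  move: h1 h2 h3; rewrite /c0 !ler_norml => /andP[h11 _] /andP[h21 _] /andP[h31 _].
  have := ler_norm (- birkhoff phi k1 (Y m z)); have := ler_norm (- birkhoff phi k2 (iter (m + k1) sh (Y m z))).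
  by rewrite !normrN; lra.
Qed.

Lemma Zn_shift b c : exists k (C : R), 0 <= C /\
  forall n, (0 < n)%N -> (Zn E phi n b <= C%:E * Zn E phi (n + k) c)%E.
Proof.
have [k [C [C0 h]]] := words_Zn b b c; exists k, C; split=> // n n0; apply: h => // [x [xa xp xb]|x y [_ xp _] [_ yp _]].
  by split=> //; rewrite -[in RHS]xb -[in RHS]xp iter_shift_at.
exact: per_eq n0 xp yp.
Qed.

Lemma grow_state b c p : grow (fun n => Zn E phi n c) p -> grow (fun n => Zn E phi n b) p.
Proof.
move=> [D [N hD]]; have [k [C [C0 h]]] := Zn_shift b c.
exists (C * (D * expR (p * k%:R))), (maxn N 1) => n; rewrite geq_max => /andP[Nn n1].
apply: le_trans (h n n1) _.
apply: le_trans (lee_wpmul2l _ (hD (n + k)%N _)) _; rewrite ?lee_fin//; first exact: leq_trans (leq_addr _ _).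
by rewrite natrD mulrDr expRD; nra.
Qed.

Lemma PG_le b c p : grow (fun n => Zn E phi n c) p -> (PG E phi b <= p%:E)%E.
Proof. by move=> h; apply: (rate_le (fun n => Zn_ge0 n b)); exact: grow_state h. Qed.

Lemma PG_ge b c p : (forall p', p' < p -> ~ grow (fun n => Zn E phi n c) p') -> (p%:E <= PG E phi b)%E.
Proof.
by move=> h; apply: (rate_ge (fun n => Zn_ge0 n b)) => p' /h hp g; apply: hp; exact: grow_state g.
Qed.

End ZnComparison.

(** * Inducing on a state *)

Section LoopWords.
Variables (R : realType) (L : loopsys) (A : nat -> L -> R).
Hypothesis A0 : forall k x, 0 <= A k x.

Fixpoint pres (l : seq nat) (x : L) := if l is k :: l' then pre k (pres l' x) else x.
Fixpoint wgt (l : seq nat) (x : L) : R := if l is k :: l' then A k (pres l' x) * wgt l' x else 1.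
Definition llen (l : seq nat) := sumn [seq tau L k | k <- l].

Lemma pres_rcons l k x : pres (rcons l k) x = pres l (pre k x).
Proof. by elim: l => //= j l ->. Qed.

Lemma wgt_rcons l k x : wgt (rcons l k) x = wgt l (pre k x) * A k x.
Proof. by elim: l => [|j l ih] /=; [rewrite mul1r mulr1|rewrite ih pres_rcons mulrA]. Qed.

Lemma llen_rcons l k : llen (rcons l k) = (llen l + tau L k)%N.
Proof. by rewrite /llen map_rcons sumn_rcons. Qed.

Lemma wgt_ge0 l x : 0 <= wgt l x.
Proof. by elim: l => //= k l ih; rewrite mulr_ge0. Qed.

Local Open Scope ereal_scope.

Variable f : L -> R.
Hypothesis f0 : forall x, (0 <= f x)%R.

Definition cn n x := \esum_(l in [set l | llen l = n]) (wgt l x * f (pres l x))%:E.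

Definition splitr (l : seq nat) : nat * seq nat := if rev l is k :: l' then (k, rev l') else (0%N, [::]).

Lemma splitr_rcons l k : splitr (rcons l k) = (k, l).
Proof. by rewrite /splitr rev_rcons revK. Qed.

Lemma term_ge0 l x : 0 <= (wgt l x * f (pres l x))%:E.
Proof. by rewrite lee_fin mulr_ge0// wgt_ge0. Qed.

Lemma cn0 x : cn 0 x = (f x)%:E.
Proof.
rewrite /cn (_ : [set l | llen l = 0%N] = [set [::]]).
  by rewrite esum_set1 /= ?lee_fin ?mul1r.
apply/seteqP; split=> [[|k l]|_ ->] //=.
by rewrite /llen/= => /eqP; rewrite addn_eq0 gtn_eqF// tau_gt0.
Qed.

Lemma cn_step n x (h : L -> R) K : (0 < n)%N ->
  (forall m y, (m < n)%N -> cn m y <= (h y)%:E) -> (forall y, (0 <= h y)%R) ->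
  asm (fun k => A k x * h (pre k x))%R K -> cn n x <= (op A h x)%:E.
Proof.
move=> n0 hm h0 ha.
pose J k := [set l | (llen l + tau L k)%N = n].
pose g (p : nat * seq nat) := (wgt (rcons p.2 p.1) x * f (pres (rcons p.2 p.1) x))%:E.
have g0 p : 0 <= g p by exact: term_ge0.
apply: (@le_trans _ _ (1%:E * \esum_(p in [set: nat] `*`` J) g p)).
  apply: (@esum_inj_le R _ _ _ _ splitr) => //.
  - move=> l l' /set_mem/= hl /set_mem/= hl'; case/lastP: l hl => [|l k] hl; first by rewrite -hl in n0.
    case/lastP: l' hl' => [|l' k'] hl'; first by rewrite -hl' in n0.
    by rewrite !splitr_rcons => -[-> ->].
  - move=> l /= hl; case/lastP: l hl => [|l k] hl; first by rewrite -hl in n0.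
    by split=> //; rewrite splitr_rcons /J/= -llen_rcons.
  - move=> l /= hl; case/lastP: l hl => [|l k] hl; first by rewrite -hl in n0.
    by rewrite splitr_rcons mul1e.
rewrite mul1e.
have -> : \esum_(p in [set: nat] `*`` J) g p =
   \esum_(k in [set: nat]) \esum_(l in J k) g (k, l).
  rewrite (esum_esum (a := fun k l => g (k, l))) => [|k l _ _]; last exact: g0.
  by apply: eq_esum => -[k l].
rewrite -(esum_sm ha); last by move=> k; rewrite mulr_ge0.
apply: le_esum => k _.
have [kn|kn] := leqP (tau L k) n; last first.
  rewrite (_ : J k = set0) ?esum_set0 ?lee_fin ?mulr_ge0//.
  by apply/seteqP; split=> l //= hl; move: kn; rewrite -hl ltnNge leq_addl.
apply: (@le_trans _ _ ((A k x)%:E * cn (n - tau L k) (pre k x))).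
  apply: (@esum_inj_le R _ _ _ _ id) => //.
  - by move=> l; rewrite /J/= => <-; rewrite addnK.
  - by move=> l; exact: term_ge0.
  - by move=> l _; rewrite /g/= pres_rcons wgt_rcons -EFinM lee_fin mulrAC mulrC.
rewrite EFinM; apply: lee_wpmul2l; first by rewrite lee_fin.
by apply: hm; rewrite ltn_subrL n0 tau_gt0.
Qed.

Lemma cn_le_super n x : (forall y, exists K, asm (fun k => A k y * f (pre k y))%R K) ->
  (forall y, (op A f y <= f y)%R) -> cn n x <= (f x)%:E.
Proof.
move=> ha hf; elim/ltn_ind: n x => n ih x.
have [->|n0] := posnP n; first by rewrite cn0.
have [K hK] := ha x.
by apply: (le_trans (cn_step n0 (fun m y mn => ih m mn y) f0 hK)); rewrite lee_fin.
Qed.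

Lemma cn_fin n M K x : (1 <= K)%R -> (forall y, asm (fun k => A k y) K) -> (forall y, (f y <= M)%R) ->
  cn n x <= (M * K ^+ n)%:E.
Proof.
move=> K1 hK fM; have M0 : (0 <= M)%R by apply: le_trans (fM x).
have K0 : (0 <= K)%R by apply: le_trans K1.
elim/ltn_ind: n x => n ih x.
have [->|n0] := posnP n; first by rewrite cn0 lee_fin expr0 mulr1.
have hc : asm (fun k => A k x * (M * K ^+ n.-1))%R (`|M * K ^+ n.-1| * K)%R.
  by apply: eq_asm (asmZ (M * K ^+ n.-1) (hK x)) => k; rewrite mulrC.
apply: le_trans (cn_step n0 (h := fun=> (M * K ^+ n.-1)%R) _ _ hc) _.
- move=> m y mn; apply: le_trans (ih m mn y) _; rewrite lee_fin; apply: ler_wpM2l => //.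
  by apply: ler_weXn2l => //; rewrite -ltnS prednK.
- by move=> y; rewrite mulr_ge0// exprn_ge0.
- rewrite lee_fin; apply: le_trans (sm_le_bound hc) _.
  by rewrite ger0_norm ?mulr_ge0 ?exprn_ge0// -mulrA -exprSr prednK.
Qed.

Definition ctot x := \esum_(l in [set: seq nat]) (wgt l x * f (pres l x))%:E.

Lemma ctot_ge x (h : L -> R) K : (forall y, (h y)%:E <= ctot y) -> (forall y, 0 <= h y)%R ->
  asm (fun k => A k x * h (pre k x))%R K -> (f x + op A h x)%:E <= ctot x.
Proof.
move=> hc h0 ha.
pose F l := (wgt l x * f (pres l x))%:E.
rewrite /ctot (esumID [set [::]]) => [|l _]; last exact: term_ge0.
rewrite !setTI EFinD; apply: leeD; first by rewrite esum_set1 /= ?mul1r ?lee_fin.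
pose e (p : nat * seq nat) := rcons p.2 p.1.
apply: (@le_trans _ _ (\esum_(l in [set e p | p in [set: nat] `*`` (fun=> [set: seq nat])]) F l)); last first.
  apply: esum_sub => [l|_ [[k l] _ <-]]; first exact: term_ge0.
  by rewrite /e /=; case: l.
rewrite esum_image; last first.
  by move=> [k l] [k' l'] _ _ /= /rcons_inj[-> ->].
rewrite -(esum_sm ha); last by move=> k; rewrite mulr_ge0.
have -> : \esum_(p in [set: nat] `*`` (fun=> [set: seq nat])) F (e p) =
    \esum_(k in [set: nat]) \esum_(l in [set: seq nat]) F (rcons l k).
  rewrite (esum_esum (a := fun k l => F (rcons l k))) => [|k l _ _]; last exact: term_ge0.
  by apply: eq_esum => -[k l].
apply: le_esum => k _.
have [/eqP|Ak] := eqVneq (A k x) 0%R.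
  by move/eqP => ->; rewrite mul0r; apply: esum_ge0 => l _; exact: term_ge0.
have Ak0 : (0 < A k x)%R by rewrite lt_neqAle eq_sym Ak A0.
rewrite -(@lee_pmul2l _ ((A k x)^-1)%:E) ?lte_fin ?invr_gt0// -EFinM mulKf//.
apply: le_trans (hc (pre k x)) _.
apply: esum_scale => [|l|l _].
- by rewrite invr_ge0.
- exact: term_ge0.
- rewrite /F pres_rcons wgt_rcons -EFinM lee_fin.
  rewrite (_ : _^-1 * _ = wgt l (pre k x) * f (pres l (pre k x)))%R//.
  by field; rewrite gt_eqF.
Qed.

Lemma ctot_sub x (M K : R) : (forall y, (f y <= M)%R) -> (forall y, asm (fun k => A k y) K) ->
  (forall y, (f y <= op A f y)%R) -> (0 < f x)%R -> ctot x = +oo.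
Proof.
move=> fM hK hf fx.
have M0 : (0 <= M)%R by apply: le_trans (fM x).
have key j y : (j%:R * f y)%:E <= ctot y.
  elim: j y => [|j ih] y; first by rewrite mul0r; apply: esum_ge0 => l _; exact: term_ge0.
  have ha : asm (fun k => A k y * (j%:R * f (pre k y)))%R (j%:R * M * K).
    have := asmZ (j%:R * M) (hK y); rewrite ger0_norm ?mulr_ge0//; apply: asm_le => k.
    rewrite ger0_norm ?mulr_ge0// mulrC; apply: ler_wpM2r => //.
    by apply: ler_wpM2l.
  apply: le_trans (ctot_ge ih _ ha); last by move=> z; rewrite mulr_ge0.
  rewrite lee_fin -natr1 mulrDl mul1r addrC lerD2l.
  apply: le_trans (ler_wpM2l _ (hf y)) _ => //.
  have hf' : asm (fun k => A k y * f (pre k y))%R (M * K).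
    have := asmZ M (hK y); rewrite ger0_norm//; apply: asm_le => k.
    by rewrite ger0_norm ?mulr_ge0// mulrC; apply: ler_wpM2r.
  by rewrite /op -(smZ _ hf') le_eqVlt; apply/orP; left; apply/eqP; apply: eq_sm => k; ring.
have [m hm] : exists m : nat, (fine (ctot x) < m%:R * f x)%R.
  exists (Num.truncn (`|fine (ctot x)| / f x)).+1; rewrite -ltr_pdivrMr//.
  apply: le_lt_trans (truncnS_gt _).
  by apply: ler_wpM2r; [rewrite invr_ge0 ltW|exact: ler_norm].
have := key m x; have := key 0%N x; rewrite mul0r.
by case: (ctot x) hm => [r||]//= hm _; rewrite lee_fin leNgt hm.
Qed.

Lemma ctot_series x : ctot x = \sum_(0 <= n <oo) cn n x.
Proof.
rewrite -nneseries_sum_bigcup.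
- by congr (esum _ _); apply/seteqP; split=> // l _; exists (llen l).
- by move=> i j _ _ [l [/= <- <-]].
- by move=> l; exact: term_ge0.
Qed.

Lemma sub_no_decay x (M K C g : R) N : (1 <= K)%R -> (forall y, (f y <= M)%R) ->
  (forall y, asm (fun k => A k y) K) ->
  (forall y, (f y <= op A f y)%R) -> (0 < f x)%R -> (0 <= g < 1)%R ->
  (forall n, (N <= n)%N -> cn n x <= (C * g ^+ n)%:E) -> False.
Proof.
move=> K1 fM hK hf fx g01 hC.
have M0 : (0 <= M)%R by apply: le_trans (fM x).
have := ctot_sub fM hK hf fx; rewrite ctot_series.
pose u n := ((n < N)%N%:R * (M * K ^+ N) + `|C| * g ^+ n)%R.
have hu : asm u (N%:R * (M * K ^+ N) + `|C| / (1 - g))%R.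
  apply: asmD; last exact: asm_geom.
  have z : (0 <= M * K ^+ N)%R by rewrite mulr_ge0// exprn_ge0//; lra.
  apply: asmP => [n|n]; first by rewrite mulr_ge0.
  rewrite -mulr_suml; apply: ler_wpM2r => //.
  rewrite -natr_sum ler_nat.
  suff -> : (\sum_(i < n) (i < N) = minn n N)%N by rewrite geq_minr.
  by elim: n => [|n ih]; rewrite ?big_ord0 ?min0n// big_ord_recr/= ih; case: ltnP; lia.
have u0 n : (0 <= u n)%R.
  rewrite addr_ge0// mulr_ge0// ?exprn_ge0//; first by rewrite mulr_ge0// exprn_ge0//; lra.
  by case/andP: g01.
have : \sum_(0 <= n <oo) cn n x <= \sum_(0 <= n <oo) (u n)%:E.
  apply: lee_nneseries => [n _ _|n _]; first by apply: esum_ge0 => l _; exact: term_ge0.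
  have g0 : (0 <= g)%R by case/andP: g01.
  have [nN|Nn] := ltnP n N.
    apply: le_trans (cn_fin n x K1 hK fM) _; rewrite lee_fin /u nN mul1r.
    rewrite -[leLHS]addr0; apply: lerD; last by rewrite mulr_ge0// exprn_ge0.
    by apply: ler_wpM2l => //; apply: ler_weXn2l => //; exact: ltnW.
  apply: le_trans (hC n Nn) _; rewrite lee_fin /u ltnNge Nn/= mul0r add0r.
  by apply: ler_wpM2r; [rewrite exprn_ge0|exact: ler_norm].
rewrite [X in _ <= X]nneseries_esumT => [|n]; last by rewrite lee_fin.
by rewrite (esum_sm hu u0) => h e; rewrite e in h.
Qed.
End LoopWords.

Section ConcreteLoops.
Variables (S : countType) (a : S) (E : rel S).
Local Notation X := (Sig a).
Local Notation sh := (@Defs.shift S a).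
Implicit Types (v : seq S).

Definition catq v (x : X) : X := fun i => if (i < size v)%N then nth a v i else x (i - size v)%N.

Lemma catq_ge v (x : X) i : catq v x (size v + i) = x i.
Proof. by rewrite /catq ltnNge leq_addr/= addKn. Qed.

Lemma iter_catq v (x : X) : iter (size v) sh (catq v x) = x.
Proof. by rewrite iter_shiftE; apply/funext => i; rewrite addnC catq_ge. Qed.

Definition closing v := path E a v && E (last a v) a.

Lemma catq_adm v (x : X) : closing v -> adm E x -> x 0%N = a -> adm E (catq (a :: v) x).
Proof.
case/andP => /(pathP a) pv lv hx x0 i; rewrite /catq/= !ltnS.
have [iv|iv] := ltnP i (size v).
  by rewrite (ltnW iv); exact: pv.
have [e|ne] := eqVneq i (size v).
  by rewrite e leqnn subSS subnn x0 -/(nth a (a :: v) (size v)) nth_last.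
have lt : (size v < i)%N by rewrite ltn_neqAle eq_sym ne.
by rewrite leqNgt lt/= subSn.
Qed.

Definition Ypt := {x : X | adm E x /\ x 0%N = a}.

Lemma Yeq (x y : Ypt) : sval x = sval y -> x = y.
Proof.
by case: x y => [x hx] [y hy] /= e; subst y; rewrite (Prop_irrelevance hx hy).
Qed.

Lemma Yadm (x : Ypt) : adm E (sval x). Proof. by case: x => x []. Qed.
Lemma Y0 (x : Ypt) : sval x 0%N = a. Proof. by case: x => x []. Qed.

Variables (v0 : seq S) (cl0 : closing v0).

Definition frw v := closing v && (a \notin v).

Definition lword (k : nat) : seq S :=
  if (pickle_inv k : option (seq S)) is Some v then (if frw v then v else v0) else v0.

Definition vd (k : nat) : bool :=
  if (pickle_inv k : option (seq S)) is Some v then frw v else false.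

Lemma lword_cl k : closing (lword k).
Proof. by rewrite /lword; case: pickle_inv => // v; case: ifP => // /andP[]. Qed.

Lemma vd_frw k : vd k -> frw (lword k).
Proof. by rewrite /vd /lword; case: pickle_inv => // v h; rewrite h. Qed.

Lemma lword_inj k k' : vd k -> vd k' -> lword k = lword k' -> k = k'.
Proof.
rewrite /vd /lword.
case e : (pickle_inv k) => [v|//]; case e' : (pickle_inv k') => [v'|//] => h h'.
rewrite h h' => vv; subst v'.
have := pickle_invK (T := seq S) k; have := pickle_invK (T := seq S) k'.
by rewrite /oapp e e' => <- <-.
Qed.

Lemma vd_pickle v : frw v -> vd (pickle v) /\ lword (pickle v) = v.
Proof. by move=> h; rewrite /vd /lword pickleK_inv h. Qed.

Definition ctau k := (size (lword k)).+1.

Lemma cpre_subproof k (x : Ypt) :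
  adm E (catq (a :: lword k) (sval x)) /\ catq (a :: lword k) (sval x) 0%N = a.
Proof. by split=> //; apply: catq_adm; [exact: lword_cl|exact: Yadm|exact: Y0]. Qed.

Definition cpre k (x : Ypt) : Ypt := exist _ _ (cpre_subproof k x).

Definition cagr n (x y : Ypt) := agree n (sval x) (sval y).

Lemma cbase_subproof : adm E (@persq S a (nth a (a :: rcons v0 a)) (size v0).+1) /\
  @persq S a (nth a (a :: rcons v0 a)) (size v0).+1 0%N = a.
Proof.
split; last by rewrite /persq mod0n.
apply: persq_adm => //; first by rewrite /= nth_rcons ltnn eqxx.
have : path E a (rcons v0 a) by rewrite rcons_path.
by move/(pathP a); rewrite size_rcons.
Qed.

Definition cbase : Ypt := exist _ _ cbase_subproof.

Lemma cagr1 (x y : Ypt) : cagr 1 x y.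
Proof. by case=> // _; rewrite !Y0. Qed.

Lemma cagr_pre k n (x y : Ypt) : cagr n x y -> cagr (ctau k + n) (cpre k x) (cpre k y).
Proof.
move=> h i hi; rewrite /cpre /= /catq; case: ifPn => //; rewrite -leqNgt => ki.
by apply: h; rewrite ltn_subLR.
Qed.

Definition cloops : loopsys.
Proof.
apply: (@LoopSys Ypt cpre ctau cagr cbase) => //.
- exact: cagr1.
- by move=> n x y h; exact: agree_sym.
- by move=> n m x y nm h; exact: agree_le h.
- by move=> k n x y; exact: cagr_pre.
Defined.

Lemma pre_at k (x : Ypt) i : sval (cpre k x) (ctau k + i)%N = sval x i.
Proof. by rewrite /= (catq_ge (a :: lword k)). Qed.

Lemma iter_pre k (x : Ypt) : iter (ctau k) sh (sval (cpre k x)) = sval x.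
Proof. exact: (iter_catq (a :: lword k)). Qed.

Lemma pre_ne k (x : Ypt) i : vd k -> (0 < i < ctau k)%N -> sval (cpre k x) i <> a.
Proof.
move=> /vd_frw/andP[_ an] /andP[i0 ik]; rewrite /= /catq ik.
case: i i0 ik => // i _ /= ik e; move/negP: an; apply; rewrite -e mem_nth//.
Qed.

Lemma first_return (x : Ypt) n : (0 < n)%N -> sval x n = a ->
  exists k (y : Ypt), [/\ vd k, (ctau k <= n)%N & x = cpre k y].
Proof.
move=> n0 xn.
have ex : exists m, (0 < m)%N && (sval x m == a) by exists n; rewrite n0 xn eqxx.
case: (ex_minnP ex) => m /andP[m0 /eqP xm] mmin.
pose v := mkseq (fun i => sval x i.+1) m.-1.
have sv : size v = m.-1 by rewrite size_mkseq.
have av i : (i < m)%N -> nth a (a :: v) i = sval x i.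
  case: i => [_|i im] /=; first by rewrite Y0.
  by rewrite nth_mkseq//; lia.
have fv : frw v.
  apply/andP; split; first apply/andP; [split|].
  - apply/(pathP a) => i; rewrite sv => im; rewrite av; last lia.
    by rewrite nth_mkseq//; exact: Yadm.
  - rewrite (last_nth a) sv av; last lia.
    by have := Yadm x m.-1; rewrite prednK// xm.
  - apply/negP => /mapP[i]; rewrite mem_iota add0n => im e.
    by have := mmin i.+1; rewrite -e eqxx => /(_ isT); lia.
have [vk lk] := vd_pickle fv.
have ty : adm E (iter m sh (sval x)) /\ iter m sh (sval x) 0%N = a.
  by split; [exact/adm_iter/Yadm|rewrite iter_shift_at].
exists (pickle v), (@exist X (fun x : X => adm E x /\ x 0%N = a) (iter m sh (sval x)) ty); split=> //.
  rewrite /ctau lk sv prednK//; apply: mmin; by rewrite n0 xn eqxx.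
apply: Yeq; apply/funext => i /=; rewrite lk /catq /= sv prednK//.
case: ltnP => im; first by rewrite av.
by rewrite iter_shift_at subnK.
Qed.

Local Notation L := cloops.
Local Notation ps := (@pres L).
Local Notation ll := (@llen L).

Lemma iter_pres l (x : L) : iter (ll l) sh (sval (ps l x)) = sval x.
Proof.
elim: l x => // k l ih x.
have -> : ll (k :: l) = (ll l + ctau k)%N by rewrite addnC.
by rewrite iterD -[ps _ _]/(cpre k (ps l x)) iter_pre ih.
Qed.

Lemma pres_at l (x : L) i : sval (ps l x) (ll l + i)%N = sval x i.
Proof. by rewrite -[in RHS](iter_pres l x) iter_shift_at addnC. Qed.

Lemma agr_pres l n (x y : L) : agr n x y -> agr (ll l + n) (ps l x) (ps l y).
Proof.
move=> h; elim: l => // k l ih; rewrite /llen /= -addnA; exact: (agr_pre k ih).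
Qed.

Lemma decode n (x : L) : sval x n = a -> exists l (y : L), [/\ all vd l, ll l = n & x = ps l y].
Proof.
elim/ltn_ind: n x => n ih x xn.
have [n0|n0] := posnP n; first by exists [::], x; rewrite n0.
have [k [y [vk kn e]]] := first_return n0 xn.
have yn : sval y (n - ctau k)%N = a by rewrite -(pre_at k y) subnKC// -e.
have [|l [z [vl ln ez]]] := ih (n - ctau k)%N _ y yn; first by rewrite ltn_subrL n0.
exists (k :: l), z; split=> /=; first by rewrite vk.
- by rewrite /llen/= -/(ll l) ln subnKC.
- by rewrite -ez.
Qed.

Lemma decode_uniq n l l' (x y : L) : all vd l -> all vd l' -> ll l = n -> ll l' = n ->
  agr n (ps l x) (ps l' y) -> l = l'.
Proof.
elim: l l' n x y => [|k l ih] [|k' l'] n x y //=.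
- by rewrite /llen /= => _ _ <-.
- by rewrite /llen /= => _ _ + e; rewrite -e.
move=> /andP[vk vl] /andP[vk' vl'] ln ln' h.
have half j j' u u' m (z z' : L) : vd j -> vd j' -> ll (j :: u) = m -> ll (j' :: u') = m ->
    agr m (ps (j :: u) z) (ps (j' :: u') z') -> (ctau j' <= ctau j)%N.
  move=> vj vj' hm hm' hz; rewrite leqNgt; apply/negP => jj.
  have jm : (ctau j < m)%N by rewrite -hm'; apply: leq_trans jj _; rewrite /llen /= leq_addr.
  have : sval (cpre j (ps u z)) (ctau j + 0)%N = sval (cpre j' (ps u' z')) (ctau j) by rewrite addn0; exact: hz (ctau j) jm.
  rewrite pre_at Y0 => e.
  by apply: (@pre_ne j' (ps u' z') (ctau j) vj') => //; rewrite jj.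
have tt : ctau k = ctau k'.
  apply/eqP; rewrite eqn_leq (half k' k l' l n y x)// ?(half k k' l l' n x y)//.
  by move=> i /h ->.
have tn : (ctau k <= n)%N by rewrite -ln /llen /= leq_addr.
have kk : k = k'.
  apply: lword_inj => //; apply: (@eq_from_nth _ a); first by case: tt.
  move=> i ik; have := h i.+1; rewrite /= /catq /= !ltnS ik -(_ : size (lword k) = size (lword k')) ?ik; last by case: tt.
  by apply; apply: leq_trans tn.
subst k'; congr cons; apply: (ih l' (n - ctau k)%N x y) => //.
- by rewrite -ln /llen /= addKn.
- by rewrite -ln' /llen /= addKn.
- move=> i hi; rewrite -(pre_at k (ps l x)) -(pre_at k (ps l' y)).
  by apply: (h (ctau k + i)%N); rewrite -ltn_subRL.
Qed.

Section Weights.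
Variables (R : realType) (Ad th : R) (phi : X -> R) (p : R).
Hypotheses (Ad0 : 0 <= Ad) (th01 : 0 < th < 1) (hphi : holder_with E Ad th phi).
Local Notation D := (dist_cst Ad th).

Definition Aw k (x : L) : R := (vd k)%:R * expR (birkhoff phi (ctau k) (sval (cpre k x)) - p * (ctau k)%:R).

Lemma Aw_ge0 k x : 0 <= Aw k x.
Proof. by rewrite mulr_ge0// expR_ge0. Qed.

Lemma Aw_dist k n (x y : L) : (0 < n)%N -> agr n x y -> Aw k x <= expR (D * th ^+ n) * Aw k y.
Proof.
move=> n0 h; rewrite /Aw mulrCA; apply: ler_wpM2l => //.
rewrite -expRD ler_expR.
have := birkhoff_dist Ad0 th01 hphi n0 (Yadm (cpre k x)) (Yadm (cpre k y)) (agr_pre k h).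
by rewrite ler_norml => /andP[_]; rewrite /tau/=; lra.
Qed.

Lemma wgtE l (x : L) : wgt Aw l x = (all vd l)%:R * expR (birkhoff phi (ll l) (sval (ps l x)) - p * (ll l)%:R).
Proof.
elim: l => [|k l ih]; first by rewrite /= birkhoff0 mulr0 subr0 expR0 mulr1.
rewrite /= ih /Aw.
have -> : ll (k :: l) = (ctau k + ll l)%N by [].
rewrite birkhoffD iter_pre natrD -mulnb natrM.
rewrite mulrACA -expRD; congr (_ * expR _); ring.
Qed.

Variables (f : L -> R) (c M : R).
Hypotheses (c0 : 0 < c) (cf : forall x, c <= f x) (fM : forall x, f x <= M).

Lemma c_f0 x : 0 <= f x. Proof. exact: le_trans (ltW c0) (cf x). Qed.

Lemma Zn_le_cn n (y : L) : (0 < n)%N ->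
  (Zn E phi n a <= (expR D / c * expR (p * n%:R))%:E * cn Aw f n y)%E.
Proof.
move=> n0; rewrite /Zn /cn.
pose P (x : X) l := [/\ all vd l, ll l = n & agree n x (sval (ps l y))].
have ex (x : X) : [/\ adm E x, iter n sh x = x & x 0%N = a] -> exists l, P x l.
  move=> [hx xn x0].
  have [|l [z [vl ln e]]] := @decode n (exist _ x (conj hx x0)).
    by rewrite /= -[n]add0n -iter_shift_at xn.
  exists l; split=> // i hi; have -> : x = sval (ps l z) by rewrite -e.
  by apply: (@agr_pres l 0 z y) => //; rewrite addn0 ln.
pose e (x : X) : seq nat := xget [::] [set l | P x l].
have he x : [/\ adm E x, iter n sh x = x & x 0%N = a] -> P x (e x).
  by move=> /ex[l hl]; exact: (@xgetPex _ [::] [set l | P x l]) (ex_intro _ l hl).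
apply: (@esum_inj_le R X (seq nat) _ _ e).
- by rewrite mulr_ge0 ?expR_ge0// divr_ge0 ?expR_ge0// ltW.
- move=> x x' /set_mem/= hx /set_mem/= hx' ee.
  have [_ _ h1] := he x hx; have [_ _ h2] := he x' hx'.
  have [_ p1 _] := hx; have [_ p2 _] := hx'.
  by apply: (per_eq n0 p1 p2); apply: agree_trans h1 _; rewrite ee; exact: agree_sym.
- by move=> x /he[].
- by move=> l; rewrite lee_fin mulr_ge0 ?wgt_ge0 ?c_f0//; exact: Aw_ge0.
- move=> x hx; have [vl ln hag] := he x hx; have [ax px x0] := hx.
  rewrite -EFinM lee_fin wgtE vl mul1r ln.
  have ag : agree n.+1 x (sval (ps (e x) y)).
    move=> i; rewrite ltnS leq_eqVlt => /orP[/eqP ->|]; last exact: hag.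
    rewrite -{1}[n]add0n -iter_shift_at px x0 -{1}ln -[ll _]addn0 pres_at.
    by rewrite Y0.
  have := birkhoff_dist1 Ad0 th01 hphi ax (Yadm (ps (e x) y)) ag.
  rewrite ler_norml => /andP[_]; set u := birkhoff _ _ _; set w := birkhoff _ _ _ => h.
  have -> : expR D / c * expR (p * n%:R) * (expR (w - p * n%:R) * f (ps (e x) y)) =
     expR (D + w) * (f (ps (e x) y) / c).
    rewrite (_ : D + w = D + p * n%:R + (w - p * n%:R)); last ring.
    by rewrite !expRD; ring.
  apply: (@le_trans _ _ (expR (D + w) * 1)); first by rewrite mulr1 ler_expR; lra.
  by apply: ler_wpM2l; [exact: expR_ge0|rewrite ler_pdivlMr// mul1r].
Qed.

Lemma cn_le_Zn n (y : L) : (0 < n)%N ->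
  (cn Aw f n y <= (M * expR D * expR (- (p * n%:R)))%:E * Zn E phi n a)%E.
Proof.
move=> n0; have M0 : 0 <= M by apply: le_trans (fM y); exact: c_f0.
pose e l : X := @persq S a (sval (ps l y)) n.
have ag l : ll l = n -> agree n (e l) (sval (ps l y)).
  by move=> ln i hi; rewrite /e persq_lt.
have hn l : ll l = n -> sval (ps l y) n = a.
  by move=> ln; rewrite -ln -[ll l]addn0 pres_at Y0.
rewrite /Zn /cn.
apply: (@le_trans _ _ (\esum_(l in [set l | ll l = n /\ all vd l]) (wgt Aw l y * f (ps l y))%:E)%E).
  apply: esum_fsets_le => Z fZ ZD.
  rewrite (fsbigID (fun l => all vd l))//= [X in (_ + X)%E]fsbig1 ?adde0; last first.
    by move=> l [_ /negP vl]; rewrite wgtE (negPf vl) !mul0r.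
  apply: esum_ge_fset; first exact: finite_setIl.
  by move=> l [/ZD].
apply: (@esum_inj_le R (seq nat) X _ _ e).
- by rewrite !mulr_ge0 ?expR_ge0.
- move=> l l' /set_mem/= [ln vl] /set_mem/= [ln' vl'] ee.
  apply: (decode_uniq vl vl' ln ln' (x := y) (y := y)).
  by apply: agree_trans (agree_sym (ag l ln)) _; rewrite ee; exact: ag.
- move=> l [ln vl]; split.
  + apply: persq_adm => //; first by rewrite hn// Y0.
    by move=> i _; exact: Yadm.
  + exact: persq_per.
  + by rewrite /e persq_lt// Y0.
- by move=> x; rewrite lee_fin expR_ge0.
- move=> l [ln vl]; rewrite -EFinM lee_fin wgtE vl mul1r ln.
  have ad : adm E (e l).
    apply: persq_adm => //; first by rewrite hn// Y0.
    by move=> i _; exact: Yadm.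
  have ag' : agree n.+1 (e l) (sval (ps l y)).
    move=> i; rewrite ltnS leq_eqVlt => /orP[/eqP ->|]; last exact: ag.
    by rewrite hn// /e /persq modnn Y0.
  have := birkhoff_dist1 Ad0 th01 hphi ad (Yadm (ps l y)) ag'.
  rewrite ler_norml => /andP[h _]; move: h; set u := birkhoff _ _ _; set w := birkhoff _ _ _ => h.
  rewrite [leLHS]mulrC -!mulrA; apply: ler_pM; [exact: c_f0|exact: expR_ge0|exact: fM|].
  by rewrite -!expRD ler_expR; lra.
Qed.

Lemma super_grow : (forall x, exists K, asm (fun k => Aw k x) K) -> (forall x, op Aw f x <= f x) ->
  grow (fun n => Zn E phi n a) p.
Proof.
move=> hK hf; exists (expR D / c * f cbase), 1%N => n n0.
apply: le_trans (Zn_le_cn cbase n0) _.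
have e0 : 0 <= expR D / c by rewrite divr_ge0 ?expR_ge0// ltW.
apply: le_trans (lee_wpmul2l _ (cn_le_super Aw_ge0 c_f0 n cbase _ hf)) _.
- by rewrite lee_fin mulr_ge0 ?expR_ge0.
- move=> y; have [K hy] := hK y; exists (M * K).
  have M0 : 0 <= M by apply: le_trans (fM y); exact: c_f0.
  have := asmZ M hy; rewrite ger0_norm//; apply: asm_le => k.
  by rewrite ger0_norm ?mulr_ge0 ?Aw_ge0 ?c_f0// mulrC; apply: ler_wpM2r; rewrite ?Aw_ge0.
- by rewrite -EFinM lee_fin mulrAC.
Qed.

Lemma sub_not_grow K : (forall x, asm (fun k => Aw k x) K) -> (forall x, f x <= op Aw f x) ->
  forall p', p' < p -> ~ grow (fun n => Zn E phi n a) p'.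
Proof.
move=> hK hf p' pp [C [N hC]].
have K1 : 1 <= `|K| + 1 by rewrite lerDr.
have M0 : 0 <= M by apply: le_trans (fM cbase); exact: c_f0.
apply: (@sub_no_decay R L Aw Aw_ge0 f c_f0 cbase M (`|K| + 1) (M * expR D * C) (expR (p' - p)) (maxn N 1) K1 fM _ hf).
- by move=> y; apply: asmW (hK y) _; have := ler_norm K; lra.
- exact: lt_le_trans (cf _).
- by rewrite expR_ge0 expR_lt1 subr_lt0.
- move=> n; rewrite geq_max => /andP[Nn n1].
  apply: le_trans (cn_le_Zn cbase n1) _.
  apply: le_trans (lee_wpmul2l _ (hC n Nn)) _; first by rewrite lee_fin !mulr_ge0 ?expR_ge0.
  rewrite -EFinM lee_fin -expRM_natr.
  rewrite (_ : (p' - p) * n%:R = - (p * n%:R) + p' * n%:R); last ring.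
  by rewrite expRD le_eqVlt; apply/orP; left; apply/eqP; ring.
Qed.
End Weights.
End ConcreteLoops.

(** * Eigenfunction at the Gurevich pressure *)

Lemma esum_supp (R : realType) (T : choiceType) (D P : set T) (f : T -> \bar R) :
  (forall i, 0%E <= f i)%E -> (forall i, D i -> ~ P i -> f i = 0%E) ->
  (\esum_(i in D) f i <= \esum_(i in D `&` P) f i)%E.
Proof.
move=> f0 h; apply: esum_fsets_le => Z fZ ZD.
rewrite (fsbigID (fun l => `[< P l >]))//= [X in (_ + X)%E]fsbig1 ?adde0; last first.
  by move=> l [Zl nP]; apply: h; [exact: ZD|move=> Pl; apply: nP; exact/asboolP].
apply: esum_ge_fset; first exact: finite_setIl.
by move=> l [/ZD Dl /asboolP].
Qed.

Lemma asm_esum (R : realType) (u : nat -> R) K : (forall n, 0 <= u n) ->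
  (\esum_(n in [set: nat]) (u n)%:E <= K%:E)%E -> asm u K.
Proof.
move=> u0 h; apply: asmP => // N; rewrite -lee_fin; apply: le_trans h.
rewrite -nneseries_esumT => [|n]; last by rewrite lee_fin.
rewrite -sumEFin -(big_mkord xpredT (fun k => (u k)%:E)).
by apply: nneseries_lim_ge => n _ _; rewrite lee_fin.
Qed.

Lemma expR_norm1 (R : realType) (z : R) : `|expR z - 1| <= `|z| * expR `|z|.
Proof.
have [z0|z0] := leP 0 z.
  rewrite !ger0_norm// ?expR_sub1_le// subr_ge0 -[leLHS]expR0 ler_expR//.
rewrite ler0_norm; last by rewrite subr_le0 -[leRHS]expR0 ler_expR ltW.
rewrite (ltr0_norm z0); have h1 := expR_ge1Dx z.
have h2 : 1 <= expR (- z) by rewrite -[leLHS]expR0 ler_expR; lra.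
have h3 : 0 <= (- z) * (expR (- z) - 1) by apply: mulr_ge0; lra.
lra.
Qed.

Lemma expR_tilt (R : realType) (om d t : R) : 0 < om -> 0 <= t -> `|d| <= om / 2 ->
  `|expR (d * t) - 1| <= 2 * `|d| / om * expR (om * t).
Proof.
move=> o0 t0 hd; apply: le_trans (expR_norm1 _) _.
rewrite normrM (ger0_norm t0).
have e1 : `|d| * t <= om / 2 * t by apply: ler_wpM2r.
have e2 : expR (`|d| * t) <= expR (om / 2 * t) by rewrite ler_expR.
have e3 : om / 2 * t <= expR (om / 2 * t) by have := expR_ge1Dx (om / 2 * t); lra.
have -> : om * t = om / 2 * t + om / 2 * t by lra.
rewrite expRD.
have -> : `|d| * t * expR (`|d| * t) = 2 * `|d| / om * ((om / 2 * t) * expR (`|d| * t)).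
  by field; rewrite gt_eqF.
apply: ler_wpM2l; first by rewrite divr_ge0 ?mulr_ge0// ltW.
by apply: ler_pM => //; rewrite mulr_ge0//; lra.
Qed.

Lemma closing_exists (S : countType) (a : S) (E : rel S) : mixing_graph E ->
  exists v0 : seq S, closing a E v0.
Proof.
move=> mix; have [n n0 [w [w0 wn hw]]] := loop_exists a mix.
exists (mkseq (fun i => w i.+1) n.-1).
have e i : (i < n)%N -> nth a (a :: mkseq (fun i => w i.+1) n.-1) i = w i.
  by case: i => [|i] hi /=; rewrite ?w0// nth_mkseq//; lia.
apply/andP; split.
  apply/(pathP a) => i; rewrite size_mkseq => hi; rewrite e; last lia.
  by rewrite nth_mkseq//; apply: hw; lia.
rewrite (last_nth a) size_mkseq e; last lia.
by have := hw n.-1; rewrite prednK// wn; apply; lia.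
Qed.

Section Base.
Variables (S : countType) (a : S) (E : rel S) (R : realType) (Ad th : R) (phi : Sig a -> R).
Hypotheses (mix : mixing_graph E) (Ad0 : 0 <= Ad) (th01 : 0 < th < 1) (hphi : holder_with E Ad th phi).
Local Notation X := (Sig a).
Local Notation sh := (@Defs.shift S a).
Local Notation D := (dist_cst Ad th).

Variables (v0 : seq S) (cl0 : closing a E v0).
Local Notation L := (cloops cl0).
Local Notation AW p := (@Aw S a E v0 cl0 R phi p).

Lemma valid_exists : exists k, vd a E k.
Proof.
have [|k [y [vk _ _]]] := @first_return S a E v0 cl0 (cbase cl0) (size v0).+1 isT.
  by rewrite /= /persq modnn.
by exists k.
Qed.

Section Moment.
Variables (q C : R).
Hypotheses (C0 : 0 <= C) (hst : forall n, (0 < n)%N -> (Zstar E phi n a <= (C * expR (q * n%:R))%:E)%E).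

Lemma Aw_moment p s om : 0 < om -> s - p <= - q - om -> forall x : L,
  asm (fun k => AW p k x * expR (s * (tau L k)%:R)) (expR D * (C / (1 - expR (- om)))).
Proof.
move=> om0 hs x; apply: asm_esum => [k|]; first by rewrite mulr_ge0 ?Aw_ge0 ?expR_ge0.
pose u (k : nat) : R := AW p k x * expR (s * (tau L k)%:R); rewrite -/(u _).
have u0 k : (0%E <= (u k)%:E)%E by rewrite lee_fin /u mulr_ge0 ?Aw_ge0 ?expR_ge0.
apply: (@le_trans _ _ (\esum_(k in [set: nat] `&` [set k | vd a E k]) (u k)%:E)%E).
  by apply: esum_supp => // k _ /negP vk; rewrite /u /Aw (negPf vk) !mul0r.
pose Zs n := [set x : X | [/\ adm E x, iter n sh x = x, x 0%N = a, (0 < n)%N &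
                              forall i, (0 < i)%N -> (i < n)%N -> x i <> a]].
pose g (n : nat) (z : X) := (expR (birkhoff phi n z) * expR ((s - p) * n%:R))%:E.
have g0 n z : (0%E <= g n z)%E by rewrite lee_fin mulr_ge0 ?expR_ge0.
pose e k : nat * X := (ctau a E v0 k, @persq S a (sval (cpre cl0 k x)) (ctau a E v0 k)).
have en k : sval (cpre cl0 k x) (ctau a E v0 k) = a by rewrite -[ctau _ _ _ _]addn0 pre_at Y0.
have ag k : agree (ctau a E v0 k).+1 (e k).2 (sval (cpre cl0 k x)).
  move=> i; rewrite ltnS leq_eqVlt => /orP[/eqP ->|hi]; last by rewrite /e /= persq_lt.
  by rewrite en /e /= /persq modnn.
have ade k : adm E (e k).2.
  rewrite -[(e k).2]/(@persq S a (sval (cpre cl0 k x)) (ctau a E v0 k)).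
  apply: persq_adm; [by []|by rewrite en Y0|].
  by move=> i _; exact: Yadm.
apply: (@le_trans _ _ ((expR D)%:E * \esum_(z in [set: nat] `*`` Zs) g z.1 z.2)%E).
  apply: (@esum_inj_le R nat (nat * X)%type _ _ e) => //.
  - move=> k k' /set_mem/= [_ vk] /set_mem/= [_ vk'] ee0.
    have tt : ctau a E v0 k = ctau a E v0 k' := congr1 fst ee0.
    have ee : (e k).2 = (e k').2 := congr1 snd ee0.
    suff [] : [:: k] = [:: k'] by [].
    apply: (@decode_uniq S a E v0 cl0 (ctau a E v0 k) [:: k] [:: k'] x x).
    + by rewrite /= vk.
    + by rewrite /= vk'.
    + by rewrite /llen/= addn0.
    + by rewrite tt /llen/= addn0.
    apply: (@agree_trans S a _ (e k).2).
      by apply: agree_sym; exact: agree_le (ag k).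
    by rewrite ee tt; exact: agree_le (ag k').
  - move=> k [_ vk]; split=> //; split=> //.
    + exact: persq_per.
    + by move=> i i0 ik; rewrite (ag k i (ltnW ik)); apply: pre_ne => //; rewrite i0.
  - move=> k [_ vk]; rewrite -EFinM lee_fin /u /Aw vk mul1r -!expRD ler_expR /=.
    have := birkhoff_dist1 Ad0 th01 hphi (ade k) (Yadm (cpre cl0 k x)) (ag k).
    by rewrite ler_norml => /andP[h _]; rewrite /tau/=; lra.
rewrite EFinM; apply: lee_wpmul2l; first by rewrite lee_fin expR_ge0.
have -> : (\esum_(z in [set: nat] `*`` Zs) g z.1 z.2 = \esum_(n in [set: nat]) \esum_(z in Zs n) g n z)%E.
  by rewrite (esum_esum (a := g)).
have eo : 0 <= expR (- om) < 1 by rewrite expR_ge0 expR_lt1; lra.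
have hC := asm_geom C0 eo.
apply: (@le_trans _ _ (\esum_(n in [set: nat]) (C * expR (- om) ^+ n)%:E)%E); last first.
  rewrite (esum_sm hC) ?lee_fin ?(sm_le_bound hC)// => n.
  by rewrite mulr_ge0// exprn_ge0// expR_ge0.
apply: le_esum => n _; have [->|n0] := posnP n.
  rewrite (_ : Zs 0%N = set0) ?esum_set0 ?lee_fin ?mulr_ge0//.
  by apply/seteqP; split=> // z [].
apply: (@le_trans _ _ ((expR ((s - p) * n%:R))%:E * Zstar E phi n a)%E).
  apply: esum_scale => [|z|z hz]; [exact: expR_ge0|by rewrite lee_fin expR_ge0|].
  by rewrite -EFinM lee_fin mulrC.
apply: le_trans (lee_wpmul2l _ (hst n0)) _; first by rewrite lee_fin expR_ge0.
rewrite -EFinM lee_fin mulrCA; apply: ler_wpM2l => //.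
rewrite -expRM_natr -expRD ler_expR -mulrDl; apply: ler_wpM2r => //; lra.
Qed.
End Moment.

Section Pressure.
Variables (Cs : R).
Hypotheses (sphi : forall x : X, adm E x -> phi x <= Cs)
  (hPG0 : (PG E (fun _ : X => 0%R : R) a < +oo)%E) (spr : SPR E phi a).

Lemma Zn0_bound : exists2 h : R, 0 <= h &
  forall n, (0 < n)%N -> (Zn E (fun _ : X => 0%R : R) n a <= (expR (h * n%:R))%:E)%E.
Proof.
have [p' _ [N hN]] := rate_lt_grow (fun n => Zn_ge0 E (fun _ : X => 0%R : R) n a) hPG0.
exists (`|p'| * N.+1%:R) => [|n n0]; first by rewrite mulr_ge0.
apply: (@le_trans _ _ (Zn E (fun _ : X => 0%R : R) (N.+1 * n) a)).
  rewrite /Zn (_ : (fun x : X => _) = fun=> 1%E); last first.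
    by apply/funext => x; rewrite /birkhoff big1// expR0.
  rewrite [leRHS](_ : _ = \esum_(x in [set x : X | [/\ adm E x, iter (N.+1 * n) sh x = x & x 0%N = a]]) 1%E)%E; last first.
    by apply: eq_esum => x _; rewrite /birkhoff big1// expR0.
  apply: esum_sub => // x [hx px x0]; split=> //.
  by elim: (N.+1) => [|m ih]; rewrite ?mul0n// mulSn iterD ih px.
apply: le_trans (hN _ _) _; first by apply: leq_trans (leq_pmulr _ n0); exact: leqnSn.
rewrite lee_fin ler_expR natrM mulrA; apply: ler_wpM2r => //; apply: ler_wpM2r => //.
exact: ler_norm.
Qed.

Lemma birkhoff_le_sup n x : adm E x -> birkhoff phi n x <= Cs * n%:R.
Proof.
move=> hx; rewrite /birkhoff.
apply: (@le_trans _ _ (\sum_(k < n) Cs)); first by apply: ler_sum => k _; exact/sphi/adm_iter.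
by rewrite sumr_const card_ord mulr_natr.
Qed.

Lemma Zn_le0 n : (Zn E phi n a <= (expR (Cs * n%:R))%:E * Zn E (fun _ : X => 0%R : R) n a)%E.
Proof.
apply: esum_scale => [|x|x [hx _ _]]; [exact: expR_ge0|by rewrite lee_fin expR_ge0|].
by rewrite -EFinM lee_fin -expRD ler_expR /birkhoff [X in _ + X]big1// addr0; exact: birkhoff_le_sup.
Qed.

Lemma Zstar_le_Zn n : (Zstar E phi n a <= Zn E phi n a)%E.
Proof. by apply: esum_sub => [x|x []//]; rewrite lee_fin expR_ge0. Qed.

Lemma PG_fin : PG E phi a \is a fin_num.
Proof.
have [h h0 hh] := Zn0_bound.
rewrite fin_numE; apply/andP; split.
  by apply/eqP => e; move: spr; rewrite /SPR e ltNge leNye.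
suff : (PG E phi a <= (Cs + h)%:E)%E by move=> le; apply/eqP => e; rewrite e in le.
apply: (rate_le (fun n => Zn_ge0 E phi n a)); exists 1, 1%N => n n0.
apply: le_trans (Zn_le0 n) _; apply: le_trans (lee_wpmul2l _ (hh n n0)) _; first by rewrite lee_fin expR_ge0.
by rewrite -EFinM lee_fin -expRD mul1r mulrDl.
Qed.

Local Notation P := (fine (PG E phi a)).

Lemma spr_star : exists q C : R, [/\ q < P, 0 <= C &
  forall n, (0 < n)%N -> (Zstar E phi n a <= (C * expR (q * n%:R))%:E)%E].
Proof.
have z0 n : (0 <= Zstar E phi n a)%E by apply: esum_ge0 => x _; rewrite lee_fin expR_ge0.
have [q qP [N hN]] := rate_lt_grow z0 spr.
have [h h0 hh] := Zn0_bound.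
exists q, (expR (`|Cs + h - q| * N%:R)); split.
- by rewrite -lte_fin fineK// PG_fin.
- exact: expR_ge0.
move=> n n0; have [nN|Nn] := ltnP n N.
  apply: le_trans (Zstar_le_Zn n) _; apply: le_trans (Zn_le0 n) _.
  apply: le_trans (lee_wpmul2l _ (hh n n0)) _; first by rewrite lee_fin expR_ge0.
  rewrite -EFinM lee_fin -!expRD ler_expR -mulrDl.
  have -> : (Cs + h) * n%:R = (Cs + h - q) * n%:R + q * n%:R by ring.
  rewrite lerD2r; apply: (@le_trans _ _ (`|Cs + h - q| * n%:R)).
    by apply: ler_wpM2r => //; exact: ler_norm.
  by apply: ler_wpM2l => //; rewrite ler_nat ltnW.
apply: le_trans (hN n Nn) _; rewrite lee_fin ler_peMl ?expR_ge0//.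
by rewrite -[leLHS]expR0 ler_expR mulr_ge0.
Qed.

Lemma rpf_base : exists (om K B' : R) (h : L -> R) (c M : R), [/\ 0 < om, 0 <= B', logLip th B' h,
   0 < c & [/\ forall x, c <= h x, forall x, h x <= M,
   forall x : L, asm (fun k => AW P k x * expR (om * (tau L k)%:R)) K,
   forall x, op (AW P) h x = h x & forall b, PG E phi b = P%:E]].
Proof.
have [q [C [qP C0 hst]]] := spr_star.
pose om := (P - q) / 2; have om0 : 0 < om by rewrite /om; lra.
pose K := expR D * (C / (1 - expR (- om))).
have hK x : asm (fun k => AW P k x * expR (om * (tau L k)%:R)) K.
  by apply: (Aw_moment C0 hst om0); rewrite /om; lra.
have A0 k x : 0 <= AW P k x by exact: Aw_ge0.
have hK' x : asm (fun k => AW P k x) K.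
  apply: asm_le (hK x) => k; rewrite ger0_norm// ler_peMr//.
  by rewrite -[leLHS]expR0 ler_expR mulr_ge0// ltW.
have D0 := dist_cst_ge0 Ad0 th01.
have [k0 vk0] := valid_exists.
pose dl := expR (- D) * AW P k0 (bpt L).
have dl0 : 0 < dl by rewrite mulr_gt0 ?expR_gt0// /Aw vk0 mul1r expR_gt0.
have hdl x : dl <= sm (fun k => AW P k x).
  have h1 : AW P k0 x <= sm (fun k => AW P k x).
    apply: le_trans (sm_ge_part k0.+1 (hK' x) (fun k => A0 k x)).
    by rewrite big_ord_recr/= lerDr sumr_ge0.
  apply: le_trans h1; rewrite /dl expRN ler_pdivrMl ?expR_gt0//.
  have h2 : AW P k0 (bpt L) <= expR (D * th ^+ 1) * AW P k0 x.
    by apply: Aw_dist => //; exact: (cagr1 (bpt L) x).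
  apply: le_trans h2 _.
  apply: ler_wpM2r => //; rewrite ler_expR ler_piMr// expr1.
  by case/andP: th01 => _ /ltW.
have [lam [h [B' [lam0 B0 hlL heq]]]] := rpf_exists D0 th01 A0 hK' dl0 hdl
   (fun k n x y n0 hxy => Aw_dist P Ad0 th01 hphi k n0 hxy).
have [h0 _] := hlL.
pose c := expR (- B') * h (bpt L); pose M := expR B' * h (bpt L).
have c0 : 0 < c by rewrite mulr_gt0 ?expR_gt0.
have ch x : c <= h x.
  by rewrite /c expRN ler_pdivrMl ?expR_gt0//; exact: (logLip_le th01 _ _ B0 hlL).
have hM x : h x <= M by exact: (logLip_le th01 _ _ B0 hlL).
have M0 : 0 <= M := le_trans (ltW c0) (le_trans (ch (bpt L)) (hM (bpt L))).
have K0 : 0 <= K := asm_ge0 (hK (bpt L)).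
have tilt d x : `|d| <= om / 2 -> [/\ asm (fun k => AW (P - d) k x) K,
   asm (fun k => AW (P - d) k x * h (pre k x)) (K * M) &
   `|op (AW (P - d)) h x - lam * h x| <= 2 * `|d| / om * (K * M)].
  move=> hd.
  have e k : AW (P - d) k x = AW P k x * expR (d * (tau L k)%:R).
    by rewrite /Aw -mulrA -expRD /tau/=; congr (_ * expR _); ring.
  have a1 : asm (fun k => AW (P - d) k x) K.
    apply: asm_le (hK x) => k; rewrite ger0_norm ?Aw_ge0// e; apply: ler_wpM2l => //.
    rewrite ler_expR; apply: ler_wpM2r => //.
    by have := ler_norm d; lra.
  have a2 : asm (fun k => AW (P - d) k x * h (pre k x)) (K * M).
    have := asmZ M a1; rewrite ger0_norm// mulrC; apply: asm_le => k.
    by rewrite ger0_norm ?mulr_ge0 ?Aw_ge0 ?(ltW (h0 _))// mulrC; apply: ler_wpM2r; rewrite ?Aw_ge0.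
  split=> //.
  have a3 : asm (fun k => AW P k x * h (pre k x)) (K * M).
    have := asmZ M (hK' x); rewrite ger0_norm// mulrC; apply: asm_le => k.
    by rewrite ger0_norm ?mulr_ge0 ?(ltW (h0 _))// mulrC; apply: ler_wpM2r.
  rewrite -heq /op -(smB a2 a3); apply: sm_bound.
  have z0 : 0 <= 2 * `|d| / om by apply: divr_ge0; [apply: mulr_ge0|exact: ltW].
  have := asmZ (2 * `|d| / om * M) (hK x).
  have zM : 0 <= 2 * `|d| / om * M by apply: mulr_ge0.
  rewrite (ger0_norm zM) [X in asm _ X -> _](_ : _ = 2 * `|d| / om * (K * M)); last by rewrite -mulrA [M * K]mulrC.
  apply: asm_le => k.
  rewrite e -mulrBl -{2}[AW P k x]mulr1 -mulrBr normrM normrM (ger0_norm (A0 k x)) (ger0_norm (ltW (h0 _))).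
  rewrite [leRHS](_ : _ = AW P k x * (2 * `|d| / om * expR (om * (tau L k)%:R)) * M); last ring.
  apply: ler_pM => //; [by rewrite mulr_ge0|exact: ltW|].
  by apply: ler_wpM2l => //; exact: expR_tilt.
have small e : 0 < e -> exists2 d, 0 < d & d <= om / 2 /\ 2 * d / om * (K * M) <= e * c.
  move=> e0; have KM : 0 <= K * M by rewrite mulr_ge0.
  exists (Num.min (om / 2) (e * c * om / (2 * (K * M + 1)))).
    have p1 : 0 < e * c * om := mulr_gt0 (mulr_gt0 e0 c0) om0.
    have p2 : 0 < 2 * (K * M + 1) by clear -KM; lra.
    by rewrite lt_min (divr_gt0 p1 p2) andbT divr_gt0.
  split; first by rewrite ge_min lexx.
  set d := Num.min _ _.
  have hd : d <= e * c * om / (2 * (K * M + 1)) by rewrite ge_min lexx orbT.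
  apply: (@le_trans _ _ (2 * (e * c * om / (2 * (K * M + 1))) / om * (K * M))).
    by apply: ler_wpM2r => //; apply: ler_wpM2r; [rewrite invr_ge0 ltW|apply: ler_wpM2l].
  rewrite (_ : 2 * _ / om * _ = e * c * (K * M / (K * M + 1))); last first.
    by field; rewrite !gt_eqF//; clear -KM; lra.
  by rewrite [_ + 1]addrC -mulrA mulrA; apply: mulr_frac_le => //; rewrite mulr_ge0// ltW.
have lam1 : lam = 1.
  apply/eqP; rewrite eq_le; apply/andP; split; rewrite leNgt; apply/negP => hl.
  - have [|d d0 [d1 d2]] := small (lam - 1); first by rewrite subr_gt0.
    have nd : `|- d| <= om / 2 by rewrite normrN gtr0_norm.
    have : ((P + d)%:E <= PG E phi a)%E.
      rewrite -[d]opprK; eapply (PG_ge mix Ad0 th01 hphi).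
      apply: (sub_not_grow (cl0 := cl0) Ad0 th01 hphi c0 ch hM (K := K)).
        by move=> x; have [] := tilt _ x nd.
      move=> x; have [_ _] := tilt _ x nd; rewrite normrN (gtr0_norm d0) ler_norml => /andP[t1 _].
      have t2 : (lam - 1) * c <= (lam - 1) * h x by apply: ler_wpM2l => //; rewrite subr_ge0 ltW.
      clear -t1 t2 d2; lra.
    by rewrite -(fineK PG_fin) lee_fin; lra.
  - have [|d d0 [d1 d2]] := small (1 - lam); first by rewrite subr_gt0.
    have nd : `|d| <= om / 2 by rewrite gtr0_norm.
    have : (PG E phi a <= (P - d)%:E)%E.
      eapply (PG_le mix Ad0 th01 hphi).
      apply: (super_grow (cl0 := cl0) Ad0 th01 hphi c0 ch hM).
        by move=> x; exists K; have [] := tilt _ x nd.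
      move=> x; have [_ _] := tilt _ x nd; rewrite (gtr0_norm d0) ler_norml => /andP[_ t1].
      have t2 : (1 - lam) * c <= (1 - lam) * h x by apply: ler_wpM2l => //; rewrite subr_ge0 ltW.
      clear -t1 t2 d2; lra.
    by rewrite -(fineK PG_fin) lee_fin; lra.
have heq1 x : op (AW P) h x = h x by rewrite heq lam1 mul1r.
exists om, K, B', h, c, M; split=> //; split=> // b.
have hf : PG E phi a = P%:E by rewrite fineK// PG_fin.
apply/eqP; rewrite eq_le; apply/andP; split.
  eapply (PG_le mix Ad0 th01 hphi).
  apply: (super_grow (cl0 := cl0) Ad0 th01 hphi c0 ch hM) => x; last by rewrite heq1.
  by exists K.
eapply (PG_ge mix Ad0 th01 hphi).
by apply: (sub_not_grow (cl0 := cl0) Ad0 th01 hphi c0 ch hM hK') => x; rewrite heq1.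
Qed.

End Pressure.
End Base.

(* [rd_P] is the pressure, [rd_h] the eigenfunction of the induced operator
   (values in [rd_c, rd_M]), and [rd_om] the exponential moment of the return
   time that the SPR property provides. *)
Record rpfpar (S : countType) (a : S) (E : rel S) (R : realType) := RpfPar {
  rd_A : R;
  rd_sup : R;
  rd_ent : R;
  rd_v0 : seq S;
  rd_cl : closing a E rd_v0;
  rd_P : R;
  rd_om : R;
  rd_K : R;
  rd_B : R;
  rd_h : cloops rd_cl -> R;
  rd_c : R;
  rd_M : R;
  rd_al : nat -> R;
  rd_gam : R }.

Record rpf_spec (S : countType) (a : S) (E : rel S) (R : realType) (th : R) (phi : Sig a -> R)
    (r : rpfpar a E R) : Prop := RpfSpec {
  rs_mix : mixing_graph E;
  rs_th : 0 < th < 1;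
  rs_A0 : 0 <= rd_A r;
  rs_holder : holder_with E (rd_A r) th phi;
  rs_supP : forall x : Sig a, adm E x -> phi x <= rd_sup r;
  rs_ent0 : 0 <= rd_ent r;
  rs_entP : forall n, (0 < n)%N -> (Zn E (fun _ : Sig a => 0%R : R) n a <= (expR (rd_ent r * n%:R))%:E)%E;
  rs_PE : forall b, PG E phi b = (rd_P r)%:E;
  rs_om0 : 0 < rd_om r;
  rs_mom : forall x : cloops (rd_cl r),
    asm (fun k => Aw phi (rd_P r) k x * expR (rd_om r * (tau (cloops (rd_cl r)) k)%:R)) (rd_K r);
  rs_B0 : 0 <= rd_B r;
  rs_hL : logLip th (rd_B r) (rd_h (r := r));
  rs_c0 : 0 < rd_c r;
  rs_ch : forall x : cloops (rd_cl r), rd_c r <= rd_h x;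
  rs_hM : forall x : cloops (rd_cl r), rd_h x <= rd_M r;
  rs_heq : forall x, op (@Aw S a E (rd_v0 r) (rd_cl r) R phi (rd_P r)) (rd_h (r := r)) x = rd_h x;
  rs_mw : metric_weights (dist_cst (rd_A r) th + 2 * rd_B r) th (rd_al r) (rd_gam r) }.

Lemma rpfdata_exists (S : countType) (a : S) (E : rel S) (R : realType) (th A Cs : R) (phi : Sig a -> R) :
  mixing_graph E -> 0 <= A -> 0 < th < 1 -> holder_with E A th phi ->
  (forall x : Sig a, adm E x -> phi x <= Cs) ->
  (PG E (fun _ : Sig a => 0%R : R) a < +oo)%E -> SPR E phi a -> exists r : rpfpar a E R, rpf_spec th phi r.
Proof.
move=> mix A0 th01 hphi sphi hPG0 spr.
have [v0 cl0] := closing_exists a mix.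
have [om [K [B [h [c [M [om0 B0 hL c0 [ch hM hK heq hP]]]]]]]] :=
  rpf_base mix A0 th01 hphi cl0 sphi hPG0 spr.
have [en en0 hen] := Zn0_bound hPG0.
have b0 : 0 <= dist_cst A th + 2 * B by rewrite addr_ge0 ?dist_cst_ge0// mulr_ge0.
have [al [gam mw]] := metric_weights_exist b0 th01.
by exists (@RpfPar S a E R A Cs en v0 cl0 (fine (PG E phi a)) om K B h c M al gam); split.
Qed.

Section Local.
Variables (S : countType) (a : S) (E : rel S) (R : realType) (th : R) (phi : Sig a -> R).
Variable d : rpfpar a E R.
Hypothesis dH : rpf_spec th phi d.
Local Notation X := (Sig a).
Local Notation L := (cloops (rd_cl d)).
Local Notation AW := (@Aw S a E (rd_v0 d) (rd_cl d) R phi (rd_P d)).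
Local Notation P := (rd_P d).
Local Notation h := (rd_h (r := d)).
Local Notation D := (dist_cst (rd_A d) th).

Definition bk := D + 2 * rd_B d.

Lemma bk_ge0 : 0 <= bk.
Proof. by rewrite addr_ge0 ?(dist_cst_ge0 (rs_A0 dH) (rs_th dH))// mulr_ge0// (rs_B0 dH). Qed.

Lemma rd_h0 x : 0 < h x. Proof. exact: lt_le_trans (rs_c0 dH) (rs_ch dH x). Qed.

Lemma rd_hM0 : 0 <= rd_M d.
Proof. exact: le_trans (ltW (rd_h0 (bpt L))) (rs_hM dH (bpt L)). Qed.

Lemma rd_AK x : asm (fun k => AW k x) (rd_K d).
Proof.
apply: asm_le (rs_mom dH x) => k; rewrite ger0_norm ?Aw_ge0// ler_peMr ?Aw_ge0//.
by rewrite -[leLHS]expR0 ler_expR mulr_ge0// ltW// (rs_om0 dH).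
Qed.

Definition gk k (x : L) : R := AW k x * h (pre k x) / h x.

Lemma gk_ge0 k x : 0 <= gk k x.
Proof. by rewrite /gk divr_ge0 ?mulr_ge0 ?Aw_ge0// ltW// rd_h0. Qed.

Lemma gk_moment x : asm (fun k => gk k x * expR (rd_om d * (tau L k)%:R)) (rd_K d * rd_M d / rd_c d).
Proof.
have M0 := rd_hM0; have z0 : 0 <= rd_M d / rd_c d by apply: divr_ge0 => //; exact: ltW (rs_c0 dH).
have := asmZ (rd_M d / rd_c d) (rs_mom dH x); rewrite (ger0_norm z0).
rewrite [X in asm _ X -> _](_ : _ = rd_K d * rd_M d / rd_c d); last by rewrite mulrC mulrA.
apply: asm_le => k; rewrite ger0_norm; last by apply: mulr_ge0; [exact: gk_ge0|exact: expR_ge0].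
rewrite mulrA; apply: ler_wpM2r; first exact: expR_ge0.
have -> : gk k x = AW k x * (h (pre k x) / h x) by rewrite /gk mulrA.
rewrite [leRHS]mulrC; apply: ler_wpM2l; first exact: Aw_ge0.
apply: ler_pM.
- exact: ltW (rd_h0 _).
- by rewrite invr_ge0 ltW// rd_h0.
- exact: (rs_hM dH).
- by rewrite lef_pV2 ?posrE ?rd_h0 ?(rs_c0 dH)// (rs_ch dH).
Qed.

Lemma gk_asm x : asm (fun k => gk k x) 1 /\ sm (fun k => gk k x) = 1.
Proof.
have a1 : asm (fun k => AW k x * h (pre k x)) (rd_K d * rd_M d).
  have := asmZ (rd_M d) (rd_AK x); rewrite (ger0_norm rd_hM0) mulrC; apply: asm_le => k.
  rewrite ger0_norm; last by apply: mulr_ge0; [exact: Aw_ge0|exact: ltW (rd_h0 _)].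
  by rewrite mulrC; apply: ler_wpM2r; [exact: Aw_ge0|exact: (rs_hM dH)].
have a2 := asmZ (h x)^-1 a1.
have s1 : sm (fun k => gk k x) = 1.
  have := smZ (h x)^-1 a1; rewrite -/(op AW h x) (rs_heq dH) mulVf ?gt_eqF ?rd_h0// => <-.
  by apply: eq_sm => k; rewrite mulrC.
split=> //; rewrite -s1; apply: asm_sm_ge0 (fun k => gk_ge0 k x).
by apply: eq_asm a2 => k; rewrite mulrC.
Qed.

Lemma gk_kern : kern bk th gk.
Proof.
have [h0 hL] := rs_hL dH; have /andP[th0 th1] := rs_th dH.
split.
- by move=> k x; exact: gk_ge0.
- by move=> x; case: (gk_asm x).
- by move=> x; case: (gk_asm x).
move=> n k x y k0 hxy.
have e1 := Aw_dist P (rs_A0 dH) (rs_th dH) (rs_holder dH) n k0 hxy.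
have e2 : h (pre n x) <= expR (rd_B d * th ^+ k) * h (pre n y).
  apply: le_trans (hL (tau L n + k)%N _ _ _ (agr_pre n hxy)) _; first by rewrite addn_gt0 k0 orbT.
  apply: ler_wpM2r; first exact: ltW.
  rewrite ler_expR; apply: ler_wpM2l; first exact: (rs_B0 dH).
  by apply: ler_wiXn2l; rewrite ?(ltW th0) ?(ltW th1)// leq_addl.
have e3 : (h x)^-1 <= expR (rd_B d * th ^+ k) * (h y)^-1.
  have := hL k y x k0 (agr_sym hxy).
  by move=> e; rewrite ler_pdivlMr ?h0// mulrC ler_pdivrMr ?h0.
have := ler_pM (mulr_ge0 (Aw_ge0 _ _ n x) (ltW (h0 (pre n x)))) _ (ler_pM (Aw_ge0 _ _ n x) (ltW (h0 _)) e1 e2) e3.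
rewrite invr_ge0 (ltW (h0 x)) => /(_ isT) /le_trans; apply.
have -> : bk = D + rd_B d + rd_B d by rewrite /bk; ring.
rewrite /gk !mulrDl !expRD.
by rewrite le_eqVlt; apply/orP; left; apply/eqP; ring.
Qed.

Definition obs (psi : X -> R) := (forall x : X, adm E x -> `|psi x| <= 1) /\
  forall n (x y : X), adm E x -> adm E y -> agree n x y -> `|psi x - psi y| <= th ^+ n.

Definition loop_sum (psi : X -> R) k (x : L) := birkhoff psi (tau L k) (sval (pre k x)).

Lemma birkhoff_bdd (psi : X -> R) (C : R) n (x : X) : (forall x : X, adm E x -> `|psi x| <= C) -> adm E x ->
  `|birkhoff psi n x| <= C * n%:R.
Proof.
move=> hC hx; apply: le_trans (ler_norm_sum _ _ _) _.
apply: (@le_trans _ _ (\sum_(k < n) C)); first by apply: ler_sum => k _; exact/hC/adm_iter.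
by rewrite sumr_const card_ord mulr_natr.
Qed.

Lemma loop_sum_bdd psi k x : obs psi -> `|loop_sum psi k x| <= (tau L k)%:R.
Proof. by move=> [h1 _]; rewrite -[leRHS]mul1r; apply: birkhoff_bdd => //; exact: Yadm. Qed.

Lemma loop_sum_lip psi n k x y : obs psi -> (0 < k)%N -> agr k x y ->
  `|loop_sum psi n x - loop_sum psi n y| <= dist_cst 1 th * th ^+ k.
Proof.
move=> [_ h1] k0 hxy; apply: (@birkhoff_dist S a E R 1 th psi) => //.
- exact: rs_th dH.
- by move=> m m2 z w hz hw hzw; rewrite mul1r; exact: h1.
- exact: Yadm.
- exact: Yadm.
- exact: (agr_pre n hxy).
Qed.

Definition taumean : R := nu gk (fun x : L => sm (fun n => gk n x * (tau L n)%:R)).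

Definition poisson (r : R) (Q : nat -> nat -> R) (psi : X -> R) := exists u : L -> R,
  [/\ Lip (rd_al d) (1 / 4) u,
    forall x, u x = sm (fun n => gk n x * (r * loop_sum psi n x))
      - Q 1%N 0%N * sm (fun n => gk n x * (tau L n)%:R) + op gk u x &
    Q 2%N 0%N * taumean = nu gk (fun x => sm (fun n => gk n x *
      ((r * loop_sum psi n x - (tau L n)%:R * Q 1%N 0%N) ^+ 2 / 2 +
      (r * loop_sum psi n x - (tau L n)%:R * Q 1%N 0%N) * u (pre n x))))].

Lemma local_pressure : exists r KQ : R, [/\ 0 < r, 2 * r + KQ <= rd_om d / 2 &
  forall psi chi, obs psi -> obs chi -> exists Q : nat -> nat -> R,
   [/\ nb Q KQ, Q 0%N 0%N = 0,
     (forall t s b, `|t| <= r -> `|s| <= r ->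
        PG E (fun x => phi x + t * psi x + s * chi x) b = (P + ev Q (t / r) (s / r))%:E) &
     poisson r Q psi]].
Proof.
have th01 := rs_th dH.
have Cp0 : 0 <= dist_cst 1 th by exact: dist_cst_ge0.
have [r [KQ [r0 rK hp]]] := perturbation bk_ge0 th01 (rs_mw dH) gk_kern (rs_om0 dH) gk_moment Cp0.
exists r, KQ; split=> // psi chi hpsi hchi.
have [Q [G [hQ Q0 hG heq [hu1 hu2 hu3]]]] := hp (loop_sum psi) (loop_sum chi)
  (fun n x => loop_sum_bdd n x hpsi) (fun n x => loop_sum_bdd n x hchi)
  (fun n k x y k0 h => loop_sum_lip n hpsi k0 h) (fun n k x y k0 h => loop_sum_lip n hchi k0 h).
exists Q; split=> //; last by exists (fun x => G x 1%N 0%N).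
move=> t s b tr sr.
set t' := t / r; set s' := s / r.
have t1 : `|t'| <= 1 by rewrite /t' normrM normfV (gtr0_norm r0) ler_pdivrMr// mul1r.
have s1 : `|s'| <= 1 by rewrite /s' normrM normfV (gtr0_norm r0) ler_pdivrMr// mul1r.
have et : t' * r = t by rewrite /t' divfK// gt_eqF.
have es : s' * r = s by rewrite /s' divfK// gt_eqF.
set q := ev Q t' s'.
have hq : `|q| <= KQ by exact: ev_bound.
pose F x := (1 + ev (G x) t' s') * h x.
have bG x : 3 / 4 <= 1 + ev (G x) t' s' <= 5 / 4.
  have : `|ev (G x) t' s'| <= 1 / 4 by exact: ev_bound.
  by rewrite ler_norml => /andP[] l1 l2; apply/andP; clear -l1 l2; lra.
have bG1 x : 3 / 4 <= 1 + ev (G x) t' s' by case/andP: (bG x).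
have bG2 x : 1 + ev (G x) t' s' <= 5 / 4 by case/andP: (bG x).
have bG0 x : 0 <= 1 + ev (G x) t' s' by apply: le_trans (bG1 x); exact: divr_ge0.
have F1 x : 3 / 4 * rd_c d <= F x.
  by apply: ler_pM; [exact: divr_ge0|exact: ltW (rs_c0 dH)|exact: bG1|exact: (rs_ch dH)].
have F2 x : F x <= 5 / 4 * rd_M d.
  by apply: ler_pM; [exact: bG0|exact: ltW (rd_h0 x)|exact: bG2|exact: (rs_hM dH)].
have c0 : 0 < 3 / 4 * rd_c d by apply: mulr_gt0; [exact: divr_gt0|exact: (rs_c0 dH)].
pose phi' x := phi x + t * psi x + s * chi x.
pose A' : R := rd_A d + `|t| + `|s|.
have A0' : 0 <= A' by rewrite !addr_ge0// (rs_A0 dH).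
have hphi' : holder_with E A' th phi'.
  move=> n n2 x y hx hy hxy; rewrite /A' !mulrDl.
  have -> : phi' x - phi' y = (phi x - phi y) + t * (psi x - psi y) + s * (chi x - chi y).
    by rewrite /phi'; ring.
  apply: le_trans (ler_normD _ _) _; apply: lerD; last first.
    by rewrite normrM; apply: ler_wpM2l => //; case: hchi => _; apply.
  apply: le_trans (ler_normD _ _) _; apply: lerD; first exact: (rs_holder dH).
  by rewrite normrM; apply: ler_wpM2l => //; case: hpsi => _; apply.
pose X' n x := t' * (r * loop_sum psi n x) + s' * (r * loop_sum chi n x) - (tau L n)%:R * q.
have AE n x : Aw phi' (P + q) n x = AW n x * expR (X' n x).
  rewrite /Aw -mulrA -expRD; congr (_ * expR _).
  rewrite /phi' birkhoffE_D birkhoffE_D !birkhoffE_Z /X' !mulrA et es /loop_sum /tau/=; ring.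
have X'le n x : X' n x <= rd_om d * (tau L n)%:R.
  have t0 : 0 <= (tau L n)%:R :> R by [].
  have l1 : t * loop_sum psi n x <= r * (tau L n)%:R.
    apply: le_trans (ler_norm _) _; rewrite normrM; apply: ler_pM => //; exact: loop_sum_bdd.
  have l2 : s * loop_sum chi n x <= r * (tau L n)%:R.
    apply: le_trans (ler_norm _) _; rewrite normrM; apply: ler_pM => //; exact: loop_sum_bdd.
  have l3 : - ((tau L n)%:R * q) <= KQ * (tau L n)%:R.
    by rewrite -mulrN mulrC; apply: ler_wpM2r => //; apply: le_trans hq; rewrite -normrN ler_norm.
  have l4 : (2 * r + KQ) * (tau L n)%:R <= rd_om d * (tau L n)%:R.
    by apply: ler_wpM2r => //; have o0 := rs_om0 dH; clear -rK o0; lra.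
  by rewrite /X' !mulrA et es; clear -l1 l2 l3 l4; lra.
have aA (x : L) : asm (fun k => Aw phi' (P + q) k x) (rd_K d).
  apply: asm_le (rs_mom dH x) => k; rewrite ger0_norm ?Aw_ge0// AE.
  by apply: ler_wpM2l; [exact: Aw_ge0|rewrite ler_expR].
have ag x : asm (fun n => gk n x * (expR (X' n x) * (1 + ev (G (pre n x)) t' s')))
    (5 / 4 * (rd_K d * rd_M d / rd_c d)).
  have := asmZ (5 / 4) (gk_moment x); rewrite ger0_norm ?divr_ge0//; apply: asm_le => n.
  have g0 := gk_ge0 n x; have p0 := bG0 (pre n x); have p1 := bG2 (pre n x).
  rewrite ger0_norm; last by apply: mulr_ge0 => //; apply: mulr_ge0 => //; exact: expR_ge0.
  rewrite [leRHS]mulrCA; apply: ler_wpM2l => //; rewrite mulrC; apply: ler_pM => //.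
  by rewrite ler_expR.
have opF x : op (fun k => Aw phi' (P + q) k) F x = F x.
  rewrite {2}/F (heq t' s' x t1 s1) -/q mulrC -(smZ (h x) (ag x)).
  apply: eq_sm => n; rewrite AE /F /gk.
  by field; rewrite gt_eqF// rd_h0.
apply/eqP; rewrite eq_le; apply/andP; split.
  eapply (PG_le (rs_mix dH) A0' th01 hphi').
  apply: (super_grow (cl0 := rd_cl d) A0' th01 hphi' c0 F1 F2) => x; last by rewrite opF.
  by exists (rd_K d); exact: aA.
eapply (PG_ge (rs_mix dH) A0' th01 hphi').
by apply: (sub_not_grow (cl0 := rd_cl d) A0' th01 hphi' c0 F1 F2 aA) => x; rewrite opF.
Qed.

End Local.

(** * The invariant functional and its measure *)

Section Functional.
Variables (S : countType) (a : S) (E : rel S) (R : realType) (th : R) (phi : Sig a -> R).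
Variable d : rpfpar a E R.
Hypothesis dH : rpf_spec th phi d.
Local Notation X := (Sig a).
Local Notation sh := (@Defs.shift S a).
Local Notation L := (cloops (rd_cl d)).
Local Notation g := (@gk S a E R phi d).
Local Notation lsum := (@loop_sum S a E R d).
Local Notation nug := (nu g).
Local Notation al := (rd_al d).
Local Notation Lp := (Lip (L := L) al).
Let b0 := bk_ge0 dH.
Let th01 := rs_th dH.
Let mw := rs_mw dH.
Let hg := gk_kern dH.

Definition avg (f : nat -> L -> R) (x : L) : R := sm (fun n => g n x * f n x).

Lemma avg_al : exists2 Ca : R, 0 <= Ca & forall f (C D : R), 0 <= C -> 0 <= D ->
  (forall n x, `|f n x| <= C * (tau L n)%:R ^+ 2) ->
  (forall n k x y, (0 < k)%N -> agr k x y -> `|f n x - f n y| <= D * al k * (tau L n)%:R ^+ 2) ->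
  Lp (Ca * (C + D)) (avg f) /\ forall x, asm (fun n => g n x * f n x) (Ca * C).
Proof.
have om0 := rs_om0 dH; have gm := gk_moment dH.
have k20 := K2_ge0 om0 gm; have cb0 := Cb_ge0 b0.
exists ((Cb (bk th d) + 1) * K2 (rd_om d) (rd_K d * rd_M d / rd_c d)).
  by apply: mulr_ge0 => //; lra.
move=> f C D C0 D0 h1 h2.
have T n : (tau L n)%:R ^+ 2 <= Tn L (rd_om d) n.
  have [t1 t2 _ /(_ 0)[|_ _]] := @Tn_ge R L (rd_om d) om0 n; first by have := om0; lra.
  by rewrite mul0r expR0 mulr1.
have h1' n x : `|f n x| <= C * Tn L (rd_om d) n.
  by apply: le_trans (h1 n x) _; apply: ler_wpM2l.
split=> [|x]; last first.
  apply: asmW (asm_gle hg om0 gm x (h1'^~ x) C0) _.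
  by rewrite mulrC; apply: ler_wpM2r => //; nra.
apply: (LipW mw (avg_Lip b0 th01 mw hg om0 gm C0 (D := D) _ h1' _)) => //.
- move=> n k x y k0 xy; apply: le_trans (h2 n k x y k0 xy) _.
  by apply: ler_wpM2l => //; apply: mulr_ge0 => //; exact: al_ge0 mw k.
- rewrite [leRHS]mulrAC; apply: ler_wpM2r => //; nra.
Qed.

Lemma avg_exists : exists2 Ca : R, 0 <= Ca & forall f (C D : R), 0 <= C -> 0 <= D ->
  (forall n x, `|f n x| <= C * (tau L n)%:R ^+ 2) ->
  (forall n k x y, (0 < k)%N -> agr k x y -> `|f n x - f n y| <= D * th ^+ k) ->
  Lp (Ca * (C + D)) (avg f) /\ forall x, asm (fun n => g n x * f n x) (Ca * C).
Proof.
have [Ca Ca0 h] := avg_al; exists (2 * Ca); first exact: mulr_ge0.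
move=> f C D C0 D0 h1 h2; have D20 : 0 <= 2 * D by exact: mulr_ge0.
have [n k x y k0 xy|hl ha] := h f C (2 * D) C0 D20 h1.
  apply: le_trans (h2 n k x y k0 xy) _; have [_ _ _ /(_ k) ta] := mw.
  apply: (@le_trans _ _ (2 * D * al k)); first by rewrite [2 * D]mulrC -mulrA; apply: ler_wpM2l.
  apply: ler_peMr; first by apply: mulr_ge0 => //; exact: al_ge0 mw k.
  by rewrite expr_ge1 ?ler1n ?tau_gt0.
split=> [|x]; first by apply: (LipW mw hl); nra.
by apply: asmW (ha x) _; nra.
Qed.

Definition bh (K D : R) (F : X -> R) := [/\ 0 <= K, 0 <= D, forall x : X, adm E x -> `|F x| <= K &
  forall n (x y : X), adm E x -> adm E y -> agree n x y -> `|F x - F y| <= D * th ^+ n].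

Lemma bhD K D F K' D' F' : bh K D F -> bh K' D' F' -> bh (K + K') (D + D') (fun x => F x + F' x).
Proof.
move=> [K0 D0 h1 h2] [K0' D0' h1' h2']; split; [exact: addr_ge0|exact: addr_ge0| |].
  by move=> x hx; apply: le_trans (ler_normD _ _) _; apply: lerD; [exact: h1|exact: h1'].
move=> n x y hx hy hxy; rewrite opprD addrACA mulrDl.
by apply: le_trans (ler_normD _ _) _; apply: lerD; [exact: h2|exact: h2'].
Qed.

Lemma bhZ c K D F : bh K D F -> bh (`|c| * K) (`|c| * D) (fun x => c * F x).
Proof.
move=> [K0 D0 h1 h2]; split; [exact: mulr_ge0|exact: mulr_ge0| |].
  by move=> x hx; rewrite normrM; apply: ler_wpM2l => //; exact: h1.
by move=> n x y hx hy hxy; rewrite -mulrBr normrM -mulrA; apply: ler_wpM2l => //; exact: h2.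
Qed.

Lemma bhM K D F K' D' F' : bh K D F -> bh K' D' F' -> bh (K * K') (K * D' + D * K') (fun x => F x * F' x).
Proof.
move=> [K0 D0 h1 h2] [K0' D0' h1' h2']; split; [exact: mulr_ge0|by apply: addr_ge0; exact: mulr_ge0| |].
  by move=> x hx; rewrite normrM; apply: ler_pM => //; [exact: h1|exact: h1'].
move=> n x y hx hy hxy.
have -> : F x * F' x - F y * F' y = F x * (F' x - F' y) + (F x - F y) * F' y by ring.
have -> : (K * D' + D * K') * th ^+ n = K * (D' * th ^+ n) + (D * th ^+ n) * K' by ring.
apply: le_trans (ler_normD _ _) _; rewrite !normrM; apply: lerD.
  by apply: ler_pM => //; [exact: h1|exact: h2'].
by apply: ler_pM => //; [exact: h2|exact: h1'].
Qed.

Lemma bh_cst c : bh `|c| 0 (fun=> c).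
Proof. by split=> // n x y _ _ _; rewrite subrr normr0 mul0r. Qed.

Lemma bh_shift K D F : bh K D F -> bh K (D / th + 2 * K) (fun x => F (sh x)).
Proof.
have /andP[t0 t1] := th01.
move=> [K0 D0 h1 h2]; split=> //.
- apply: addr_ge0; first by rewrite divr_ge0// ?ltW.
  by apply: mulr_ge0.
- by move=> x hx; apply: h1; exact: (adm_iter 1 hx).
move=> [|n] x y hx hy hxy; have ax := adm_iter 1 hx; have ay := adm_iter 1 hy.
  rewrite expr0 mulr1; apply: (@le_trans _ _ (2 * K)); last first.
    by rewrite lerDr; apply: divr_ge0 => //; exact: ltW.
  apply: le_trans (ler_normB _ _) _.
  by have := h1 _ ax; have := h1 _ ay; rewrite /=; lra.
apply: le_trans (h2 n _ _ ax ay _) _.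
  by apply: (@agree_iter S a 1); rewrite addn1.
rewrite mulrDl exprS; have -> : D / th * (th * th ^+ n) = D * th ^+ n by field; rewrite gt_eqF.
rewrite lerDl; apply: mulr_ge0; first exact: mulr_ge0.
by apply: mulr_ge0; [exact: ltW|apply: exprn_ge0; exact: ltW].
Qed.

Lemma bh_iter K D F n : bh K D F -> exists D', bh K D' (fun x => F (iter n sh x)).
Proof.
move=> h; elim: n => [|n [D' ih]]; first by exists D.
exists (D' / th + 2 * K); have := bh_shift ih.
by under eq_fun do rewrite -iterSr.
Qed.

Lemma bh_sum n (F : nat -> X -> R) : (forall k, (k < n)%N -> exists K D, bh K D (F k)) ->
  exists K D, bh K D (fun x => \sum_(k < n) F k x).
Proof.
elim: n => [|n ih] h.
  by exists `|0 : R|, 0; under eq_fun do rewrite big_ord0; exact: bh_cst.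
have [K [D h1]] := ih (fun k kn => h k (ltnW kn)); have [K' [D' h2]] := h n (ltnSn n).
exists (K + K'), (D + D'); under eq_fun do rewrite big_ord_recr/=; exact: bhD.
Qed.

Lemma bh_birkhoff K D F n : bh K D F -> exists K' D', bh K' D' (birkhoff F n).
Proof.
move=> h; apply: (@bh_sum n (fun k x => F (iter k sh x))) => k _.
by have [D' h'] := bh_iter k h; exists K, D'.
Qed.

Lemma bh_coord l (K : R) (F : X -> R) : 0 <= K -> (forall x : X, adm E x -> `|F x| <= K) ->
  (forall x y : X, agree l x y -> F x = F y) -> bh K (2 * K / th ^+ l) F.
Proof.
have /andP[t0 t1] := th01.
move=> K0 h1 h2; split=> //.
  by apply: divr_ge0; [exact: mulr_ge0|apply: exprn_ge0; exact: ltW].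
move=> n x y hx hy hxy; have [ln|nl] := leqP l n.
  rewrite (h2 x y (agree_le ln hxy)) subrr normr0; apply: mulr_ge0; last by rewrite exprn_ge0 ?ltW.
  by apply: divr_ge0; [exact: mulr_ge0|apply: exprn_ge0; exact: ltW].
apply: (@le_trans _ _ (2 * K)).
  by apply: le_trans (ler_normB _ _) _; have := h1 _ hx; have := h1 _ hy; lra.
rewrite -mulrA ler_peMr//; first exact: mulr_ge0.
rewrite mulrC ler_pdivlMr ?exprn_gt0// mul1r.
by apply: ler_wiXn2l; [exact: ltW|exact: ltW|exact: ltnW].
Qed.

Definition JF (F : X -> R) : L -> R := avg (lsum F).
Definition MF (F : X -> R) : R := nug (JF F) / taumean phi d.

Lemma loop_sum_bd K D F n x : bh K D F -> `|lsum F n x| <= K * (tau L n)%:R.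
Proof. by move=> [_ _ h1 _]; apply: (birkhoff_bdd (E := E)); [exact: h1|exact: Yadm]. Qed.

Lemma J_exists : exists2 CJ : R, 0 <= CJ & forall K D F, bh K D F ->
  Lp (CJ * (K + D)) (JF F) /\ forall x, asm (fun n => g n x * lsum F n x) (CJ * K).
Proof.
have [Ca Ca0 hA] := avg_exists; have /andP[t0 t1] := th01.
exists (Ca * (1 / (1 - th))); first by apply: mulr_ge0 => //; apply: divr_ge0 => //; lra.
move=> K D F hF; have [K0 D0 h1 h2] := hF.
have D0' : 0 <= dist_cst D th by exact: dist_cst_ge0.
have i1 : 1 <= 1 / (1 - th) by rewrite ler_pdivlMr; lra.
have [n x|n k x y k0 hxy|hl ha] := hA (lsum F) K (dist_cst D th) K0 D0'.
- apply: le_trans (loop_sum_bd n x hF) _; apply: ler_wpM2l => //.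
  by rewrite expr2 ler_peMr// ler1n tau_gt0.
- apply: (@birkhoff_dist S a E R D th F D0 th01 _ (tau L n) k) => //.
  + by move=> m _ z w hz hw hzw; exact: h2.
  + exact: Yadm.
  + exact: Yadm.
  + exact: (agr_pre n hxy).
split=> [|x].
  apply: (LipW mw hl); rewrite -mulrA; apply: ler_wpM2l => //.
  by rewrite /dist_cst mulrDr [1 / (1 - th) * D]mulrC mul1r; apply: lerD => //; nra.
apply: asmW (ha x) _; rewrite -mulrA; apply: ler_wpM2l => //; nra.
Qed.

Lemma tau_J : (fun x : L => sm (fun n => g n x * (tau L n)%:R)) = JF (fun=> 1).
Proof.
apply/funext => x; apply: eq_sm => n; congr (_ * _).
by rewrite /loop_sum /birkhoff sumr_const card_ord.
Qed.

Lemma taumean_ge1 : 1 <= taumean phi d.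
Proof. exact: (taubar_ge1 b0 th01 mw hg (rs_om0 dH) (gk_moment dH)). Qed.

Lemma taumean_gt0 : 0 < taumean phi d.
Proof. exact: lt_le_trans taumean_ge1. Qed.

Lemma eq_MF F G : (forall x : X, adm E x -> F x = G x) -> MF F = MF G.
Proof.
move=> h; rewrite /MF; suff -> : JF F = JF G by [].
apply/funext => x; apply: eq_sm => n; congr (_ * _); apply: eq_bigr => k _.
by apply/h/adm_iter/Yadm.
Qed.

Lemma MF_cst c : MF (fun=> c) = c.
Proof.
have [CJ CJ0 hJ] := J_exists; have [h1 _] := hJ _ _ _ (bh_cst 1).
rewrite /MF (_ : JF (fun=> c) = fun x => c * JF (fun=> 1) x).
  rewrite (nuZ b0 th01 mw hg _ h1) /taumean tau_J mulfK//.
  by rewrite gt_eqF// -tau_J; exact: taumean_gt0.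
apply/funext => x; rewrite -tau_J.
have ta := tauhat_asm hg (rs_om0 dH) (gk_moment dH) x.
rewrite -(smZ c ta); apply: eq_sm => n.
by rewrite /loop_sum /birkhoff sumr_const card_ord -mulr_natr; ring.
Qed.

Lemma MFD K D F K' D' G : bh K D F -> bh K' D' G -> MF (fun x => F x + G x) = MF F + MF G.
Proof.
have [CJ CJ0 hJ] := J_exists => hF hG.
have [h1 a1] := hJ _ _ _ hF; have [h2 a2] := hJ _ _ _ hG.
rewrite /MF -mulrDl -(nuD b0 th01 mw hg h1 h2).
congr (nu _ _ / _); apply/funext => x; rewrite -(smD (a1 x) (a2 x)); apply: eq_sm => n.
by rewrite -mulrDr; congr (_ * _); exact: birkhoffE_D.
Qed.

Lemma MFZ c K D F : bh K D F -> MF (fun x => c * F x) = c * MF F.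
Proof.
have [CJ CJ0 hJ] := J_exists => hF; have [h1 a1] := hJ _ _ _ hF.
rewrite /MF mulrA -(nuZ b0 th01 mw hg _ h1).
congr (nu _ _ / _); apply/funext => x; rewrite -(smZ c (a1 x)); apply: eq_sm => n.
by rewrite mulrCA; congr (_ * _); exact: birkhoffE_Z.
Qed.

Lemma MF_ge0 K D F : bh K D F -> (forall x : X, adm E x -> 0 <= F x) -> 0 <= MF F.
Proof.
have [CJ CJ0 hJ] := J_exists => hF F0; have [h1 a1] := hJ _ _ _ hF.
apply: divr_ge0; last exact: ltW taumean_gt0.
apply: (nu_ge b0 th01 mw hg h1) => x; apply: (sm_ge0 (a1 x)) => n.
by apply: mulr_ge0; [exact: (gk_ge0 dH)|apply: sumr_ge0 => k _; exact/F0/adm_iter/Yadm].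
Qed.

Lemma MFB K D F K' D' G : bh K D F -> bh K' D' G -> MF (fun x => F x - G x) = MF F - MF G.
Proof.
move=> hF hG; rewrite -mulN1r -(MFZ (-1) hG) -(MFD hF (bhZ (-1) hG)).
by apply: eq_MF => x _; rewrite mulN1r.
Qed.

Lemma MF_le K D F K' D' G : bh K D F -> bh K' D' G -> (forall x : X, adm E x -> F x <= G x) -> MF F <= MF G.
Proof.
move=> hF hG FG; rewrite -subr_ge0 -(MFB hG hF).
have := bhD hG (bhZ (-1) hF); under eq_fun do rewrite mulN1r.
by move=> h; apply: (MF_ge0 h) => x hx; rewrite subr_ge0 FG.
Qed.

Lemma MF_near K D F c e : bh K D F -> (forall x : X, adm E x -> `|F x - c| <= e) -> `|MF F - c| <= e.
Proof.
move=> hF h; rewrite ler_norml lerBlDl lerBrDr; apply/andP; split.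
  rewrite -[leLHS]MF_cst; apply: (MF_le (bh_cst _) hF) => x hx.
  by have := h x hx; rewrite ler_norml => /andP[]; lra.
rewrite -[leRHS]MF_cst; apply: (MF_le hF (bh_cst _)) => x hx.
by have := h x hx; rewrite ler_norml => /andP[]; lra.
Qed.

Lemma MF_sum n (F : nat -> X -> R) : (forall k, (k < n)%N -> exists K D, bh K D (F k)) ->
  MF (fun x => \sum_(k < n) F k x) = \sum_(k < n) MF (F k).
Proof.
elim: n => [|n ih] h.
  by rewrite big_ord0 -[RHS](MF_cst 0); apply: eq_MF => x _; rewrite big_ord0.
have [K [D h1]] := bh_sum (fun k kn => h k (ltnW kn)); have [K' [D' h2]] := h n (ltnSn n).
rewrite big_ord_recr/= -ih => [|k kn]; last exact/h/ltnW.
by rewrite -(MFD h1 h2); apply: eq_MF => x _; rewrite big_ord_recr.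
Qed.

Lemma bh_Y K D F : bh K D F -> Lp (2 * D) (fun y : L => F (sval y)).
Proof.
move=> [K0 D0 h1 h2]; split; first exact: mulr_ge0.
move=> k x y k0 hxy; apply: le_trans (h2 k _ _ (Yadm x) (Yadm y) hxy) _.
have [_ _ _ /(_ k) ta] := mw.
by rewrite [2 * D]mulrC -mulrA; apply: ler_wpM2l.
Qed.

Lemma MF_shift K D F : bh K D F -> MF (fun x => F (sh x)) = MF F.
Proof.
have [CJ CJ0 hJ] := J_exists => hF; have [h1 a1] := hJ _ _ _ hF.
have hY := bh_Y hF; have [K0 D0 f1 f2] := hF.
have bY : bdd K (fun y : L => F (sval y)) by move=> y; exact/f1/Yadm.
rewrite /MF; congr (_ / _).
have hL := contraction b0 th01 mw hg hY.
have -> : JF (fun x => F (sh x)) = fun x => JF F x + (F (sval x) + -1 * op g (fun y : L => F (sval y)) x).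
  apply/funext => x.
  have c1 : asm (fun n => F (sval x) * g n x) (`|F (sval x)| * 1) := asmZ _ (q_asm hg x).
  have c2 := op_asm hg x bY.
  rewrite mulN1r -[F (sval x)]mulr1 -(q_sm hg x) -(smZ _ (q_asm hg x)) -(smB c1 c2).
  rewrite -(smD (a1 x) (asmD c1 (asmN c2))); apply: eq_sm => n.
  have e : lsum (fun x => F (sh x)) n x = lsum F n x + (F (sval x) - F (sval (pre n x))).
    have b1 := birkhoffD F (tau L n) 1 (sval (pre n x)).
    have b2 := birkhoffD F 1 (tau L n) (sval (pre n x)).
    have e2 : birkhoff F (tau L n) (iter 1 sh (sval (pre n x))) = lsum (fun x => F (sh x)) n x.
      by apply: eq_bigr => k _; rewrite -iterD addn1 iterS.
    have e3 : iter (tau L n) sh (sval (pre n x)) = sval x by exact: (iter_pre (rd_cl d)).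
    move: b1; rewrite addnC b2 e3 !birkhoff1 e2 -/(lsum F n x).
    by lra.
  rewrite e; ring.
rewrite (nuD b0 th01 mw hg h1 (LipD hY (LipZ (-1) hL))) (nuD b0 th01 mw hg hY (LipZ (-1) hL)).
by rewrite (nuZ b0 th01 mw hg _ hL) (nu_op b0 th01 mw hg hY); ring.
Qed.

Lemma op_cvg0 (f : nat -> L -> R) (B : R) : (forall k, bdd B (f k)) -> (forall x, (fun k => f k x) @ \oo --> 0) ->
  forall x, (fun k => op g (f k) x) @ \oo --> 0.
Proof.
move=> hB h x; have B0 : 0 <= B by apply: le_trans (hB 0%N (bpt L)).
rewrite -(sm0 R).
apply: (sm_tannery (v := fun n => B * g n x) (K := `|B| * 1)).
- move=> k n; rewrite normrM (ger0_norm (gk_ge0 dH n x)) mulrC; apply: ler_wpM2r; [exact: (gk_ge0 dH)|exact: hB].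
- exact: asmZ (q_asm hg x).
- by move=> n; rewrite -[0](mulr0 (g n x)); apply: cvgM; [exact: cvg_cst|exact: h].
Qed.

Lemma MF_cvg0 (F : nat -> X -> R) K D : (forall k, bh K D (F k)) ->
  (forall x : X, adm E x -> (fun k => F k x) @ \oo --> 0) -> (fun k => MF (F k)) @ \oo --> 0.
Proof.
have [CJ CJ0 hJ] := J_exists => hF h0.
have h1 k := (hJ _ _ _ (hF k)).1; have a1 k := (hJ _ _ _ (hF k)).2.
have [K0 D0 _ _] := hF 0%N.
have J0 x : (fun k => JF (F k) x) @ \oo --> 0.
  rewrite -(sm0 R).
  apply: (sm_tannery (v := fun n => K * (g n x * (tau L n)%:R)) (K := `|K| * (1 * K2 (rd_om d) (rd_K d * rd_M d / rd_c d)))).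
  - move=> k n; rewrite normrM (ger0_norm (gk_ge0 dH n x)) mulrCA; apply: ler_wpM2l; first exact: (gk_ge0 dH).
    exact: loop_sum_bd (hF k).
  - apply: asmZ; exact: (tauhat_asm hg (rs_om0 dH) (gk_moment dH) x).
  - move=> n; rewrite -[0](mulr0 (g n x)); apply: cvgM; first exact: cvg_cst.
    have -> : (0 : R) = \sum_(i < tau L n) 0 by rewrite big1.
    apply: (@cvg_sum_ord R (tau L n) (fun k i => F k (iter i sh (sval (pre n x)))) (fun=> 0)) => i; exact/h0/adm_iter/Yadm.
have bJ k : bdd (CJ * K) (JF (F k)) by move=> x; exact: sm_bound (a1 k x).
have it N x : (fun k => iter N (op g) (JF (F k)) x) @ \oo --> 0.
  elim: N x => [|N ih] x; first exact: J0.
  by apply: (@op_cvg0 (fun k => iter N (op g) (JF (F k))) (CJ * K)) => // k; exact: (iter_bdd hg).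
apply/cvgn_epsP => e e0.
set H := CJ * (K + D) in h1; have H0 : 0 <= H by apply: mulr_ge0 => //; exact: addr_ge0.
have e1 : 0 < e / 2 / (H + 1) by rewrite !divr_gt0//; lra.
have [N hN] := expr_eventually_le (gam01 mw) e1.
have [M hM] := (cvgn_epsP _ _).1 (it N (bpt L)) _ (divr_gt0 e0 (ltr0n _ 2)).
exists M => k Mk; rewrite sub0r normrN /MF normrM normfV (gtr0_norm taumean_gt0).
rewrite ler_pdivrMr ?taumean_gt0//.
apply: (@le_trans _ _ e); last by rewrite ler_peMr ?(ltW e0)//; exact: taumean_ge1.
have n1 := nu_near b0 th01 mw hg N (bpt L) (h1 k).
have n2 := hM k Mk; rewrite sub0r normrN in n2.
have n3 : H * rd_gam d ^+ N <= e / 2.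
  apply: le_trans (ler_wpM2l H0 (hN N (leqnn N))) _.
  rewrite mulrCA -[leRHS]mulr1; apply: ler_wpM2l; first lra.
  by rewrite ler_pdivrMr; lra.
have := ler_distD (iter N (op g) (JF (F k)) (bpt L)) (nug (JF (F k))) 0.
by rewrite !subr0 distrC; lra.
Qed.

End Functional.

(* Words are stored in reverse order: the children of z are the k :: z. *)
Section NestedIntervals.
Variables (R : realType) (q : seq nat -> R).
Hypotheses (q0 : forall z, 0 <= q z) (q1 : q [::] = 1)
  (qs : forall z, asm (fun k => q (k :: z)) (q z) /\ sm (fun k => q (k :: z)) = q z).

Fixpoint ilo (z : seq nat) : R := if z is k :: z' then ilo z' + \sum_(j < k) q (nat_of_ord j :: z') else 0.

Lemma child_sum k z : \sum_(j < k) q (nat_of_ord j :: z) <= q z.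
Proof.
have [ha hs] := qs z; rewrite -[leRHS]hs.
exact: (sm_ge_part k ha (fun _ => q0 _)).
Qed.

Definition inI z (w : R) := ilo z <= w < ilo z + q z.

Lemma inI_child k z w : inI (k :: z) w -> inI z w.
Proof.
move=> /andP[/= h1 h2]; have [ha _] := qs z; apply/andP; split.
  by apply: le_trans h1; rewrite lerDl sumr_ge0.
apply: lt_le_trans h2 _; rewrite -addrA lerD2l.
by have := child_sum k.+1 z; rewrite big_ord_recr.
Qed.

Lemma inI_ex z w : inI z w -> exists k, inI (k :: z) w.
Proof.
move=> /andP[h1 h2]; have [ha hs] := qs z.
have ex : exists k, w < ilo z + \sum_(j < k) q (nat_of_ord j :: z).
  have e0 : 0 < (ilo z + q z - w) / 2 by lra.
  have [N hN] := (cvgn_epsP _ _).1 (asm_cvg ha) _ e0.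
  exists N; have := hN N (leqnn N); rewrite hs series_ordE ler_norml => /andP[_]; lra.
case: (ex_minnP ex) => -[|k] hk kmin; first by move: hk; rewrite big_ord0 addr0; lra.
exists k; apply/andP; split=> /=.
  by rewrite leNgt; apply/negP => /kmin; rewrite ltnn.
by rewrite -addrA; move: hk; rewrite big_ord_recr.
Qed.

Lemma inI_uniq_lt k k' z w : (k < k')%N -> inI (k :: z) w -> inI (k' :: z) w -> False.
Proof.
move=> kk /andP[_ /= h1] /andP[/= h2 _].
have : \sum_(j < k.+1) q (nat_of_ord j :: z) <= \sum_(j < k') q (nat_of_ord j :: z).
  by rewrite (@sum_ord_split R (fun j => q (j :: z)) _ _ kk) lerDl sumr_ge0.
by rewrite big_ord_recr/=; lra.
Qed.

Lemma inI_uniq k k' z w : inI (k :: z) w -> inI (k' :: z) w -> k = k'.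
Proof.
move=> h h'; have [kk|kk|//] := ltngtP k k'; first by case: (inI_uniq_lt kk h h').
by case: (inI_uniq_lt kk h' h).
Qed.

Fixpoint ncode (n : nat) (w : R) : seq nat :=
  if n is m.+1 then xget 0%N [set k | inI (k :: ncode m w) w] :: ncode m w else [::].

Lemma ncode_in n w : 0 <= w < 1 -> inI (ncode n w) w.
Proof.
move=> w01; elim: n => [|n ih]; first by rewrite /inI /= q1 add0r.
have [k hk] := inI_ex ih.
by rewrite /=; exact: (@xgetPex _ 0%N [set k | inI (k :: ncode n w) w]) (ex_intro _ k hk).
Qed.

Lemma ncode_inI z w : 0 <= w < 1 -> (inI z w <-> ncode (size z) w = z).
Proof.
move=> w01; split=> [|<-]; last exact: ncode_in.
elim: z => [|k z ih] h //=; rewrite ih; last exact: inI_child h.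
congr cons; apply: (@inI_uniq _ _ z w) => //.
exact: (@xgetPex _ 0%N [set k | inI (k :: z) w]) (ex_intro _ k h).
Qed.

Lemma size_code n w : size (ncode n w) = n.
Proof. by elim: n => //= n ->. Qed.

Lemma code_pos n w : 0 <= w < 1 -> 0 < q (ncode n w).
Proof. by move=> /(ncode_in n)/andP[h1 h2]; lra. Qed.

Lemma ilo_bound z : 0 <= ilo z /\ ilo z + q z <= 1.
Proof.
elim: z => [|k z [h1 h2]] /=; first by rewrite q1 add0r.
have [ha _] := qs z; split; first by rewrite addr_ge0// sumr_ge0.
apply: le_trans h2; rewrite -addrA lerD2l.
by have := child_sum k.+1 z; rewrite big_ord_recr.
Qed.

End NestedIntervals.

Section PushUnit.
Variables (R : realType) (S : countType) (a : S) (T : R -> Sig a).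
Hypothesis mT : measurable_fun setT T.

Local Notation unit_leb := (mrestr (@lebesgue_measure R) (measurable_itv `[0 : R, 1[)).

Definition push_unit : set (Sig a) -> \bar R := pushforward unit_leb (fun x => T x).

Let push0 : push_unit set0 = 0%E.
Proof. by rewrite /push_unit /pushforward preimage_set0 measure0. Qed.

Let push_ge0 A : (0 <= push_unit A)%E.
Proof. by rewrite /push_unit /pushforward measure_ge0. Qed.

Let push_sigma : semi_sigma_additive push_unit.
Proof.
move=> F mF tF mUF; rewrite /push_unit /pushforward preimage_bigcup.
apply: measure_semi_sigma_additive.
- by move=> n; rewrite -[X in measurable X]setTI; exact: mT.
- apply/trivIsetP => /= i j _ _ ij; rewrite -preimage_setI.
  by move/trivIsetP : tF => /(_ _ _ _ _ ij) ->//; rewrite preimage_set0.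
- by rewrite -preimage_bigcup -[X in measurable X]setTI; exact: mT.
Qed.

HB.instance Definition _ := isMeasure.Build _ _ _ push_unit push0 push_ge0 push_sigma.

Let push_setT : push_unit setT = 1%E.
Proof.
rewrite /push_unit /pushforward preimage_setT /mrestr setTI lebesgue_measure_itv /=.
by rewrite lte_fin ltr01 sube0.
Qed.

HB.instance Definition _ := Measure_isProbability.Build _ _ _ push_unit push_setT.

Definition push_prob : probability (Sig a) R := push_unit.
End PushUnit.

Section Kolmogorov.
Variables (R : realType) (S : countType) (a : S) (Q : seq S -> R).
Hypotheses (Q0 : forall z, 0 <= Q z) (Q1 : Q [::] = 1)
  (Qs : forall z, let u k := if (pickle_inv k : option S) is Some s then Q (rcons z s) else 0 in
     asm u (Q z) /\ sm u = Q z).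
Local Notation X := (Sig a).

Definition dec (k : nat) : S := odflt a (pickle_inv k).
Definition okc (k : nat) : bool := (pickle_inv k : option S) != None.

Lemma dec_inj k k' : okc k -> okc k' -> dec k = dec k' -> k = k'.
Proof.
rewrite /okc /dec; case e : (pickle_inv k) => [s|//]; case e' : (pickle_inv k') => [s'|//] _ _ /= ss.
subst s'; have := pickle_invK (T := S) k; have := pickle_invK (T := S) k'.
by rewrite /oapp e e' => <- <-.
Qed.

Lemma dec_pickle s : okc (pickle s) /\ dec (pickle s) = s.
Proof. by rewrite /okc /dec pickleK_inv. Qed.

Definition qq (z : seq nat) : R := if all okc z then Q (rev (map dec z)) else 0.

Lemma qq_ge0 z : 0 <= qq z. Proof. by rewrite /qq; case: ifP. Qed.

Lemma qq1 : qq [::] = 1. Proof. by rewrite /qq /= /rev /=. Qed.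

Lemma qqs z : asm (fun k => qq (k :: z)) (qq z) /\ sm (fun k => qq (k :: z)) = qq z.
Proof.
rewrite /qq /=; have [az|az] := boolP (all okc z); last first.
  have -> : (fun k => if okc k && false then Q (rev (dec k :: map dec z)) else 0) = fun=> 0.
    by apply/funext => k; rewrite andbF.
  by rewrite sm0; split=> //; exact: asm0.
have := Qs (rev (map dec z)); rewrite /=.
suff -> : (fun k => if okc k && true then Q (rev (dec k :: map dec z)) else 0) =
   (fun k => if (pickle_inv k : option S) is Some s then Q (rcons (rev (map dec z)) s) else 0) by [].
by apply/funext => k; rewrite andbT /okc /dec rev_cons; case: (pickle_inv k).
Qed.

Definition Tmap (w : R) : X := fun n => if (0 <= w < 1) then dec (head 0%N (ncode qq n.+1 w)) else a.

Lemma code_nth n w i : (i < n)%N -> nth 0%N (ncode qq n w) i = head 0%N (ncode qq (n - i) w).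
Proof.
elim: n i => // n ih [|i] hi; first by rewrite subn0.
by rewrite [ncode qq n.+1 w]/= /= subSS ih.
Qed.

Lemma Tmap_cyl n (v : nat -> S) w : 0 <= w < 1 ->
  ((forall i, (i < n)%N -> Tmap w i = v i) <->
   inI qq (rev (mkseq (fun i => pickle (v i)) n)) w).
Proof.
move=> w01; have C := ncode_inI qq_ge0 qq1 qqs _ w01.
apply: (iff_trans _ (iff_sym (C _))); rewrite size_rev size_mkseq.
have okn : all okc (ncode qq n w).
  have := code_pos qq1 qqs n w01; rewrite {1}/qq; case: ifP => //; by rewrite ltxx.
have hd i : (i < n)%N -> nth 0%N (ncode qq n w) (n - i.+1) = head 0%N (ncode qq i.+1 w).
  by move=> hi; rewrite code_nth; [congr (head _ (ncode _ _ _)); lia|lia].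
split=> [h|e i hi].
  apply: (@eq_from_nth _ 0%N); first by rewrite size_code size_rev size_mkseq.
  move=> j; rewrite size_code => jn; rewrite nth_rev size_mkseq// nth_mkseq; last lia.
  pose i := (n - j.+1)%N; have hi : (i < n)%N by rewrite /i; lia.
  have -> : j = (n - i.+1)%N by rewrite /i; lia.
  have -> : (n - (n - i.+1).+1)%N = i by lia.
  apply: dec_inj.
  - by apply: (allP okn); apply: mem_nth; rewrite size_code; lia.
  - by case: (dec_pickle (v i)).
  - by rewrite hd// (dec_pickle (v i)).2 -(h i hi) /Tmap w01.
rewrite /Tmap w01 -hd// e nth_rev size_mkseq; last lia.
have -> : (n - (n - i.+1).+1)%N = i by lia.
by rewrite nth_mkseq// (dec_pickle (v i)).2.
Qed.

Definition cyl n (v : nat -> S) : set X := [set x : X | forall i, (i < n)%N -> x i = v i].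

Lemma meas_inI z : measurable [set w | inI qq z w].
Proof.
have -> : [set w | inI qq z w] = [set` `[ilo qq z, ilo qq z + qq z[].
  by apply/seteqP; split=> w /=; rewrite in_itv.
exact: measurable_itv.
Qed.

Lemma Tmap_meas : measurable_fun setT Tmap.
Proof.
apply: (@measurability _ _ (measurableTypeR R) (Sig a) setT Tmap (@cylinders S a)) => //.
move=> _ [_ [n [v ->]] <-]; rewrite setTI.
have m01 : measurable [set w : R | 0 <= w < 1].
  have -> : [set w : R | 0 <= w < 1] = [set` `[0 : R, 1[] by apply/seteqP; split=> w /=; rewrite in_itv.
  exact: measurable_itv.
have -> : Tmap @^-1` [set x : X | forall i, (i < n)%N -> x i = v i] =
  ([set w : R | 0 <= w < 1] `&` [set w | inI qq (rev (mkseq (fun i => pickle (v i)) n)) w]) `|`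
  (~` [set w : R | 0 <= w < 1] `&` [set _ | forall i, (i < n)%N -> a = v i]).
  apply/seteqP; split=> w /=.
    have [w01|/negP w01] := boolP (0 <= w < 1) => h.
      by left; split=> //; exact/(Tmap_cyl n v w01).
    by right; split=> // i hi; rewrite -(h i hi) /Tmap (negPf (introN idP w01)).
  move=> [[w01 /(Tmap_cyl n v w01)]//|[w01 h] i hi].
  by rewrite /Tmap (negPf (introN idP w01)); exact: h.
apply: measurableU; first by apply: measurableI => //; exact: meas_inI.
apply: measurableI; first exact: measurableC.
have [h|h] := pselect (forall i, (i < n)%N -> a = v i).
  by have -> : [set _ : R | forall i, (i < n)%N -> a = v i] = setT by apply/seteqP; split.
by have -> : [set _ : R | forall i, (i < n)%N -> a = v i] = set0 by apply/seteqP; split.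
Qed.

Lemma kolmogorov : exists m : probability X R, forall n (v : nat -> S),
  m (cyl n v) = (Q (mkseq v n))%:E.
Proof.
exists (push_prob Tmap_meas) => n v.
set z := rev (mkseq (fun i => pickle (v i)) n).
have -> : Q (mkseq v n) = qq z.
  rewrite /qq /z all_rev; have -> : all okc (mkseq (fun i => pickle (v i)) n).
    by apply/allP => _ /mapP[i _ ->]; case: (dec_pickle (v i)).
  rewrite map_rev revK /mkseq -map_comp; congr Q; apply: eq_map => i /=.
  by rewrite (dec_pickle (v i)).2.
have [i0 i1] := ilo_bound qq_ge0 qq1 qqs z.
have e : Tmap @^-1` cyl n v `&` [set` `[0 : R, 1[] = [set` `[ilo qq z, ilo qq z + qq z[].
  apply/seteqP; split=> w /=; rewrite !in_itv/=.
    by move=> [h w01]; exact/(Tmap_cyl n v w01).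
  move=> h; have w01 : 0 <= w < 1 by move: h => /andP[]; lra.
  by split=> //; exact/(Tmap_cyl n v w01).
rewrite -[LHS]/(lebesgue_measure (Tmap @^-1` cyl n v `&` [set` `[0 : R, 1[])) e lebesgue_measure_itv /= lte_fin.
have := qq_ge0 z; rewrite le_eqVlt => /orP[/eqP <-|qz].
  by rewrite addr0 ltxx.
by rewrite ltrDl qz -EFinD addrAC subrr add0r.
Qed.
End Kolmogorov.

Section Coordinates.
Variables (S : countType) (a : S) (E : rel S) (R : realType).
Local Notation X := (Sig a).
Local Notation sh := (@Defs.shift S a).

Definition coord l (B : set X) := forall x y : X, agree l x y -> B x -> B y.

Lemma meas_cylinder n (v : nat -> S) : measurable [set x : X | forall i, (i < n)%N -> x i = v i].
Proof. by apply: sub_sigma_algebra; exists n, v. Qed.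

Lemma meas_coord l B : coord l B -> measurable B.
Proof.
move=> cB.
pose F (k : nat) : set X := if (unpickle k : option (seq S)) is Some z then
  (if `[< exists2 x : X, B x & mkseq x l = z >] then [set x : X | forall i, (i < l)%N -> x i = nth a z i] else set0)
  else set0.
have -> : B = \bigcup_k F k.
  apply/seteqP; split=> x.
    move=> Bx; exists (pickle (mkseq x l)) => //; rewrite /F pickleK.
    have -> : `[< exists2 y : X, B y & mkseq y l = mkseq x l >] by apply/asboolP; exists x.
    by move=> i il; rewrite nth_mkseq.
  move=> [k _]; rewrite /F; case: unpickle => // z; case: asboolP => // -[y By ez] hx.
  by apply: cB By => i il; rewrite hx// -ez nth_mkseq.
apply: bigcupT_measurable => k; rewrite /F; case: unpickle => // z.
by case: ifP => // _; exact: meas_cylinder.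
Qed.

Lemma coordW l m B : (l <= m)%N -> coord l B -> coord m B.
Proof. by move=> lm h x y xy; apply: h; exact: agree_le xy. Qed.

Lemma coordI l m A B : coord l A -> coord m B -> coord (maxn l m) (A `&` B).
Proof.
move=> hA hB x y xy [Ax Bx]; split.
  by apply: hA Ax; apply: agree_le xy; exact: leq_maxl.
by apply: hB Bx; apply: agree_le xy; exact: leq_maxr.
Qed.

Lemma coord_shift l B : coord l B -> coord l.+1 (sh @^-1` B).
Proof. by move=> h x y xy; apply: h => i il; exact: (xy i.+1). Qed.

Lemma coord_fun l (T : Type) (F : X -> T) (P : T -> Prop) : (forall x y : X, agree l x y -> F x = F y) ->
  coord l [set x | P (F x)].
Proof. by move=> h x y xy /=; rewrite (h x y xy). Qed.

Lemma meas_adm : measurable [set x : X | adm E x].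
Proof.
have -> : [set x : X | adm E x] = \bigcap_i [set x : X | E (x i) (x i.+1)].
  by apply/seteqP; split=> x h i; [move=> _; exact: h|exact: (h i)].
apply: bigcapT_measurable => i; apply: (@meas_coord i.+2) => x y xy /=.
by rewrite (xy i)// (xy i.+1).
Qed.

Definition cont_adm (F : X -> R) := forall (x : X) e, adm E x -> 0 < e -> exists n : nat,
  forall y : X, adm E y -> agree n x y -> `|F x - F y| <= e.

Lemma meas_restr (F : X -> R) : cont_adm F -> measurable_fun setT (restr E F).
Proof.
move=> hF; apply: (measurability _ (measurable_realfun.RGenOInfty.measurableE R)).
move=> _ [_ [c ->] <-]; rewrite setTI.
pose U n : set X := [set x | exists z : X, [/\ adm E z, agree n x z &
  forall y : X, adm E y -> agree n z y -> c < F y]].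
have mU : measurable (\bigcup_n U n).
  apply: bigcupT_measurable => n; apply: (@meas_coord n) => x y xy [z [az xz hz]].
  by exists z; split=> //; apply: agree_trans xz; exact: agree_sym.
have -> : restr E F @^-1` `]c, +oo[%classic = ([set x : X | adm E x] `&` \bigcup_n U n) `|`
    (~` [set x : X | adm E x] `&` [set _ | c < 0]).
  apply/seteqP; split=> x /=; rewrite /restr in_itv/= andbT.
    case: asboolP => hx cx; last by right.
    left; split=> //.
    have [|n hn] := hF x ((F x - c) / 2) hx; first by rewrite divr_gt0 ?subr_gt0.
    exists n => //; exists x; split=> // y hy xy; have := hn y hy xy.
    by rewrite ler_norml => /andP[_]; lra.
  move=> [[hx [n _ [z [az xz hz]]]]|[hx c0]]; case: asboolP => // _.
  by apply: hz => //; exact: agree_sym.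
apply: measurableU; first by apply: measurableI => //; exact: meas_adm.
apply: measurableI; first by apply: measurableC; exact: meas_adm.
have [h|h] := boolP (c < 0).
  by have -> : [set _ : X | is_true true] = setT by apply/seteqP; split.
by have -> : [set _ : X | is_true false] = set0 by apply/seteqP; split.
Qed.

Lemma meas_shift : measurable_fun setT sh.
Proof.
apply: (@measurability _ _ X X setT sh (@cylinders S a)) => //.
move=> _ [_ [n [v ->]] <-]; rewrite setTI; apply: (@meas_coord n.+1).
by apply: coord_shift => x y xy h i hi; rewrite -(h i hi) xy.
Qed.

Lemma measure_coord_eq (m1 m2 : probability X R) :
  (forall l B, coord l B -> m1 B = m2 B) -> forall B, measurable B -> m1 B = m2 B.
Proof.
move=> h B mB.
apply: (@g_sigma_algebra_measure_unique _ R X [set B | exists l, coord l B] _ (fun=> setT)).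
- by move=> A [l]; exact: meas_coord.
- by move=> i; exists 0%N.
- by apply/seteqP; split=> // x _; exists 0%N.
- by move=> A C [l hA] [k hC]; exists (maxn l k); exact: coordI.
- by move=> A [l]; exact: h.
- by move=> k; apply: le_lt_trans (probability_le1 m1 measurableT) (ltry 1).
- refine (@sub_sigma_algebra2 X setT _ (@cylinders S a) _ B mB).
  move=> _ [n [v ->]]; exists n => x y xy hx i hi; by rewrite -(hx i hi) xy.
Qed.

End Coordinates.

Section Prob.
Variables (d : measure_display) (T : measurableType d) (R : realType) (m : probability T R).
Implicit Types A B : set T.

Definition pr A : R := fine (m A).

Lemma prE A : measurable A -> (pr A)%:E = m A.
Proof. by move=> mA; rewrite /pr fineK// fin_num_measure. Qed.

Lemma pr_ge0 A : 0 <= pr A.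
Proof. by rewrite /pr fine_ge0. Qed.

Lemma prT : pr setT = 1.
Proof. by rewrite /pr probability_setT. Qed.

Lemma pr0 : pr set0 = 0.
Proof. by rewrite /pr measure0. Qed.

Lemma pr_mono A B : measurable A -> measurable B -> A `<=` B -> pr A <= pr B.
Proof. by move=> mA mB AB; rewrite -lee_fin !prE// le_measure// inE. Qed.

Lemma pr_le1 A : measurable A -> pr A <= 1.
Proof. by move=> mA; rewrite -prT; apply: pr_mono. Qed.

Lemma prU A B : measurable A -> measurable B -> A `&` B = set0 -> pr (A `|` B) = pr A + pr B.
Proof.
move=> mA mB AB; apply: EFin_inj; rewrite EFinD !prE//; last exact: measurableU.
by apply: measureU.
Qed.

Lemma prC A : measurable A -> pr (~` A) = 1 - pr A.
Proof.
move=> mA; have mC := measurableC mA.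
have := prU mA mC (setICr A); rewrite setUv prT; lra.
Qed.

Lemma prUle A B : measurable A -> measurable B -> pr (A `|` B) <= pr A + pr B.
Proof.
move=> mA mB; have mD : measurable (B `\` A) by exact: measurableD.
rewrite -(setDUK (A := A) (B := A `|` B)); last by move=> x; left.
rewrite prU//; [|by rewrite setDUl setDv set0U|by rewrite setDE setIC -setIA setICl setI0].
  by rewrite lerD2l setDUl setDv set0U; apply: pr_mono => // x [].
Qed.

Lemma prIC A B : measurable A -> measurable B -> pr B = pr (B `&` A) + pr (B `&` ~` A).
Proof.
move=> mA mB; rewrite -prU; [by rewrite -setIUr setUv setIT| | |].
- exact: measurableI.
- exact/measurableI/measurableC.
- by rewrite setIACA setICr setI0.
Qed.

Lemma prI_full A B : measurable A -> measurable B -> pr A = 1 -> pr (B `&` A) = pr B.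
Proof.
move=> mA mB A1; rewrite [RHS](prIC mA mB).
suff -> : pr (B `&` ~` A) = 0 by rewrite addr0.
apply/eqP; rewrite eq_le pr_ge0 andbT -(subrr 1) -{2}A1 -prC//.
by apply: pr_mono; [exact/measurableI/measurableC|exact: measurableC|move=> x []].
Qed.

Lemma pr_sum_cvg (B : nat -> set T) : (forall k, measurable (B k)) -> trivIset setT B ->
  (fun n => \sum_(k < n) pr (B k)) @ \oo --> pr (\bigcup_k B k).
Proof.
move=> mB tB; have mU := bigcupT_measurable _ mB.
have h := measure_semi_sigma_additive (s := m) _ mB tB mU.
have h' : (fun n => \sum_(0 <= i < n) m (B i))%E @ \oo --> (pr (\bigcup_k B k))%:E by rewrite (prE mU); exact: h.
apply: cvg_trans (fine_cvg h'); apply: near_eq_cvg; apply: nearW => n /=.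
rewrite big_mkord.
have -> : (\sum_(i < n) m (B i) = (\sum_(i < n) pr (B i))%:E)%E.
  by rewrite -sumEFin; apply: eq_bigr => i _; rewrite prE.
by [].
Qed.

Lemma pr_cvg_nondecr (B : nat -> set T) : (forall k, measurable (B k)) -> (forall k, B k `<=` B k.+1) ->
  (fun n => pr (B n)) @ \oo --> pr (\bigcup_k B k).
Proof.
move=> mB hB; have mU := bigcupT_measurable _ mB.
have nd : nondecreasing_seq B.
  by apply/nondecreasing_seqP => n; apply/subsetPset.
have := nondecreasing_cvg_mu (mu := m) mB mU nd.
by move=> h; apply: (@fine_cvg _ _ _ _ (m \o B)); rewrite prE.
Qed.

End Prob.

Section Integ.
Variables (S : countType) (a : S) (E : rel S) (R : realType) (m : probability (Sig a) R).
Hypothesis madm : m [set x : Sig a | adm E x] = 1%E.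
Local Notation X := (Sig a).
Local Notation mr := (fun F => measurable_fun setT (restr E F)).

Definition bm (K : R) (F : X -> R) := measurable_fun setT (restr E F) /\ forall x : X, adm E x -> `|F x| <= K.

Lemma restr_bdd K F : bm K F -> forall x, `|restr E F x| <= `|K|.
Proof.
move=> [_ h] x; rewrite /restr; case: asboolP => [/h hx|_]; last by rewrite normr0.
by apply: le_trans hx _; exact: ler_norm.
Qed.

Lemma bm_integrable K F : bm K F -> m.-integrable setT (EFin \o restr E F).
Proof.
move=> h; apply: measurable_bounded_integrable => //.
- by apply: le_lt_trans (probability_le1 m measurableT) (ltry 1).
- by case: h.
- by exists `|K|; split=> // M KM x _; apply: le_trans (restr_bdd h x) (ltW KM).
Qed.

Lemma integE F : integ E m F = Rintegral m setT (restr E F).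
Proof. by []. Qed.

Lemma integ_fin K F : bm K F -> (\int[m]_x (restr E F x)%:E)%E = (integ E m F)%:E.
Proof. by move=> h; rewrite /integ fineK//; apply: integrable_fin_num => //; exact: bm_integrable h. Qed.

Lemma restrD (F G : X -> R) : restr E (fun x : X => F x + G x) = (fun x : X => restr E F x + restr E G x).
Proof. by apply/funext => x; rewrite /restr; case: asboolP => //; rewrite addr0. Qed.

Lemma restrZ c (F : X -> R) : restr E (fun x : X => c * F x) = (fun x : X => c * restr E F x).
Proof. by apply/funext => x; rewrite /restr; case: asboolP => //; rewrite mulr0. Qed.

Lemma bmD K K' F G : bm K F -> bm K' G -> bm (K + K') (fun x => F x + G x).
Proof.
move=> [h1 h2] [h3 h4]; split; first by rewrite restrD; exact: measurable_funD.
by move=> x hx; apply: le_trans (ler_normD _ _) _; apply: lerD; [exact: h2|exact: h4].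
Qed.

Lemma bmZ c K F : bm K F -> bm (`|c| * K) (fun x => c * F x).
Proof.
move=> [h1 h2]; split; first by rewrite restrZ; apply: measurable_funM.
by move=> x hx; rewrite normrM; apply: ler_wpM2l => //; exact: h2.
Qed.

Definition ib (F : X -> R) := m.-integrable setT (EFin \o restr E F).

Lemma ib_measurable F : ib F -> measurable_fun setT (restr E F).
Proof. by move=> h; apply/measurable_EFinP; exact: measurable_int h. Qed.

Lemma ibD F G : ib F -> ib G -> ib (fun x => F x + G x).
Proof. by move=> hF hG; rewrite /ib restrD; exact: (integrableD measurableT hF hG). Qed.

Lemma ibZ c F : ib F -> ib (fun x => c * F x).
Proof. by move=> hF; rewrite /ib restrZ; exact: (integrableZl measurableT c hF). Qed.

Lemma integD F G : ib F -> ib G -> integ E m (fun x => F x + G x) = integ E m F + integ E m G.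
Proof. by move=> hF hG; rewrite !integE restrD; apply: RintegralD. Qed.

Lemma integZ c F : ib F -> integ E m (fun x => c * F x) = c * integ E m F.
Proof. by move=> hF; rewrite !integE restrZ; apply: RintegralZl. Qed.

Lemma integ_le F G : ib F -> ib G -> (forall x : X, adm E x -> F x <= G x) -> integ E m F <= integ E m G.
Proof.
move=> hF hG h; rewrite !integE; apply: le_Rintegral => // x _.
by rewrite /restr; case: asboolP => // /h.
Qed.

Lemma restr_indic B : measurable B -> restr E (\1_B : X -> R) = \1_(B `&` [set x : X | adm E x]).
Proof.
move=> mB; apply/funext => x; rewrite /restr !indicE classical_sets.in_setI.
have -> : (x \in [set x : X | adm E x]) = `[< adm E x >] by [].
by case: asboolP => hx; rewrite ?andbT// andbF.
Qed.

Lemma bm_indic B : measurable B -> bm 1 (\1_B).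
Proof.
move=> mB; split.
  by rewrite restr_indic//; apply: measurable_indic; apply: measurableI => //; exact: meas_adm.
by move=> x _; rewrite indicE normr_nat lern1 leq_b1.
Qed.

Lemma integ_indic B : measurable B -> integ E m (\1_B) = pr m B.
Proof.
move=> mB; have mA := @meas_adm S a E.
have mI : measurable (B `&` [set x : X | adm E x]) by exact: measurableI.
rewrite /integ restr_indic// integral_indic// setIT -[fine _]/(pr m _).
by apply: prI_full => //; rewrite /pr madm.
Qed.

Lemma bm_cst c : bm `|c| (fun=> c).
Proof.
split=> //; apply: meas_restr => x e _ e0; exists 0%N => y _ _.
by rewrite subrr normr0 ltW.
Qed.

Lemma ib_cst c : ib (fun=> c).
Proof. exact: bm_integrable (bm_cst c). Qed.

Lemma integ_cst c : integ E m (fun=> c) = c.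
Proof.
have -> : (fun=> c) = (fun x : X => c * (\1_setT x)) :> (X -> R).
  by apply/funext => x; rewrite indicE in_setT mulr1.
by rewrite (integZ _ (bm_integrable (bm_indic measurableT))) integ_indic// prT mulr1.
Qed.

Lemma integ_near K F c e : bm K F -> (forall x : X, adm E x -> `|F x - c| <= e) -> `|integ E m F - c| <= e.
Proof.
move=> hF h; rewrite ler_norml lerBlDl lerBrDr; apply/andP; split.
  rewrite -[leLHS]integ_cst; apply: (integ_le (bm_integrable (bm_cst _)) (bm_integrable hF)) => x hx.
  by have := h x hx; rewrite ler_norml => /andP[]; lra.
rewrite -[leRHS]integ_cst; apply: (integ_le (bm_integrable hF) (bm_integrable (bm_cst _))) => x hx.
by have := h x hx; rewrite ler_norml => /andP[]; lra.
Qed.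

End Integ.

Section RpfMeasure.
Variables (S : countType) (a : S) (E : rel S) (R : realType) (th : R) (phi : Sig a -> R).
Variable d : rpfpar a E R.
Hypothesis dH : rpf_spec th phi d.
Local Notation X := (Sig a).
Local Notation sh := (@Defs.shift S a).
Local Notation M := (@MF S a E R phi d).
Local Notation bhh := (@bh S a E R th).

Lemma bh_ind l (B : set X) : coord l B -> bhh 1 (2 * 1 / th ^+ l) (\1_B).
Proof.
move=> cB; apply: (bh_coord dH) => //.
  by move=> x _; rewrite indicE normr_nat lern1 leq_b1.
move=> x y xy; rewrite !indicE; congr (_ %:R); congr nat_of_bool.
by apply/idP/idP => /set_mem h; apply/mem_set; [exact: cB h|apply: cB h; exact: agree_sym].
Qed.

Lemma coord_sym n k : coord n.+1 [set x : X | pickle (x n) = k].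
Proof. by move=> x y xy /= <-; rewrite xy. Qed.

Lemma coord_symge n N : coord n.+1 [set x : X | (N <= pickle (x n))%N].
Proof. by move=> x y xy /=; rewrite xy. Qed.

Lemma M_split n K D F N : bhh K D F -> M F =
  \sum_(k < N) M (fun x => F x * \1_[set x : X | pickle (x n) = k] x) +
  M (fun x => F x * \1_[set x : X | (N <= pickle (x n))%N] x).
Proof.
move=> hF.
have h k : bhh (K * 1) (K * (2 * 1 / th ^+ n.+1) + D * 1) (fun x => F x * \1_[set x : X | pickle (x n) = k] x).
  exact: (bhM hF (bh_ind (@coord_sym n k))).
have hN := bhM hF (bh_ind (@coord_symge n N)).
have hs k : (k < N)%N -> exists K D, bhh K D (fun x => F x * \1_[set x : X | pickle (x n) = k] x).
  by move=> _; exists (K * 1), (K * (2 * 1 / th ^+ n.+1) + D * 1).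
rewrite -(MF_sum dH hs); have [K' [D' hs']] := bh_sum hs.
rewrite -(MFD dH hs' hN); apply: (eq_MF (E := E)) => x _.
have [Nx|xN] := leqP N (pickle (x n)).
  rewrite big1 ?add0r ?indicE ?mem_set ?mulr1// => k _.
  by rewrite indicE memNset ?mulr0//= => e; move: Nx; rewrite e leqNgt ltn_ord.
have -> : \1_[set x0 : X | (N <= pickle (x0 n))%N] x = 0 :> R.
  by rewrite indicE memNset//= leqNgt xN.
rewrite mulr0 addr0.
rewrite (bigD1 (Ordinal xN))//= indicE mem_set// mulr1 big1 ?addr0// => k ne.
rewrite indicE memNset ?mulr0//= => e; move/eqP: ne; apply; exact: val_inj.
Qed.

Lemma M_split_cvg n K D F : bhh K D F ->
  (fun N => \sum_(k < N) M (fun x => F x * \1_[set x : X | pickle (x n) = k] x)) @ \oo --> M F.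
Proof.
move=> hF.
have h0 : (fun N => M (fun x => F x * \1_[set x : X | (N <= pickle (x n))%N] x)) @ \oo --> 0.
  apply: (MF_cvg0 dH (K := K * 1) (D := K * (2 * 1 / th ^+ n.+1) + D * 1)).
    by move=> N; exact: (bhM hF (bh_ind (@coord_symge n N))).
  move=> x _; apply/cvgn_epsP => e e0; exists (pickle (x n)).+1 => N hN.
  by rewrite indicE memNset ?mulr0 ?subr0 ?normr0 ?ltW//= leqNgt hN.
have -> : (fun N => \sum_(k < N) M (fun x => F x * \1_[set x : X | pickle (x n) = k] x)) =
  (fun N => M F - M (fun x => F x * \1_[set x : X | (N <= pickle (x n))%N] x)).
  by apply/funext => N; rewrite (M_split n N hF) addrK.
by rewrite -[X in _ --> X]subr0; apply: cvgB => //; exact: cvg_cst.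
Qed.

Definition word_set (z : seq S) : set X := [set x | forall i, (i < size z)%N -> x i = nth a z i].

Lemma coord_word z : coord (size z) (word_set z).
Proof. by move=> x y xy h i hi; rewrite -(h i hi) xy. Qed.

Lemma word_rcons z s : word_set (rcons z s) = word_set z `&` [set x | x (size z) = s].
Proof.
apply/seteqP; split=> x.
  move=> h; split=> [i hi|].
    by have := h i; rewrite size_rcons nth_rcons hi; apply; rewrite ltnS ltnW.
  by have := h (size z); rewrite size_rcons nth_rcons ltnn eqxx; apply.
move=> [h1 h2] i; rewrite size_rcons nth_rcons ltnS leq_eqVlt => /orP[/eqP ->|hi].
  by rewrite ltnn eqxx.
by rewrite hi h1.
Qed.

Lemma sym_pickle n k : [set x : X | pickle (x n) = k] =
  if (pickle_inv k : option S) is Some s then [set x : X | x n = s] else set0.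
Proof.
case e : (pickle_inv k) => [s|].
  have es : pickle s = k by have := pickle_invK (T := S) k; rewrite /oapp e.
  by apply/seteqP; split=> x /= => [h|->//]; apply: (pcan_inj pickleK); rewrite h.
apply/seteqP; split=> x //= h.
by have := pickleK_inv (x n); rewrite h e.
Qed.

Lemma mulr_indic (A B : set X) (x : X) : \1_A x * \1_B x = \1_(A `&` B) x :> R.
Proof. by rewrite indicI. Qed.

Lemma M0 : M (\1_(set0 : set X)) = 0.
Proof. by rewrite -[RHS](MF_cst dH 0); apply: (eq_MF (E := E)) => x _; rewrite indic0. Qed.

Lemma M_word_split z : let u k := if (pickle_inv k : option S) is Some s then M (\1_(word_set (rcons z s))) else 0 in
  asm u (M (\1_(word_set z))) /\ sm u = M (\1_(word_set z)).
Proof.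
move=> u; have hz := bh_ind (coord_word (z := z)).
have e k : M (fun x => \1_(word_set z) x * \1_[set x : X | pickle (x (size z)) = k] x) = u k.
  transitivity (M (\1_(word_set z `&` [set x : X | pickle (x (size z)) = k]))); last first.
    rewrite sym_pickle /u; case: pickle_inv => [s|]; first by rewrite word_rcons.
    by rewrite setI0 M0.
  by apply: (eq_MF (E := E)) => x _; exact: mulr_indic.
have u0 k : 0 <= u k.
  rewrite -e; apply: (MF_ge0 dH (bhM hz (bh_ind (@coord_sym (size z) k)))) => x _.
  by rewrite mulr_ge0 ?indicE.
split.
  apply: asmP => // N; rewrite (M_split (size z) N hz).
  under [X in _ <= X + _]eq_bigr do rewrite e.
  rewrite lerDl; apply: (MF_ge0 dH (bhM hz (bh_ind (@coord_symge (size z) N)))) => x _.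
  by rewrite mulr_ge0 ?indicE.
apply: sm_unique; have := M_split_cvg (size z) hz.
apply: cvg_trans; apply: near_eq_cvg; apply: nearW => N; rewrite series_ordE.
by apply: eq_bigr => k _; rewrite e.
Qed.

Lemma rpf_kolmogorov : exists m : probability X R, forall l B, coord l B -> pr m B = M (\1_B).
Proof.
have [|||m hm] := @kolmogorov R S a (fun z => M (\1_(word_set z))).
- by move=> z; apply: (MF_ge0 dH (bh_ind (coord_word (z := z)))) => x _; rewrite indicE.
- rewrite -[RHS](MF_cst dH 1); apply: (eq_MF (E := E)) => x _.
  by rewrite indicE mem_set.
- exact: M_word_split.
exists m => l B cB.
suff key j z : (size z + j = l)%N -> pr m (B `&` word_set z) = M (\1_(B `&` word_set z)).
  have := key l [::] erefl; have -> : word_set [::] = setT by apply/seteqP; split.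
  by rewrite setIT.
elim: j z => [|j ih] z zl.
  have [[x [Bx zx]]|nx] := pselect (exists x, (B `&` word_set z) x); last first.
    have -> : B `&` word_set z = set0 by apply/seteqP; split=> // x hx; apply: nx; exists x.
    by rewrite pr0 M0.
  have -> : B `&` word_set z = word_set z.
    apply/seteqP; split=> [y []//|y zy]; split=> //; apply: cB Bx => i.
    by rewrite -zl addn0 => hi; rewrite zx// zy.
  have := hm (size z) (nth a z); rewrite mkseq_nth => h.
  by rewrite /pr -[word_set z]/(@cyl S a (size z) (nth a z)) h.
pose C k := (B `&` word_set z) `&` [set x : X | pickle (x (size z)) = k].
have cBz : coord l (B `&` word_set z).
  have := coordI cB (coord_word (z := z)); apply: coordW.
  by rewrite geq_max leqnn -zl leq_addr.
have mC k : measurable (C k).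
  apply: measurableI; first exact: meas_coord cBz.
  exact: meas_coord (@coord_sym (size z) k).
have eC k : pr m (C k) = M (\1_(C k)).
  rewrite /C sym_pickle; case: pickle_inv => [s|]; last by rewrite setI0 pr0 M0.
  by rewrite -setIA -word_rcons; apply: ih; rewrite size_rcons -zl addSnnS.
have c1 := M_split_cvg (size z) (bh_ind cBz).
have tC : trivIset setT C.
  apply/trivIsetP => i j' _ _ ij; apply/seteqP; split=> // x [[_ /= e1] [_ /= e2]].
  by move/eqP: ij; apply; rewrite -e1 -e2.
have c2 := pr_sum_cvg (m := m) mC tC.
have e2 : \bigcup_k C k = B `&` word_set z.
  by apply/seteqP; split=> [x [k _ []]//|x hx]; exists (pickle (x (size z))).
rewrite e2 in c2; apply: (cvgn_uniq c2); move: c1; apply: cvg_trans.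
apply: near_eq_cvg; apply: nearW => N; apply: eq_bigr => k _.
by rewrite eC; apply: (eq_MF (E := E)) => x _; rewrite mulr_indic.
Qed.

Lemma bh_cont K D F : bhh K D F -> cont_adm E F.
Proof.
have /andP[t0 t1] := rs_th dH.
move=> [K0 D0 _ h] x e hx e0.
have t01 : 0 <= th < 1 by rewrite (ltW t0) t1.
have e1 : 0 < e / (D + 1) by apply: divr_gt0 => //; lra.
have [n hn] := expr_eventually_le t01 e1; exists n => y hy xy.
apply: le_trans (h n x y hx hy xy) _.
apply: le_trans (ler_wpM2l D0 (hn n (leqnn n))) _.
rewrite mulrCA -[leRHS]mulr1; apply: ler_wpM2l; first exact: ltW.
by rewrite ler_pdivrMr; lra.
Qed.

Lemma bh_bm K D F : bhh K D F -> bm E K F.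
Proof. by move=> h; split; [apply: meas_restr; exact: bh_cont h|case: h]. Qed.

Section Represents.
Variable m : probability X R.
Hypothesis hm : forall l B, coord l B -> pr m B = M (\1_B).

Lemma rep_adm : m [set x : X | adm E x] = 1%E.
Proof.
pose B i : set X := [set x | ~ E (x i) (x i.+1)].
have cB i : coord i.+2 (B i) by move=> x y xy; rewrite /B /= (xy i)// (xy i.+1).
have mB i : measurable (B i) by exact: meas_coord (cB i).
have B0 i : m (B i) = 0%E.
  rewrite -prE// (hm (cB i)); congr EFin; rewrite -[RHS](MF_cst dH 0).
  by apply: (eq_MF (E := E)) => x hx; rewrite indicE memNset//= => /(_ (hx i)).
have mA := @meas_adm S a E.
have e : ~` [set x : X | adm E x] = \bigcup_i B i.
  apply/seteqP; split=> x /=; last by move=> [i _ /= h] /(_ i).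
  by move=> /existsNP[i hi]; exists i.
have : m (~` [set x : X | adm E x]) = 0%E.
  rewrite e; apply: (measure_negligible (bigcupT_measurable _ mB)).
  by apply: negligible_bigcup => i; apply/negligibleP => //; exact: B0.
rewrite -(prE m mA) -(prE m (measurableC mA)) prC// => -[h]; congr EFin; lra.
Qed.

Lemma rep_invariant : invariant_prob E m.
Proof.
split; first exact: rep_adm.
move=> A mA.
have ms := @meas_shift S a.
apply: (@g_sigma_algebra_measure_unique _ R X [set B | exists l, coord l B] _ (fun=> setT) _ _ (pushforward m sh) m).
- by move=> B [l]; exact: meas_coord.
- by move=> i; exists 0%N.
- by apply/seteqP; split=> // x _; exists 0%N.
- by move=> B C [l hB] [k hC]; exists (maxn l k); exact: coordI.
- move=> B [l cB]; have mB := meas_coord cB; have mS := meas_coord (coord_shift cB).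
  transitivity (pr m (sh @^-1` B))%:E; first by rewrite prE.
  transitivity (pr m B)%:E; last by rewrite prE.
  rewrite (hm cB) (hm (coord_shift cB)); congr EFin.
  rewrite -(MF_shift dH (bh_ind cB)); apply: (eq_MF (E := E)) => x _; rewrite !indicE.
  congr (nat_of_bool _)%:R; by apply/idP/idP => /set_mem h; apply/mem_set.
- by move=> k; apply: le_lt_trans (probability_le1 m measurableT) (ltry 1).
- refine (@sub_sigma_algebra2 X setT _ (@cylinders S a) _ A mA).
  by move=> _ [n [v ->]]; exists n => x y xy hx i hi; rewrite -(hx i hi) xy.
Qed.

Lemma integ_sum n (F : nat -> X -> R) : (forall k, exists K, bm E K (F k)) ->
  (exists K, bm E K (fun x => \sum_(k < n) F k x)) /\
  integ E m (fun x => \sum_(k < n) F k x) = \sum_(k < n) integ E m (F k).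
Proof.
move=> h; elim: n => [|n [[K ih1] ih2]].
  split; first by exists `|0 : R|; under eq_fun do rewrite big_ord0; exact: bm_cst.
  by under eq_fun do rewrite big_ord0; rewrite big_ord0 (integ_cst rep_adm).
have [K' h'] := h n; split.
  by exists (K + K'); under eq_fun do rewrite big_ord_recr/=; exact: bmD.
by under eq_fun do rewrite big_ord_recr/=; rewrite big_ord_recr/= (integD (bm_integrable m ih1) (bm_integrable m h')) ih2.
Qed.

Lemma rep_integ K D F : bhh K D F -> integ E m F = M F.
Proof.
move=> hF; have [K0 D0 F1 F2] := hF; have /andP[t0 t1] := rs_th dH.
have t01 : 0 <= th < 1 by rewrite (ltW t0) t1.
suff key e : 0 < e -> `|integ E m F - M F| <= 4 * e.
  apply/eqP; rewrite -subr_eq0 -normr_eq0; apply/eqP/le_anti; rewrite normr_ge0 andbT.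
  by apply/ler_addgt0Pl => e e0; rewrite addr0; have := key (e / 4); rewrite divr_gt0// => /(_ isT); lra.
move=> e0.
have e1 : 0 < e / (D + 1) by apply: divr_gt0 => //; lra.
have [l hl] := expr_eventually_le t01 e1.
have Dl : D * th ^+ l <= e.
  apply: le_trans (ler_wpM2l D0 (hl l (leqnn l))) _.
  rewrite mulrCA -[leRHS]mulr1; apply: ler_wpM2l; first exact: ltW.
  by rewrite ler_pdivrMr ?ltr_wpDl// mul1r lerDl.
pose N : R := (Num.truncn (1 / e)).+1%:R.
have N0 : 0 < N by rewrite ltr0n.
have N1 : 1 / N <= e.
  by rewrite ler_pdivrMr// mulrC -ler_pdivrMr//; exact: ltW (truncnS_gt _).
pose rp' (x : X) : X := xget (fun=> a) [set y : X | adm E y /\ agree l x y].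
have rp'P (x : X) : adm E x -> adm E (rp' x) /\ agree l x (rp' x).
  by move=> hx; exact: (@xgetPex _ (fun=> a) [set y : X | adm E y /\ agree l x y]) (ex_intro _ x (conj hx (fun _ _ => erefl))).
have rp'E (x y : X) : agree l x y -> rp' x = rp' y.
  move=> xy; rewrite /rp'; congr (xget _ _); apply/seteqP; split=> z /= [hz hxz]; split=> //.
    by apply: agree_trans hxz; exact: agree_sym.
  exact: agree_trans xy hxz.
pose H (x : X) : nat := Num.truncn ((F (rp' x) + K) * N).
pose J := (Num.truncn (2 * K * N)).+1.
pose c (j : nat) : R := j%:R / N - K.
pose B j : set X := [set x | H x = j].
have cB j : coord l (B j) by move=> x y xy /=; rewrite /B /= /H (rp'E x y xy).
pose G (x : X) := \sum_(j < J) c j * \1_(B j) x.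
have FG (x : X) : adm E x -> `|F x - G x| <= 2 * e.
  move=> hx; have [hr xr] := rp'P x hx.
  have Fr := F1 _ hr; have := Fr; rewrite ler_norml => /andP[Fr1 Fr2].
  have p0 : 0 <= (F (rp' x) + K) * N by apply: mulr_ge0; [lra|exact: ltW].
  have HJ : (H x < J)%N.
    rewrite /H /J ltnS; apply: Num.Theory.le_truncn.
    by apply: ler_wpM2r; [exact: ltW|lra].
  have -> : G x = c (H x).
    rewrite /G (bigD1 (Ordinal HJ))//= indicE mem_set//= mulr1 big1 ?addr0// => j ne.
    rewrite indicE memNset ?mulr0//= => ej; move/eqP: ne; apply; exact: val_inj.
  have /andP[q1 q2] := Num.Theory.truncn_itv p0.
  have h1 : `|F (rp' x) - c (H x)| <= 1 / N.
    have v1 : (H x)%:R / N <= F (rp' x) + K by rewrite ler_pdivrMr.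
    have v2 : 0 <= 1 / N by rewrite divr_ge0// ?ltW.
    have v3 : F (rp' x) + K <= (H x)%:R / N + 1 / N.
      by rewrite -mulrDl ler_pdivlMr// natr1; exact: ltW.
    rewrite ler_norml /c; move: v1 v2 v3; set u := _%:R / N; set v := 1 / N => v1 v2 v3.
    by apply/andP; clear -v1 v2 v3; lra.
  have h2 := F2 l _ _ hx hr xr.
  have h1' := le_trans h1 N1; have h2' := le_trans h2 Dl.
  by have := ler_distD (F (rp' x)) (F x) (c (H x)); clear -h1' h2'; lra.
have bB j : bm E (`|c j| * 1) (fun x => c j * \1_(B j) x) by apply: bmZ; apply: bm_indic; exact: meas_coord (cB j).
have hB j := bhZ (c j) (bh_ind (cB j)).
have bB' j : exists K, bm E K (fun x => c j * \1_(B j) x) by eexists; exact: bB.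
have hB' j (_ : (j < J)%N) : exists K D, bhh K D (fun x => c j * \1_(B j) x) by do 2 eexists; exact: hB.
have [[KG bG] eG] := @integ_sum J (fun j x => c j * \1_(B j) x) bB'.
have [KG' [DG hG]] := @bh_sum S a E R th J (fun j x => c j * \1_(B j) x) hB'.
have eMG : M G = integ E m G.
  rewrite (MF_sum dH hB') eG.
  apply: eq_bigr => j _; rewrite (MFZ dH _ (bh_ind (cB j))).
  have mB := meas_coord (cB j).
  by rewrite (integZ _ (bm_integrable m (bm_indic E R mB))) (integ_indic rep_adm mB) (hm (cB j)).
have n1 : `|M (fun x => F x - G x) - 0| <= 2 * e.
  have hh := bhD hF (bhZ (-1) hG).
  apply: (MF_near dH (K := K + `|-1| * KG') (D := D + `|-1| * DG)).
    by move: hh; under eq_fun do rewrite mulN1r.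
  by move=> x hx; rewrite subr0; exact: FG.
have n2 : `|integ E m (fun x => F x + -1 * G x) - 0| <= 2 * e.
  apply: (integ_near rep_adm (bmD (bh_bm hF) (bmZ (-1) bG))) => x hx.
  by rewrite subr0 mulN1r; exact: FG.
rewrite (MFB dH hF hG) subr0 eMG in n1.
rewrite (integD (bm_integrable m (bh_bm hF)) (bm_integrable m (bmZ (-1) bG))) (integZ _ (bm_integrable m bG)) subr0 mulN1r in n2.
by have := ler_distD (integ E m G) (integ E m F) (M F); rewrite [`|integ E m G - M F|]distrC; lra.
Qed.

End Represents.
End RpfMeasure.

(** * Gibbs estimates *)

Section EtaBound.
Variable R : realType.
Lemma mulln_le (z x : R) : - (expR z * z) <= expR z * x + expR (- x).
Proof.
have h := expR_ge1Dx (- x - z).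
have e : expR (- x) = expR z * expR (- x - z) by rewrite -expRD; congr expR; ring.
rewrite e -mulrDr -mulrN; apply: ler_wpM2l; first exact: expR_ge0.
by lra.
Qed.

Lemma eta_le (u x : R) : 0 <= u -> etaf u <= u * x + expR (- x).
Proof.
move=> u0; rewrite /etaf; case: (leP u 0) => u1.
  have -> : u = 0 by lra.
  by rewrite mul0r add0r expR_ge0.
by have := mulln_le (ln u) x; rewrite lnK.
Qed.
Lemma clip_lip (u v c : R) : `|Num.min (Num.max 0 u) c - Num.min (Num.max 0 v) c| <= `|u - v|.
Proof.
have n1 := ler_norm (u - v); have n2 := ler_norm (v - u); rewrite distrC in n2.
by rewrite /Num.min /Num.max; case: (ltP 0 u) => ?; case: (ltP 0 v) => ?; do 2?case: (ltP _ c) => ?; rewrite ler_norml; apply/andP; split; lra.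
Qed.
End EtaBound.

Section Estimates.
Variables (S : countType) (a : S) (E : rel S) (R : realType) (th : R) (phi : Sig a -> R).
Variable d : rpfpar a E R.
Hypothesis dH : rpf_spec th phi d.
Local Notation X := (Sig a).
Local Notation sh := (@Defs.shift S a).
Local Notation L := (cloops (rd_cl d)).
Local Notation AW := (@Aw S a E (rd_v0 d) (rd_cl d) R phi (rd_P d)).
Local Notation g := (@gk S a E R phi d).
Local Notation M := (@MF S a E R phi d).
Local Notation bhh := (@bh S a E R th).
Local Notation vdd := (vd a E).
Local Notation D := (dist_cst (rd_A d) th).
Local Notation lw := (lword a E (rd_v0 d)).
Let b0 := bk_ge0 dH.
Let th01 := rs_th dH.
Let mw := rs_mw dH.
Let hg := gk_kern dH.

Lemma gk_nvd n x : ~~ vdd n -> g n x = 0.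
Proof. by move=> v; rewrite /gk /Aw (negPf v) !mul0r. Qed.

Lemma MF_bound (K Df : R) F (B : nat -> L -> R) KB : bhh K Df F -> 0 <= KB ->
  (forall n x, vdd n -> loop_sum (d := d) F n x <= B n x) ->
  (forall x, asm (fun n => g n x * B n x) KB) -> M F <= KB.
Proof.
have [CJ CJ0 hJ] := J_exists dH => hF KB0 hB hA; have [h1 a1] := hJ _ _ _ hF.
rewrite /MF ler_pdivrMr ?(taumean_gt0 dH)//.
apply: (@le_trans _ _ KB); last by rewrite ler_peMr//; exact: taumean_ge1 dH.
apply: (nu_le b0 th01 mw hg h1) => x; apply: le_trans (sm_le_bound (hA x)).
apply: (sm_le (a1 x) (hA x)) => n; have [v|v] := boolP (vdd n).
  by apply: ler_wpM2l; [exact: gk_ge0 dH n x|exact: hB].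
by rewrite gk_nvd// !mul0r.
Qed.

Lemma tau2_asm : exists2 C : R, 0 <= C & forall x, asm (fun n => g n x * (tau L n)%:R ^+ 2) C.
Proof.
have om0 := rs_om0 dH; have gm := gk_moment dH.
exists (K2 (rd_om d) (rd_K d * rd_M d / rd_c d)); first exact: (K2_ge0 om0 gm).
move=> x; have := asm_gle hg om0 gm x (f := fun n => (tau L n)%:R ^+ 2) (C := 1).
rewrite mul1r; apply=> // n; rewrite ger0_norm ?exprn_ge0// mul1r.
have [t1 t2 _ /(_ 0)[|_ _]] := @Tn_ge R L (rd_om d) om0 n; first by have := om0; lra.
by rewrite mul0r expR0 mulr1.
Qed.

Lemma pre_inj k k' (x x' : L) : vdd k -> vdd k' -> pre k x = pre k' x' -> k = k' /\ x = x'.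
Proof.
move=> v v' e.
have half j j' (y y' : L) : vdd j -> vdd j' -> pre j y = pre j' y' -> (tau L j' <= tau L j)%N.
  move=> vj vj' ee; rewrite leqNgt; apply/negP => lt.
  have := @pre_ne S a E (rd_v0 d) (rd_cl d) j' y' (tau L j) vj'; rewrite tau_gt0 lt => /(_ isT).
  rewrite -[cpre _ _ _]/(pre j' y') -ee; apply.
  by rewrite -[tau L j]addn0 (pre_at (rd_cl d)) Y0.
have tt : tau L k = tau L k'.
  by apply/eqP; rewrite eqn_leq (half k' k x' x)// (half k k' x x').
have kk : k = k'.
  suff [] : [:: k] = [:: k'] by [].
  apply: (@decode_uniq S a E (rd_v0 d) (rd_cl d) (tau L k) [:: k] [:: k'] x x').
  - by rewrite /= v.
  - by rewrite /= v'.
  - by rewrite /llen/= addn0.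
  - by rewrite tt /llen/= addn0.
  - have h : agr (tau L k) (pre k x) (pre k' x') by rewrite e => i.
    exact: h.
subst k'; split=> //; apply: Yeq.
by rewrite -(iter_pre (rd_cl d) k x) -(iter_pre (rd_cl d) k x') [cpre _ k x]e.
Qed.

Section Gibbs.
Definition in_word l (y : L) : Prop := exists y', y = pres l y'.
Definition iw l (y : L) : R := (`[< in_word l y >])%:R.

Lemma iw_pre k l n (c : L -> R) x : vdd k -> vdd n ->
  c (pre n x) * iw (k :: l) (pre n x) = if n == k then c (pre k x) * iw l x else 0.
Proof.
move=> vk vn; rewrite /iw; case: eqVneq => [->|ne].
  congr (_ * _%:R); congr nat_of_bool; apply/asboolP/asboolP => -[y' e].
    by have [_ ->] := pre_inj vk vk e; exists y'.
  by exists y'; rewrite /= -e.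
case: asboolP => [[y' e]|_]; last by rewrite mulr0.
by have [nk _] := pre_inj vn vk e; rewrite nk eqxx in ne.
Qed.

Lemma op_iw k l (c : L -> R) x : vdd k ->
  op g (fun y => c y * iw (k :: l) y) x = g k x * c (pre k x) * iw l x.
Proof.
move=> vk; rewrite /op (sm_single (a := k)).
  by rewrite iw_pre// eqxx mulrA.
move=> n nk; have [vn|vn] := boolP (vdd n); last by rewrite gk_nvd// mul0r.
by rewrite iw_pre// (negPf nk) mulr0.
Qed.

Lemma iter_iw l (c : L -> R) x : all vdd l ->
  iter (size l) (op g) (fun y => c y * iw l y) x = wgt (fun k => g k) l x * c (pres l x).
Proof.
elim: l c x => [|k l ih] c x.
  by rewrite /= mul1r /iw asboolT ?mulr1//; exists x.
move=> /= /andP[vk vl]; rewrite -iterS iterSr.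
have -> : op g (fun y => c y * iw (k :: l) y) = fun y => (g k y * c (pre k y)) * iw l y.
  by apply/funext => y; rewrite op_iw.
by rewrite (ih (fun y => g k y * c (pre k y)))//; ring.
Qed.

Lemma wgt_gk l x : wgt (fun k => g k) l x = wgt AW l x * rd_h (pres l x) / rd_h x.
Proof.
elim: l => [|k l ih] /=; first by rewrite mul1r divff// gt_eqF// (rd_h0 dH).
by rewrite ih /gk; field; apply/andP; split; rewrite gt_eqF// (rd_h0 dH).
Qed.

Lemma gibbs_word : exists2 C : R, 0 <= C & forall n (z : X), adm E z -> z 0%N = a -> z n = a ->
  M (\1_[set x : X | agree n.+1 z x]) <= C * expR (birkhoff phi n z - n%:R * rd_P d).
Proof.
have M0 := rd_hM0 dH; have c0 := rs_c0 dH.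
exists (rd_M d / rd_c d * expR D).
  by apply: mulr_ge0; [apply: divr_ge0 => //; exact: ltW|exact: expR_ge0].
move=> n z az z0 zn; set W : set X := [set x | agree n.+1 z x].
have cW : coord n.+1 W by move=> x y xy hx i hi; rewrite (hx i hi) xy.
have hW := bh_ind dH cW.
have [l [y0 [vl ln ez]]] := @decode S a E (rd_v0 d) (rd_cl d) n (exist _ z (conj az z0)) zn.
have iwE (y : L) : \1_W (sval y) = iw l y.
  rewrite indicE /iw; congr (nat_of_bool _)%:R; apply/idP/asboolP => [/set_mem h|[y' ->]].
    have yn : sval y n = a by rewrite -(h n).
    have [l' [y' [vl' ln' ey]]] := @decode S a E (rd_v0 d) (rd_cl d) n y yn.
    exists y'; rewrite {1}ey; congr (pres _ _).
    apply: (@decode_uniq S a E (rd_v0 d) (rd_cl d) n l' l y' y0) => //.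
    rewrite -ey -ez => i hi /=; rewrite -(h i)//; exact: ltnW.
  apply/mem_set => i; rewrite ltnS => hi.
  have -> : z = sval (pres l y0) by rewrite -ez.
  have := @agr_pres S a E (rd_v0 d) (rd_cl d) l 1 y0 y' (cagr1 y0 y').
  by apply; rewrite ln addn1 ltnS.
have hWY := bh_Y dH hW.
have [CJ CJ0 hJ] := J_exists dH; have [h1 a1] := hJ _ _ _ hW.
have JE : @JF S a E R phi d (\1_W) = op g (fun y : L => \1_W (sval y)).
  apply/funext => x; apply: eq_sm => k; have [vk|vk] := boolP (vdd k); last by rewrite gk_nvd// !mul0r.
  congr (_ * _); rewrite /loop_sum /birkhoff.
  case et : (tau L k) => [|t]; first by have := @tau_gt0 L k; rewrite et.
  rewrite big_ord_recl big1 ?addr0// => i _.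
  rewrite indicE memNset//= => h.
  have := @pre_ne S a E (rd_v0 d) (rd_cl d) k x i.+1 vk.
  have lt : (0 < i.+1 < tau L k)%N by rewrite et /= ltnS.
  have e : z 0%N = sval (pre k x) i.+1 by rewrite (h 0%N isT) /Defs.shift iter_shift_at add1n.
  by move=> /(_ lt); apply; rewrite -[LHS]/(sval (pre k x) i.+1) -e.
rewrite /MF JE (nu_op b0 th01 mw hg hWY) ler_pdivrMr ?(taumean_gt0 dH)//.
set RHS0 := _ * expR (_ - _).
have R0 : 0 <= RHS0.
  by apply: mulr_ge0; [apply: mulr_ge0; [apply: divr_ge0 => //; exact: ltW|exact: expR_ge0]|exact: expR_ge0].
apply: (@le_trans _ _ RHS0); last by rewrite ler_peMr//; exact: taumean_ge1 dH.
apply: (nu_le_iter b0 th01 mw hg (n := size l) hWY) => x.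
have -> : (fun y : L => \1_W (sval y)) = fun y => 1 * iw l y by apply/funext => y; rewrite mul1r iwE.
rewrite (iter_iw (fun=> 1))// mulr1 wgt_gk wgtE vl mul1r ln.
have adx := Yadm (pres l x).
have ag : agree n.+1 (sval (pres l x)) z.
  have -> : z = sval (pres l y0) by rewrite -ez.
  have := @agr_pres S a E (rd_v0 d) (rd_cl d) l 1 x y0 (cagr1 x y0).
  by rewrite ln addn1.
have := birkhoff_dist1 (rs_A0 dH) th01 (rs_holder dH) adx az ag.
rewrite ler_norml => /andP[_ hd].
rewrite /RHS0 -[leRHS]mulrA -expRD -mulrA mulrC; apply: ler_pM.
- by apply: divr_ge0; exact: ltW (rd_h0 dH _).
- exact: expR_ge0.
- apply: ler_pM; [exact: ltW (rd_h0 dH _)|by rewrite invr_ge0 ltW// (rd_h0 dH)|exact: rs_hM dH _|].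
  by rewrite lef_pV2 ?posrE ?(rd_h0 dH)// (rs_ch dH).
- by rewrite ler_expR; lra.
Qed.
End Gibbs.

Definition novisit k : set X := [set x | forall i, (i <= k)%N -> x i <> a].

Lemma coord_novisit k : coord k.+1 (novisit k).
Proof. by move=> x y xy h i hi; rewrite -xy ?ltnS//; exact: h. Qed.

Lemma M_novisit : exists2 C : R, 0 <= C & forall k, M (\1_(novisit k)) <= C / k.+1%:R.
Proof.
have [C C0 hC] := tau2_asm; exists C => // k.
apply: (MF_bound (B := fun n _ => (k.+1%:R)^-1 * (tau L n)%:R ^+ 2) (bh_ind dH (coord_novisit (k := k)))).
- by apply: divr_ge0.
- move=> n x _; rewrite /loop_sum /birkhoff.
  have [tk|kt] := leqP (tau L n) k.
    rewrite big1 ?mulr_ge0 ?invr_ge0 ?exprn_ge0// => i _.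
    rewrite indicE memNset// => /(_ (tau L n - i)%N).
    rewrite iter_shift_at subnK; last exact: ltnW.
    have -> : sval (pre n x) (tau L n) = a by rewrite -[tau L n]addn0 (pre_at (rd_cl d)) Y0.
    by apply=> //; apply: leq_trans (leq_subr _ _) tk.
  apply: (@le_trans _ _ (\sum_(i < tau L n) 1)).
    by apply: ler_sum => i _; rewrite indicE lern1 leq_b1.
  rewrite sumr_const card_ord mulrC ler_pdivlMr// expr2.
  by apply: ler_wpM2l => //; rewrite ler_nat.
- move=> x; have := asmZ (k.+1%:R)^-1 (hC x); rewrite ger0_norm ?invr_ge0// mulrC.
  by apply: eq_asm => n; rewrite mulrCA.
Qed.

Lemma loops_count : exists h C : R, [/\ 0 <= h, 0 <= C &
  asm (fun k => (vdd k)%:R * expR (- (h * (tau L k)%:R))) C].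
Proof.
have e0 := rs_ent0 dH.
have z0 : holder_with E 0 th (fun _ : X => 0%R : R) by move=> n _ x y _ _ _; rewrite subrr normr0 mul0r.
have hst n : (0 < n)%N -> (Zstar E (fun _ : X => 0%R : R) n a <= (1 * expR (rd_ent d * n%:R))%:E)%E.
  by move=> n0; apply: le_trans (@Zstar_le_Zn S a E R _ n) _; rewrite mul1r; exact: (rs_entP dH).
have i1 : 0 < 1 - expR (- 1 : R) by rewrite subr_gt0 expR_lt1; lra.
have := @Aw_moment S a E R 0 th (fun=> 0) (lexx 0) th01 z0 (rd_v0 d) (rd_cl d) (rd_ent d) 1 ler01 hst (rd_ent d + 1) 0 1 ltr01.
move=> /(_ _ (bpt L)) H.
exists (rd_ent d + 1), (expR (dist_cst 0 th) * (1 / (1 - expR (- 1)))); split.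
- by lra.
- by apply: mulr_ge0; [exact: expR_ge0|apply: divr_ge0 => //; exact: ltW].
- apply: eq_asm (H _) => [k|]; last lra.
  by rewrite /Aw mul0r expR0 mulr1 /birkhoff big1// add0r.
Qed.

Lemma M_phi_neg : exists2 C : R, 0 <= C & forall N : nat, exists K Df,
  bhh K Df (fun x => Num.min (Num.max 0 (- phi x)) N%:R) /\
  M (fun x => Num.min (Num.max 0 (- phi x)) N%:R) <= C.
Proof.
have [h [Cl [h0 Cl0 hCl]]] := loops_count.
have om0 := rs_om0 dH; have M0 := rd_hM0 dH; have c0 := rs_c0 dH; have /andP[t0 t1] := th01.
have K0 : 0 <= rd_K d := asm_ge0 (rs_mom dH (bpt L)).
pose q : R := `|rd_sup d| + `|rd_P d| + h.
have q0 : 0 <= q by rewrite !addr_ge0.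
have mc0 : 0 <= rd_M d / rd_c d by rewrite divr_ge0// ?ltW.
pose C := rd_M d / rd_c d * (q / rd_om d * rd_K d + Cl).
have C0 : 0 <= C.
  apply: mulr_ge0 => //; apply: addr_ge0 => //; apply: mulr_ge0 => //.
  by rewrite divr_ge0// ?ltW.
exists C => // N.
pose F (x : X) := Num.min (Num.max 0 (- phi x)) N%:R.
have F01 x : 0 <= F x <= N%:R by rewrite /F le_min ge_min le_max lexx ler0n lexx orbT.
have Flip x y : `|F x - F y| <= `|phi x - phi y|.
  by apply: le_trans (clip_lip _ _ _) _; rewrite (_ : - phi x - - phi y = - (phi x - phi y)) ?normrN//; ring.
pose Df := rd_A d + 2 * N%:R / th ^+ 2.
have t2 : 0 < th ^+ 2 by exact: exprn_gt0.
have hF : bhh N%:R Df F.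
  split=> //.
  - by apply: addr_ge0; [exact: rs_A0 dH|apply: divr_ge0; [exact: mulr_ge0|exact: ltW]].
  - by move=> x _; have /andP[f1 f2] := F01 x; rewrite ger0_norm.
  move=> n x y hx hy xy; have [n2|n2] := leqP 2 n.
    apply: le_trans (Flip x y) _; apply: le_trans (rs_holder dH n2 hx hy xy) _.
    apply: ler_wpM2r; first by rewrite exprn_ge0 ?ltW.
    by rewrite lerDl; apply: divr_ge0; [exact: mulr_ge0|exact: ltW].
  apply: (@le_trans _ _ (2 * N%:R)).
    by have /andP[f1 f2] := F01 x; have /andP[f3 f4] := F01 y; rewrite ler_norml; apply/andP; clear -f1 f2 f3 f4; lra.
  apply: (@le_trans _ _ (2 * N%:R / th ^+ 2 * th ^+ n)); last first.
    apply: ler_wpM2r; first by rewrite exprn_ge0 ?ltW.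
    by rewrite lerDr; exact: rs_A0 dH.
  rewrite -[2 * N%:R / _ * _]mulrA ler_peMr; [by []|exact: mulr_ge0|].
  rewrite mulrC ler_pdivlMr// mul1r.
  by apply: ler_wiXn2l; [exact: ltW|exact: ltW|exact: ltnW].
exists N%:R, Df; split=> //.
apply: (MF_bound (B := fun n x => `|rd_sup d| * (tau L n)%:R - birkhoff phi (tau L n) (sval (pre n x))) hF C0).
  move=> n x _; rewrite /loop_sum /birkhoff.
  have -> : `|rd_sup d| * (tau L n)%:R = \sum_(i < tau L n) `|rd_sup d| by rewrite sumr_const card_ord mulr_natr.
  rewrite -sumrB; apply: ler_sum => i _; have hx := adm_iter i (Yadm (pre n x)).
  have p1 := rs_supP dH hx; have p2 := ler_norm (rd_sup d); have p3 := normr_ge0 (rd_sup d).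
  by rewrite /F ge_min ge_max; apply/orP; left; apply/andP; clear -p1 p2 p3; lra.
move=> x.
have a1 := asmZ (q / rd_om d) (rs_mom dH x); have a2 := asmZ (rd_M d / rd_c d) (asmD a1 hCl).
rewrite (ger0_norm mc0) in a2; rewrite ger0_norm in a2; last by rewrite divr_ge0// ?ltW.
apply: asm_le a2 => n; have [vn|vn] := boolP (vdd n); last first.
  rewrite gk_nvd// mul0r normr0; apply: mulr_ge0 => //; rewrite mul0r addr0.
  by apply: mulr_ge0; [apply: divr_ge0 => //; exact: ltW|apply: mulr_ge0; [exact: Aw_ge0|exact: expR_ge0]].
set t : R := (tau L n)%:R; set z := birkhoff phi _ _.
have tt0 : 0 <= t by [].
have B0 : 0 <= `|rd_sup d| * t - z.
  have := birkhoff_le_sup (rs_supP dH) (tau L n) (Yadm (pre n x)).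
  have : rd_sup d * t <= `|rd_sup d| * t by apply: ler_wpM2r => //; exact: ler_norm.
  by rewrite -/t /z; lra.
have g0 := gk_ge0 dH n x.
rewrite ger0_norm; last exact: mulr_ge0.
have A0 : 0 <= AW n x by exact: Aw_ge0.
have gA : g n x <= rd_M d / rd_c d * AW n x.
  have -> : g n x = (rd_h (pre n x) / rd_h x) * AW n x by rewrite /gk; ring.
  apply: ler_wpM2r => //; apply: ler_pM.
  - exact: ltW (rd_h0 dH _).
  - by rewrite invr_ge0 ltW// (rd_h0 dH).
  - exact: rs_hM dH _.
  - by rewrite lef_pV2 ?posrE ?(rd_h0 dH)// (rs_ch dH).
apply: le_trans (ler_wpM2r B0 gA) _; rewrite -[leLHS]mulrA; apply: (ler_wpM2l mc0).
rewrite mul1r.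
have AE : AW n x = expR (z - rd_P d * t) by rewrite /Aw vn mul1r.
have m1 := mulln_le (z - rd_P d * t) (h * t); rewrite -AE in m1.
have m2 : rd_om d * t <= expR (rd_om d * t) by apply: le_trans (expR_ge1Dx _); rewrite lerDr.
have m3 : q * t * AW n x <= q / rd_om d * (AW n x * expR (rd_om d * t)).
  have -> : q * t * AW n x = q / rd_om d * (AW n x * (rd_om d * t)) by field; rewrite gt_eqF.
  apply: ler_wpM2l; first by rewrite divr_ge0// ?ltW.
  exact: ler_wpM2l.
have m4 : (`|rd_sup d| - rd_P d + h) * t * AW n x <= q * t * AW n x.
  apply: ler_wpM2r => //; apply: ler_wpM2r => //; rewrite /q.
  by rewrite lerD2r lerD2l -normrN; exact: ler_norm.
by lra.
Qed.

Definition sym_set (s : S) : set X := [set x | x 0%N = s].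

Lemma coord_sym_set s : coord 1 (sym_set s).
Proof. by move=> x y xy /= <-; rewrite xy. Qed.

Lemma loop_letter n (x : L) i : (i < tau L n)%N -> sval (pre n x) i \in a :: lw n.
Proof.
by move=> hi; rewrite /= /cpre /= /catq hi mem_nth.
Qed.

Lemma min_loop : exists r : S -> nat, forall s,
  (forall k, vdd k -> s \in a :: lw k -> (r s <= tau L k)%N) /\
  ((exists k, [/\ vdd k, s \in a :: lw k & r s = tau L k]) \/ M (\1_(sym_set s)) = 0).
Proof.
suff /choice[r hr] : forall s, exists r : nat,
  (forall k, vdd k -> s \in a :: lw k -> (r <= tau L k)%N) /\
  ((exists k, [/\ vdd k, s \in a :: lw k & r = tau L k]) \/ M (\1_(sym_set s)) = 0) by exists r.
move=> s.
have [ex|nex] := pselect (exists n, `[< exists k, [/\ vdd k, s \in a :: lw k & n = tau L k] >]).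
  case: (ex_minnP ex) => r /asboolP hr rmin; exists r; split; last by left.
  by move=> k vk sk; apply: rmin; apply/asboolP; exists k.
exists 0%N; split=> //; right.
apply/eqP; rewrite eq_le; apply/andP; split; last first.
  by apply: (MF_ge0 dH (bh_ind dH (coord_sym_set (s := s)))) => x _; rewrite indicE.
apply: (MF_bound (B := fun _ _ => 0) (bh_ind dH (coord_sym_set (s := s)))) => //.
  move=> n x vn; rewrite /loop_sum /birkhoff big1// => i _.
  rewrite indicE memNset//= /sym_set /= iter_shift_at add0n => e.
  apply: nex; exists (tau L n); apply/asboolP; exists n; split=> //.
  by rewrite -e; exact: loop_letter.
by move=> x N; rewrite big1// => i _; rewrite mulr0 normr0.
Qed.

Lemma M_symbols_eta : exists2 C : R, 0 <= C & forall U : seq S, uniq U ->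
  \sum_(s <- U) etaf (M (\1_(sym_set s))) <= C.
Proof.
have [r hr] := min_loop.
have [h [Cl [h0 Cl0 hCl]]] := loops_count.
have [C C0 hC] := tau2_asm.
pose P s := M (\1_(sym_set s)).
have P0 s : 0 <= P s by apply: (MF_ge0 dH (bh_ind dH (coord_sym_set (s := s)))) => x _; rewrite indicE.
have sumr U : uniq U -> \sum_(s <- U) P s * (r s)%:R <= C.
  move=> uU.
  pose u k : S := nth a U k.
  pose F (x : X) : R := \sum_(k < size U) (r (u k))%:R * \1_(sym_set (u k)) x.
  have hb k (_ : (k < size U)%N) : exists K D, bhh K D (fun x => (r (u k))%:R * \1_(sym_set (u k)) x).
    by do 2 eexists; exact: bhZ (bh_ind dH (coord_sym_set (s := u k))).
  have [K [Df hF]] := bh_sum hb.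
  have -> : \sum_(s <- U) P s * (r s)%:R = M F.
    rewrite (MF_sum dH hb) (big_nth a) big_mkord; apply: eq_bigr => k _.
    by rewrite (MFZ dH _ (bh_ind dH (coord_sym_set (s := u k)))) mulrC.
  apply: (MF_bound (B := fun n _ => (tau L n)%:R ^+ 2) hF C0) => // n x vn.
  rewrite /loop_sum /birkhoff expr2.
  apply: (@le_trans _ _ (\sum_(i < tau L n) (tau L n)%:R)); last by rewrite sumr_const card_ord mulr_natr.
  apply: ler_sum => i _; rewrite /F.
  set s := sval (pre n x) i.
  have sE k : \1_(sym_set (u k)) (iter i sh (sval (pre n x))) = (u k == s)%:R :> R.
    rewrite indicE; congr (nat_of_bool _)%:R; apply/idP/eqP => [/set_mem|e].
      by rewrite /sym_set /mkset iter_shift_at add0n -/s => e; rewrite e.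
    by apply/mem_set; rewrite /sym_set /mkset iter_shift_at add0n -/s e.
  have [sU|sU] := boolP (s \in U); last first.
    rewrite big1// => k _; rewrite sE; case: eqP => [e|]; rewrite ?mulr0//.
    by move/negP: sU; case; rewrite -e mem_nth.
  have iU : (index s U < size U)%N by rewrite index_mem.
  rewrite (bigD1 (Ordinal iU))//= sE /u nth_index// eqxx mulr1 big1 ?addr0.
    by rewrite ler_nat; apply: (hr s).1 => //; exact: loop_letter.
  move=> k ne; rewrite sE; case: eqP => [e|]; rewrite ?mulr0//.
  by move/eqP: ne; case; apply: val_inj => /=; rewrite -e /u index_uniq.
have sume U : uniq U -> \sum_(s <- U | P s != 0) expR (- ((h + 1) * (r s)%:R)) <= Cl.
  move=> uU.
  have ex s : exists k, P s != 0 -> [/\ vdd k, s \in a :: lw k & r s = tau L k].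
    have [_ [[k hk]|e]] := hr s; first by exists k.
    by exists 0%N; rewrite /P e eqxx.
  have [kk hkk] := choice ex.
  pose N := (\max_(s <- U) (kk s)).+1.
  have kN s : s \in U -> (kk s < N)%N by move=> sU; rewrite ltnS; apply: leq_bigmax_seq.
  apply: le_trans (hCl N).
  apply: (@le_trans _ _ (\sum_(s <- U | P s != 0) \sum_(k < N) (vdd k)%:R * (s \in a :: lw k)%:R * expR (- ((h + 1) * (tau L k)%:R)))).
    rewrite big_seq_cond [leRHS]big_seq_cond; apply: ler_sum => s /andP[sU Ps].
    have [v1 v2 v3] := hkk s Ps.
    rewrite (bigD1 (Ordinal (kN s sU)))//= v1 v2 !mul1r v3 lerDl; apply: sumr_ge0 => k _.
    by rewrite !mulr_ge0// expR_ge0.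
  rewrite exchange_big/=; apply: ler_sum => k _.
  rewrite ger0_norm ?mulr_ge0 ?expR_ge0//.
  under eq_bigr do rewrite -mulrA; rewrite -mulr_sumr; apply: ler_wpM2l => //.
  rewrite -mulr_suml.
  have h1 : \sum_(s <- U | P s != 0) (s \in a :: lw k)%:R <= (tau L k)%:R :> R.
    rewrite -natr_sum ler_nat.
    apply: (@leq_trans (\sum_(s <- U) (s \in a :: lw k))%N).
      by rewrite [leqRHS](bigID (fun s => P s != 0))/= leq_addr.
    have -> : (\sum_(s <- U) (s \in a :: lw k) = count (mem (a :: lw k)) U)%N.
      by rewrite -sum1_count [RHS]big_mkcond/=; apply: eq_bigr => s _; case: (s \in _).
    rewrite -size_filter -[tau L k]/(size (a :: lw k)); apply: uniq_leq_size; first exact: filter_uniq.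
    by move=> s; rewrite mem_filter => /andP[].
  have h2 : expR (- ((h + 1) * (tau L k)%:R)) = expR (- (h * (tau L k)%:R)) / expR (tau L k)%:R.
    by rewrite -expRN -expRD; congr expR; ring.
  apply: le_trans (ler_wpM2r (expR_ge0 _) h1) _.
  rewrite h2 mulrA ler_pdivrMr ?expR_gt0// mulrC; apply: ler_wpM2l; first exact: expR_ge0.
  by apply: le_trans (expR_ge1Dx _); rewrite lerDr.
exists ((h + 1) * C + Cl); first by rewrite addr_ge0// mulr_ge0// addr_ge0.
move=> U uU.
apply: (@le_trans _ _ (\sum_(s <- U | P s != 0) (P s * ((h + 1) * (r s)%:R) + expR (- ((h + 1) * (r s)%:R))))).
  rewrite (bigID (fun s => P s != 0))/= [X in _ + X]big1 ?addr0; last first.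
    by move=> s /negbNE/eqP; rewrite -/(P s) => ->; rewrite /etaf lexx.
  by apply: ler_sum => s _; exact: eta_le (P0 s).
rewrite big_split/=; apply: lerD; last exact: sume.
apply: le_trans (ler_wpM2l _ (sumr U uU)); last by rewrite addr_ge0.
rewrite mulr_sumr [leRHS](bigID (fun s => P s != 0))/=.
apply: (@le_trans _ _ (\sum_(s <- U | P s != 0) (h + 1) * (P s * (r s)%:R))).
  by apply: ler_sum => s _; rewrite mulrCA.
rewrite lerDl; apply: sumr_ge0 => s _.
by apply: mulr_ge0; [exact: addr_ge0|exact: mulr_ge0 (P0 s) (ler0n _ _)].
Qed.

End Estimates.

(** * Entropy of finite partitions *)

Section EtaFun.
Variable R : realType.
Implicit Types u v x : R.

Lemma etafE u : 0 <= u -> etaf u = - (u * ln u).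
Proof.
move=> u0; rewrite /etaf; case: (leP u 0) => // u1.
have -> : u = 0 by lra.
by rewrite mul0r oppr0.
Qed.

Lemma etaf0 : etaf (0 : R) = 0. Proof. by rewrite /etaf lexx. Qed.

Lemma etaf_ge0 u : u <= 1 -> 0 <= etaf u.
Proof.
move=> u1; rewrite /etaf; case: (leP u 0) => // u0.
by rewrite oppr_ge0; apply: mulr_ge0_le0; [exact: ltW|exact: ln_le0].
Qed.

Lemma etaf_sub u v : 0 <= u -> 0 <= v -> etaf (u + v) <= etaf u + etaf v.
Proof.
move=> u0 v0.
have [->|un] := eqVneq u 0; first by rewrite add0r etaf0 add0r.
have [->|vn] := eqVneq v 0; first by rewrite addr0 etaf0 addr0.
have up : 0 < u by rewrite lt_neqAle eq_sym un.
have vp : 0 < v by rewrite lt_neqAle eq_sym vn.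
have uv : 0 < u + v by lra.
rewrite !etafE ?addr_ge0//.
have l1 : ln u <= ln (u + v) by rewrite ler_ln ?posrE//; lra.
have l2 : ln v <= ln (u + v) by rewrite ler_ln ?posrE//; lra.
have h1 := ler_wpM2l u0 l1; have h2 := ler_wpM2l v0 l2.
by rewrite mulrDl; lra.
Qed.

Lemma etaf_sum (I : Type) (s : seq I) (P : pred I) (p : I -> R) : (forall i, 0 <= p i) ->
  etaf (\sum_(i <- s | P i) p i) <= \sum_(i <- s | P i) etaf (p i).
Proof.
move=> p0; elim: s => [|i s ih]; first by rewrite !big_nil etaf0.
rewrite !big_cons; case: ifP => // _.
apply: le_trans (etaf_sub (p0 i) _) _; first by apply: sumr_ge0.
by rewrite lerD2l.
Qed.

Lemma etaf_gibbs (p a b c : R) : 0 <= p -> 0 <= a -> 0 <= b -> 0 <= c ->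
  (0 < p -> [/\ 0 < a, 0 < b & 0 < c]) ->
  etaf p <= - (p * ln a) - p * ln b + p * ln c + a * b / c - p.
Proof.
move=> p0 a0 b0 c0 h; rewrite etafE//.
have [->|pn] := eqVneq p 0.
  have q : 0 <= a * b / c by apply: divr_ge0 => //; exact: mulr_ge0.
  by rewrite !mul0r; lra.
have pp : 0 < p by rewrite lt_neqAle eq_sym pn.
have [ap bp cp] := h pp.
have q : 0 < a * b / c / p by apply: divr_gt0 => //; apply: divr_gt0 => //; exact: mulr_gt0.
have := le_ln1Dx (x := a * b / c / p - 1).
have -> : 1 + (a * b / c / p - 1) = a * b / c / p by ring.
have -> : ln (a * b / c / p) = ln a + ln b - ln c - ln p.
  have ab : 0 < a * b := mulr_gt0 ap bp; have abc := divr_gt0 ab cp.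
  by rewrite ln_div ?posrE// ln_div ?posrE// lnM ?posrE.
have hq : -1 < a * b / c / p - 1 by lra.
move=> /(_ hq) hl.
have := ler_wpM2l p0 hl; rewrite [p * (_ / p - 1)]mulrBr mulrCA divff ?gt_eqF// !mulr1.
by rewrite !mulrBr mulrDr; lra.
Qed.
End EtaFun.

Section Partitions.
Variables (d : measure_display) (T : measurableType d) (R : realType) (m : probability T R).
Local Notation pm := (pr m).

Definition mpart (A : finType) (f : T -> A) := forall i, measurable (f @^-1` [set i]).

Definition Hf (A : finType) (f : T -> A) : R := \sum_i etaf (pm (f @^-1` [set i])).

Lemma mpart_set (A : finType) (f : T -> A) (P : pred A) : mpart f -> measurable [set x | P (f x)].
Proof.
move=> hf; have -> : [set x | P (f x)] = \bigcup_(i in [set i | P i]) (f @^-1` [set i]).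
  by apply/seteqP; split=> x /= [] => [h|i Pi ->//]; exists (f x).
by apply: fin_bigcup_measurable => // i _; exact: hf.
Qed.

Lemma mpart_comp (A B : finType) (e : A -> B) (f : T -> A) : mpart f -> mpart (fun x => e (f x)).
Proof.
move=> hf b; have := mpart_set (fun i => e i == b) hf.
by congr measurable; apply/seteqP; split=> x /= /eqP.
Qed.

Lemma mpart_pair (A B : finType) (f : T -> A) (g : T -> B) : mpart f -> mpart g ->
  mpart (fun x => (f x, g x)).
Proof.
move=> hf hg [i j]; have := measurableI _ _ (hf i) (hg j).
by congr measurable; apply/seteqP; split=> x /= [-> ->].
Qed.

Lemma pr_part (A : finType) (f : T -> A) B : mpart f -> measurable B ->
  pm B = \sum_i pm (B `&` (f @^-1` [set i])).
Proof.
move=> hf mB.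
suff key s : uniq s -> pm (B `&` [set x | f x \in s]) = \sum_(i <- s) pm (B `&` (f @^-1` [set i])).
  have := key (index_enum A) (index_enum_uniq A); rewrite /=.
  rewrite (_ : B `&` [set x | f x \in index_enum A] = B)//.
  by apply/seteqP; split=> [x []//|x Bx]; split=> //=; rewrite mem_index_enum.
elim: s => [|i s ih] /=.
  rewrite big_nil => _; rewrite (_ : B `&` _ = set0) ?pr0//.
  by apply/seteqP; split=> x //= [].
move=> /andP[si us]; rewrite big_cons -ih// -prU.
- rewrite -setIUr; congr (pm (B `&` _)); apply/seteqP; split=> x /=; rewrite inE.
    by case/orP => [/eqP|]; [left|right].
  by case=> [->|->]; rewrite ?eqxx ?orbT.
- by apply: measurableI.
- by apply: measurableI => //; apply: (mpart_set (fun i => i \in s) hf).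
- apply/seteqP; split=> x //= [[_ e] [_]]; rewrite e => si'.
  by rewrite si' in si.
Qed.

Lemma pr_marg (A B : finType) (f : T -> A) (e : A -> B) b : mpart f ->
  pm ((fun x => e (f x)) @^-1` [set b]) = \sum_(i | e i == b) pm (f @^-1` [set i]).
Proof.
move=> hf; rewrite (pr_part hf (mpart_comp e hf b)) [RHS]big_mkcond/=.
apply: eq_bigr => i _; case: eqP => [eb|ne].
  by congr pr; apply/seteqP; split=> x /= => [[]//|->]; split.
rewrite (_ : _ `&` _ = set0) ?pr0//; apply/seteqP; split=> x //= [h1 h2].
by apply: ne; rewrite -h2.
Qed.

Lemma Hf_ge0 (A : finType) (f : T -> A) : mpart f -> 0 <= Hf f.
Proof. by move=> hf; apply: sumr_ge0 => i _; apply: etaf_ge0; exact: pr_le1. Qed.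

Lemma Hf_comp_le (A B : finType) (f : T -> A) (e : A -> B) : mpart f -> Hf (fun x => e (f x)) <= Hf f.
Proof.
move=> hf; rewrite /Hf.
apply: (@le_trans _ _ (\sum_b \sum_(i | e i == b) etaf (pm (f @^-1` [set i])))).
  by apply: ler_sum => b _; rewrite pr_marg//; apply: etaf_sum => i; exact: pr_ge0.
by rewrite (exchange_big_dep xpredT)//=; apply: ler_sum => i _; rewrite (big_pred1 (e i)).
Qed.

Lemma Hf_inj (A B : finType) (f : T -> A) (e : A -> B) : mpart f -> injective e ->
  Hf (fun x => e (f x)) = Hf f.
Proof.
move=> hf ei; apply/eqP; rewrite eq_le Hf_comp_le//=.
have [a0 _|na] := pickP (fun _ : A => true); last first.
  by rewrite /Hf [leLHS]big1 => [|i]; [apply: (Hf_ge0 (mpart_comp e hf))|have := na i].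
pose e' b := odflt a0 [pick i | e i == b].
have ee i : e' (e i) = i.
  by rewrite /e'; case: pickP => [j /eqP/ei|/(_ i)]//=; rewrite eqxx.
rewrite -[leLHS](_ : Hf (fun x => e' (e (f x))) = _); last by congr Hf; apply/funext => x; rewrite ee.
exact: (Hf_comp_le e' (mpart_comp e hf)).
Qed.

Lemma Hf_submod (A B C : finType) (f : T -> A) (g : T -> B) (k : T -> C) :
  mpart f -> mpart g -> mpart k ->
  Hf (fun x => (f x, g x, k x)) + Hf k <= Hf (fun x => (f x, k x)) + Hf (fun x => (g x, k x)).
Proof.
move=> hf hg hk.
have hfgk := mpart_pair (mpart_pair hf hg) hk.
pose p (t : A * B * C) := pm ((fun x => (f x, g x, k x)) @^-1` [set t]).
pose pac (t : A * C) := pm ((fun x => (f x, k x)) @^-1` [set t]).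
pose pbc (t : B * C) := pm ((fun x => (g x, k x)) @^-1` [set t]).
pose pc c := pm (k @^-1` [set c]).
have p0 t : 0 <= p t by exact: pr_ge0.
have eac t : pac t = \sum_(u | (u.1.1, u.2) == t) p u := pr_marg (fun u => (u.1.1, u.2)) t hfgk.
have ebc t : pbc t = \sum_(u | (u.1.2, u.2) == t) p u := pr_marg (fun u => (u.1.2, u.2)) t hfgk.
have ec c : pc c = \sum_(u | u.2 == c) p u := pr_marg (fun u => u.2) c hfgk.
have eca c : pc c = \sum_(u | u.2 == c) pac u := pr_marg (fun u => u.2) c (mpart_pair hf hk).
have ecb c : pc c = \sum_(u | u.2 == c) pbc u := pr_marg (fun u => u.2) c (mpart_pair hg hk).
have le_sum (I : finType) (q : I -> R) (Q : pred I) u : (forall u, 0 <= q u) -> Q u -> q u <= \sum_(v | Q v) q v.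
  by move=> q0 Qu; rewrite (bigD1 u)//= lerDl; apply: sumr_ge0.
have key : Hf (fun x => (f x, g x, k x)) <= \sum_u (- (p u * ln (pac (u.1.1, u.2))) - p u * ln (pbc (u.1.2, u.2))
     + p u * ln (pc u.2) + pac (u.1.1, u.2) * pbc (u.1.2, u.2) / pc u.2 - p u).
  apply: ler_sum => u _; apply: etaf_gibbs; rewrite ?pr_ge0// => pu.
  split; apply: (lt_le_trans pu).
  - by rewrite eac; apply: le_sum.
  - by rewrite ebc; apply: le_sum.
  - by rewrite -/(pc u.2) ec; apply: le_sum.
have Hk : Hf k = - \sum_u p u * ln (pc u.2).
  rewrite /Hf -sumrN (partition_big (fun u => u.2) xpredT)//=.
  apply: eq_bigr => c _; rewrite etafE ?pr_ge0// -/(pc c) {1}ec -mulNr -sumrN mulr_suml.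
  by apply: eq_bigr => u /eqP ->; rewrite mulNr.
have Hac : Hf (fun x => (f x, k x)) = - \sum_u p u * ln (pac (u.1.1, u.2)).
  rewrite /Hf -sumrN (partition_big (fun u : A * B * C => (u.1.1, u.2)) xpredT)//=.
  apply: eq_bigr => c _; rewrite etafE ?pr_ge0// -/(pac c) {1}eac -mulNr -sumrN mulr_suml.
  by apply: eq_bigr => u /eqP ->; rewrite mulNr.
have Hbc : Hf (fun x => (g x, k x)) = - \sum_u p u * ln (pbc (u.1.2, u.2)).
  rewrite /Hf -sumrN (partition_big (fun u : A * B * C => (u.1.2, u.2)) xpredT)//=.
  apply: eq_bigr => c _; rewrite etafE ?pr_ge0// -/(pbc c) {1}ebc -mulNr -sumrN mulr_suml.
  by apply: eq_bigr => u /eqP ->; rewrite mulNr.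
have S1 : \sum_u p u = \sum_c pc c.
  by rewrite (partition_big (fun u => u.2) xpredT)//=; apply: eq_bigr => c _; rewrite ec.
have S2 : \sum_(u : A * B * C) pac (u.1.1, u.2) * pbc (u.1.2, u.2) / pc u.2 = \sum_c pc c.
  rewrite (partition_big (fun u : A * B * C => u.2) xpredT)//=; apply: eq_bigr => c _.
  have sa : pc c = \sum_i pac (i, c).
    rewrite eca (reindex_onto (fun i => (i, c)) (fun u => u.1)) => [|[i c'] /= /eqP ->//].
    by apply: eq_big => [i|i _]//=; rewrite !eqxx.
  have sb : pc c = \sum_i pbc (i, c).
    rewrite ecb (reindex_onto (fun i => (i, c)) (fun u => u.1)) => [|[i c'] /= /eqP ->//].
    by apply: eq_big => [i|i _]//=; rewrite !eqxx.
  rewrite (reindex_onto (fun v : A * B => (v, c)) (fun u => u.1)) => [|[i c'] /= /eqP ->//].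
  transitivity (\sum_(v : A * B) pac (v.1, c) * pbc (v.2, c) / pc c).
    by apply: eq_big => [v|v _]//=; rewrite !eqxx.
  rewrite -mulr_suml -(pair_big xpredT xpredT (fun i j => pac (i, c) * pbc (j, c)))/=.
  under eq_bigr do rewrite -mulr_sumr -sb.
  rewrite -mulr_suml -sa; have [->|n0] := eqVneq (pc c) 0; first by rewrite !mul0r.
  by rewrite mulfK.
move: key; rewrite sumrB !big_split/= !sumrN S1 S2 -Hac -Hbc.
have -> : \sum_u p u * ln (pc u.2) = - Hf k by rewrite Hk opprK.
lra.
Qed.

Section Itineraries.
Variable sh : T -> T.
Hypothesis msh : forall B, measurable B -> measurable (sh @^-1` B).
Hypothesis ish : forall B, measurable B -> pm (sh @^-1` B) = pm B.

Lemma iter_meas n B : measurable B -> measurable (iter n sh @^-1` B) /\ pm (iter n sh @^-1` B) = pm B.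
Proof.
elim: n B => [|n ih] B mB //.
have [h1 h2] := ih _ (msh mB).
split; first by have := h1; congr measurable; apply/seteqP; split.
by rewrite -(ish mB) -h2; congr pr; apply/seteqP; split.
Qed.

Lemma mpart_iter n (A : finType) (f : T -> A) : mpart f -> mpart (fun x => f (iter n sh x)).
Proof. by move=> hf i; have [h _] := iter_meas n (hf i). Qed.

Lemma Hf_iter n (A : finType) (f : T -> A) : mpart f -> Hf (fun x => f (iter n sh x)) = Hf f.
Proof. by move=> hf; apply: eq_bigr => i _; have [_ <-] := iter_meas n (hf i). Qed.

Definition itin (A : finType) (f : T -> A) n (x : T) : n.-tuple A := [tuple f (iter j sh x) | j < n].

Lemma itinS (A : finType) (f : T -> A) n x : itin f n.+1 x = [tuple of rcons (itin f n x) (f (iter n sh x))].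
Proof.
apply: eq_from_tnth => j; rewrite tnth_mktuple (tnth_nth (f x)).
rewrite -[nth _ _ _]/(nth (f x) (rcons (itin f n x) (f (iter n sh x))) j) nth_rcons size_tuple.
have [jn|nj] := ltnP j n.
  by rewrite -[nth _ _ _]/(nth (f x) (itin f n x) (Ordinal jn)) -tnth_nth tnth_mktuple.
have jn : nat_of_ord j = n by apply/eqP; rewrite eqn_leq nj -ltnS ltn_ord.
by rewrite jn eqxx.
Qed.

Lemma mpart_itin (A : finType) (f : T -> A) n : mpart f -> mpart (itin f n).
Proof.
move=> hf; elim: n => [|n ih].
  move=> t; rewrite (_ : _ @^-1` _ = setT)//; apply/seteqP; split=> // x _ /=.
  by rewrite [t]tuple0 [itin f 0 x]tuple0.
have := mpart_comp (fun u : n.-tuple A * A => [tuple of rcons u.1 u.2]) (mpart_pair ih (mpart_iter n hf)).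
by congr mpart; apply/funext => x; rewrite itinS.
Qed.

Lemma rcons_inj2 (A : finType) n : injective (fun u : n.-tuple A * A => [tuple of rcons u.1 u.2]).
Proof.
move=> [t i] [t' i'] /(congr1 val)/= /rcons_inj[e ->].
by congr pair; exact: val_inj.
Qed.

Lemma Hf_itinS (A : finType) (f : T -> A) n : mpart f ->
  Hf (itin f n.+1) = Hf (fun x => (itin f n x, f (iter n sh x))).
Proof.
move=> hf; rewrite -(Hf_inj (mpart_pair (mpart_itin (n := n) hf) (mpart_iter n hf)) (@rcons_inj2 A n)).
by congr Hf; apply/funext => x; rewrite itinS.
Qed.

Lemma Hf_itin_cond (A B : finType) (f : T -> A) (g : T -> B) n : mpart f -> mpart g ->
  Hf (fun x => (itin f n x, itin g n x)) - Hf (itin g n) <= n%:R * (Hf (fun x => (f x, g x)) - Hf g).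
Proof.
move=> hf hg; elim: n => [|n ih].
  rewrite mul0r; rewrite (_ : Hf _ = Hf (itin g 0)) ?subrr//.
  rewrite -(Hf_inj (mpart_itin (n := 0%N) hg) (e := fun t => ([tuple] : 0.-tuple A, t))) => [|t t' []//].
  by congr Hf; apply/funext => x; rewrite [itin f 0 x]tuple0.
have ha := mpart_itin (n := n) hf; have hb := mpart_itin (n := n) hg.
have hf' := mpart_iter n hf; have hg' := mpart_iter n hg.
have e1 : Hf (fun x => (itin f n.+1 x, itin g n.+1 x)) =
  Hf (fun x => (((itin f n x, itin g n x), f (iter n sh x)), g (iter n sh x))).
  rewrite -(Hf_inj (mpart_pair (mpart_pair (mpart_pair ha hb) hf') hg')
    (e := fun u : n.-tuple A * n.-tuple B * A * B => ([tuple of rcons u.1.1.1 u.1.2], [tuple of rcons u.1.1.2 u.2]))).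
    by congr Hf; apply/funext => x; rewrite !itinS.
  move=> [[[t s] i] j] [[[t' s'] i'] j'] /= [e1 e2].
  have [ta ia] := rcons_inj e1; have [sb jb] := rcons_inj e2.
  by rewrite ia jb (val_inj ta) (val_inj sb).
have s1 := Hf_submod (mpart_pair ha hb) hf' hg'.
have s2 := Hf_submod ha hg' hb.
have e2 : Hf (fun x => ((itin f n x, itin g n x), g (iter n sh x))) =
  Hf (fun x => (itin f n x, g (iter n sh x), itin g n x)).
  rewrite -(Hf_inj (mpart_pair (mpart_pair ha hg') hb) (e := fun u : n.-tuple A * B * n.-tuple B => (u.1.1, u.2, u.1.2)))//.
  by move=> [[t i] s] [[t' i'] s'] /= [-> -> ->].
have e3 : Hf (fun x => (g (iter n sh x), itin g n x)) = Hf (itin g n.+1).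
  rewrite Hf_itinS// -(Hf_inj (mpart_pair hb hg') (e := fun u => (u.2, u.1)))//.
  by move=> [t i] [t' i'] /= [-> ->].
have e4 : Hf (fun x => (f (iter n sh x), g (iter n sh x))) = Hf (fun x => (f x, g x)).
  exact: (Hf_iter n (mpart_pair hf hg)).
have e5 := Hf_iter n hg.
by rewrite e1 -natr1 mulrDl mul1r; move: s1 s2 ih; rewrite e2 e3 e4 e5; lra.
Qed.

End Itineraries.
End Partitions.

(** * Upper bound of the variational principle *)

Section InvariantIntegrals.
Variables (S : countType) (a : S) (E : rel S) (R : realType) (m : probability (Sig a) R).
Hypothesis hm : invariant_prob E m.
Local Notation X := (Sig a).
Local Notation sh := (@Defs.shift S a).
Let madm : m [set x : X | adm E x] = 1%E := hm.1.
Let msh := @meas_shift S a.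

Lemma ae_adm : (\forall x \ae m, adm E x).
Proof.
exists (~` [set x : X | adm E x]); split=> //.
- by apply: measurableC; exact: meas_adm.
- by have := probability_setC m (@meas_adm S a E); rewrite madm subee.
Qed.

Lemma ge0_integral_shift (f : X -> \bar R) : measurable_fun setT f -> (forall x, 0 <= f x)%E ->
  (\int[m]_x f (sh x) = \int[m]_x f x)%E.
Proof.
move=> mf f0; have := ge0_integral_pushforward msh m (D := setT) measurableT mf (fun x _ => f0 x).
rewrite preimage_setT => <-; apply: eq_measure_integral => A mA _; exact: hm.2.
Qed.

Lemma ib_shift (F : X -> R) : ib E m F ->
  ib E m (fun x => F (sh x)) /\ integ E m (fun x => F (sh x)) = integ E m F.
Proof.
move=> hF; have mF := ib_measurable hF; have /integrableP[mF' iF] := hF.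
have mFs : measurable_fun setT (fun x => restr E F (sh x)) by apply: measurableT_comp.
have iFs : m.-integrable setT (EFin \o (fun x => restr E F (sh x))).
  apply/integrableP; split; first exact/measurable_EFinP.
  rewrite (_ : (\int[m]_x _)%E = (\int[m]_x `|(EFin \o restr E F) x|)%E)//.
  by apply: (ge0_integral_shift (f := fun x => `|(EFin \o restr E F) x|%E)) => //; exact: measurableT_comp.
have e : restr E (fun x : X => F (sh x)) = (fun x => restr E F (sh x)) \* (\1_[set x : X | adm E x]).
  apply/funext => x; rewrite /restr /= indicE.
  have -> : (x \in [set x : X | adm E x]) = `[< adm E x >] by [].
  case: (asboolP (adm E x)) => hx; last by rewrite mulr0.
  by rewrite mulr1 asboolT//; exact: (adm_iter 1 hx).
have mr : measurable_fun setT (restr E (fun x : X => F (sh x))).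
  by rewrite e; apply: measurable_funM => //; apply: measurable_indic; exact: meas_adm.
split.
  apply: (le_integrable measurableT _ _ iFs); first exact/measurable_EFinP.
  move=> x _ /=; rewrite lee_fin e /= normrM; apply: ler_piMr => //.
  by rewrite indicE normr_nat lern1 leq_b1.
rewrite /integ; congr fine.
transitivity (\int[m]_x (restr E F (sh x))%:E)%E.
  apply: ae_eq_integral => //; [exact/measurable_EFinP|exact/measurable_EFinP|].
  have [N [mN N0 hN]] := ae_adm; exists N; split=> //; apply: subset_trans hN => x nx hx; apply: nx => _ /=.
  rewrite e /= indicE; have -> : (x \in [set x : X | adm E x]) = true by exact: asboolT.
  by rewrite mulr1.
have := integral_pushforward msh (mu := m) (D := setT) mF' iFs measurableT.
rewrite preimage_setT => <-; apply: eq_measure_integral => A mA _; exact: hm.2.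
Qed.

Lemma ib_birkhoff (F : X -> R) n : ib E m F ->
  ib E m (birkhoff F n) /\ integ E m (birkhoff F n) = n%:R * integ E m F.
Proof.
move=> hF; have hk k : ib E m (fun x => F (iter k sh x)) /\ integ E m (fun x => F (iter k sh x)) = integ E m F.
  elim: k => [|k [ih1 ih2]] //; have [h1 h2] := ib_shift ih1; rewrite -ih2 -h2.
  by split; [have := h1; congr ib|congr integ]; apply/funext => x; rewrite iterSr.
elim: n => [|n [ih1 ih2]].
  rewrite mul0r -[X in _ = X](integ_cst (E := E) madm).
  have e : birkhoff F 0 = (fun=> 0) by apply/funext => x; rewrite birkhoff0.
  by rewrite e; split=> //; exact: (@ib_cst _ _ E _ m).
have e : birkhoff F n.+1 = (fun x => birkhoff F n x + F (iter n sh x)).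
  by apply/funext => x; rewrite -addn1 birkhoffD birkhoff1.
by rewrite e (integD ih1 (hk n).1) (hk n).2 ih2 -natr1 mulrDl mul1r; split=> //; exact: (ibD ih1 (hk n).1).
Qed.

Lemma integ_simple (A : finType) (f : X -> A) (c : A -> R) : mpart f ->
  ib E m (fun x => c (f x)) /\ integ E m (fun x => c (f x)) = \sum_i c i * pr m (f @^-1` [set i]).
Proof.
move=> hf; have e : (fun x => c (f x)) = (fun x => \sum_(i <- index_enum A) c i * \1_(f @^-1` [set i]) x).
  apply/funext => x; rewrite (bigD1 (f x))//= indicE.
  have -> : (x \in f @^-1` [set f x]) = true by apply/mem_set.
  rewrite mulr1 big1 ?addr0// => i; rewrite indicE => /negP ni.
  by rewrite memNset ?mulr0// => /= h; apply: ni; rewrite h.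
rewrite e; elim: (index_enum A) => [|i s [ih1 ih2]].
  have -> : (fun x : X => \sum_(i <- [::]) c i * \1_(f @^-1` [set i]) x) = (fun=> 0).
    by apply/funext => x; rewrite big_nil.
  by rewrite big_nil (integ_cst madm); split=> //; exact: (@ib_cst _ _ E _ m).
have h1 : ib E m (\1_(f @^-1` [set i])) := bm_integrable m (bm_indic E R (hf i)).
have -> : (fun x : X => \sum_(i <- i :: s) c i * \1_(f @^-1` [set i]) x) =
  (fun x => c i * \1_(f @^-1` [set i]) x + \sum_(i <- s) c i * \1_(f @^-1` [set i]) x).
  by apply/funext => x; rewrite big_cons.
rewrite big_cons; split; first exact: (ibD (ibZ (c i) h1) ih1).
by rewrite (integD (ibZ (c i) h1) ih1) ih2 (integZ _ h1) (integ_indic (E := E) madm (hf i)).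
Qed.
End InvariantIntegrals.

Section ApproxPartitions.
Variables (S : countType) (a : S) (R : realType) (m : probability (Sig a) R).
Local Notation X := (Sig a).

Definition sdiff (A B : set X) : set X := (A `\` B) `|` (B `\` A).

Lemma coord_approx (B : set X) (e : R) : measurable B -> 0 < e ->
  exists l B', coord l B' /\ pr m (sdiff B B') <= e.
Proof.
pose D := [set B : set X | measurable B /\ forall e : R, 0 < e -> exists l B', coord l B' /\ pr m (sdiff B B') <= e].
have msd A A' : measurable A -> measurable A' -> measurable (sdiff A A').
  by move=> mA mA'; apply: measurableU; apply: measurableD.
have DU A A' : D A -> D A' -> D (A `|` A').
  move=> [mA hA] [mA' hA']; split; first exact: measurableU.
  move=> d d0; have d2 : 0 < d / 2 by lra.
  have [l [C [hC C1]]] := hA _ d2.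
  have [l' [C' [hC' C1']]] := hA' _ d2.
  have mC := meas_coord hC; have mC' := meas_coord hC'.
  exists (maxn l l'), (C `|` C'); split.
    move=> x y xy [Cx|Cx]; [left|right].
      by apply: (hC x) => //; apply: agree_le xy; exact: leq_maxl.
    by apply: (hC' x) => //; apply: agree_le xy; exact: leq_maxr.
  apply: (@le_trans _ _ (pr m (sdiff A C `|` sdiff A' C'))); last first.
    by apply: le_trans (prUle _ _ _) _; [exact: msd|exact: msd|lra].
  apply: pr_mono; [by apply: msd; exact: measurableU|by apply: measurableU; exact: msd|].
  by move=> x [[[Ax|Ax] nC]|[[Cx|Cx] nA]]; [left; left|right; left|left; right|right; right];
    split=> // h; [apply: nC; left|apply: nC; right|apply: nA; left|apply: nA; right].
suff h : measurable `<=` D by move=> mB e0; have [_ /(_ _ e0)] := h _ mB.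
have D0 : D set0.
  split=> // d d0; exists 0%N, set0; split=> //; rewrite /sdiff !set0D setU0 pr0; exact: ltW.
apply: smallest_sub; last first.
  move=> A [n [w ->]]; split; first exact: meas_cylinder.
  move=> d d0; exists n, [set x : X | forall i, (i < n)%N -> x i = w i]; split.
    by move=> x y xy hx i hi; rewrite -(hx i hi) (xy i hi).
  by rewrite /sdiff !setDv setU0 pr0 ltW.
split=> //.
  move=> A [mA hA]; rewrite setTD; split; first exact: measurableC.
  move=> d d0; have [l [C [hC C1]]] := hA d d0; exists l, (~` C); split.
    by move=> x y xy nC Cy; apply: nC; apply: hC Cy => i hi; rewrite (xy i hi).
  rewrite (_ : sdiff (~` A) (~` C) = sdiff A C)//; rewrite /sdiff !setDE !setCK setUC.
  by rewrite [~` C `&` A]setIC [~` A `&` C]setIC.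
change (forall F : nat -> set X, (forall k, D (F k)) -> D (\bigcup_k F k)).
move=> F hF; have mF k : measurable (F k) by case: (hF k).
split; first exact: bigcup_measurable.
move=> d d0; pose G n := \big[setU/set0]_(k < n) F k.
have DG n : D (G n).
  by elim: n => [|n ih]; rewrite /G ?big_ord0// big_ord_recr; exact: DU.
have mG n : measurable (G n) by case: (DG n).
have GG : \bigcup_n G n = \bigcup_n F n.
  apply/seteqP; split=> x [n _].
    by rewrite /G -bigcup_mkord => -[k _ Fk]; exists k.
  by move=> Fx; exists n.+1 => //; rewrite /G -bigcup_mkord; exists n => //=.
have := @pr_cvg_nondecr _ _ _ m G mG; rewrite GG => hc.
have {}hc : (fun n => pr m (G n)) @ \oo --> pr m (\bigcup_n F n).
  by apply: hc => k; rewrite /G big_ord_recr/=; exact: subsetUl.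
have d2 : 0 < d / 2 by lra.
have /cvgrPdist_le/(_ (d / 2) d2) [N _ /(_ N (leqnn _)) hN] := hc.
have [l [C [hC C1]]] := (DG N).2 _ d2.
have mC := meas_coord hC; have mU : measurable (\bigcup_n F n) by exact: bigcup_measurable.
have GU : G N `<=` \bigcup_n F n by rewrite -GG; exact: bigcup_sup.
exists l, C; split=> //.
apply: (@le_trans _ _ (pr m ((\bigcup_n F n) `\` G N `|` sdiff (G N) C))).
  apply: pr_mono; [exact: msd|by apply: measurableU; [exact: measurableD|exact: msd]|].
  move=> x [[Ux nC]|[Cx nU]].
    by have [g|ng] := pselect (G N x); [right; left|left].
  by right; right; split=> // /GU.
apply: le_trans (prUle _ _ _) _; [exact: measurableD|exact: msd|].
have := prIC m (mG N) mU; rewrite setIidr// -setDE => e1.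
by move: hN; rewrite e1 ler_norml => /andP[]; lra.
Qed.

Lemma partition_approx k (f : X -> 'I_k) (e : R) : mpart f -> 0 < e ->
  exists l (f' : X -> 'I_k), (forall x y : X, agree l x y -> f' x = f' y) /\
    pr m [set x | f x != f' x] <= e.
Proof.
move=> hf e0; have i0 : 'I_k := f point.
have k0 : (0 : R) < k%:R by rewrite ltr0n; case: (k) i0 => [[]|].
have /choice[p hp] : forall i, exists p : nat * set X, coord p.1 p.2 /\ pr m (sdiff (f @^-1` [set i]) p.2) <= e / k%:R.
  by move=> i; have [l [B hB]] := coord_approx (hf i) (divr_gt0 e0 k0); exists (l, B).
pose l := \max_i (p i).1; pose f' (x : X) : 'I_k := odflt i0 [pick i | `[< (p i).2 x >]].
have hl i (x y : X) : agree l x y -> (p i).2 x -> (p i).2 y.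
  by move=> xy; apply: (hp i).1; apply: agree_le xy; exact: leq_bigmax.
exists l, f'; split.
  move=> x y xy; rewrite /f'; congr odflt; apply: eq_pick => i.
  by apply: asbool_equiv_eq; split; apply: hl => // j jl; rewrite xy.
have msd i : measurable (sdiff (f @^-1` [set i]) (p i).2).
  by have mC := meas_coord (hp i).1; apply: measurableU; apply: measurableD => //; exact: hf.
apply: (@le_trans _ _ (\sum_(i < k) e / k%:R)); last first.
  by rewrite sumr_const card_ord -[_ *+ k]mulr_natr divfK// gt_eqF.
apply: (@le_trans _ _ (pr m (\big[setU/set0]_(i < k) sdiff (f @^-1` [set i]) (p i).2))).
  apply: pr_mono; last 1 first.
  - have sub i x : sdiff (f @^-1` [set i]) (p i).2 x -> (\big[setU/set0]_(i < k) sdiff (f @^-1` [set i]) (p i).2) x.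
      by move=> h; rewrite (bigD1 i)//=; left.
    move=> x /=; rewrite /f'; case: pickP => [i /asboolP pix /= fi|no _]; last first.
      by apply: (sub (f x)); left; split=> //= h; have := no (f x); rewrite asboolT.
    by apply: (sub i); right; split=> //= e'; rewrite e' eqxx in fi.
  - have hf' : mpart f'.
      move=> i; apply: (meas_coord (l := l)); apply: (coord_fun (P := fun j => j = i)) => x y xy.
      rewrite /f'; congr odflt; apply: eq_pick => j.
      by apply: asbool_equiv_eq; split; apply: hl => // j' jl; rewrite xy.
    exact: (mpart_set (fun u => u.1 != u.2) (mpart_pair hf hf')).
  - by apply: bigsetU_measurable => i _; exact: msd.
have [mB hB] : measurable (\big[setU/set0]_(i < k) sdiff (f @^-1` [set i]) (p i).2) /\
  pr m (\big[setU/set0]_(i < k) sdiff (f @^-1` [set i]) (p i).2) <= \sum_(i < k) e / k%:R.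
  elim/big_ind2: _ => [|A u B v [mA hA] [mB hB]|i _]; first by rewrite pr0.
    split; first exact: measurableU.
    by apply: le_trans (prUle _ mA mB) _; exact: lerD.
  by split; [exact: msd|exact: (hp i).2].
exact: hB.
Qed.
End ApproxPartitions.

Section CondSmall.
Variables (d : measure_display) (T : measurableType d) (R : realType) (m : probability T R).

Lemma etaf_decr (p s : R) : 0 <= p -> 0 <= s -> p + s <= 1 -> etaf p - etaf (p + s) <= s.
Proof.
move=> p0 s0 ps1.
have [p00|pn] := eqVneq p 0.
  have : 0 <= etaf s by apply: etaf_ge0; lra.
  by rewrite p00 etaf0 !add0r; lra.
have pp : 0 < p by rewrite lt_neqAle eq_sym pn.
rewrite !etafE ?addr_ge0//.
have h1 : -1 < s / p by apply: lt_le_trans (divr_ge0 s0 p0); lra.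
have := le_ln1Dx h1; have -> : 1 + s / p = (p + s) / p by field.
rewrite ln_div ?posrE//; last lra.
move=> h2; have := ler_wpM2l p0 h2; rewrite mulrCA divff// mulr1 mulrBr => h3.
have h4 : s * ln (p + s) <= 0 by apply: mulr_ge0_le0 => //; apply: ln_le0.
by rewrite mulrDl; lra.
Qed.

Lemma cond_small (A : finType) (f g : T -> A) (x : R) : mpart f -> mpart g -> 0 <= x ->
  Hf m (fun t => (f t, g t)) - Hf m g <= pr m [set t | f t != g t] * (1 + x) + #|{: A * A}|%:R * expR (- x).
Proof.
move=> hf hg x0; have hfg := mpart_pair hf hg.
pose q (u : A * A) := pr m ((fun t => (f t, g t)) @^-1` [set u]).
have q0 u : 0 <= q u by exact: pr_ge0.
have eg j : pr m (g @^-1` [set j]) = \sum_(u | u.2 == j) q u := pr_marg m (fun u => u.2) j hfg.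
have eg2 j : pr m (g @^-1` [set j]) = q (j, j) + \sum_(u | (u.1 != u.2) && (u.2 == j)) q u.
  rewrite eg (bigD1 (j, j))//=; congr (_ + _); apply: eq_bigl => -[i i'] /=.
  rewrite xpair_eqE andbC; case: (eqVneq i' j) => [->|]; last by rewrite !andbF.
  by rewrite !andbT.
have en : pr m [set t | f t != g t] = \sum_(u | u.1 != u.2) q u.
  have := @pr_marg _ _ _ m _ _ _ (fun u : A * A => u.1 != u.2) true hfg.
  rewrite (_ : _ @^-1` _ = [set t | f t != g t]); last by apply/seteqP; split.
  by move=> ->; apply: eq_bigl => u; rewrite eqb_id.
have h1 : Hf m (fun t => (f t, g t)) = \sum_(u | u.1 == u.2) etaf (q u) + \sum_(u | u.1 != u.2) etaf (q u).
  by rewrite -(bigID (fun u : A * A => u.1 == u.2) xpredT).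
have split2 (F : A * A -> R) : \sum_(u | u.1 == u.2) F u = \sum_j F (j, j).
  rewrite (reindex_onto (fun j => (j, j)) (fun u => u.2)) => [|[i j] /= /eqP ->//].
  by apply: eq_bigl => j; rewrite /= !eqxx.
have h2 : \sum_(u | u.1 == u.2) etaf (q u) - Hf m g <= \sum_(u | u.1 != u.2) q u.
  rewrite split2 -sumrB (partition_big (fun u : A * A => u.2) xpredT)//=.
  apply: ler_sum => j _; rewrite eg2; apply: etaf_decr => //; first by apply: sumr_ge0.
  by rewrite -eg2; exact: pr_le1.
have h3 : \sum_(u | u.1 != u.2) etaf (q u) <= (\sum_(u | u.1 != u.2) q u) * x + #|{: A * A}|%:R * expR (- x).
  apply: (@le_trans _ _ (\sum_(u | u.1 != u.2) (q u * x + expR (- x)))).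
    by apply: ler_sum => u _; exact: eta_le.
  rewrite big_split/= -mulr_suml lerD2l sumr_const -[_ *+ _]mulr_natl.
  by apply: ler_wpM2r; [exact: expR_ge0|rewrite ler_nat max_card].
by rewrite h1 en; lra.
Qed.
End CondSmall.

Section UpperBound.
Variables (S : countType) (a : S) (E : rel S) (R : realType) (A th Cs P : R) (phi : Sig a -> R) (b0 : S).
Hypotheses (mix : mixing_graph E) (A0 : 0 <= A) (th01 : 0 < th < 1) (hphi : holder_with E A th phi).
Local Notation X := (Sig a).
Local Notation sh := (@Defs.shift S a).
Hypotheses (hsup : forall x : X, adm E x -> phi x <= Cs) (hP : PG E phi b0 = P%:E).

Definition words_bound (Z : nat -> X -> Prop) (p C : R) N0 := 0 <= C /\
  forall n (I : finType) (W : pred I) (y : I -> X), (N0 <= n)%N ->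
    (forall w, W w -> adm E (y w) /\ Z n (y w)) ->
    (forall v w, W v -> W w -> agree n (y v) (y w) -> v = w) ->
    \sum_(w | W w) expR (birkhoff phi n (y w)) <= C * expR (p * n%:R).

Lemma words_grow (b b' : S) (p : R) : P < p ->
  exists (C : R) N0, words_bound (fun n x => x 0%N = b /\ x n = b') p C N0.
Proof.
move=> Pp; have [k [C [C0 hC]]] := words_Zn mix A0 th01 hphi b b' b0.
have [p' p'p [N hN]] : exists2 p' : R, (p'%:E < p%:E)%E &
    exists N, forall n, (N <= n)%N -> (Zn E phi n b0 <= (expR (p' * n%:R))%:E)%E.
  apply: (@rate_lt_grow _ (fun n => Zn E phi n b0)) => [n|]; first exact: Zn_ge0.
  by rewrite -[rate _]/(PG E phi b0) hP lte_fin.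
rewrite lte_fin in p'p.
exists (C * expR (`|p| * k%:R)), (maxn N 1); split; first by rewrite mulr_ge0// ?expR_ge0.
move=> n I W y; rewrite geq_max => /andP[Nn n1] hW inj.
have h1 := hC n [set y w | w in [set w | W w]] n1.
have {}h1 : (\esum_(x in [set y w | w in [set w | W w]]) (expR (birkhoff phi n x))%:E <= C%:E * Zn E phi (n + k) b0)%E.
  apply: h1 => [x [w /hW[ya [y1 y2]] <-]//|x x' [v Wv <-] [w Ww <-] /(inj _ _ Wv Ww) ->//].
have h2 : (\esum_(w in [set w | W w]) (expR (birkhoff phi n (y w)))%:E <=
    1%:E * \esum_(x in [set y w | w in [set w | W w]]) (expR (birkhoff phi n x))%:E)%E.
  apply: (@esum_inj_le R _ _ _ _ y) => //.
  - move=> v w /set_mem Wv /set_mem Ww e; apply: inj => //; rewrite e; exact: (fun i _ => erefl).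
  - by move=> w Ww; exists w.
  - by move=> w Ww; rewrite mul1e.
rewrite mul1e in h2; rewrite -lee_fin.
apply: (@le_trans _ _ (\esum_(w in [set w | W w]) (expR (birkhoff phi n (y w)))%:E)%E).
  rewrite esum_fset; [|exact: finite_finset|by move=> w _; rewrite lee_fin expR_ge0].
  rewrite -sumEFin (bigfs _ (index_enum_uniq I))//.
  by move=> w _; rewrite mem_index_enum.
apply: le_trans (le_trans h2 h1) _.
apply: (@le_trans _ _ (C%:E * (expR (p * (n + k)%:R))%:E)%E).
  apply: lee_wpmul2l => //; apply: le_trans (hN _ _) _; first by rewrite (leq_trans Nn)// leq_addr.
  by rewrite lee_fin ler_expR; apply: ler_wpM2r => //; exact: ltW.
rewrite -EFinM lee_fin -mulrA -expRD; apply: ler_wpM2l => //; rewrite ler_expR natrD mulrDr addrC lerD2r.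
by apply: ler_wpM2r => //; exact: ler_norm.
Qed.

Lemma words_grow_fin (K : nat) (p : R) : P < p ->
  exists (C : R) N0, words_bound (fun n x => (pickle (x 0%N) < K)%N /\ (pickle (x n) < K)%N) p C N0.
Proof.
move=> Pp.
have /choice[c hc] : forall ij : 'I_K * 'I_K, exists c : R * nat,
    words_bound (fun n x => pickle (x 0%N) = ij.1 /\ pickle (x n) = ij.2) p c.1 c.2.
  move=> [i j].
  have [[[b b'] /= [hb hb']]|no] := pselect (exists u : S * S, pickle u.1 = i /\ pickle u.2 = j).
    have [C [N0 [C0 h]]] := words_grow b b' Pp; exists (C, N0); split=> // n I W y N0n hW; apply: h => // w /hW[ya [y1 y2]].
    by do !split=> //; apply: (pcan_inj pickleK); rewrite ?hb ?hb'.
  exists (0, 0%N); split=> // n I W y _ hW _; rewrite big1 ?mul0r// => w /hW[_ [y1 y2]].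
  by case: no; exists (y w 0%N, y w n).
exists (\sum_ij (c ij).1), (\max_ij (c ij).2); split; first by apply: sumr_ge0 => ij _; exact: (hc ij).1.
move=> n I W y N0n hW inj.
pose Q (ij : 'I_K * 'I_K) w := [&& W w, pickle (y w 0%N) == ij.1 & pickle (y w n) == ij.2].
apply: (@le_trans _ _ (\sum_ij \sum_(w | Q ij w) expR (birkhoff phi n (y w)))).
  rewrite (exchange_big_dep W)/=; last by move=> ij w _ /and3P[].
  apply: ler_sum => w Ww; have [_ [k1 k2]] := hW w Ww.
  rewrite (bigD1 (Ordinal k1, Ordinal k2))/=; last by rewrite /Q Ww !eqxx.
  by rewrite lerDl; apply: sumr_ge0 => ij _; exact: expR_ge0.
rewrite mulr_suml; apply: ler_sum => ij _; apply: (hc ij).2.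
- by apply: leq_trans N0n; exact: leq_bigmax.
- by move=> w /and3P[Ww /eqP k1 /eqP k2]; have [ya _] := hW w Ww.
- by move=> v w /and3P[Wv _ _] /and3P[Ww _ _]; exact: inj.
Qed.

Variable m : probability X R.
Hypothesis hm : invariant_prob E m.
Let madm : m [set x : X | adm E x] = 1%E := hm.1.

Lemma ish B : measurable B -> pr m (sh @^-1` B) = pr m B.
Proof. by move=> mB; rewrite /pr hm.2. Qed.

Lemma msh' (B : set X) : measurable B -> measurable (sh @^-1` B).
Proof. by move=> mB; have := @meas_shift S a measurableT B mB; rewrite setTI. Qed.

Lemma coord_mpart l (I : finType) (f : X -> I) : (forall x y : X, agree l x y -> f x = f y) -> mpart f.
Proof. by move=> hf i; apply: (meas_coord (l := l)); apply: (coord_fun (P := fun j => j = i)). Qed.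

Lemma pickle_tight (e : R) : 0 < e -> exists K, pr m [set x : X | ~~ (pickle (x 0%N) < K)%N] <= e.
Proof.
move=> e0; pose B K := [set x : X | (pickle (x 0%N) < K)%N].
have mB K : measurable (B K).
  apply: (meas_coord (l := 1)) => x y xy; rewrite /B/= => h; by rewrite -(xy 0%N).
have hc : (fun n => pr m (B n)) @ \oo --> pr m (\bigcup_k B k).
  by apply: pr_cvg_nondecr => // k x /=; exact: ltnW.
rewrite (_ : \bigcup_k B k = setT) ?prT in hc; last first.
  by apply/seteqP; split=> // x _; exists (pickle (x 0%N)).+1 => //; exact: ltnSn.
have /cvgrPdist_le/(_ e e0) [N _ /(_ N (leqnn _)) hN] := hc.
exists N; rewrite (_ : [set x | _] = ~` (B N)); last by apply/seteqP; split=> x /negP.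
by rewrite prC//; move: hN; rewrite ler_norml => /andP[].
Qed.

Hypothesis iphi : ib E m phi.
Local Notation I := (integ E m phi).

Lemma itin_bound l k (f : X -> 'I_k) (e p : R) : (forall x y : X, agree l x y -> f x = f y) -> 0 < e -> P < p ->
  exists (C : R) N0, forall n, (N0 <= n)%N ->
    Hf m (itin sh f n) <= n%:R * (p - I) + 2 * e * (n%:R * (ln k%:R + `|Cs| + `|p|)) + C.
Proof.
move=> hf e0 Pp; have mf := coord_mpart hf.
have k1 : (1 : R) <= k%:R by rewrite ler1n; case: (k) (f point) => [[]|].
have lk0 : 0 <= ln (k%:R : R) by exact: ln_ge0.
have [K hK] := pickle_tight e0; have [C1 [N1 [C10 hC1]]] := words_grow_fin K Pp.
pose C := C1 + 1; have C0 : 1 <= C by rewrite /C; lra.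
have lC : 0 <= ln C by exact: ln_ge0.
exists (3 + `|p - I| * l%:R + `|I| * l%:R + ln C + 2 * e * (l%:R * (`|Cs| + `|p|) + ln C)), N1 => n N1n.
pose N := (n + l)%N.
have iN i (j : 'I_n) : (i < l)%N -> (i + j < N)%N.
  by move=> il; rewrite addnC -addSn; exact: leq_add (ltn_ord j) (ltnW il).
pose gd (x : X) : bool := (pickle (x 0%N) < K)%N && (pickle (x N) < K)%N.
pose v (x : X) := (itin sh f n x, gd x).
have vN (x y : X) : agree N.+1 x y -> v x = v y.
  move=> xy; rewrite /v /gd !xy//; congr pair; apply: eq_from_tnth => j; rewrite !tnth_mktuple.
  apply: hf => i il; rewrite !iter_shift_at; apply: xy; rewrite ltnS; exact: ltnW (iN i j il).
have mv : mpart v := coord_mpart vN.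
pose ok (w : n.-tuple 'I_k) := `[< exists x : X, adm E x /\ v x = (w, true) >].
have /choice[y hy] : forall w, exists y : X, ok w -> [/\ adm E y, v y = (w, true) &
    forall z : X, adm E z -> v z = (w, true) -> birkhoff phi N z <= birkhoff phi N y + 1].
  move=> w; have [/asboolP [x0 [xa xv]]|no] := boolP (ok w); last by exists point.
  pose Z := [set birkhoff phi N x | x in [set x : X | adm E x /\ v x = (w, true)]].
  have Zs : has_sup Z.
    split; first by exists (birkhoff phi N x0), x0.
    exists (N%:R * Cs) => _ [x [hx _] <-]; rewrite /birkhoff -[N in N%:R](card_ord N) mulr_natl -sumr_const.
    by apply: ler_sum => i _; apply: hsup; exact: adm_iter.
  have [_ [x [hx1 hx2] <-] hx] := sup_adherent ltr01 Zs.
  exists x => _; split=> // z za zv.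
  have : birkhoff phi N z <= sup Z by apply: ub_le_sup; [exact: Zs.2|exists z].
  lra.
have sumok : \sum_(w | ok w) expR (birkhoff phi N (y w)) <= C * expR (p * N%:R).
  apply: (@le_trans _ _ (C1 * expR (p * N%:R))); last by apply: ler_wpM2r; [exact: expR_ge0|rewrite /C; lra].
  apply: hC1; first by rewrite (leq_trans N1n)// leq_addr.
    by move=> w /hy[ya [_ /andP[g1 g2]] _].
  move=> u w /hy[_ [e1 _] _] /hy[_ [e2 _] _] uw; rewrite -e1 -e2; apply: eq_from_tnth => j.
  rewrite !tnth_mktuple; apply: hf => i il; rewrite !iter_shift_at; exact: uw (iN i j il).
pose Lz := p * N%:R + ln C.
pose xi (u : n.-tuple 'I_k * bool) : R := if u.2 then Lz - birkhoff phi N (y u.1) else n%:R * ln k%:R.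
pose okb (u : n.-tuple 'I_k * bool) : R := if u.2 then (ok u.1)%:R else 1.
have h1 : Hf m v <= integ E m (fun x => xi (v x)) + 2.
  rewrite (integ_simple hm xi mv).2.
  apply: (@le_trans _ _ (\sum_u (xi u * pr m (v @^-1` [set u]) + okb u * expR (- xi u)))).
    apply: ler_sum => -[w c] _; have q0 := pr_ge0 m (v @^-1` [set (w, c)]).
    have [hok|hnok] : okb (w, c) = 1 \/ (c = true /\ ~~ ok w).
      by rewrite /okb /=; case: (c); [case: (ok w) => /=; [left|right]|left].
    - by rewrite hok mul1r mulrC; exact: eta_le.
    - have [c1 nw] := hnok; rewrite (_ : pr m _ = 0) ?etaf0 ?mulr0 ?add0r.
        by rewrite /okb /= c1 (negbTE nw) mul0r.
      rewrite -(prI_full (meas_adm (a := a) E) (mv _)) ?/pr ?madm//.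
      rewrite (_ : _ `&` _ = set0) ?measure0//; apply/seteqP; split=> x //= [xv xa].
      by case/negP: nw; apply/asboolP; exists x; rewrite xv c1.
  rewrite big_split/= lerD2l -(pair_big xpredT xpredT (fun w c => okb (w, c) * expR (- xi (w, c))))/=.
  under eq_bigr do rewrite big_bool /= /okb /xi /= mul1r.
  rewrite big_split/=.
  have -> : 2 = 1 + 1 :> R by rewrite -natr1.
  apply: lerD; last first.
    rewrite sumr_const card_tuple card_ord -mulrN -[_ *+ _]mulr_natl mulrN expRN.
    rewrite mulrC -mulrC expRM_natl lnK ?posrE; last lra.
    by rewrite natrX divff// expf_neq0// gt_eqF//; lra.
  rewrite (eq_bigr (fun w => if ok w then expR (- Lz) * expR (birkhoff phi N (y w)) else 0)); last first.
    by move=> w _; case: (ok w); rewrite ?mul0r// mul1r -expRD; congr expR; ring.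
  rewrite -big_mkcond/= -mulr_sumr.
  apply: le_trans (ler_wpM2l (expR_ge0 _) sumok) _.
  have eC : C = expR (ln C) by rewrite lnK ?posrE; lra.
  rewrite {1}eC.
  by rewrite -!expRD -[leRHS]expR0 ler_expR /Lz; lra.
have [hb1 hb2] := ib_birkhoff hm N iphi.
pose bd (x : X) : R := (~~ (pickle (x 0%N) < K)%N)%:R + (~~ (pickle (x N) < K)%N)%:R.
have mK : mpart (fun x : X => ~~ (pickle (x 0%N) < K)%N).
  by apply: (coord_mpart (l := 1)) => x y' xy; rewrite (xy 0%N).
have mKN : mpart (fun x : X => ~~ (pickle (x N) < K)%N).
  by apply: (coord_mpart (l := N.+1)) => x y' xy; rewrite (xy N).
have bool_int (g : X -> bool) : mpart g -> integ E m (fun x => (g x)%:R) = pr m [set x | g x].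
  move=> mg; rewrite (integ_simple hm (fun c : bool => c%:R) mg).2 big_bool /= mul1r mul0r addr0.
  by congr pr; apply/seteqP; split=> x /=.
have ibd1 := (integ_simple hm (fun c : bool => c%:R) mK).1.
have ibd2 := (integ_simple hm (fun c : bool => c%:R) mKN).1.
have ibd : ib E m bd := ibD ibd1 ibd2.
have bdle : integ E m bd <= 2 * e.
  rewrite (integD ibd1 ibd2) (bool_int _ mK) (bool_int _ mKN).
  have -> : pr m [set x : X | ~~ (pickle (x N) < K)%N] = pr m [set x : X | ~~ (pickle (x 0%N) < K)%N].
    have mB := mpart_set id mK; have [_ <-] := iter_meas (m := m) msh' ish N mB.
    by congr pr; apply/seteqP; split=> x /=; rewrite iter_shift_at.
  by move: hK; move: (pr m _) => z; lra.
pose Bc := n%:R * ln k%:R + N%:R * `|Cs| + `|Lz|.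
have Bc0 : 0 <= Bc by rewrite /Bc; apply: addr_ge0 => //; apply: addr_ge0; apply: mulr_ge0.
have pt (x : X) : adm E x -> xi (v x) <= (-1) * birkhoff phi N x + (1 + Lz + Bc * bd x).
  move=> xa; rewrite /xi /=; case: ifP => g.
    have ow : ok (itin sh f n x) by apply/asboolP; exists x; rewrite /v g.
    have [_ _ /(_ x xa)] := hy _ ow; rewrite /v g => /(_ erefl) h.
    have : 0 <= Bc * bd x by apply: mulr_ge0 => //; apply: addr_ge0.
    clear -h; lra.
  have b1 : 1 <= bd x.
    move: g; rewrite /gd /bd; case: (_ < K)%N => /=; last by rewrite lerDl.
    by move=> ->; rewrite add0r.
  have c1 : birkhoff phi N x <= N%:R * `|Cs|.
    rewrite /birkhoff -[N in N%:R](card_ord N) mulr_natl -sumr_const; apply: ler_sum => i _.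
    by apply: le_trans (ler_norm _); apply: hsup; exact: adm_iter.
  have c2 := ler_norm (- Lz); rewrite normrN in c2.
  have := ler_wpM2l Bc0 b1; rewrite {1}/Bc; clear -c1 c2; lra.
have i1 : ib E m (fun x => (-1) * birkhoff phi N x) := ibZ (-1) hb1.
have i2 : ib E m (fun x => (1 + Lz) + Bc * bd x) := ibD (ib_cst E m (1 + Lz)) (ibZ Bc ibd).
have := integ_le (integ_simple hm xi mv).1 (ibD i1 i2) pt.
rewrite (integD i1 i2) (integZ _ hb1) hb2 (integD (ib_cst E m (1 + Lz)) (ibZ Bc ibd)) (integ_cst (E := E) madm) (integZ _ ibd).
have h2 : Hf m (itin sh f n) <= Hf m v by apply: (Hf_comp_le m (fun u : n.-tuple 'I_k * bool => u.1) mv).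
have h3 := ler_wpM2l Bc0 bdle.
have h4 : Bc <= n%:R * ln k%:R + (n%:R + l%:R) * `|Cs| + (`|p| * (n%:R + l%:R) + ln C).
  rewrite /Bc /N natrD lerD2l; apply: le_trans (ler_normD _ _) _; rewrite normrM (ger0_norm lC) lerD2r.
  by rewrite normr_nat /N natrD.
have h5 : (2 * e) * Bc <= (2 * e) * (n%:R * ln k%:R + (n%:R + l%:R) * `|Cs| + (`|p| * (n%:R + l%:R) + ln C)).
  by apply: ler_wpM2l => //; rewrite mulr_ge0// ltW.
have h6 : (p - I) * l%:R <= `|p - I| * l%:R by apply: ler_wpM2r => //; exact: ler_norm.
move=> h7; have := normr_ge0 I => In0; have := mulr_ge0 In0 (ler0n R l) => h8.
move: h1 h2 h3 h5 h6 h7 h8; rewrite /Lz /N natrD.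
move: (Hf m v) (Hf m (itin sh f n)) (integ E m (fun x => xi (v x))) (integ E m bd) => H1 H2 J1 J2.
generalize Bc => B'.
move: I (ln k%:R) (ln C) `|Cs| `|p| `|p - I| `|I| (n%:R : R) (l%:R : R) => I' lk lC' c p1 p2 i nn ll; lra.
Qed.

Lemma HjoinE k (f : X -> 'I_k) n : Hjoin m f n = Hf m (itin sh f n).
Proof.
apply: eq_bigr => w _; congr (etaf (pr m _)); apply/seteqP; split=> x /=.
  by move=> h; apply: eq_from_tnth => j; rewrite tnth_mktuple.
by move=> <- j; rewrite tnth_mktuple.
Qed.

Lemma hKS_le : (hKS m <= (P - I)%:E)%E.
Proof.
apply: ge_ereal_sup => _ [k [f [mf ->]]]; apply/lee_addgt0Pr => e e0; rewrite -EFinD.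
have k1 : (1 : R) <= k%:R by rewrite ler1n; case: (k) (f point) => [[]|].
have lk0 : 0 <= ln (k%:R : R) by exact: ln_ge0.
pose c := #|{: 'I_k * 'I_k}|%:R : R; have c0 : 0 <= c by exact: ler0n.
pose x := ln (1 + 8 * c / e).
have ce : 0 <= 8 * c / e by apply: divr_ge0; [apply: mulr_ge0|exact: ltW].
have x0 : 0 <= x by apply: ln_ge0; lra.
have hx : c * expR (- x) <= e / 8.
  rewrite expRN lnK ?posrE; last lra.
  rewrite ler_pdivrMr; last lra.
  by rewrite mulrDr mulr1 (_ : e / 8 * (8 * c / e) = c); [lra|field; rewrite gt_eqF].
have d0 : 0 < e / 8 / (1 + x) by apply: divr_gt0; lra.
have [l [f' [hf' hd]]] := partition_approx m mf d0.
have mf' := coord_mpart hf'.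
have h1 := cond_small m mf mf' x0.
have h2 : Hf m (fun t => (f t, f' t)) - Hf m f' <= e / 4.
  have := ler_wpM2r (_ : 0 <= 1 + x) hd; rewrite divfK; last by apply: lt0r_neq0; lra.
  move=> h; have {}h : pr m [set t | f t != f' t] * (1 + x) <= e / 8 by apply: h; lra.
  apply: le_trans h1 _; rewrite -/c; lra.
pose B := ln (k%:R : R) + `|Cs| + `|P + e / 4|.
have B0 : 0 <= B by rewrite /B; do !apply: addr_ge0.
have e1 : 0 < e / 8 / (1 + B) by rewrite !divr_gt0// ltr_pwDl.
have pe : P < P + e / 4 by lra.
have [C [N0 hC]] := itin_bound hf' e1 pe.
have [N1 hN1] : exists N1 : nat, `|C| * 4 / e <= N1%:R.
  by have := archi_boundP (_ : 0 <= `|C| * 4 / e); exists (Num.bound (`|C| * 4 / e)); apply: ltW; apply: H; apply: divr_ge0; [apply: mulr_ge0|exact: ltW].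
apply: (@limn_esup_le _ _ _ (maxn 1 (maxn N0 N1))) => n; rewrite !geq_max => /and3P[n1 nN0 nN1].
have np : (0 : R) < n%:R by rewrite ltr0n.
rewrite lee_fin ler_pdivrMl// HjoinE.
have g1 := Hf_itin_cond (m := m) msh' ish n mf mf'.
have g2 : Hf m (itin sh f n) <= Hf m (fun x => (itin sh f n x, itin sh f' n x)).
  pose v (x : X) := (itin sh f n x, itin sh f' n x).
  have mv : mpart v := mpart_pair (mpart_itin msh' ish (n := n) mf) (mpart_itin msh' ish (n := n) mf').
  exact: (Hf_comp_le m (fun u : n.-tuple 'I_k * n.-tuple 'I_k => u.1) mv).
have g3 := ler_wpM2l (ltW np) h2.
have g4 : 2 * (e / 8 / (1 + B)) * (n%:R * B) <= n%:R * (e / 4).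
  have -> : 2 * (e / 8 / (1 + B)) * (n%:R * B) = (n%:R * (e / 4)) * (B / (1 + B)).
    by field; rewrite gt_eqF// ltr_pwDl.
  by apply: mulr_frac_le => //; apply: mulr_ge0; [exact: ltW|exact: divr_ge0 (ltW e0) _].
have g5 : C <= n%:R * (e / 4).
  apply: le_trans (ler_norm C) _; have : `|C| * 4 / e <= n%:R by apply: le_trans hN1 _; rewrite ler_nat.
  by rewrite ler_pdivrMr// -ler_pdivlMr// mulrA.
have g6 := hC n nN0; rewrite -/B in g6.
have : n%:R * (P + e / 4 - I) = n%:R * (P - I) + n%:R * (e / 4) by ring.
have : n%:R * (P - I + e) = n%:R * (P - I) + 4 * (n%:R * (e / 4)) by field.
move: g1 g2 g3 g4 g5 g6; move: (2 * (e / 8 / (1 + B)) * (n%:R * B)) (n%:R * (P + e / 4 - I)) (n%:R * (P - I + e)) => Q1 Q2 Q3.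
move: (n%:R * (P - I)) (n%:R * (e / 4)) (n%:R * _) => Q4 Q5 Q6; lra.
Qed.
End UpperBound.

Lemma holder_cont (S : countType) (a : S) (E : rel S) (R : realType) (A th : R) (phi : Sig a -> R) :
  0 <= A -> 0 < th < 1 -> holder_with E A th phi -> cont_adm E phi.
Proof.
move=> A0 th01 hphi x e xa e0; have Ap : 0 < e / (1 + A) by apply: divr_gt0 => //; lra.
have /cvgrPdist_le/(_ _ Ap) [N _ hN] : (fun n => th ^+ n) @ \oo --> (0 : R).
  by apply: cvg_expr; rewrite ger0_norm; lra.
exists (maxn N 2) => y ya xy; apply: le_trans (hphi _ (leq_maxr N 2) _ _ xa ya xy) _.
have := hN _ (leq_maxl N 2); rewrite sub0r normrN ger0_norm ?exprn_ge0//; last lra.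
rewrite ler_pdivlMr; last lra.
have t0 : 0 <= th ^+ maxn N 2 by apply: exprn_ge0; lra.
by rewrite mulrDr mulr1 mulrC; lra.
Qed.

Lemma integral_bounded_above (S : countType) (a : S) (E : rel S) (R : realType) (m : probability (Sig a) R)
    (Cs : R) (phi : Sig a -> R) : cont_adm E phi -> (forall x : Sig a, adm E x -> phi x <= Cs) ->
  ib E m phi \/ (\int[m]_x (restr E phi x)%:E = -oo)%E.
Proof.
move=> /meas_restr mr hs; pose f := EFin \o restr E phi.
have mf : measurable_fun setT f by exact/measurable_EFinP.
have fp : (\int[m]_x f^\+ x < +oo)%E.
  apply: (@le_lt_trans _ _ (\int[m]_x (cst `|Cs|%:E x))%E); last first.
    by rewrite integral_cst//; apply: lte_mul_pinfty => //; apply: le_lt_trans (probability_le1 m measurableT) (ltry 1).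
  apply: ge0_le_integral => //; first exact: measurable_funepos.
  move=> x _; rewrite /f funeposE /= -EFin_max lee_fin ge_max normr_ge0 andbT /restr.
  by case: asboolP => [/hs h|_//]; apply: le_trans h (ler_norm _).
have [fm|fm] := ltP (\int[m]_x f^\- x)%E +oo%E.
  left; apply/integrableP; split=> //; rewrite -/f.
  have -> : (\int[m]_x `|f x| = \int[m]_x (f^\+ x + f^\- x))%E.
    by apply: eq_integral => x _; rewrite -[LHS]/((abse \o f) x) fune_abse.
  rewrite ge0_integralD//; [exact: lte_add_pinfty|exact: measurable_funepos|exact: measurable_funeneg].
right; rewrite -/f integralE; have -> : (\int[m]_x f^\- x = +oo)%E by apply/eqP; rewrite eq_le leey.
by rewrite addeC; case: (\int[m]_x f^\+ x)%E fp.
Qed.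

Lemma Pmu_le (S : countType) (a : S) (E : rel S) (R : realType) (A th Cs P : R) (phi : Sig a -> R) (b0 : S)
    (m : probability (Sig a) R) :
  mixing_graph E -> 0 <= A -> 0 < th < 1 -> holder_with E A th phi ->
  (forall x : Sig a, adm E x -> phi x <= Cs) -> PG E phi b0 = P%:E -> invariant_prob E m ->
  (Pmu E m phi <= P%:E)%E.
Proof.
move=> mix A0 th01 hphi hs hP hm; rewrite /Pmu.
have [ip|->] := integral_bounded_above m (holder_cont A0 th01 hphi) hs; last first.
  by rewrite addeC addNye leNye.
rewrite (_ : \int[m]_x _ = (integ E m phi)%:E)%E; last by rewrite /integ fineK//; apply: integrable_fin_num.
rewrite -leeBrDr//; exact: (hKS_le mix A0 th01 hphi hs hP hm ip).
Qed.

(** * Lower bound of the variational principle *)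

Section Tail.
Variables (S : countType) (a : S) (E : rel S) (R : realType) (m : probability (Sig a) R).
Local Notation X := (Sig a).

Lemma ib_tail (F : X -> R) (e : R) : ib E m F -> 0 < e -> exists (T : R) (H : X -> R),
  [/\ 0 <= T, ib E m H, forall x : X, 0 <= H x, (forall x : X, adm E x -> `|F x| <= T + H x) & integ E m H <= e].
Proof.
move=> hF e0; have mF := ib_measurable hF.
pose G (N : nat) (x : X) : R := Num.max 0 (`|F x| - N%:R).
have eG N : restr E (G N) = (fun x : X => Num.max 0 (`|restr E F x| - N%:R)).
  apply/funext => x; rewrite /restr /G; case: asboolP => // _.
  by rewrite normr0 sub0r max_l// oppr_le0.
have mG N : measurable_fun setT (restr E (G N)).
  rewrite eG; apply: measurable_maxr => //; apply: measurable_funB => //.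
  by apply: measurableT_comp.
have leG N x : `|restr E (G N) x| <= `|restr E F x|.
  rewrite eG ger0_norm ?le_max ?lexx// ge_max normr_ge0 /= lerBlDr lerDl; exact: ler0n.
have iG N : ib E m (G N).
  apply: (le_integrable measurableT _ _ hF); first exact/measurable_EFinP.
  by move=> x _ /=; rewrite lee_fin.
have hc := @dominated_cvg _ _ _ m setT measurableT (fun N => EFin \o restr E (G N)) (cst 0%E) (fun x => `|(EFin \o restr E F) x|%E).
have {}hc : (\int[m]_x (restr E (G N) x)%:E @[N --> \oo] --> 0)%E.
  have := hc _ _ _ _ _; rewrite integral_cst// mul0e; apply.
  - by move=> N; exact/measurable_EFinP.
  - move=> x _ /=; apply: cvg_near_cst.
    exists (Num.bound `|restr E F x|) => // N /= hN; rewrite eG; congr EFin; apply: max_l.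
    rewrite subr_le0; apply: ltW; apply: lt_le_trans (archi_boundP (normr_ge0 _)) _.
    by rewrite ler_nat.
  - by move=> x _.
  - exact: integrable_abse.
  - by move=> N x _ /=; rewrite lee_fin.
have {}hc : (fun N => integ E m (G N)) @ \oo --> 0.
  by apply: fine_cvg; exact: hc.
have /cvgrPdist_le/(_ e e0) [N _ /(_ N (leqnn _)) hN] := hc.
exists N%:R, (G N); split=> // [x|x _|].
- by rewrite /G le_max lexx.
- by rewrite /G -lerBlDl le_max lexx orbT.
- by apply: le_trans (ler_norm _) _; move: hN; rewrite sub0r normrN.
Qed.
End Tail.

Lemma minn_lt_eq (a b K : nat) : (minn a K < K)%N -> minn a K = minn b K -> a = b.
Proof. lia. Qed.

Section LowerBound.
Variables (S : countType) (a : S) (E : rel S) (R : realType) (th : R) (phi : Sig a -> R).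
Variable d : rpfpar a E R.
Hypothesis dH : rpf_spec th phi d.
Local Notation X := (Sig a).
Local Notation sh := (@Defs.shift S a).
Local Notation M := (@MF S a E R phi d).
Local Notation P := (rd_P d).
Variable m : probability X R.
Hypothesis hm : forall l B, coord l B -> pr m B = M (\1_B).
Let inv := rep_invariant dH hm.
Let madm := inv.1.
Let cphi := holder_cont (rs_A0 dH) (rs_th dH) (rs_holder dH).

Lemma ib_phi : ib E m phi.
Proof.
have [//|ninf] := integral_bounded_above m cphi (rs_supP dH); exfalso.
have [C C0 hC] := M_phi_neg dH.
have mr := meas_restr cphi; pose f := EFin \o restr E phi.
have mf : measurable_fun setT f by exact/measurable_EFinP.
pose G (N : nat) (x : X) : R := Num.min (Num.max 0 (- phi x)) N%:R.
have eG N : restr E (G N) = (fun x : X => Num.min (Num.max 0 (- restr E phi x)) N%:R).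
  apply/funext => x; rewrite /restr /G; case: asboolP => // _.
  by rewrite oppr0 max_l// min_l.
have mG N : measurable_fun setT (fun x => (restr E (G N) x)%:E).
  by apply/measurable_EFinP; rewrite eG; apply: measurable_minr => //; apply: measurable_maxr => //; exact: measurable_funN.
have lim x : (f^\- x)%E = limn (fun N => (restr E (G N) x)%:E).
  apply/esym/cvg_lim => //; apply: cvg_near_cst.
  exists (Num.bound `|restr E phi x|) => // N /= hN; rewrite eG funenegE /f /= -EFin_max; congr EFin.
  rewrite min_l 1?maxC// ge_max ler0n andbT.
  apply: ltW; apply: le_lt_trans (ler_norm _) _; rewrite normrN.
  by apply: lt_le_trans (archi_boundP (normr_ge0 _)) _; rewrite ler_nat.
have fm : (\int[m]_x f^\- x <= C%:E)%E.
  rewrite (eq_integral (fun x => limn (fun N => (restr E (G N) x)%:E))) => [|x _]; last exact: lim.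
  rewrite monotone_convergence//; last 2 first.
  - by move=> N x _; rewrite lee_fin eG le_min ler0n le_max lexx.
  - move=> x _ N N' NN'; rewrite lee_fin !eG; rewrite le_min !ge_min lexx /= ler_nat NN' orbT //.
  apply: lime_le; last first.
    apply: nearW => N; have [K [Df [h1 h2]]] := hC N.
    by rewrite (integ_fin m (bh_bm dH h1)) lee_fin (rep_integ dH hm h1).
  apply: ereal_nondecreasing_is_cvgn => N N' NN'; apply: ge0_le_integral => //.
  - by move=> x _; rewrite lee_fin eG le_min ler0n le_max lexx.
  - by move=> x _; rewrite lee_fin !eG le_min !ge_min lexx /= ler_nat NN' orbT.
have : (\int[m]_x f x)%E = -oo%E := ninf.
have p1 : (0 <= \int[m]_x f^\+ x)%E by apply: integral_ge0 => x _; exact: funepos_ge0.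
have p2 : (0 <= \int[m]_x f^\- x)%E by apply: integral_ge0 => x _; exact: funeneg_ge0.
by rewrite integralE; move: fm p1 p2; case: (\int[m]_x f^\- x)%E => [r| |] //; case: (\int[m]_x f^\+ x)%E.
Qed.

Definition nv r : set X := [set x | forall i, (i < r)%N -> x i <> a].

Lemma coord_nv r : coord r (nv r).
Proof. by move=> x y xy hx i ir; rewrite -(xy i ir); exact: hx. Qed.

Lemma pr_nv_small (e : R) : 0 < e -> exists r0, forall r, (r0 <= r)%N -> pr m (nv r) <= e.
Proof.
move=> e0; have [C C0 hC] := M_novisit dH.
have ce : 0 <= C / e by rewrite divr_ge0// ?ltW.
exists (Num.bound (C / e)).+1 => -[//|r]; rewrite ltnS => hr; rewrite (hm (@coord_nv _)).
have -> : nv r.+1 = @novisit _ a r by apply/seteqP; split=> x h i ir; apply: h.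
apply: le_trans (hC r) _; rewrite ler_pdivrMr ?ltr0n//.
have := archi_boundP ce; rewrite ltr_pdivrMr// => h.
rewrite mulrC; apply: le_trans (ltW h) _; apply: ler_wpM2r; first exact: ltW.
by rewrite ler_nat leqW.
Qed.

Definition tfun (x : X) : R := P + (-1) * phi x.

Definition edge n (x : X) (k : nat) : R :=
  \1_(nv k.+1) x + \1_(iter k.+1 sh @^-1` nv (n - k.+1)) x.

Lemma edge_ge0 n x k : 0 <= edge n x k.
Proof. by rewrite /edge !indicE addr_ge0. Qed.

Lemma sum_window (f : nat -> R) i j n : (i <= j)%N -> (j <= n)%N ->
  \sum_(k < n) (if (i <= k < j)%N then f k else 0) = \sum_(k < j - i) f (k + i)%N.
Proof.
move=> ij jn; rewrite -big_mkcond/= -(big_mkord (fun k => i <= k < j)%N f).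
have -> : \sum_(k < j - i) f (k + i)%N = \sum_(i <= k < j) f k by rewrite -[X in \sum_(X <= _ < _) _]add0n big_addn big_mkord.
by rewrite [RHS](big_nat_widen _ _ n)// [RHS](big_nat_widenl i 0%N)//; apply: eq_bigl => k; rewrite andbC.
Qed.

Lemma word_gibbs : exists2 C : R, 0 <= C & forall n (x : X), adm E x -> 0 < pr m [set y : X | agree n x y] ->
  \sum_(k < n) (tfun (iter k sh x) - `|tfun (iter k sh x)| * edge n x k) - C
    <= - ln (pr m [set y : X | agree n x y]).
Proof.
have [C C0 hC] := gibbs_word dH; exists (ln (1 + C)); first by apply: ln_ge0; lra.
move=> n x xa; have cW l (y : X) : coord l [set y' : X | agree l y y'].
  by move=> u v uv yu i il; rewrite (yu i il) (uv i il).
have mW l y := meas_coord (cW l y).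
set p := pr m _ => p0; have p1 : p <= 1 by exact: pr_le1.
have lC : 0 <= ln (1 + C) by apply: ln_ge0; lra.
have term t e : 0 <= e -> t - `|t| * e <= t :> R.
  by move=> e0; have : 0 <= `|t| * e := mulr_ge0 (normr_ge0 t) e0; lra.
have term0 t e : 1 <= e -> t - `|t| * e <= 0 :> R.
  by move=> e1; have := ler_wpM2l (normr_ge0 t) e1; have := ler_norm t; lra.
have [[v0 /andP[v0n xv0]]|no] := pselect (exists i, (i < n)%N && (x i == a)); last first.
  have lp : ln p <= 0 by apply: ln_le0.
  suff : \sum_(k < n) (tfun (iter k sh x) - `|tfun (iter k sh x)| * edge n x k) <= 0 by lra.
  apply: sumr_le0 => k _; apply: term0; rewrite /edge !indicE (@mem_set _ (nv k.+1) x) ?lerDl//.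
  move=> i ik xi; apply: no; exists i; rewrite xi eqxx andbT; exact: leq_trans ik (ltn_ord k).
have ex1 : exists i, (i < n)%N && (x i == a) by exists v0; rewrite v0n.
have [i /andP[iN /eqP xi] imin] := ex_minnP ex1.
have ub k : (k < n)%N && (x k == a) -> (k <= n)%N by case/andP => /ltnW.
have [j /andP[jN /eqP xj] jmax] := ex_maxnP ex1 ub.
have ij : (i <= j)%N by apply: imin; rewrite jN xj eqxx.
have sub : [set y : X | agree n x y] `<=` iter i sh @^-1` [set y : X | agree (j - i).+1 (iter i sh x) y].
  move=> y xy k kj; rewrite !iter_shift_at; apply: xy; lia.
have [mI eI] := iter_meas (m := m) (@msh' S a) (ish inv) i (mW (j - i).+1 (iter i sh x)).
have hp : p <= C * expR (birkhoff phi (j - i) (iter i sh x) - (j - i)%:R * P).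
  apply: le_trans (pr_mono m (mW _ _) mI sub) _; rewrite eI (hm (cW _ _)); apply: hC.
  - exact: adm_iter.
  - by rewrite iter_shift_at.
  - by rewrite iter_shift_at subnK.
have Cp : 0 < C.
  rewrite lt_neqAle C0 andbT eq_sym; apply/eqP => Cz; move: hp; rewrite Cz mul0r; lra.
have lp : ln p <= ln (1 + C) + (birkhoff phi (j - i) (iter i sh x) - (j - i)%:R * P).
  apply: (@le_trans _ _ (ln (C * expR (birkhoff phi (j - i) (iter i sh x) - (j - i)%:R * P)))).
    by rewrite ler_ln ?posrE//; apply: mulr_gt0 => //; exact: expR_gt0.
  by rewrite lnM ?posrE ?expR_gt0// expRK lerD2r ler_ln ?posrE ?ltr_pwDl ?lerDr.
suff : \sum_(k < n) (tfun (iter k sh x) - `|tfun (iter k sh x)| * edge n x k) <=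
   (j - i)%:R * P - birkhoff phi (j - i) (iter i sh x) by lra.
apply: (@le_trans _ _ (\sum_(k < n) (if (i <= k < j)%N then tfun (iter k sh x) else 0))).
  apply: ler_sum => k _; case: ifP => hk; first exact: term (edge_ge0 _ _ _).
  apply: term0; rewrite /edge !indicE; case: (ltnP k i) hk => [ki _|ik /= /negbT].
    rewrite (@mem_set _ (nv k.+1) x) ?lerDl// => l lk xl.
    have := imin l; rewrite xl eqxx andbT (leq_trans lk (ltn_ord k)) => /(_ isT).
    by rewrite leqNgt (leq_trans lk ki).
  rewrite -leqNgt => jk; rewrite [X in _ + X](_ : _ = 1) ?lerDr//.
  rewrite mem_set// => l lk; rewrite iter_shift_at => xl.
  have := jmax (l + k.+1)%N; rewrite xl eqxx andbT addnC -ltn_subRL lk => /(_ isT).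
  by rewrite leqNgt addSn ltnS (leq_trans jk)// leq_addr.
have -> : (j - i)%:R * P - birkhoff phi (j - i) (iter i sh x) = birkhoff tfun (j - i) (iter i sh x).
  by rewrite /birkhoff /tfun big_split/= sumr_const card_ord -mulr_sumr mulN1r mulr_natl.
rewrite (sum_window (fun k => tfun (iter k sh x)) ij (ltnW jN)) /birkhoff.
by apply: ler_sum => k _; rewrite iterD.
Qed.

Lemma word_lower (e : R) : 0 < e -> exists C : R, forall n, exists Phi : X -> R,
  [/\ ib E m Phi,
    (forall x : X, adm E x -> 0 < pr m [set y : X | agree n x y] -> Phi x <= - ln (pr m [set y : X | agree n x y]))
    & n%:R * (P - integ E m phi - e) - C <= integ E m Phi].
Proof.
move=> e0; have it : ib E m tfun := ibD (ib_cst E m P) (ibZ (-1) ib_phi).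
have et : integ E m tfun = P - integ E m phi.
  by rewrite (integD (ib_cst E m P) (ibZ (-1) ib_phi)) (integ_cst (E := E) madm) (integZ _ ib_phi) mulN1r.
have e4 : 0 < e / 4 by lra.
have [T [H [T0 iH H0 hT hH]]] := ib_tail it e4.
have eT : 0 < e / (4 * (1 + T)) by apply: divr_gt0 => //; lra.
have [r0 hr0] := pr_nv_small eT; have [Cg Cg0 hg] := word_gibbs.
exists (Cg + 2 * T * r0%:R) => n.
have [ibt hbt] := ib_birkhoff inv n it; have [ibH hbH] := ib_birkhoff inv n iH.
pose cnt (x : X) := \sum_(k < n) edge n x k.
have ibe k : ib E m (fun x => edge n x k) /\ integ E m (fun x => edge n x k) = pr m (nv k.+1) + pr m (nv (n - k.+1)).
  have m1 := meas_coord (@coord_nv k.+1).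
  have [m2 e2] := iter_meas (m := m) (@msh' S a) (ish inv) k.+1 (meas_coord (@coord_nv (n - k.+1))).
  have i1 := bm_integrable m (bm_indic E R m1); have i2 := bm_integrable m (bm_indic E R m2).
  by split; [exact: (ibD i1 i2)|rewrite (integD i1 i2) !(integ_indic (E := E) madm)// e2].
have [ibc hc] : ib E m cnt /\ integ E m cnt = \sum_(k < n) (pr m (nv k.+1) + pr m (nv (n - k.+1))).
  have key l : ib E m (fun x => \sum_(k < l) edge n x k) /\
      integ E m (fun x => \sum_(k < l) edge n x k) = \sum_(k < l) (pr m (nv k.+1) + pr m (nv (n - k.+1))).
    elim: l => [|l [ih1 ih2]].
      have -> : (fun x => \sum_(k < 0) edge n x k) = (fun=> 0) by apply/funext => x; rewrite big_ord0.
      by rewrite big_ord0 (integ_cst (E := E) madm); split=> //; exact: ib_cst.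
    have -> : (fun x => \sum_(k < l.+1) edge n x k) = (fun x => \sum_(k < l) edge n x k + edge n x l).
      by apply/funext => x; rewrite big_ord_recr.
    have [h1 h2] := ibe l; rewrite big_ord_recr/= -h2 -ih2; split; first exact: (ibD ih1 h1).
    exact: (integD ih1 h1).
  exact: key.
have i1 : ib E m (fun x => birkhoff tfun n x + - Cg) := ibD ibt (ib_cst E m (- Cg)).
have i2 : ib E m (fun x => (- T) * cnt x + (-2) * birkhoff H n x) := ibD (ibZ (- T) ibc) (ibZ (-2) ibH).
exists (fun x => (birkhoff tfun n x + - Cg) + ((- T) * cnt x + (-2) * birkhoff H n x)); split.
- exact: (ibD i1 i2).
- move=> x xa p0; apply: le_trans (hg n x xa p0).
  rewrite sumrB -/(birkhoff tfun n x).
  suff : \sum_(k < n) `|tfun (iter k sh x)| * edge n x k <= T * cnt x + 2 * birkhoff H n x by clear; lra.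
  rewrite /cnt /birkhoff !mulr_sumr -big_split/=; apply: ler_sum => k _.
  have h1 := hT _ (adm_iter k xa); have h2 := H0 (iter k sh x); have h3 := edge_ge0 n x k.
  have h4 : edge n x k <= 2.
    by rewrite /edge !indicE; have := leq_b1 (x \in nv k.+1); have := leq_b1 (x \in iter k.+1 sh @^-1` nv (n - k.+1)); rewrite -!(ler_nat R); lra.
  have := ler_wpM2r h3 h1; have := ler_wpM2l h2 h4; lra.
- rewrite (integD i1 i2) (integD ibt (ib_cst E m (- Cg))) (integD (ibZ (- T) ibc) (ibZ (-2) ibH)).
  rewrite (integZ _ ibc) (integZ _ ibH) hbt hbH (integ_cst (E := E) madm) et hc.
  pose q r := pr m (nv r); have q0 r : 0 <= q r by exact: pr_ge0.
  have q1 r : q r <= (r < r0)%N%:R + e / (4 * (1 + T)).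
    case: ltnP => h; last by rewrite add0r; exact: hr0.
    by apply: (@le_trans _ _ 1); [apply: pr_le1; apply: meas_coord (@coord_nv r)|rewrite lerDl ltW].
  have cntr s : \sum_(0 <= r < s) (r < r0)%N%:R <= r0%:R :> R.
    rewrite -natr_sum ler_nat; elim: s => [|s ih]; first by rewrite big_geq.
    have [h|h] := ltnP s r0; last by rewrite big_nat_recr//= ltnNge h addn0.
    apply: leq_trans h; rewrite -[leqRHS](subn0 s.+1) -[leqRHS]muln1 -sum_nat_const_nat.
    by apply: leq_sum => i _; exact: leq_b1.
  have s1 : \sum_(k < n) pr m (nv k.+1) <= r0%:R + n%:R * (e / (4 * (1 + T))).
    apply: (@le_trans _ _ (\sum_(k < n) ((k.+1 < r0)%N%:R + e / (4 * (1 + T))))).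
      by apply: ler_sum => k _; exact: q1.
    rewrite big_split/= sumr_const card_ord -[_ *+ n]mulr_natl lerD2r.
    apply: le_trans (cntr n.+1); rewrite big_nat_recl//= -(big_mkord xpredT (fun k => (k.+1 < r0)%N%:R)).
    by rewrite lerDr.
  have s2 : \sum_(k < n) pr m (nv (n - k.+1)) <= r0%:R + n%:R * (e / (4 * (1 + T))).
    apply: (@le_trans _ _ (\sum_(k < n) ((k < r0)%N%:R + e / (4 * (1 + T))))).
      by rewrite [leRHS](reindex_inj rev_ord_inj)/=; apply: ler_sum => k _; exact: q1.
    rewrite big_split/= sumr_const card_ord -[_ *+ n]mulr_natl lerD2r.
    by rewrite -(big_mkord xpredT (fun k => (k < r0)%N%:R)); exact: cntr.
  rewrite big_split/=.
  have s4 := ler_wpM2l T0 (lerD s1 s2).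
  have s5 : T * (n%:R * (e / (4 * (1 + T)))) <= n%:R * (e / 4).
    have -> : T * (n%:R * (e / (4 * (1 + T)))) = n%:R * (e / 4) * (T / (1 + T)).
      by field; rewrite gt_eqF// ltr_pwDl.
    by apply: mulr_frac_le => //; apply: mulr_ge0; [exact: ler0n|exact: ltW].
  have s6 := ler_wpM2l (ler0n R n) hH.
  move: s4 s5 s6; move: (\sum_(k < n) _ + _) (n%:R * (e / (4 * (1 + T)))) => Q1 Q2.
  rewrite !mulrDr; lra.
Qed.

Definition alf K (x : X) : 'I_K.+1 := inord (minn (pickle (x 0%N)) K).

Lemma alfE K x : nat_of_ord (alf K x) = minn (pickle (x 0%N)) K.
Proof. by rewrite /alf inordK// ltnS geq_minr. Qed.

Lemma mpart_alf K : mpart (@alf K).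
Proof. by apply: (coord_mpart (l := 1)) => x y xy; rewrite /alf (xy 0%N). Qed.

Lemma Hf_alf_bdd : exists C : R, forall K, Hf m (@alf K) <= C.
Proof.
have [C C0 hC] := M_symbols_eta dH; exists (C + 1) => K.
have pa (i : 'I_K.+1) : (i < K)%N -> (@alf K @^-1` [set i]) = [set x : X | pickle (x 0%N) = i].
  move=> iK; apply/seteqP; split=> x /= h; first by have := congr1 val h; rewrite /= alfE; lia.
  by apply: val_inj; rewrite /= alfE h; lia.
rewrite /Hf big_ord_recr/=; apply: lerD; last first.
  by apply: le_trans (eta_le 0 (pr_ge0 _ _)) _; rewrite mulr0 oppr0 expR0 add0r.
pose U := pmap (pickle_inv (T := S)) (iota 0 K).
have pinv k s : pickle_inv k = Some s -> pickle (s : S) = k by move=> h; have := @pickle_invK S k; rewrite h.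
have uU : uniq U.
  apply: (@pmap_uniq _ _ _ pickle) (iota_uniq 0 K) => k; exact: pickle_invK.
apply: le_trans (hC U uU).
have -> : \sum_(s <- U) etaf (M (\1_(sym_set s))) =
  \sum_(0 <= k < K) (if pickle_inv k is Some s then etaf (M (\1_(sym_set s))) else 0).
  rewrite /index_iota subn0 /U; elim: (iota 0 K) => [|k l ih]; first by rewrite !big_nil.
  rewrite big_cons -ih /=; case e : (pickle_inv k) => [s|] /=; first by rewrite big_cons.
  by rewrite add0r.
rewrite big_mkord; apply: ler_sum => i _; rewrite pa//= sym_pickle.
case: (pickle_inv i) => [s|]; last by rewrite pr0 etaf0.
by rewrite -(hm (@coord_sym_set _ _ _)).
Qed.

Lemma Hf_words (e : R) n (Phi : X -> R) K0 : 0 < e -> (0 < n)%N -> ib E m Phi ->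
  (forall x : X, adm E x -> 0 < pr m [set y : X | agree n x y] -> Phi x <= - ln (pr m [set y : X | agree n x y])) ->
  exists2 K, (K0 <= K)%N & integ E m Phi - e <= Hf m (itin sh (@alf K) n).
Proof.
move=> e0 n0 iP hP; have e2 : 0 < e / 2 by lra.
have [T [H [T0 iH H0 hT hH]]] := ib_tail iP e2.
have np : (0 : R) < n%:R by rewrite ltr0n.
have et : 0 < e / 2 / (1 + T) / n%:R by apply: divr_gt0 => //; apply: divr_gt0; lra.
have [K1 hK1] := pickle_tight m et.
exists (maxn K0 K1); first exact: leq_maxl.
set K := maxn _ _; pose v (x : X) := itin sh (@alf K) n x.
have mv : mpart v := mpart_itin (@msh' S a) (ish inv) (n := n) (@mpart_alf K).
pose q w := pr m (v @^-1` [set w]); pose good (w : n.-tuple 'I_K.+1) := [forall j, (tnth w j < K)%N].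
pose bad w := ~~ good w || (q w == 0).
have q0 w : 0 <= q w by exact: pr_ge0.
have q1 w : q w <= 1 by apply: pr_le1; exact: mv.
pose xi w : R := if bad w then 0 else - ln (q w).
have [ix hx] := integ_simple inv xi mv.
have h1 : integ E m (fun x => xi (v x)) <= Hf m v.
  rewrite hx; apply: ler_sum => w _; rewrite -/(q w) /xi; case: ifP => _.
    by rewrite mul0r; exact: etaf_ge0.
  by rewrite etafE// mulNr mulrC.
have mB := mpart_set bad mv; pose B := [set x | bad (v x)].
have iB : ib E m (\1_B) := bm_integrable m (bm_indic E R mB).
have prB : pr m B <= e / 2 / (1 + T).
  pose A := [set x : X | ~~ (pickle (x 0%N) < K)%N].
  have mA : measurable A.
    by apply: (meas_coord (l := 1)) => x y xy; rewrite /A /= -(xy 0%N).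
  pose B1 := [set x : X | ~~ good (v x)]; pose B2 := [set x : X | q (v x) == 0].
  have mB1 := mpart_set (fun w => ~~ good w) mv; have mB2 := mpart_set (fun w => q w == 0) mv.
  have b2 : pr m B2 = 0.
    have := pr_marg m (fun w => q w == 0) true mv; rewrite (_ : _ @^-1` _ = B2); last by apply/seteqP; split.
    by move=> ->; rewrite big1// => w /eqP h; apply/eqP; rewrite -/(q w) h.
  have b1 : pr m B1 <= n%:R * pr m A.
    have iA : ib E m (\1_A) := bm_integrable m (bm_indic E R mA).
    have [ibA <-] : ib E m (birkhoff (\1_A) n) /\ integ E m (birkhoff (\1_A) n) = n%:R * pr m A.
      by rewrite -(integ_indic (E := E) madm mA); exact: ib_birkhoff.
    rewrite -(integ_indic (E := E) madm mB1); apply: integ_le => //; first exact: bm_integrable (bm_indic E R mB1).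
    move=> x xa; rewrite indicE; have [|nb] := boolP (x \in B1); last first.
      by apply: sumr_ge0 => k _; rewrite indicE.
    rewrite inE /B1 /= negb_forall => /existsP[j]; rewrite -leqNgt tnth_mktuple alfE => hj.
    rewrite /birkhoff (bigD1 j)//= indicE mem_set ?lerDl; first by apply: sumr_ge0 => k _; rewrite indicE.
    by rewrite /A /= -leqNgt; apply: leq_trans hj (geq_minl _ _).
  have A1 : pr m A <= e / 2 / (1 + T) / n%:R.
    apply: le_trans hK1; apply: pr_mono => //.
      by apply: (meas_coord (l := 1)) => x y xy /=; rewrite -(xy 0%N).
    by move=> x; rewrite /A /= -!leqNgt; apply: leq_trans; exact: leq_maxr.
  apply: (@le_trans _ _ (pr m (B1 `|` B2))).
    apply: pr_mono => //; first exact: measurableU.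
    by move=> x /orP[]; [left|right].
  apply: le_trans (prUle _ mB1 mB2) _; rewrite b2 addr0; apply: le_trans b1 _.
  by have := ler_wpM2l (ltW np) A1; rewrite mulrCA divff ?mulr1//; apply: lt0r_neq0.
have i1 : ib E m (fun x => (- T) * \1_B x + (-1) * H x) := ibD (ibZ (- T) iB) (ibZ (-1) iH).
have h2 : integ E m (fun x => Phi x + ((- T) * \1_B x + (-1) * H x)) <= integ E m (fun x => xi (v x)).
  apply: integ_le => //; first exact: (ibD iP i1).
  move=> x xa; have h := hT x xa; have hx0 := H0 x; rewrite /xi; case: ifP => bx.
    rewrite indicE mem_set//= mulr1; have := ler_norm (Phi x); lra.
  rewrite indicE memNset /B/= ?bx// mulr0 add0r.
  move: bx; rewrite /bad => /negbT; rewrite negb_or negbK => /andP[gx qx].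
  have ew : v @^-1` [set v x] = [set y : X | agree n x y].
    apply/seteqP; split=> y /= h3.
      move=> i i_n; apply: (pcan_inj pickleK).
      have g1 := forallP gx (Ordinal i_n); rewrite tnth_mktuple alfE iter_shift_at /= in g1.
      have := congr1 (fun w => nat_of_ord (tnth w (Ordinal i_n))) h3; rewrite !tnth_mktuple !alfE !iter_shift_at /= => /esym; exact: minn_lt_eq.
    apply: eq_from_tnth => j; rewrite !tnth_mktuple; apply: val_inj; rewrite /= !alfE !iter_shift_at.
    by rewrite add0n h3.
  have := hP x xa; rewrite -ew -/(q (v x)) => /(_ _) h4; have : Phi x <= - ln (q (v x)).
    by apply: h4; rewrite lt_neqAle eq_sym qx q0.
  clear -hx0; lra.
rewrite (integD iP i1) (integD (ibZ (- T) iB) (ibZ (-1) iH)) (integZ _ iB) (integZ _ iH) (integ_indic (E := E) madm mB) in h2.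
have h3 : T * pr m B <= e / 2.
  apply: le_trans (ler_wpM2l T0 prB) _; rewrite mulrCA; exact: mulr_frac_le (ltW e2).
rewrite -/v; clear -h1 h2 h3 hH; lra.
Qed.

Lemma hKS_ge : ((P - integ E m phi)%:E <= hKS m)%E.
Proof.
apply/lee_addgt0Pr => e e0; have e4 : 0 < e / 4 by lra.
have [K hK] : exists K, forall K', (K <= K')%N -> Hf m (@alf K') <= Hf m (@alf K) + e / 4.
  have [C hC] := Hf_alf_bdd.
  have hs : has_sup (range (fun K => Hf m (@alf K))).
    by split; [exists (Hf m (@alf 0)), 0%N|exists C => _ [K _ <-]].
  have [_ [K _ <-] hK] := sup_adherent e4 hs; exists K => K' KK'.
  have : Hf m (@alf K') <= sup (range (fun K => Hf m (@alf K))) by apply: ub_le_sup; [exact: hs.2|exists K'].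
  lra.
have [C hC] := word_lower e4.
suff h : ((P - integ E m phi - e)%:E <= hpart m (@alf K))%E.
  rewrite -leeBlDr//; apply: le_trans h _; apply: ereal_sup_ubound; exists K.+1, (@alf K).
  by split=> //; exact: mpart_alf.
apply: limn_esup_ge => N.
have Cp : 0 <= (`|C| + e / 4) * 4 / e by have := normr_ge0 C => C0; apply: divr_ge0; [apply: mulr_ge0|]; lra.
pose n := (N + (Num.bound ((`|C| + e / 4) * 4 / e)).+1)%N; exists n; first exact: leq_addr.
have n0 : (0 < n)%N by rewrite /n addnS.
have np : (0 : R) < n%:R by rewrite ltr0n.
have [Phi [iP hP h1]] := hC n; have [K' KK' h2] := Hf_words K e4 n0 iP hP.
rewrite lee_fin -ler_pdivrMl ?invr_gt0// invrK HjoinE.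
have mK := @mpart_alf K; have mK' := @mpart_alf K'.
have g1 := Hf_itin_cond (m := m) (@msh' S a) (ish inv) n mK' mK.
have g2 : Hf m (itin sh (@alf K') n) <= Hf m (fun x => (itin sh (@alf K') n x, itin sh (@alf K) n x)).
  pose v (x : X) := (itin sh (@alf K') n x, itin sh (@alf K) n x).
  have mv : mpart v := mpart_pair (mpart_itin (@msh' S a) (ish inv) (n := n) mK') (mpart_itin (@msh' S a) (ish inv) (n := n) mK).
  exact: (Hf_comp_le m (fun u : n.-tuple 'I_K'.+1 * n.-tuple 'I_K.+1 => u.1) mv).
have g3 : Hf m (fun x => (alf K' x, alf K x)) <= Hf m (@alf K').
  have := Hf_comp_le m (fun i : 'I_K'.+1 => (i, inord (minn i K) : 'I_K.+1)) mK'.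
  by congr (Hf m _ <= _); apply/funext => x; rewrite alfE -minnA (minn_idPr KK').
have g4 : n%:R * (Hf m (fun x => (alf K' x, alf K x)) - Hf m (@alf K)) <= n%:R * (e / 4).
  by apply: ler_wpM2l; [exact: ltW|rewrite lerBlDl; exact: le_trans g3 (hK K' KK')].
have g5 : C + e / 4 <= n%:R * (e / 4).
  have h : (`|C| + e / 4) * 4 / e <= n%:R.
    apply: le_trans (ltW (archi_boundP Cp)) _; rewrite ler_nat /n addnS; apply: leqW; exact: leq_addl.
  by move: h; rewrite ler_pdivrMr// -ler_pdivlMr// mulrA; apply: le_trans; rewrite lerD2r ler_norm.
have : n%:R * (P - integ E m phi - e) = n%:R * (P - integ E m phi - e / 4) - 3 * (n%:R * (e / 4)) by field.
have q3 : 0 <= n%:R * (e / 4) by apply: mulr_ge0; [exact: ler0n|exact: ltW].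
move: g1 g4 g5 h1 q3; move: (n%:R * (P - integ E m phi - e)) (n%:R * (P - integ E m phi - e / 4)) (n%:R * (e / 4)) (n%:R * _).
move=> Q1 Q2 Q3 Q4; clear -g2 h2; lra.
Qed.

Lemma rpf_equilibrium b : PG E phi b = Pmu E m phi.
Proof.
rewrite (rs_PE dH); apply/eqP; rewrite eq_le; apply/andP; split; last first.
  exact: (Pmu_le (rs_mix dH) (rs_A0 dH) (rs_th dH) (rs_holder dH) (rs_supP dH) (rs_PE dH b) inv).
rewrite /Pmu (_ : \int[m]_x _ = (integ E m phi)%:E)%E; last first.
  by rewrite /integ fineK//; apply: integrable_fin_num => //; exact: ib_phi.
by rewrite -leeBlDr//; exact: hKS_ge.
Qed.
End LowerBound.

(** * Derivatives of power series *)

Section PowerSeries.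
Variable R : realType.
Implicit Types (c : nat -> nat -> R) (t s rho : R).

Definition wt rho c : nat -> nat -> R := fun i j => c i j * rho ^+ (i + j).
Definition good c := forall rho, 0 < rho < 1 -> exists K, nb (wt rho c) K.
Definition dT c : nat -> nat -> R := fun i j => i.+1%:R * c i.+1 j.
Definition trA c : nat -> nat -> R := fun i j => c j i.
Definition dS c := trA (dT (trA c)).

Lemma nb_trA c K : nb c K -> nb (trA c) K.
Proof. by move=> h N; rewrite exchange_big; exact: h. Qed.

Lemma nb_wt c K rho : 0 <= rho <= 1 -> nb c K -> nb (wt rho c) K.
Proof.
move=> /andP[r0 r1]; apply: nb_le => i j; rewrite /wt normrM ler_piMr//.
by rewrite normrX ger0_norm// exprn_ile1.
Qed.

Lemma natX_le (q : R) n : 0 <= q < 1 -> n%:R * q ^+ n <= 1 / (1 - q).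
Proof.
move=> /andP[q0 q1]; rewrite ler_pdivlMr ?subr_gt0//.
suff h : forall n, n%:R * q ^+ n <= \sum_(k < n) q ^+ k.
  apply: (@le_trans _ _ ((\sum_(k < n) q ^+ k) * (1 - q))); first by apply: ler_wpM2r => //; lra.
  have := subrX1 q n; have : 0 <= q ^+ n by exact: exprn_ge0.
  move: (\sum_(k < n) q ^+ k) => Q; lra.
elim=> [|m ih]; first by rewrite mul0r big_ord0.
rewrite big_ord_recr/= -natr1 mulrDl mul1r; apply: lerD; last by rewrite exprS ler_piMl ?exprn_ge0// ltW.
apply: le_trans ih; apply: ler_wpM2l => //; rewrite exprS ler_piMl ?exprn_ge0//; exact: ltW.
Qed.

Lemma nb_dT c K (r r' : R) : 0 < r' < r -> nb (wt r c) K -> nb (wt r' (dT c)) (K * (1 / (1 - r' / r) / r')).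
Proof.
move=> /andP[r0 rr] h N; have rp : 0 < r by lra.
have q01 : 0 <= r' / r < 1 by rewrite divr_ge0 ?ltW//= ltr_pdivrMr// mul1r.
have C0 : 0 <= 1 / (1 - r' / r) / r' by case/andP: q01 => _ q1; do 2 (apply: divr_ge0; last lra); lra.
have hb := nb_rect h N.+1 N.
apply: le_trans (ler_wpM2r C0 hb); rewrite big_ord_recl mulrDl [X in _ <= _ + X]mulr_suml.
apply: (@le_trans _ _ (\sum_(i < N) (\sum_(j < N) `|wt r c (lift ord0 i) j|) * (1 / (1 - r' / r) / r'))); last first.
  by rewrite lerDr; apply: mulr_ge0 => //; apply: sumr_ge0.
apply: ler_sum => i _; rewrite mulr_suml; apply: ler_sum => j _; rewrite /wt /dT lift0.
have -> : i.+1%:R * c i.+1 j * r' ^+ (i + j) = c i.+1 j * r ^+ (i.+1 + j) * (i.+1%:R * (r' / r) ^+ i.+1 / r' * (r' / r) ^+ j).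
  have rn : r != 0 by rewrite gt_eqF.
  have rn' : r' != 0 by rewrite gt_eqF.
  by rewrite !exprMn !exprVn addSn !exprS !exprD; field; rewrite ?expf_neq0 ?rn ?rn'.
rewrite normrM; apply: ler_wpM2l => //; case/andP: q01 => q0 q1.
have q3 : 0 <= (r' / r) ^+ j by exact: exprn_ge0.
have q2 : 0 <= i.+1%:R * (r' / r) ^+ i.+1 / r'.
  by apply: divr_ge0; [apply: mulr_ge0 => //; exact: exprn_ge0|exact: ltW].
rewrite ger0_norm; last exact: mulr_ge0.
apply: (@le_trans _ _ (i.+1%:R * (r' / r) ^+ i.+1 / r')); first by rewrite ler_piMr// exprn_ile1// ltW.
by apply: ler_wpM2r; [rewrite invr_ge0 ltW|apply: natX_le; rewrite q0 q1].
Qed.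

Lemma good_dT c : good c -> good (dT c).
Proof.
move=> h rho /andP[r0 r1]; pose r := (1 + rho) / 2.
have [K hK] : exists K, nb (wt r c) K by apply: h; rewrite /r; lra.
by eexists; apply: (nb_dT (r := r)) hK; rewrite /r; lra.
Qed.

Lemma good_trA c : good c -> good (trA c).
Proof.
move=> h rho hr; have [K hK] := h rho hr; exists K; apply: eq_nb (nb_trA hK) => i j.
by rewrite /wt /trA addnC.
Qed.

Lemma good_dS c : good c -> good (dS c).
Proof. by move=> h; apply: good_trA; apply: good_dT; exact: good_trA. Qed.

Lemma nb_good c K : nb c K -> good c.
Proof. by move=> h rho /andP[r0 r1]; exists K; apply: nb_wt h; rewrite !ltW. Qed.

Lemma goodZ k c : good c -> good (sclA k c).
Proof.
move=> h rho hr; have [K hK] := h rho hr; exists (`|k| * K).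
by apply: eq_nb (nbZ (R := R) k hK) => i j; rewrite /wt /sclA mulrA.
Qed.

Section Evaluation.
Variables (rho K : R) (c : nat -> nat -> R).
Hypotheses (r01 : 0 < rho) (hK : nb (wt rho c) K).

Lemma div_le1 t : `|t| <= rho -> `|t / rho| <= 1.
Proof. by move=> h; rewrite normrM normfV (gtr0_norm r01) ler_pdivrMr// mul1r. Qed.

Lemma row_scale i s : `|s| <= rho ->
  asm (fun j => wt rho c i j * (s / rho) ^+ j) (sm (fun j => `|wt rho c i j|)) /\
  rho ^+ i * sm (fun j => c i j * s ^+ j) = sm (fun j => wt rho c i j * (s / rho) ^+ j).
Proof.
move=> sr; have h := ev_row_asm (div_le1 sr) i hK; split=> //.
have e j : c i j * s ^+ j = rho ^- i * (wt rho c i j * (s / rho) ^+ j).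
  by rewrite /wt exprMn exprVn exprD; field; rewrite ?expf_neq0// gt_eqF.
by rewrite (eq_sm e) (smZ _ h) mulrA mulfV ?mul1r// expf_neq0// gt_eqF.
Qed.

Lemma ev_scale t s : `|t| <= rho -> `|s| <= rho -> ev c t s = ev (wt rho c) (t / rho) (s / rho).
Proof.
move=> tr sr; apply: eq_sm => i; have [_ <-] := row_scale i sr.
by rewrite mulrA exprMn exprVn divfK// expf_neq0// gt_eqF.
Qed.

Lemma ev_le t s : `|t| <= rho -> `|s| <= rho -> `|ev c t s| <= K.
Proof. by move=> tr sr; rewrite ev_scale//; apply: ev_bound => //; exact: div_le1. Qed.

Lemma row_asm t s : `|t| <= rho -> `|s| <= rho -> asm (fun i => t ^+ i * sm (fun j => c i j * s ^+ j)) K.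
Proof.
move=> tr sr; apply: eq_asm (ev_asm (div_le1 tr) (div_le1 sr) hK) => i; have [_ <-] := row_scale i sr.
by rewrite mulrA exprMn exprVn divfK// expf_neq0// gt_eqF.
Qed.
End Evaluation.

Lemma ev_trA1 c K t s : `|t| <= 1 -> `|s| <= 1 -> nb c K -> ev c t s = ev (trA c) s t.
Proof.
move=> t1 s1 h; have h' := nb_trA h.
pose f i j := t ^+ i * (c i j * s ^+ j).
have hf i : asm (f i) (sm (fun j => `|c i j|)).
  apply: asmW (asmZ (t ^+ i) (ev_row_asm s1 i h)) _.
  rewrite ler_piMl//; last exact: normrX_le1.
  by apply: (sm_ge0 (asm_norm (nb_row i h))).
transitivity (sm (fun i => sm (f i))); first by apply: eq_sm => i; rewrite (smZ _ (ev_row_asm s1 i h)).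
rewrite (sm_swap hf (nb_rows h)); apply: eq_sm => j.
rewrite -(smZ _ (ev_row_asm t1 j h')); apply: eq_sm => i; rewrite /f /trA; ring.
Qed.

Lemma radius t s : `|t| < 1 -> `|s| < 1 -> exists rho : R, [/\ 0 < rho < 1, `|t| < rho & `|s| < rho].
Proof.
move=> t1 s1; exists ((1 + Num.max `|t| `|s|) / 2).
have h1 : `|t| <= Num.max `|t| `|s| by rewrite le_max lexx.
have h2 : `|s| <= Num.max `|t| `|s| by rewrite le_max lexx orbT.
have h3 : Num.max `|t| `|s| < 1 by rewrite gt_max t1 s1.
have := normr_ge0 t; split; lra.
Qed.

Lemma ev_trA c t s : good c -> `|t| < 1 -> `|s| < 1 -> ev c t s = ev (trA c) s t.
Proof.
move=> h t1 s1; have [rho [r01 tr sr]] := radius t1 s1.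
have [K hK] := h rho r01; have rp : 0 < rho by case/andP: r01.
have hK' : nb (wt rho (trA c)) K by apply: eq_nb (nb_trA hK) => i j; rewrite /wt /trA addnC.
move: tr sr => /ltW tr /ltW sr; rewrite (ev_scale rp hK tr sr) (ev_scale rp hK' sr tr).
rewrite (ev_trA1 _ _ hK); [|exact: div_le1..].
by apply: eq_ev => i j; rewrite /wt /trA addnC.
Qed.

Lemma row_abs c K rho i s : 0 < rho -> nb (wt rho c) K -> `|s| <= rho -> exists B, asm (fun j => c i j * s ^+ j) B.
Proof.
move=> rp hK sr; have [h _] := row_scale rp hK i sr.
have e j : c i j * s ^+ j = rho ^- i * (wt rho c i j * (s / rho) ^+ j).
  by rewrite /wt exprMn exprVn exprD; field; rewrite ?expf_neq0// gt_eqF.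
by eexists; apply: eq_asm e (asmZ _ h).
Qed.

Lemma row_dT c K rho i s : 0 < rho -> nb (wt rho c) K -> `|s| <= rho ->
  sm (fun j => dT c i j * s ^+ j) = i.+1%:R * sm (fun j => c i.+1 j * s ^+ j).
Proof.
move=> rp hK sr; rewrite /dT; under eq_sm do rewrite -mulrA.
by have [B hB] := row_abs i.+1 rp hK sr; exact: smZ hB.
Qed.

Lemma ev_is_derive c t s : good c -> `|t| < 1 -> `|s| < 1 ->
  is_derive t (1 : R) (fun u => ev c u s) (ev (dT c) t s).
Proof.
move=> h t1 s1; have [rho [r01 tr sr]] := radius t1 s1; have rp : 0 < rho by case/andP: r01.
have g1 := good_dT h; have g2 := good_dT g1.
have [K hK] := h rho r01; have [K1 hK1] := g1 rho r01; have [K2 hK2] := g2 rho r01.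
pose b i := sm (fun j => c i j * s ^+ j).
have e1 : pseries_diffs b = (fun i => sm (fun j => dT c i j * s ^+ j)).
  by apply/funext => i; rewrite /pseries_diffs -(row_dT i rp hK (ltW sr)).
have e2 : pseries_diffs (pseries_diffs b) = (fun i => sm (fun j => dT (dT c) i j * s ^+ j)).
  by rewrite e1; apply/funext => i; rewrite /pseries_diffs -(row_dT i rp hK1 (ltW sr)).
have psE (c' : nat -> nat -> R) u : pseries (fun i => sm (fun j => c' i j * s ^+ j)) u =
   series (fun i => u ^+ i * sm (fun j => c' i j * s ^+ j)).
  by rewrite /pseries; congr series; apply/funext => i; rewrite mulrC.
have cv (c' : nat -> nat -> R) K' : nb (wt rho c') K' -> cvgn (pseries (fun i => sm (fun j => c' i j * s ^+ j)) rho).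
  move=> hc; rewrite psE; have hr : `|rho| <= rho by rewrite gtr0_norm.
  have := asm_cvg (row_asm rp hc hr (ltW sr)); exact: cvgP.
have := @pseries_snd_diffs R b rho t; rewrite e2 e1 (gtr0_norm rp) => /(_ (cv _ _ hK) (cv _ _ hK1) (cv _ _ hK2) tr).
have -> : limn (pseries (fun i => sm (fun j => dT c i j * s ^+ j)) t) = ev (dT c) t s by rewrite psE.
by have -> : (fun x => limn (pseries b x)) = (fun u => ev c u s) by apply/funext => u; rewrite psE.
Qed.

Lemma exprB_le (t t' rho : R) i : `|t| <= rho -> `|t'| <= rho -> `|t ^+ i.+1 - t' ^+ i.+1| <= `|t - t'| * (i.+1%:R * rho ^+ i).
Proof.
move=> tr tr'; have r0 : 0 <= rho by apply: le_trans tr.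
rewrite subrXX normrM; apply: ler_wpM2l => //; apply: le_trans (ler_norm_sum _ _ _) _.
have -> : i.+1%:R * rho ^+ i = \sum_(k < i.+1) rho ^+ i by rewrite sumr_const card_ord mulr_natl.
apply: ler_sum => k _.
have -> : rho ^+ i = rho ^+ (i.+1.-1 - k) * rho ^+ k by rewrite -exprD subnK// -ltnS.
by rewrite normrM !normrX; apply: ler_pM; rewrite ?exprn_ge0//; apply: lerXn2r; rewrite ?nnegrE.
Qed.

Lemma ev_lip c K K1 rho t t' s : 0 < rho -> nb (wt rho c) K -> nb (wt rho (dT c)) K1 ->
  `|t| <= rho -> `|t'| <= rho -> `|s| <= rho -> `|ev c t s - ev c t' s| <= K1 * `|t - t'|.
Proof.
move=> rp hK hK1 tr tr' sr; pose b i := sm (fun j => c i j * s ^+ j).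
have a1 := row_asm rp hK tr sr; have a2 := row_asm rp hK tr' sr.
have a12 : asm (fun i => t ^+ i * b i - t' ^+ i * b i) (K + K).
  by apply: eq_asm (asmD a1 (asmN a2)) => i.
rewrite /ev -(smB a1 a2) (sm_recl a12) !expr0 subrr add0r mulrC.
have [hr h3] : asm (fun i => rho ^+ i * sm (fun j => dT c i j * s ^+ j)) K1 /\ True.
  by split=> //; apply: (row_asm rp hK1) => //; rewrite gtr0_norm.
pose V i := `|t - t'| * `|rho ^+ i * sm (fun j => dT c i j * s ^+ j)|.
apply: le_trans (sm_norm_le (v := V) _ (asmZ `|t - t'| (asm_norm hr))) _.
  move=> i; rewrite /V -mulrBl normrM (row_dT i rp hK sr).
  rewrite !normrM (ger0_norm (exprn_ge0 i (ltW rp))) normr_nat.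
  have -> : rho ^+ i * (i.+1%:R * `|sm (fun j => c i.+1 j * s ^+ j)|) = (i.+1%:R * rho ^+ i) * `|b i.+1| by rewrite /b; ring.
  by rewrite mulrA; apply: ler_wpM2r => //; exact: exprB_le.
by rewrite (smZ _ (asm_norm hr)); apply: ler_wpM2l => //; apply: le_trans (ler_norm _) _; exact: sm_bound (asm_norm hr).
Qed.

Lemma lerD_frac (K1 K2 u v e : R) : 0 <= K1 -> 0 <= K2 -> 0 <= e -> u <= e / (1 + K1 + K2) -> v <= e / (1 + K1 + K2) ->
  K1 * u + K2 * v <= e.
Proof.
move=> k1 k2 e0 hu hv; apply: le_trans (lerD (ler_wpM2l k1 hu) (ler_wpM2l k2 hv)) _.
by rewrite -mulrDl mulrCA ler_piMr// ler_pdivrMr; lra.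
Qed.

Lemma ev_continuous c t s : good c -> `|t| < 1 -> `|s| < 1 ->
  {for (t, s), continuous (fun q : R * R => ev c q.1 q.2)}.
Proof.
move=> h t1 s1; have [rho [r01 tr sr]] := radius t1 s1; have rp : 0 < rho by case/andP: r01.
have [K hK] := h rho r01; have [K1 hK1] := good_dT h r01.
have ht := good_trA h; have [K' hK'] := ht rho r01; have [K2 hK2] := good_dT ht r01.
have K10 := nb_ge0 hK1; have K20 := nb_ge0 hK2.
apply/cvgrPdist_le => e e0.
have hd : 0 < Num.min (Num.min (rho - `|t|) (rho - `|s|)) (e / (1 + K1 + K2)).
  by rewrite !lt_min !subr_gt0 tr sr divr_gt0// -addrA; apply: ltr_wpDr => //; exact: addr_ge0.
near=> q.
have [q1 q2] : `|t - q.1| < Num.min (Num.min (rho - `|t|) (rho - `|s|)) (e / (1 + K1 + K2)) /\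
  `|s - q.2| < Num.min (Num.min (rho - `|t|) (rho - `|s|)) (e / (1 + K1 + K2)).
  by near: q; exact: (nbhsx_ballx (t, s) _ hd).
move: q1 q2; rewrite !lt_min => /andP[/andP[a1 a2] a3] /andP[/andP[b1 b2] b3].
have tq : `|q.1| <= rho.
  by rewrite -(subKr t q.1); apply: le_trans (ler_normB _ _) _; clear -a1; lra.
have sq : `|q.2| <= rho.
  by rewrite -(subKr s q.2); apply: le_trans (ler_normB _ _) _; clear -b2; lra.
have r1 : rho < 1 by case/andP: r01.
have h1 := ev_lip rp hK hK1 (ltW tr) tq (ltW sr).
have h2 := ev_lip rp hK' hK2 (ltW sr) sq tq.
have q1' := le_lt_trans tq r1; have q2' := le_lt_trans sq r1.
rewrite -(ev_trA h q1' s1) -(ev_trA h q1' q2') in h2.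
rewrite -(subrKA (ev c q.1 s)); apply: le_trans (ler_normD _ _) _; apply: le_trans (lerD h1 h2) _ => /=.
by apply: lerD_frac => //; exact: ltW.
Unshelve. all: by end_near.
Qed.

Lemma ev_affine_derive c (t0 r t s : R) : 0 < r -> good c -> `|t - t0| < r -> `|s| < 1 ->
  is_derive t (1 : R) (fun u => ev c ((u - t0) / r) s) (r^-1 * ev (dT c) ((t - t0) / r) s).
Proof.
move=> r0 h tr s1.
have t1 : `|(t - t0) / r| < 1 by rewrite normrM normfV (gtr0_norm r0) ltr_pdivrMr// mul1r.
have hg := ev_is_derive h t1 s1.
have haf : is_derive t (1 : R) (fun u => (u - t0) / r) r^-1.
  have -> : (fun u : R => (u - t0) / r) = (fun u => r^-1 * u + - (t0 / r)).
    by apply/funext => u; rewrite mulrBl mulrC.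
  by apply: is_derive_eq; rewrite subr0; exact: mulr1.
by have := @is_derive1_comp R (fun v => ev c v s) (fun u => (u - t0) / r) t _ _ hg haf; rewrite mulrC.
Qed.

Lemma is_derive_affine (F : R -> R) (k b t D : R) : is_derive t (1 : R) F D -> is_derive t (1 : R) (fun u => k + b * F u) (b * D).
Proof. by move=> h; have := is_deriveD (is_derive_cst k t (1 : R)) (is_deriveZ b h); rewrite add0r. Qed.

Lemma near_dist (t0 t e : R) (Q : R -> Prop) : `|t - t0| < e -> (forall u, `|u - t0| < e -> Q u) -> \forall u \near t, Q u.
Proof.
move=> h hQ; have h' : 0 < e - `|t - t0| by lra.
apply: filterS (nbhsx_ballx t _ h') => u /= hu; apply: hQ.
by rewrite -(subrKA t); apply: le_lt_trans (ler_normD _ _) _; rewrite distrC; move: hu; rewrite /ball/=; lra.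
Qed.

Section OneVariable.
Variables (f : R -> R) (k t0 e r : R).

Lemma rep_derive1n c : 0 < r -> e <= r -> good c ->
  (forall t, `|t - t0| < e -> f t = k + ev c ((t - t0) / r) 0) ->
  forall n t, `|t - t0| < e ->
  derivable (derive1n n f) t 1 /\ derive1n n.+1 f t = r ^- n.+1 * ev (iter n.+1 dT c) ((t - t0) / r) 0.
Proof.
move=> r0 er hc hf; have g n : good (iter n dT c) by elim: n => [//|n ih]; exact: good_dT.
have one k' c' (F : R -> R) b : good c' -> (forall t, `|t - t0| < e -> F t = k' + b * ev c' ((t - t0) / r) 0) ->
    forall t, `|t - t0| < e -> is_derive t (1 : R) F (b * (r^-1 * ev (dT c') ((t - t0) / r) 0)).
  move=> hc' hF t ht; have n0 : `|0 : R| < 1 by rewrite normr0.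
  have h1 := ev_affine_derive r0 hc' (lt_le_trans ht er) n0.
  have : is_derive t (1 : R) (fun u => k' + b * ev c' ((u - t0) / r) 0) (b * (r^-1 * ev (dT c') ((t - t0) / r) 0)).
    exact: is_derive_affine.
  by apply: near_eq_is_derive; apply: near_dist ht _ => u /hF ->.
elim=> [|n ih] t ht.
  have h := @one k c f 1 hc (fun t ht => etrans (hf t ht) (congr1 (+%R k) (esym (mul1r _)))) t ht.
  by split=> //; rewrite derive1n1 derive1E (@derive_val _ _ _ _ _ _ _ h) mul1r expr1.
have hF u : `|u - t0| < e -> derive1n n.+1 f u = 0 + r ^- n.+1 * ev (iter n.+1 dT c) ((u - t0) / r) 0.
  by move=> /ih[_ ->]; rewrite add0r.
have h := one _ _ _ _ (g n.+1) hF t ht; split=> //.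
by rewrite derive1nS derive1E (@derive_val _ _ _ _ _ _ _ h) mulrA -invfM -exprSr.
Qed.

Lemma ev_s0 c K t : nb c K -> `|t| <= 1 -> ev c t 0 = sm (fun i => t ^+ i * c i 0%N).
Proof.
move=> hc t1; apply: eq_sm => i; congr (_ * _).
by rewrite (sm_single (a := 0%N)) ?expr0 ?mulr1// => j j0; rewrite expr0n (negbTE j0) mulr0.
Qed.

Lemma rep_bounds c K : 0 < r -> e <= r / 8 -> nb c K -> (forall t, `|t - t0| < e -> f t = k + ev c ((t - t0) / r) 0) ->
  forall t, `|t - t0| < e -> [/\ `|derive1n 1 f t| <= 4 * K / r, `|derive1n 2 f t| <= 32 * K / r ^+ 2
     & `|derive1n 3 f t| <= 512 * K / r ^+ 3].
Proof.
move=> r0 er hc hf t ht; have hg := nb_good hc.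
have er' : e <= r by lra.
have K0 := nb_ge0 hc.
have h1 : nb (wt 1 c) K by apply: eq_nb hc => i j; rewrite /wt expr1n mulr1.
have e2 : 1 / (1 - 1 / 2 / 1) / (1 / 2) = 4 :> R by field.
have e4 : 1 / (1 - 1 / 4 / (1 / 2)) / (1 / 4) = 8 :> R by field.
have e8 : 1 / (1 - 1 / 8 / (1 / 4)) / (1 / 8) = 16 :> R by field.
have h2 : nb (wt (1 / 2) (dT c)) (K * 4) by rewrite -e2; apply: nb_dT h1; lra.
have h3 : nb (wt (1 / 4) (dT (dT c))) (K * 4 * 8) by rewrite -e4; apply: nb_dT h2; lra.
have h4 : nb (wt (1 / 8) (dT (dT (dT c)))) (K * 4 * 8 * 16) by rewrite -e8; apply: nb_dT h3; lra.
have tr : `|(t - t0) / r| <= 1 / 8.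
  by rewrite normrM normfV (gtr0_norm r0) ler_pdivrMr//; lra.
have z0 x : 0 < x -> `|0 : R| <= x by rewrite normr0; exact: ltW.
have bd n (x C : R) : 1 / 8 <= x -> nb (wt x (iter n dT c)) C -> `|r ^- n * ev (iter n dT c) ((t - t0) / r) 0| <= C / r ^+ n.
  move=> x8 hx; have xp : 0 < x by lra.
  rewrite normrM normfV (ger0_norm (exprn_ge0 n (ltW r0))) mulrC; apply: ler_wpM2r.
    by rewrite invr_ge0 exprn_ge0 ?ltW.
  by apply: (ev_le xp hx) (z0 _ xp); exact: le_trans tr x8.
have hd n := (rep_derive1n r0 er' hg hf n ht).2; rewrite !hd.
have -> : 32 * K = K * 4 * 8 by ring.
have -> : 512 * K = K * 4 * 8 * 16 by ring.
have -> : 4 * K / r = K * 4 / r ^+ 1 by rewrite expr1 [4 * K]mulrC.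
split; [apply: (bd 1%N (1 / 2)) h2|apply: (bd 2%N (1 / 4)) h3|apply: (bd 3%N (1 / 8)) h4]; lra.
Qed.

End OneVariable.

Lemma rep_analytic (f : R -> R) (D : set R) : (forall t0, D t0 -> exists (k r K : R) (c : nat -> nat -> R),
   [/\ 0 < r, nb c K & forall t, `|t - t0| < r -> f t = k + ev c ((t - t0) / r) 0]) -> real_analytic_on f D.
Proof.
move=> h t0 /h[k [r [K [c [r0 hc hf]]]]]; exists r; split=> //.
exists (fun n => (n == 0%N)%:R * k + c n 0%N / r ^+ n) => t ht.
have t1 : `|(t - t0) / r| <= 1 by rewrite normrM normfV (gtr0_norm r0) ler_pdivrMr// mul1r ltW.
rewrite hf// (ev_s0 hc t1).
have ha : asm (fun i => ((t - t0) / r) ^+ i * c i 0%N) K.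
  have := nb_asm; have h0 : `|0 : R| <= 1 by rewrite normr0 ler01.
  move=> _; apply: eq_asm (ev_asm t1 h0 hc) => i; congr (_ * _).
  by rewrite (sm_single (a := 0%N)) ?expr0 ?mulr1// => j j0; rewrite expr0n (negbTE j0) mulr0.
have h1 := asm_cvg ha; have h2 : (fun=> k) @ \oo --> (k : R) by exact: cvg_cst.
have h3 := (cvgn_epsP _ _).1 (cvgD h2 h1); apply: (cvgn_epsP _ _).2 => eps /h3[N hN]; exists (maxn N 1) => n; rewrite geq_max => /andP[Nn].
have := hN n Nn; rewrite -[(_ + _) n]/(k + series _ n) series_ordE; case: n {Nn} => // n + _.
congr (`|_ - _| <= _); rewrite [in LHS]big_ord_recl [in RHS]big_ord_recl /= !expr0 !mul1r divr1 mulr1 -addrA.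
congr (_ + (_ + _)); apply: eq_bigr => i _; rewrite mul0r add0r exprMn exprVn; ring.
Qed.

Lemma rep_smooth2 (f : R -> R -> R) (k e r : R) c : 0 < r -> e <= r -> good c ->
  (forall t s, `|t| < e -> `|s| < e -> f t s = k + ev c (t / r) (s / r)) ->
  smooth2_on f [set q : R * R | `|q.1| < e /\ `|q.2| < e].
Proof.
move=> r0 er hc hf.
have near0 t (Q : R -> Prop) : `|t| < e -> (forall u, `|u| < e -> Q u) -> \forall u \near t, Q u.
  move=> ht hQ; apply: (@near_dist 0 t e Q); rewrite ?subr0// => u; rewrite subr0; exact: hQ.
have div1 t : `|t| < e -> `|t / r| < 1.
  by move=> ht; rewrite normrM normfV (gtr0_norm r0) ltr_pdivrMr// mul1r; exact: lt_le_trans ht er.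
pose repr g k' c' := good c' /\ forall t s, `|t| < e -> `|s| < e -> g t s = k' + ev c' (t / r) (s / r).
have dvT g k' c' : repr g k' c' -> forall t s, `|t| < e -> `|s| < e ->
    is_derive t (1 : R) (fun u => g u s) (r^-1 * ev (dT c') (t / r) (s / r)).
  move=> [hc' hg] t s ht hs.
  have h1 : is_derive t (1 : R) (fun u => ev c' (u / r) (s / r)) (r^-1 * ev (dT c') (t / r) (s / r)).
    have := @ev_affine_derive c' 0 r t (s / r) r0 hc'; rewrite !subr0 => /(_ (lt_le_trans ht er) (div1 s hs)).
    by have -> : (fun u => ev c' ((u - 0) / r) (s / r)) = (fun u => ev c' (u / r) (s / r)) by apply/funext => u; rewrite subr0.
  have : is_derive t (1 : R) (fun u => k' + ev c' (u / r) (s / r)) (r^-1 * ev (dT c') (t / r) (s / r)).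
    by rewrite -[_ * ev _ _ _]mul1r; have := is_derive_affine k' 1 h1; under eq_fun do rewrite mul1r.
  by apply: near_eq_is_derive; apply: near0 ht _ => u hu; rewrite hg.
have tr g k' c' : repr g k' c' -> repr (fun s t => g t s) k' (trA c').
  by move=> [hc' hg]; split; [exact: good_trA|move=> t s ht hs; rewrite (hg _ _ hs ht) (ev_trA hc' (div1 s hs) (div1 t ht))].
have dvS g k' c' : repr g k' c' -> forall t s, `|t| < e -> `|s| < e ->
    is_derive s (1 : R) (fun u => g t u) (r^-1 * ev (dS c') (t / r) (s / r)).
  move=> hr t s ht hs; have := dvT _ _ _ (tr _ _ _ hr) s t hs ht.
  rewrite -[ev (dS c') _ _]ev_trA ?div1//; exact: good_dT (good_trA hr.1).
have step b g k' c' : repr g k' c' -> exists k'' c'', repr (pderiv b g) k'' c''.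
  move=> hr; exists 0, (sclA r^-1 (if b then dT c' else dS c')); split.
    by apply: goodZ; case: b; [exact: good_dT hr.1|exact: good_dS hr.1].
  move=> t s ht hs; have [rho [r01 tr1 sr1]] := radius (div1 t ht) (div1 s hs).
  have rp : 0 < rho by case/andP: r01.
  have evZ' c1 : good c1 -> ev (sclA r^-1 c1) (t / r) (s / r) = r^-1 * ev c1 (t / r) (s / r).
    move=> h; have [K hK] := h rho r01; rewrite /ev /sclA -(smZ _ (row_asm rp hK (ltW tr1) (ltW sr1))).
    apply: eq_sm => i; rewrite mulrCA; congr (_ * _).
    have [B hB] := row_abs i rp hK (ltW sr1).
    by rewrite -(smZ _ hB); apply: eq_sm => j; rewrite mulrA.
  rewrite add0r; case: b.
    rewrite evZ'; last exact: good_dT hr.1.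
    by rewrite /pderiv derive1E; have h := dvT _ _ _ hr t s ht hs; rewrite derive_val.
  rewrite evZ'; last exact: good_dS hr.1.
  by rewrite /pderiv derive1E; have h := dvS _ _ _ hr t s ht hs; rewrite derive_val.
have all l : exists k' c', repr (ipderiv l f) k' c'.
  by elim: l => [|b l [k' [c' ih]]]; [exists k, c|exact: step ih].
move=> l; have [k' [c' hr]] := all l; split=> -[t s] /= [ht hs].
  by split; [have h := dvT _ _ _ hr t s ht hs|have h := dvS _ _ _ hr t s ht hs].
have hcont : (fun q : R * R => k' + ev c' (q.1 / r) (q.2 / r)) x @[x --> (t, s)] --> k' + ev c' (t / r) (s / r).
  apply: cvgD; first exact: cvg_cst.
  apply: (@cvg_comp _ _ _ (fun q : R * R => (q.1 / r, q.2 / r)) (fun q : R * R => ev c' q.1 q.2) _ (nbhs (t / r, s / r))).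
    have c1 : (fun q : R * R => q.1 / r) @ (t, s) --> t / r by apply: cvgMl; exact: cvg_fst.
    have c2 : (fun q : R * R => q.2 / r) @ (t, s) --> s / r by apply: cvgMl; exact: cvg_snd.
    exact: (cvg_pair c1 c2).
  exact: (ev_continuous hr.1 (div1 t ht) (div1 s hs)).
rewrite hr.2//; apply: cvg_trans hcont; apply: near_eq_cvg.
have : \forall q \near (t, s), `|q.1| < e /\ `|q.2| < e.
  have n1 := near0 t (fun u => `|u| < e) ht (fun u h => h); have n2 := near0 s (fun u => `|u| < e) hs (fun u h => h).
  by exists ([set u | `|u| < e], [set u | `|u| < e]) => //= -[u v] /= [].
by apply: filterS => -[u v] /= [hu hv]; rewrite hr.2.
Qed.

End PowerSeries.

(** * Tangency and uniqueness *)

Section Tangent.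
Variables (S : countType) (a : S) (E : rel S) (R : realType) (th : R) (phi : Sig a -> R).
Variable d : rpfpar a E R.
Hypothesis dH : rpf_spec th phi d.
Local Notation X := (Sig a).
Local Notation P := (rd_P d).
Local Notation L := (cloops (rd_cl d)).
Local Notation g := (gk phi (d := d)).

Lemma obs_cont (chi : X -> R) : obs E th chi -> cont_adm E chi.
Proof.
move=> [_ h]; apply: (holder_cont ler01 (rs_th dH)) => n _ x y xa ya xy.
by rewrite mul1r; exact: h.
Qed.

Lemma ib_obs (mu : probability X R) (chi : X -> R) : obs E th chi -> ib E mu chi.
Proof.
move=> h; apply: (bm_integrable mu (K := 1)); split; last exact: h.1.
exact: meas_restr (obs_cont h).
Qed.

Lemma holder_perturb (chi : X -> R) (t : R) : obs E th chi -> holder_with E (rd_A d + `|t|) th (fun x => phi x + t * chi x).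
Proof.
move=> h n n2 x y xa ya xy; rewrite mulrDl.
have -> : phi x + t * chi x - (phi y + t * chi y) = (phi x - phi y) + t * (chi x - chi y) by ring.
apply: le_trans (ler_normD _ _) _; apply: lerD; first exact: (rs_holder dH).
by rewrite normrM; apply: ler_wpM2l => //; exact: h.2.
Qed.

Lemma sup_perturb (chi : X -> R) (t : R) (x : X) : obs E th chi -> adm E x -> phi x + t * chi x <= rd_sup d + `|t|.
Proof.
move=> h xa; apply: lerD; first exact: (rs_supP dH).
apply: le_trans (ler_norm _) _; rewrite normrM -[leRHS]mulr1; apply: ler_wpM2l => //; exact: h.1.
Qed.

Lemma Pmu_fin (mu : probability X R) (c : R) : Pmu E mu phi = c%:E ->
  ib E mu phi /\ hKS mu = (c - integ E mu phi)%:E.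
Proof.
rewrite /Pmu => h.
have [ip|ni] := integral_bounded_above mu (holder_cont (rs_A0 dH) (rs_th dH) (rs_holder dH)) (rs_supP dH).
  split=> //; move: h; rewrite (_ : \int[mu]_x _ = (integ E mu phi)%:E)%E.
    by case: (hKS mu) => [r| |] //; rewrite -EFinD => -[<-]; congr EFin; ring.
  by rewrite /integ fineK//; apply: integrable_fin_num.
by move: h; rewrite ni addeC; case: (hKS mu).
Qed.

Lemma ev00 (c : nat -> nat -> R) : ev c 0 0 = c 0%N 0%N.
Proof.
rewrite /ev (sm_single (a := 0%N)) => [|i i0]; last by rewrite expr0n (negbTE i0) mul0r.
by rewrite expr0 mul1r (sm_single (a := 0%N)) => [|j j0]; rewrite ?expr0 ?mulr1// expr0n (negbTE j0) mulr0.
Qed.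

Lemma tangent (mu : probability X R) (chi : X -> R) (r K : R) (Q : nat -> nat -> R) (b : S) :
  invariant_prob E mu -> Pmu E mu phi = P%:E -> obs E th chi -> 0 < r -> nb Q K -> Q 0%N 0%N = 0 ->
  (forall t, `|t| <= r -> PG E (fun x => phi x + t * chi x) b = (P + ev Q (t / r) 0)%:E) ->
  integ E mu chi = Q 1%N 0%N / r.
Proof.
move=> hmu hP hchi r0 hQ Q0 hp; have [ip hK] := Pmu_fin hP; have ic := ib_obs mu hchi.
set I := integ E mu chi; pose F t := ev Q ((t - 0) / r) 0 + (- I) * t.
have F0 : F 0 = 0 by rewrite /F subrr mul0r ev00 Q0 mulr0 addr0.
have Fge t : `|t| <= r -> 0 <= F t.
  move=> tr; have := Pmu_le (rs_mix dH) (addr_ge0 (rs_A0 dH) (normr_ge0 t)) (rs_th dH) (holder_perturb t hchi)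
    (fun x xa => sup_perturb t hchi xa) (hp t tr) hmu.
  have it : ib E mu (fun x => phi x + t * chi x) := ibD ip (ibZ t ic).
  rewrite /Pmu hK (_ : \int[mu]_x _ = (integ E mu (fun x => phi x + t * chi x)%R)%:E)%E; last first.
    by rewrite /integ fineK//; apply: integrable_fin_num.
  rewrite (integD ip (ibZ t ic)) (integZ _ ic) -EFinD lee_fin /F subr0 -/I; lra.
have dF t : `|t| < r -> is_derive t (1 : R) F (r^-1 * ev (dT Q) ((t - 0) / r) 0 + - I).
  move=> tr; have tr' : `|t - 0| < r by rewrite subr0.
  have n0 : `|0 : R| < 1 by rewrite normr0.
  have h1 := ev_affine_derive r0 (nb_good hQ) tr' n0.
  have h2 : is_derive t (1 : R) (fun t => (- I) * t) (- I).
    have := is_deriveZ (- I) (is_derive_id t (1 : R)); by rewrite [_ *: _]mulr1.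
  exact: is_deriveD h1 h2.
have rr : - r <= r by lra.
have z : (0 : R) \in `]- r, r[ by rewrite in_itv/= oppr_lt0 r0.
have itv t : t \in `]- r, r[ -> `|t| < r by rewrite in_itv/= ltr_norml.
have Fmin (t : R) : t \in `]- r, r[ -> F 0 <= F t by move=> /itv/ltW/Fge; rewrite F0.
have hmin := derive1_at_min rr (fun t ht => @ex_derive _ _ _ _ _ _ _ (dF t (itv t ht))) z Fmin.
have := dF 0 (itv 0 z); rewrite subrr mul0r ev00 => h0.
have e1 := @derive_val _ _ _ _ _ _ _ hmin; have e2 := @derive_val _ _ _ _ _ _ _ h0.
by move: e2; rewrite e1 /dT mul1r; lra.
Qed.

Lemma pressure_rep : exists r K : R, [/\ 0 < r, 0 <= K & forall chi, obs E th chi -> exists (Q : nat -> nat -> R),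
  [/\ nb Q K, Q 0%N 0%N = 0, forall t b, `|t| <= r -> PG E (fun x => phi x + t * chi x) b = (P + ev Q (t / r) 0)%:E
   & poisson phi d r Q chi]].
Proof.
have [r [K [r0 rK h]]] := local_pressure dH; exists r, K; split=> //.
  have o0 : obs E th (fun _ : X => 0).
    split=> [x _|n x y _ _ _]; rewrite ?subrr normr0 ?ler01//.
    by apply: exprn_ge0; have := rs_th dH; lra.
  have [Q [hQ _ _ _]] := h _ _ o0 o0; exact: nb_ge0 hQ.
move=> chi hc; have [Q [hQ Q0 hp hu]] := h chi chi hc hc; exists Q; split=> // t b tr; have z : `|0 : R| <= r by rewrite normr0 ltW.
have -> : (fun x => phi x + t * chi x) = (fun x => phi x + t * chi x + 0 * chi x).
  by apply/funext => x; rewrite mul0r addr0.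
by rewrite (hp t 0 b tr z) mul0r.
Qed.

Lemma obs_coord l (B : set X) : coord l B -> obs E th (fun x => th ^+ l * \1_B x).
Proof.
have th01 := rs_th dH; have [t0 t1] : 0 <= th /\ th <= 1 by lra.
move=> hB; have le1 x : `|th ^+ l * \1_B x| <= th ^+ l.
  rewrite normrM (ger0_norm (exprn_ge0 _ t0)) ler_piMr ?exprn_ge0//.
  by rewrite indicE normr_nat lern1 leq_b1.
split=> [x _|n x y _ _ xy]; first by apply: le_trans (le1 x) _; exact: exprn_ile1.
rewrite -mulrBr normrM (ger0_norm (exprn_ge0 _ t0)).
have [ln|nl] := leqP l n.
  have -> : \1_B x = \1_B y :> R.
    have xy' := agree_le ln xy; rewrite !indicE; congr (nat_of_bool _)%:R; apply/idP/idP => /set_mem h; apply/mem_set.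
      exact: hB h.
    by apply: hB h; apply: agree_sym.
  by rewrite subrr normr0 mulr0 exprn_ge0.
apply: (@le_trans _ _ (th ^+ l)).
  rewrite ler_piMr ?exprn_ge0// !indicE; case: (x \in B); case: (y \in B); rewrite ?subrr ?subr0 ?sub0r ?normrN ?normr0 ?normr1//.
by rewrite ler_wiXn2l ?t0 ?t1// ltnW.
Qed.

Lemma equilibrium_unique (m mu : probability X R) : invariant_prob E m -> invariant_prob E mu ->
  Pmu E m phi = P%:E -> Pmu E mu phi = P%:E -> same_measure mu m.
Proof.
move=> hm hmu Pm Pu; have [r [K [r0 _ h]]] := pressure_rep.
suff : forall l (B : set X), coord l B -> mu B = m B by move=> hc A mA; apply: (measure_coord_eq hc).
move=> l B hB; have mB := meas_coord hB; rewrite -!prE//; congr EFin.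
have hc := obs_coord hB; have [Q [hQ Q0 hp _]] := h _ hc.
have t1 := tangent hmu Pu hc r0 hQ Q0 (fun t => hp t a); have t2 := tangent hm Pm hc r0 hQ Q0 (fun t => hp t a).
have thp : 0 < th ^+ l by apply: exprn_gt0; have := rs_th dH; lra.
have iz (nu' : probability X R) : nu' [set x : X | adm E x] = 1%E -> integ E nu' (fun x => th ^+ l * \1_B x) = th ^+ l * pr nu' B.
  by move=> h1; rewrite (integZ _ (bm_integrable nu' (bm_indic E R mB))) (integ_indic (E := E) h1 mB).
by move: t1; rewrite -t2 (iz _ hmu.1) (iz _ hm.1) => /(mulfI (lt0r_neq0 thp)).
Qed.
End Tangent.

(** * Asymptotic variance *)

Lemma sum_cst (R : pzRingType) n (c : R) : \sum_(i < n) c = n%:R * c.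
Proof. by rewrite sumr_const card_ord mulr_natl. Qed.

Lemma birkhoffS (S : countType) (a : S) (R : realType) (F : Sig a -> R) n x :
  birkhoff F n.+1 x = birkhoff F n x + F (iter n (@Defs.shift S a) x).
Proof. by rewrite -addn1 birkhoffD birkhoff1. Qed.

Section Variance.
Variables (S : countType) (a : S) (E : rel S) (R : realType) (th : R) (phi : Sig a -> R).
Variable d : rpfpar a E R.
Hypothesis dH : rpf_spec th phi d.
Local Notation X := (Sig a).
Local Notation sh := (@Defs.shift S a).
Local Notation L := (cloops (rd_cl d)).
Local Notation g := (@gk S a E R phi d).
Local Notation nug := (nu g).
Local Notation al := (rd_al d).
Local Notation Lp := (Lip (L := L) al).
Local Notation M := (@MF S a E R phi d).
Local Notation bhh := (@bh S a E R th).
Local Notation lsum := (@loop_sum S a E R d).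
Local Notation avgg := (@avg S a E R phi d).
Let b0 := bk_ge0 dH.
Let th01 := rs_th dH.
Let mw := rs_mw dH.
Let hg := gk_kern dH.

Section Poisson.
Variables (U : L -> R) (HU : R) (pb : X -> R) (Kp Dp : R).
Hypotheses (hU : Lp HU U) (hpb : bhh Kp Dp pb).
Hypothesis hPoisson : forall x, U x = avgg (lsum pb) x + op g U x.

(* [U] solves the Poisson equation of the induced system; [MV F] is the mean of
   [F] against the coboundary part [vv], so that covariances telescope. *)
Definition vv n (x : L) i : R := U (pre n x) + birkhoff pb i (sval (pre n x)).
Definition vF (F : X -> R) n (x : L) : R := \sum_(i < tau L n) vv n x i * F (iter i sh (sval (pre n x))).
Definition JV F : L -> R := avgg (vF F).
Definition MV F : R := nug (JV F) / taumean phi d.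

Lemma vv_bounds : exists C : R, [/\ 0 <= C,
  forall n (x : L) i, (i <= tau L n)%N -> `|vv n x i| <= C * (tau L n)%:R &
  forall n k x y i, (i <= tau L n)%N -> (0 < k)%N -> agr k x y -> `|vv n x i - vv n y i| <= C * al k].
Proof.
have [K0 D0 h1 h2] := hpb; have hB := bdd_of_Lip mw hU; have [H0 hl] := hU.
set B := `|U (bpt L)| + HU in hB; have B0 : 0 <= B by exact: bdd_ge0 hB.
have C0 := dist_cst_ge0 D0 th01.
exists (B + Kp + HU + 2 * dist_cst Dp th); split; first by lra.
  move=> n x i it; have t1 : (1 : R) <= (tau L n)%:R by rewrite ler1n tau_gt0.
  apply: le_trans (ler_normD _ _) _.
  have := birkhoff_bdd i (C := Kp) h1 (Yadm (pre n x)).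
  have : Kp * i%:R <= Kp * (tau L n)%:R by apply: ler_wpM2l => //; rewrite ler_nat.
  have := hB (pre n x); nra.
move=> n k x y i it k0 xy; have a0 := al_ge0 mw k.
rewrite /vv opprD addrACA; apply: le_trans (ler_normD _ _) _.
have e1 : `|U (pre n x) - U (pre n y)| <= HU * al k.
  apply: le_trans (hl k.+1 _ _ isT (agr_preS n xy)) _; apply: ler_wpM2l => //.
  exact: (al_le b0 th01 mw k0 (leqnSn k)).
have e2 : `|birkhoff pb i (sval (pre n x)) - birkhoff pb i (sval (pre n y))| <= dist_cst Dp th * th ^+ k.
  apply: (@birkhoff_dist S a E R Dp th pb D0 th01 _ i k) => //.
  - by move=> m _ z w hz hw hzw; exact: h2.
  - exact: Yadm.
  - exact: Yadm.
  - by apply: agree_le (agr_pre n xy); rewrite leq_add2r.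
have [_ _ _ /(_ k) ta] := mw.
have : dist_cst Dp th * th ^+ k <= dist_cst Dp th * (2 * al k) by apply: ler_wpM2l.
nra.
Qed.

Lemma vF_ok K D F : bhh K D F -> exists H B, Lp H (JV F) /\ forall x, asm (fun n => g n x * vF F n x) B.
Proof.
have [Ca Ca0 h] := avg_al dH; have [C [C0 v1 v2]] := vv_bounds => -[K0 D0 f1 f2].
have CK : 0 <= C * K by exact: mulr_ge0.
have CD : 0 <= C * K + C * (2 * D) by apply: addr_ge0 => //; apply: mulr_ge0 => //; exact: mulr_ge0.
have [n x|n k x y k0 xy|hl ha] := h (vF F) _ _ CK CD.
- apply: le_trans (ler_norm_sum _ _ _) _.
  rewrite (_ : C * K * _ = (tau L n)%:R * (C * (tau L n)%:R * K)); last ring.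
  rewrite -(sum_cst (tau L n)); apply: ler_sum => i _; rewrite normrM; apply: ler_pM => //; first by apply: v1; exact: ltnW.
  by apply: f1; exact/adm_iter/Yadm.
- have a0 := al_ge0 mw k.
  rewrite /vF -sumrB; apply: le_trans (ler_norm_sum _ _ _) _.
  rewrite (_ : _ * al k * _ = (tau L n)%:R * ((C * K + C * (2 * D)) * al k * (tau L n)%:R)); last ring.
  rewrite -(sum_cst (tau L n)); apply: ler_sum => i _.
  have it := ltnW (ltn_ord i); have t1 : (1 : R) <= (tau L n)%:R by rewrite ler1n tau_gt0.
  set p := vv n x i; set q := vv n y i; set s := F _; set t := F (iter i sh (sval (pre n y))).
  have -> : p * s - q * t = (p - q) * s + q * (s - t) by ring.
  apply: le_trans (ler_normD _ _) _; rewrite !normrM.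
  have e1 : `|p - q| * `|s| <= (C * al k) * K.
    by apply: ler_pM => //; [exact: v2|apply: f1; exact/adm_iter/Yadm].
  have e2 : `|q| * `|s - t| <= (C * (tau L n)%:R) * (D * (2 * al k)).
    apply: ler_pM => //; first exact: v1.
    apply: (@le_trans _ _ (D * th ^+ k)).
      apply: f2; [exact/adm_iter/Yadm|exact/adm_iter/Yadm|].
      by apply: agree_iter; apply: agree_le (agr_pre n xy); rewrite addnC leq_add2r.
    by apply: ler_wpM2l => //; have [_ _ _ /(_ k)] := mw.
  have : (C * al k * K) * 1 <= (C * al k * K) * (tau L n)%:R by apply: ler_wpM2l => //; do !apply: mulr_ge0 => //.
  rewrite mulr1; move: e1 e2; move: (`|p - q| * _) (`|q| * _) => w1 w2; nra.
- by do 2 eexists; split; [exact: hl|exact: ha].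
Qed.

Lemma MVD K D F K' D' G : bhh K D F -> bhh K' D' G -> MV (fun x => F x + G x) = MV F + MV G.
Proof.
move=> /vF_ok[H [B [h1 a1]]] /vF_ok[H' [B' [h2 a2]]].
rewrite /MV -mulrDl -(nuD b0 th01 mw hg h1 h2); congr (nu _ _ / _); apply/funext => x.
rewrite -(smD (a1 x) (a2 x)); apply: eq_sm => n; rewrite -mulrDr -big_split; congr (_ * _).
by apply: eq_bigr => i _; rewrite mulrDr.
Qed.

Lemma MVZ c K D F : bhh K D F -> MV (fun x => c * F x) = c * MV F.
Proof.
move=> /vF_ok[H [B [h1 a1]]]; rewrite /MV mulrA -(nuZ b0 th01 mw hg _ h1); congr (nu _ _ / _); apply/funext => x.
rewrite -(smZ c (a1 x)); apply: eq_sm => n; rewrite [RHS]mulrCA; congr (_ * _).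
by rewrite /vF mulr_sumr; apply: eq_bigr => i _; rewrite mulrCA.
Qed.

Lemma JF_ok K D F : bhh K D F -> exists H B, Lp H (JF phi (d := d) F) /\ forall x, asm (fun n => g n x * lsum F n x) B.
Proof. by have [CJ CJ0 h] := J_exists dH => /h[h1 h2]; do 2 eexists; split; [exact: h1|exact: h2]. Qed.

Lemma M_pb0 : M pb = 0.
Proof.
have [H [B [h1 a1]]] := JF_ok hpb; have h2 := contraction b0 th01 mw hg hU.
rewrite /MF (_ : JF phi (d := d) pb = (fun x => U x + (-1) * op g U x)).
  by rewrite (nuD b0 th01 mw hg hU (LipZ (-1) h2)) (nuZ b0 th01 mw hg _ h2) (nu_op b0 th01 mw hg hU) mulN1r subrr mul0r.
by apply/funext => x; rewrite hPoisson -/(JF phi pb x); lra.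
Qed.

Lemma MV_shift K D F : bhh K D F -> M (fun x => pb x * F (sh x)) = MV F - MV (fun x => F (sh x)).
Proof.
move=> hF; have hFs := bh_shift dH hF; have hP := bhM hpb hFs.
have [H1 [B1 [l1 a1]]] := vF_ok hF; have [H2 [B2 [l2 a2]]] := vF_ok hFs; have [H3 [B3 [l3 a3]]] := JF_ok hP.
have [H4 [B4 [l4 a4]]] := JF_ok hpb.
have hFY := bh_Y dH hF; have [K0 D0 f1 f2] := hF.
have bU := bdd_of_Lip mw hU; set B := `|U (bpt L)| + HU in bU.
have hUF : exists2 H, Lp H (fun x => U x * F (sval x)) & bdd (B * K) (fun x : L => U x * F (sval x)).
  have [H0 hl] := hU; have [D20 hl'] := hFY; have B0 := bdd_ge0 bU.
  exists (HU * K + B * (2 * D)); last first.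
    by move=> x; rewrite normrM; apply: ler_pM => //; exact/f1/Yadm.
  split; first by do !apply: addr_ge0; do ?apply: mulr_ge0.
  move=> k x y k0 xy.
  have -> : U x * F (sval x) - U y * F (sval y) = (U x - U y) * F (sval x) + U y * (F (sval x) - F (sval y)) by ring.
  apply: le_trans (ler_normD _ _) _; rewrite !normrM mulrDl; apply: lerD.
    by rewrite mulrAC; apply: ler_pM => //; [exact: hl|exact/f1/Yadm].
  by rewrite -mulrA; apply: ler_pM => //; exact: hl'.
have [HUF lUF bUF] := hUF; have lop := contraction b0 th01 mw hg lUF.
rewrite /MF /MV -mulrBl; congr (_ / _).
have -> : JF phi (d := d) (fun x => pb x * F (sh x)) = fun x => (JV F x + (-1) * JV (fun x => F (sh x)) x) +
    (U x * F (sval x) + (-1) * op g (fun x => U x * F (sval x)) x).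
  apply/funext => x; rewrite [U x * _]mulrC {1}hPoisson mulrDr.
  have c1 := op_asm hg x bU; have c2 := op_asm hg x bUF.
  rewrite /JV /avg /op -!(smZ _ c1) -(smZ _ (a4 x)) -(smZ _ (a2 x)) -(smZ _ c2).
  have s1 := asmD (a1 x) (asmZ (-1) (a2 x)).
  have s2 := asmD (asmZ (F (sval x)) (a4 x)) (asmZ (F (sval x)) c1).
  rewrite -(smD (a1 x) (asmZ (-1) (a2 x))) -(smD (asmZ (F (sval x)) (a4 x)) (asmZ (F (sval x)) c1)).
  rewrite -(smD s2 (asmZ (-1) c2)) -(smD s1 (asmD s2 (asmZ (-1) c2))).
  apply: eq_sm => n; set y := sval (pre n x).
  have ex : iter (tau L n) sh y = sval x by exact: (iter_pre (rd_cl d)).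
  suff -> : lsum (fun x => pb x * F (sh x)) n x = vF F n x - vF (fun x => F (sh x)) n x +
      (U (pre n x) + lsum pb n x) * F (sval x) - U (pre n x) * F y by ring.
  rewrite -ex /loop_sum /vF -/y /vv -/y; elim: (tau L n) => [|j ih].
    by rewrite !big_ord0 !birkhoff0 /=; ring.
  rewrite !big_ord_recr !birkhoffS ih iterS /=; ring.
rewrite (nuD b0 th01 mw hg (LipD l1 (LipZ (-1) l2)) (LipD lUF (LipZ (-1) lop))).
rewrite (nuD b0 th01 mw hg l1 (LipZ (-1) l2)) (nuD b0 th01 mw hg lUF (LipZ (-1) lop)).
by rewrite !(nuZ b0 th01 mw hg _ l2, nuZ b0 th01 mw hg _ lop) (nu_op b0 th01 mw hg lUF); ring.
Qed.

Definition kappa : R := M (fun x => pb x * pb x) + 2 * MV pb.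

Lemma loop_square n x : lsum pb n x ^+ 2 + 2 * (lsum pb n x * U (pre n x)) =
  lsum (fun x => pb x * pb x) n x + 2 * vF pb n x.
Proof.
rewrite /loop_sum /vF /vv; elim: (tau L n) => [|j ih]; first by rewrite !big_ord0 !birkhoff0; ring.
rewrite big_ord_recr !birkhoffS /=.
by have := ih; set s := birkhoff pb j _; set q := birkhoff _ j _; set w := \sum_(i < j) _ => h; lra.
Qed.

Lemma kappaE : kappa * taumean phi d = nug (avgg (fun n x => lsum pb n x ^+ 2 + 2 * (lsum pb n x * U (pre n x)))).
Proof.
have [H1 [B1 [l1 a1]]] := vF_ok hpb; have [H2 [B2 [l2 a2]]] := JF_ok (bhM hpb hpb).
rewrite /kappa /MF /MV mulrA -mulrDl divfK ?gt_eqF ?taumean_gt0//; last exact: taumean_gt0 dH.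
rewrite -(nuZ b0 th01 mw hg _ l1) -(nuD b0 th01 mw hg l2 (LipZ 2 l1)); congr nu; apply/funext => x.
rewrite -(smZ _ (a1 x)) -(smD (a2 x) (asmZ 2 (a1 x))); apply: eq_sm => n.
by rewrite loop_square; ring.
Qed.

Lemma bh_sums N : exists K D, bhh K D (birkhoff pb N).
Proof. exact: (bh_birkhoff dH N hpb). Qed.

Lemma second_moment N : M (fun x => birkhoff pb N x * birkhoff pb N x) + 2 * MV (birkhoff pb N) = N%:R * kappa.
Proof.
elim: N => [|N ih].
  have -> : birkhoff pb 0 = (fun x => 0 * pb x) by apply/funext => x; rewrite birkhoff0 mul0r.
  rewrite (MVZ 0 hpb) !mul0r mulr0 addr0 -[RHS](MF_cst dH 0); apply: eq_MF => x _; ring.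
have [K [D hN]] := bh_sums N; have hs := bh_shift dH hN.
have e : birkhoff pb N.+1 = (fun x => pb x + birkhoff pb N (sh x)).
  by apply/funext => x; rewrite -add1n birkhoffD birkhoff1.
have hNN := bhM hN hN; have hss := bh_shift dH hNN; have hps := bhM hpb hs.
have e2 : M (fun x => birkhoff pb N.+1 x * birkhoff pb N.+1 x) = M (fun x => pb x * pb x) +
    2 * M (fun x => pb x * birkhoff pb N (sh x)) + M (fun x => birkhoff pb N x * birkhoff pb N x).
  rewrite -(MF_shift dH hNN) -(MFZ dH 2 hps) -(MFD dH (bhM hpb hpb) (bhZ 2 hps)).
  rewrite -(MFD dH (bhD (bhM hpb hpb) (bhZ 2 hps)) hss); apply: (eq_MF (E := E)) => x _; rewrite e; ring.
have e3 := MVD hpb hs; rewrite -e in e3.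
rewrite e2 (MV_shift hN) e3 -[N.+1%:R]natr1 [RHS]mulrDl mul1r -ih /kappa; ring.
Qed.

Lemma tau3_asm : exists2 C : R, 0 <= C & forall x, asm (fun n => g n x * (tau L n)%:R ^+ 3) C.
Proof.
have om0 := rs_om0 dH; have K0 := asm_ge0 (gk_moment dH (bpt L)).
have c0 : 0 <= 27 / rd_om d ^+ 3 by apply: divr_ge0 => //; apply: exprn_ge0; exact: ltW.
exists (`|27 / rd_om d ^+ 3| * (rd_K d * rd_M d / rd_c d)); first exact: mulr_ge0.
move=> x; apply: asm_le (asmZ (27 / rd_om d ^+ 3) (gk_moment dH x)) => n.
rewrite normrM (ger0_norm (gk_ge0 dH n x)) ger0_norm ?exprn_ge0// [leRHS]mulrCA; apply: ler_wpM2l; first exact: gk_ge0 dH n x.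
set y := rd_om d * (tau L n)%:R.
have y0 : 0 <= y by rewrite mulr_ge0// ?ltW.
have h1 : y / 3 <= expR (y / 3) by have := @expR_ge1Dx R (y / 3); lra.
have h2 : (y / 3) ^+ 3 <= expR (y / 3) ^+ 3 by apply: lerXn2r; rewrite ?nnegrE ?expR_ge0//; lra.
rewrite -expRM_natr in h2; have e : y / 3 * 3 = y by field.
rewrite e in h2.
have -> : (tau L n)%:R ^+ 3 = 27 / rd_om d ^+ 3 * (y / 3) ^+ 3 by rewrite /y; field; lra.
exact: ler_wpM2l.
Qed.

Lemma MV_bound : exists2 C : R, 0 <= C & forall K D F (lam : R), bhh K D F -> 0 < lam ->
  `|2 * MV F| <= lam * C + M (fun x => F x * F x) / lam.
Proof.
have [C3 C30 h3] := tau3_asm; have [C [C0 v1 _]] := vv_bounds.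
have tp := taumean_gt0 dH.
exists (C ^+ 2 * C3 / taumean phi d); first by apply: divr_ge0; [apply: mulr_ge0 => //; exact: exprn_ge0|exact: ltW].
have one K D F (lam : R) : bhh K D F -> 0 < lam ->
    2 * MV F <= lam * (C ^+ 2 * C3 / taumean phi d) + M (fun x => F x * F x) / lam.
  move=> hF l0; have [H1 [B1 [l1 a1]]] := vF_ok hF; have [H2 [B2 [l2 a2]]] := JF_ok (bhM hF hF).
  rewrite /MV /MF.
  suff : nug (fun x => 2 * JV F x + (- lam^-1) * JF phi (d := d) (fun x => F x * F x) x) <= lam * (C ^+ 2 * C3).
    rewrite (nuD b0 th01 mw hg (LipZ 2 l1) (LipZ _ l2)) !(nuZ b0 th01 mw hg _ l1, nuZ b0 th01 mw hg _ l2).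
    have ti : 0 <= (taumean phi d)^-1 by rewrite invr_ge0 ltW.
    move=> /(ler_wpM2r ti); move: (_^-1) (lam^-1) (nug _) (nug _) => t l' n1 n2; lra.
  apply: (nu_le b0 th01 mw hg (LipD (LipZ 2 l1) (LipZ _ l2))) => x.
  rewrite -(smZ _ (a1 x)) -(smZ _ (a2 x)) -(smD (asmZ 2 (a1 x)) (asmZ _ (a2 x))).
  have := sm_le (asmD (asmZ 2 (a1 x)) (asmZ (- lam^-1) (a2 x))) (asmZ (lam * C ^+ 2) (h3 x)).
  rewrite (smZ _ (h3 x)) => h; apply: le_trans (h _) _; last first.
    by rewrite mulrA; apply: ler_wpM2l; [apply: mulr_ge0; [exact: ltW|exact: exprn_ge0]|exact: sm_le_bound].
  move=> n; have -> : 2 * (g n x * vF F n x) + - lam^-1 * (g n x * lsum (fun x => F x * F x) n x) =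
      g n x * (2 * vF F n x + - lam^-1 * lsum (fun x => F x * F x) n x) by ring.
  rewrite [leRHS]mulrCA; apply: ler_wpM2l; first exact: gk_ge0 dH n x.
  rewrite /vF /loop_sum /birkhoff !mulr_sumr -big_split /=.
  have -> : lam * C ^+ 2 * (tau L n)%:R ^+ 3 = \sum_(i < tau L n) lam * (C * (tau L n)%:R) ^+ 2.
    rewrite sum_cst; ring.
  apply: ler_sum => i _; have := v1 n x i (ltnW (ltn_ord i)); set v := vv n x i; set f := F _ => hv.
  have hv2 : v ^+ 2 <= (C * (tau L n)%:R) ^+ 2.
    by rewrite -(real_normK (num_real v)); apply: lerXn2r; rewrite ?nnegrE ?mulr_ge0.
  have := sqr_ge0 (lam * v - f); have : lam * v ^+ 2 <= lam * (C * (tau L n)%:R) ^+ 2 by apply: ler_wpM2l => //; exact: ltW.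
  move=> h1 h2; have h4 : 0 <= lam^-1 * (lam * v - f) ^+ 2 by apply: mulr_ge0 => //; rewrite invr_ge0 ltW.
  have e : lam^-1 * (lam * v - f) ^+ 2 = lam * v ^+ 2 - 2 * (v * f) + lam^-1 * (f * f) by field; lra.
  by move: h1 h4; rewrite e mulNr; lra.
move=> K D F lam hF l0; rewrite ler_norml (one K D F lam hF l0) andbT.
have := one _ _ _ lam (bhZ (-1) hF) l0; rewrite (MVZ (-1) hF).
have -> : M (fun x => -1 * F x * (-1 * F x)) = M (fun x => F x * F x) by apply: (eq_MF (E := E)) => x _; ring.
lra.
Qed.

Lemma second_moment_cvg : (fun N : nat => N%:R^-1 * M (fun x => birkhoff pb N x * birkhoff pb N x)) @ \oo --> kappa.
Proof.
have [C C0 hC] := MV_bound; apply: (cvgn_epsP _ _).2 => e e0.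
pose k := `|kappa|; have k0 : 0 <= k by exact: normr_ge0.
pose eta := Num.min (1 / 2) (e / (2 * (2 * k + 3))).
have [eta0 eta1 eta2] : [/\ 0 < eta, eta <= 1 / 2 & eta * (2 * (2 * k + 3)) <= e].
  have p : 0 < 2 * (2 * k + 3) by lra.
  split; first by rewrite lt_min !divr_gt0.
    by rewrite ge_min lexx.
  by rewrite -ler_pdivlMr// ge_min lexx orbT.
have [N1 hN1] : exists N1 : nat, C / eta / eta <= N1%:R.
  exists (Num.bound (C / eta / eta)); apply: ltW; apply: archi_boundP.
  by do 2 (apply: divr_ge0; last exact: ltW).
exists (maxn N1 1) => N; rewrite geq_max => /andP[NN1 Np].
have np : (0 : R) < N%:R by rewrite ltr0n.
have [K [D hN]] := bh_sums N; have ei : 0 < eta^-1 by rewrite invr_gt0.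
have hb := hC _ _ _ (eta^-1) hN ei.
have hA := second_moment N; set A := M _ in hA hb *; set w := MV _ in hA hb.
have A0 : 0 <= A.
  by apply: (MF_ge0 dH (bhM hN hN)) => x _; rewrite -expr2 sqr_ge0.
have cN : eta^-1 * C <= N%:R * eta.
  have h : C / eta / eta <= N%:R by apply: le_trans hN1 _; rewrite ler_nat.
  by move: h; rewrite ler_pdivrMr// mulrC.
rewrite invrK in hb.
have e1 : `|A - N%:R * kappa| <= N%:R * eta + A * eta.
  have -> : A - N%:R * kappa = - (2 * w) by rewrite -hA; ring.
  by rewrite normrN; apply: le_trans hb _; lra.
have A2 : A <= N%:R * (2 * k + 2).
  have hk : N%:R * kappa <= N%:R * k by apply: ler_wpM2l; [exact: ltW|exact: ler_norm].
  have h1 : A * eta <= A * (1 / 2) by apply: ler_wpM2l.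
  have h2 : N%:R * eta <= N%:R * (1 / 2) by apply: ler_wpM2l => //; exact: ltW.
  have h3 := le_trans (ler_norm _) e1; have h4 : 0 <= N%:R * k by rewrite mulr_ge0// ?ltW.
  lra.
have -> : kappa - N%:R^-1 * A = N%:R^-1 * (N%:R * kappa - A) by rewrite [RHS]mulrBr [X in _ = X - _]mulrA mulVf ?mul1r// gt_eqF.
rewrite normrM gtr0_norm ?invr_gt0// distrC ler_pdivrMl//; apply: le_trans e1 _.
have : A * eta <= N%:R * (2 * k + 2) * eta by apply: ler_wpM2r => //; exact: ltW.
have : N%:R * (eta * (2 * (2 * k + 3))) <= N%:R * e by apply: ler_wpM2l => //; exact: ltW.
nra.
Qed.
End Poisson.

Lemma var_seq_cvg (m : probability X R) (chi : X -> R) (r : R) (Q : nat -> nat -> R) :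
  (forall l B, coord l B -> pr m B = M (\1_B)) -> obs E th chi -> 0 < r -> poisson phi d r Q chi ->
  var_seq E m chi @ \oo --> 2 * Q 2%N 0%N / r ^+ 2.
Proof.
move=> hm hc r0 [u [hu pu qu]].
pose I := Q 1%N 0%N / r; pose pb (x : X) := chi x + - I; pose U (x : L) := r^-1 * u x.
have hchi : bh E th 1 1 chi.
  split=> // [x xa|n x y xa ya xy]; [exact: hc.1|rewrite mul1r; exact: hc.2].
have hpb := bhD hchi (bh_cst a E th (- I)); rewrite -/pb in hpb.
have hU : Lp (`|r^-1| * (1 / 4)) U := LipZ r^-1 hu.
have ls n (x : L) : lsum pb n x = lsum chi n x + - I * (tau L n)%:R.
  by rewrite /loop_sum /pb birkhoffE_D; congr (_ + _); rewrite /birkhoff sum_cst mulrC.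
have ta x := tauhat_asm hg (rs_om0 dH) (gk_moment dH) x.
have [CJ CJ0 hJ] := J_exists dH; have [_ ac] := hJ _ _ _ hchi.
have hP x : U x = avgg (lsum pb) x + op g U x.
  have bu := bdd_of_Lip mw hu.
  rewrite /U pu (opZ hg _ _ bu) /avg.
  have -> : sm (fun n => g n x * lsum pb n x) =
    sm (fun n => g n x * lsum chi n x) + - I * sm (fun n => g n x * (tau L n)%:R).
    rewrite -(smZ (- I) (ta x)) -(smD (ac x) (asmZ (- I) (ta x))); apply: eq_sm => n; rewrite ls; ring.
  have -> : sm (fun n => g n x * (r * lsum chi n x)) = r * sm (fun n => g n x * lsum chi n x).
    by rewrite -(smZ r (ac x)); apply: eq_sm => n; rewrite mulrCA.
  rewrite /I; field; lra.
have kE : kappa U pb = 2 * Q 2%N 0%N / r ^+ 2.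
  have tp := taumean_gt0 dH; apply: (mulIf (lt0r_neq0 tp)); rewrite (kappaE hU hpb).
  have [H1 [B1 [l1 a1]]] := vF_ok hU hpb hpb; have [H2 [B2 [l2 a2]]] := JF_ok (bhM hpb hpb).
  have -> : 2 * Q 2%N 0%N / r ^+ 2 * taumean phi d = 2 / r ^+ 2 * (Q 2%N 0%N * taumean phi d) by ring.
  rewrite qu.
  have lv n x : lsum pb n x ^+ 2 + 2 * (lsum pb n x * U (pre n x)) =
      lsum (fun x => pb x * pb x) n x + 2 * vF U pb pb n x by exact: loop_square.
  set G := (fun x : L => sm _).
  have eG : avgg (fun n x => lsum pb n x ^+ 2 + 2 * (lsum pb n x * U (pre n x))) =
     (fun x => 2 / r ^+ 2 * G x).
    apply/funext => x; rewrite /G /avg.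
    have aa : asm (fun n => g n x * (lsum pb n x ^+ 2 + 2 * (lsum pb n x * U (pre n x)))) (B2 + `|2| * B1).
      by apply: eq_asm (asmD (a2 x) (asmZ 2 (a1 x))) => n; rewrite lv; ring.
    have eg n : g n x * ((r * lsum chi n x - (tau L n)%:R * Q 1%N 0%N) ^+ 2 / 2 +
        (r * lsum chi n x - (tau L n)%:R * Q 1%N 0%N) * u (pre n x)) =
      r ^+ 2 / 2 * (g n x * (lsum pb n x ^+ 2 + 2 * (lsum pb n x * U (pre n x)))).
      by rewrite ls /I /U; field; lra.
    rewrite (eq_sm eg) (smZ _ aa) mulrA (_ : 2 / r ^+ 2 * (r ^+ 2 / 2) = 1) ?mul1r//; field; lra.
  have lG : Lp (`|r ^+ 2 / 2| * (H2 + `|2| * H1)) G.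
    have := LipZ (r ^+ 2 / 2) (LipD l2 (LipZ 2 l1)); congr (Lip _ _ _); apply/funext => x.
    have e2 : JF phi (d := d) (fun x => pb x * pb x) x + 2 * JV U pb pb x =
      avgg (fun n x => lsum pb n x ^+ 2 + 2 * (lsum pb n x * U (pre n x))) x.
      rewrite -(smZ _ (a1 x)) -(smD (a2 x) (asmZ 2 (a1 x))); apply: eq_sm => n; rewrite lv; ring.
    by rewrite e2 eG mulrA (_ : r ^+ 2 / 2 * (2 / r ^+ 2) = 1) ?mul1r//; field; lra.
  by rewrite eG (nuZ b0 th01 mw hg _ lG).
have inv := rep_invariant dH hm.
have M0 := M_pb0 hU hpb hP.
have bpb N x : birkhoff pb N x = birkhoff chi N x - N%:R * I.
  by rewrite /pb birkhoffE_D; congr (_ + _); rewrite /birkhoff sum_cst mulrN.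
have MI N : M (birkhoff chi N) = N%:R * I.
  have e : birkhoff chi N = (fun x => birkhoff pb N x + N%:R * I).
    by apply/funext => x; rewrite bpb subrK.
  have [K [D hN]] := bh_sums hpb N.
  rewrite e (MFD dH hN (bh_cst a E th (N%:R * I))) (MF_cst dH).
  suff -> : M (birkhoff pb N) = 0 by rewrite add0r.
  elim: N {e K D hN} => [|N ih].
    by rewrite -[RHS](MF_cst dH 0); apply: eq_MF => x _; rewrite birkhoff0.
  have [K [D hN]] := bh_sums hpb N; have [D' hi] := bh_iter dH N hpb.
  have hsh : M (fun x => pb (iter N sh x)) = 0.
    elim: (N) => [//|j ihj]; have [D'' hj] := bh_iter dH j hpb.
    by rewrite -ihj -(MF_shift dH hj); apply: (eq_MF (E := E)) => x _; rewrite iterSr.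
  by rewrite -[RHS]addr0 -{1}ih -hsh -(MFD dH hN hi); apply: (eq_MF (E := E)) => x _; rewrite birkhoffS.
suff -> : var_seq E m chi = (fun N : nat => N%:R^-1 * M (fun x => birkhoff pb N x * birkhoff pb N x)).
  by have := second_moment_cvg hU hpb hP; rewrite kE.
apply/funext => N.
have [K [D hN]] := bh_sums hpb N; have [K' [D' hN']] := bh_birkhoff dH N hchi.
rewrite /var_seq (rep_integ dH hm hN') MI; congr (_ * _).
have eq1 x : (birkhoff chi N x - N%:R * I) ^+ 2 = birkhoff pb N x * birkhoff pb N x by rewrite bpb expr2.
by under eq_fun do rewrite eq1; rewrite (rep_integ dH hm (bhM hN hN)).
Qed.
End Variance.

(** * Perturbation of the SPR property *)

Section Perturbation.
Variables (S : countType) (a : S) (E : rel S) (R : realType).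
Local Notation X := (Sig a).

Lemma obs_Hbeta (theta beta : R) (psi : X -> R) : 0 < theta < 1 -> `|ln theta| < beta ->
  Hbeta_norm_le1 E beta psi -> obs E theta psi.
Proof.
move=> /andP[t0 t1] hb [A [B [A0 B0 AB hA hB]]].
split=> [x xa|n x y xa ya xy]; first by apply: le_trans (hA x xa) _; lra.
have [[k0 nk0]|no] := pselect (exists k, x k <> y k); last first.
  have -> : x = y by apply/funext => k; apply/eqP; rewrite -[_ == _]negbK; apply/negP => /eqP h; apply: no; exists k.
  by rewrite subrr normr0 exprn_ge0// ltW.
have [k /eqP nk kmin] := ex_minnP (ex_intro (fun k => x k != y k) k0 (introN eqP nk0)).
have nk' : (n <= k)%N by rewrite leqNgt; apply/negP => /xy.
have xyk : agree k x y by move=> i ik; apply/eqP; rewrite -[_ == _]negbK; apply/negP => /kmin; rewrite leqNgt ik.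
have h := hB x y k xa ya xyk nk.
have e1 : expR (beta * k%:R) * theta ^+ k >= 1.
  rewrite -{1}(lnK (_ : theta \is Num.pos)) ?posrE// -expRM_natr -expRD -[leLHS]expR0 ler_expR -mulrDl.
  by apply: mulr_ge0 => //; have := ler_norm (- ln theta); rewrite normrN; lra.
apply: (@le_trans _ _ (theta ^+ k)); last by rewrite ler_wiXn2l ?ltW.
have tk : 0 <= theta ^+ k by rewrite exprn_ge0// ltW.
have n0 := normr_ge0 (psi x - psi y).
apply: (@le_trans _ _ (`|psi x - psi y| * (expR (beta * k%:R) * theta ^+ k))).
  by rewrite ler_peMr.
by rewrite mulrA; have := ler_wpM2r tk h; nra.
Qed.

Lemma esum_perturb (D : set X) n (phi psi : X -> R) (c : R) : D `<=` [set x : X | adm E x] ->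
  (forall x : X, adm E x -> phi x <= psi x + c) ->
  (\esum_(x in D) (expR (birkhoff phi n x))%:E <= (expR (c * n%:R))%:E * \esum_(x in D) (expR (birkhoff psi n x))%:E)%E.
Proof.
move=> hD h; apply: esum_scale => [|x|x /hD xa]; first exact: expR_ge0.
  by rewrite lee_fin expR_ge0.
rewrite -EFinM lee_fin -expRD ler_expR /birkhoff mulrC -(sum_cst n c) addrC -big_split/=.
by apply: ler_sum => k _; apply: h; exact: adm_iter.
Qed.

Lemma grow_perturb (z z' : nat -> \bar R) (c p : R) :
  (forall n, z n <= (expR (c * n%:R))%:E * z' n)%E -> grow z' p -> grow z (p + c).
Proof.
move=> h [C [N hC]]; exists C, N => n Nn; apply: le_trans (h n) _.
apply: le_trans (lee_wpmul2l _ (hC n Nn)) _; first by rewrite lee_fin expR_ge0.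
by rewrite -EFinM lee_fin mulrDl expRD; lra.
Qed.

Lemma SPR_perturb (th A P : R) (phi : X -> R) : mixing_graph E -> 0 < th < 1 -> 0 <= A -> holder_with E A th phi ->
  PG E phi a = P%:E -> SPR E phi a -> exists2 e : R, 0 < e & forall (A' : R) (psi : X -> R), 0 <= A' ->
    holder_with E A' th psi -> (forall x : X, adm E x -> `|psi x - phi x| <= e) -> SPR E psi a.
Proof.
move=> mix th01 A0 hphi hP; rewrite /SPR hP => hs.
have zs0 (f : X -> R) n : (0 <= Zstar E f n a)%E by apply: esum_ge0 => x _; rewrite lee_fin expR_ge0.
have [p' + [N hN]] := rate_lt_grow (zs0 phi) hs; rewrite lte_fin => pP.
exists ((P - p') / 4); first lra.
set e := _ / 4 => A' psi A'0 hpsi hd.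
have d1 x : adm E x -> psi x <= phi x + e by move=> /hd; rewrite ler_norml => /andP[]; lra.
have d2 x : adm E x -> phi x <= psi x + e by move=> /hd; rewrite ler_norml => /andP[]; lra.
have h1 : (rate (fun n => Zstar E psi n a) <= (p' + e)%:E)%E.
  apply: (rate_le (zs0 psi)); apply: (grow_perturb (z' := fun n => Zstar E phi n a)).
    by move=> n; apply: esum_perturb d1 => x [].
  by exists 1, N => n /hN; rewrite mul1r.
have h2 : ((P - e)%:E <= PG E psi a)%E.
  apply: (@PG_ge _ _ _ _ _ _ _ mix A'0 th01 hpsi a a) => q qP g.
  have : (PG E phi a <= (q + e)%:E)%E.
    apply: (@PG_le _ _ _ _ _ _ _ mix A0 th01 hphi a a); apply: (grow_perturb _ g) => n.
    by apply: esum_perturb d2 => x [].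
  by rewrite hP lee_fin; lra.
apply: (le_lt_trans h1); apply: lt_le_trans h2; rewrite lte_fin /e; lra.
Qed.
End Perturbation.

Theorem theorem3p3 (R : realType) (S : countType) (E : rel S) (a : S)
    (theta : R) (phi : Sig a -> R) :
  mixing_graph E ->
  (@PG S a E R (fun _ => 0%R) a < +oo)%E ->
  (0 < theta < 1) ->
  weakly_holder E theta phi ->
  sup_finite E phi ->
  SPR E phi a ->
  exists M eps : R, 1 < M /\ 0 < eps /\
  forall beta : R, `|ln theta| < beta ->
  forall psi : Sig a -> R, Hbeta_norm_le1 E beta psi ->
  forall b : S,
  let p := fun t : R => fine (PG E (fun x => phi x + t * psi x) b) in
  (* (1) *)
  ((forall t, `|t| < eps -> PG E (fun x => phi x + t * psi x) b \is a fin_num) /\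
   real_analytic_on p [set t | `|t| < eps]) /\
  (* (2)-(4) *)
  (forall t, `|t| <= eps ->
     exists m : probability (Sig a) R,
       [/\ invariant_prob E m,
           PG E (fun x => phi x + t * psi x) b = Pmu E m (fun x => phi x + t * psi x),
           (forall mu : probability (Sig a) R, invariant_prob E mu ->
              ~ same_measure mu m ->
              (Pmu E mu (fun x => (phi x + t * psi x)%R)
                 < PG E (fun x => (phi x + t * psi x)%R) b)%E),
           (`|t| < eps -> derivable p t 1 /\ derive1 p t = integ E m psi) &
           (`|t| < eps -> derivable (derive1 p) t 1 /\
              var_seq E m psi @ \oo --> derive1n 2 p t)]) /\
  (* (5) *)
  (forall t, `|t| < eps ->
     [/\ `|derive1n 1 p t| <= M, `|derive1n 2 p t| <= M & `|derive1n 3 p t| <= M]) /\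
  (* (6) *)
  (forall vphi : Sig a -> R, Hbeta_norm_le1 E beta vphi ->
     (forall t s, `|t| < eps -> `|s| < eps ->
        PG E (fun x => phi x + t * psi x + s * vphi x) b \is a fin_num) /\
     smooth2_on (fun t s => fine (PG E (fun x => phi x + t * psi x + s * vphi x) b))
                [set q : R * R | `|q.1| < eps /\ `|q.2| < eps]).
Proof.
move=> mix ent th01 [A0 hA0] [Cs hCs] spr.
have hA : holder_with E `|A0| theta phi.
  move=> n n2 x y xa ya xy; apply: le_trans (hA0 n n2 x y xa ya xy) _.
  by apply: ler_wpM2r; [apply: exprn_ge0; lra|exact: ler_norm].
have [d dH] := rpfdata_exists mix (normr_ge0 A0) th01 hA hCs ent spr.
have [r2 [K2 [r20 _ h2]]] := local_pressure dH.
have [r1 [K1 [r10 K10 h1]]] := pressure_rep dH.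
have [e0 e00 hspr] := SPR_perturb mix th01 (rs_A0 dH) (rs_holder dH) (rs_PE dH a) spr.
pose eps := Num.min (Num.min (r1 / 8) r2) e0.
have [eps0 er1 er2 ee0] : [/\ 0 < eps, eps <= r1 / 8, eps <= r2 & eps <= e0].
  rewrite /eps !lt_min !ge_min !lexx !orbT /=; split=> //; rewrite e00 r20 !andbT; lra.
have bn (c : R) k : 0 <= c -> 0 <= c * K1 / r1 ^+ k.
  by move=> c0; apply: divr_ge0; [exact: mulr_ge0|apply: exprn_ge0; exact: ltW].
have b1 := bn 4 1%N (ler0n R 4); have b2 := bn 32 2%N (ler0n R 32); have b3 := bn 512 3%N (ler0n R 512).
rewrite expr1 in b1.
exists (2 + 4 * K1 / r1 + 32 * K1 / r1 ^+ 2 + 512 * K1 / r1 ^+ 3), eps.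
split; first lra.
split=> // beta hbeta psi hpsi b p; have ho := obs_Hbeta th01 hbeta hpsi.
have data t : `|t| <= eps -> exists d' : rpfpar a E R, rpf_spec theta (fun x => phi x + t * psi x) d'.
  move=> te; have hh := holder_perturb dH t ho; have At := addr_ge0 (rs_A0 dH) (normr_ge0 t).
  apply: (rpfdata_exists mix At th01 hh (fun x xa => sup_perturb dH t ho xa) ent).
  apply: (hspr _ _ At hh) => x xa; rewrite addrAC subrr add0r normrM.
  apply: le_trans (le_trans te ee0); rewrite -[leRHS]mulr1; apply: ler_wpM2l => //; exact: ho.1.
have shiftE t0 u : (fun x => phi x + (t0 + u) * psi x) = (fun x => (phi x + t0 * psi x) + u * psi x).
  by apply/funext => x; rewrite mulrDl addrA.
have rep t0 (d' : rpfpar a E R) : rpf_spec theta (fun x => phi x + t0 * psi x) d' -> exists (r K : R) (Q : nat -> nat -> R),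
   [/\ 0 < r, nb Q K, Q 0%N 0%N = 0,
     (forall u, `|u| <= r -> PG E (fun x => phi x + t0 * psi x + u * psi x) b = (rd_P d' + ev Q (u / r) 0)%:E) &
     (forall t, `|t - t0| < r -> p t = rd_P d' + ev Q ((t - t0) / r) 0) /\
     poisson (fun x => phi x + t0 * psi x) d' r Q psi].
  move=> dH'; have [r [K [r0 _ h]]] := pressure_rep dH'; have [Q [hQ Q0 hp hu]] := h psi ho.
  exists r, K, Q; split=> // [u|]; first exact: hp.
  split=> // t ht; rewrite /p.
  have -> : (fun x => phi x + t * psi x) = (fun x => phi x + t0 * psi x + (t - t0) * psi x).
    by rewrite -shiftE addrC subrK.
  by rewrite hp//; exact: ltW.
have fin t : `|t| <= eps -> PG E (fun x => phi x + t * psi x) b \is a fin_num.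
  by move=> /data[d' dH']; rewrite (rs_PE dH').
split; [split=> [t te|]|split; [|split]].
- by apply: fin; exact: ltW.
- apply: rep_analytic => t0 /= t0e; have [d' dH'] := data t0 (ltW t0e).
  have [r [K [Q [r0 hQ _ _ [hp _]]]]] := rep t0 d' dH'.
  by exists (rd_P d'), r, K, Q.
- move=> t te; have [d' dH'] := data t te; have [m hm] := rpf_kolmogorov dH'.
  have [r [K [Q [r0 hQ Q0 hPG [hp hpo]]]]] := rep t d' dH'.
  have inv := rep_invariant dH' hm; have eqm := rpf_equilibrium dH' hm b.
  have Pm : Pmu E m (fun x => phi x + t * psi x) = (rd_P d')%:E by rewrite -eqm (rs_PE dH').
  have tt : `|t - t| < r by rewrite subrr normr0.
  have hd n := rep_derive1n r0 (lexx r) (nb_good hQ) hp n tt.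
  exists m; split; [exact: inv|exact: eqm| | |].
  + move=> mu hmu ns; rewrite (rs_PE dH') lt_neqAle; apply/andP; split; last first.
      exact: (Pmu_le mix (rs_A0 dH') th01 (rs_holder dH') (rs_supP dH') (rs_PE dH' b) hmu).
    by apply/eqP => e; apply: ns; apply: (equilibrium_unique dH' inv hmu Pm e).
  + move=> _; have [h3 h4] := hd 0%N; split; first exact: h3.
    by rewrite (tangent dH' inv Pm ho r0 hQ Q0 hPG) -derive1n1 h4 subrr mul0r ev00 /= /dT mul1r expr1 mulrC.
  + move=> _; have [h3 h4] := hd 1%N; split; first by move: h3; rewrite derive1n1.
    have -> : derive1n 2 p t = 2 * Q 2%N 0%N / r ^+ 2.
      by rewrite h4 subrr mul0r ev00 /= /dT mul1r mulrC.
    exact: (var_seq_cvg dH' hm ho r0 hpo).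
- have [Q [hQ _ hp _]] := h1 psi ho.
  have hp0 t : `|t - 0| < eps -> p t = rd_P d + ev Q ((t - 0) / r1) 0.
    rewrite subr0 => te; rewrite /p hp//; apply: (le_trans (ltW te)); clear -r10 er1; lra.
  move=> t te; have te' : `|t - 0| < eps by rewrite subr0.
  have [c1 c2 c3] := rep_bounds r10 er1 hQ hp0 te'.
  move: b1 b2 b3 c1 c2 c3; move: (4 * K1 / r1) (32 * K1 / r1 ^+ 2) (512 * K1 / r1 ^+ 3) => x1 x2 x3 y1 y2 y3 c1 c2 c3.
  by split; [apply: le_trans c1 _|apply: le_trans c2 _|apply: le_trans c3 _]; clear -y1 y2 y3; lra.
- move=> vphi hvphi; have hov := obs_Hbeta th01 hbeta hvphi.
  have [Q [hQ _ hp _]] := h2 psi vphi ho hov.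
  have le2 x : `|x| < eps -> `|x| <= r2 by move=> /ltW h; exact: le_trans er2.
  split=> [t s te se|]; first by rewrite hp//; exact: le2.
  apply: (rep_smooth2 (k := rd_P d) r20 er2 (nb_good hQ)) => t s te se.
  by rewrite hp//; exact: le2.
Qed.
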